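(* Let $N>2$ and let $f$ satisfy (A1)–(A4). Let $u^*$ be the unique positive radial singular solution of $-\Delta u=f(u)$ in $\mathbb{R}^N\setminus\{0\}$ (see context). Suppose in addition: (A5) $q_{JL}<q_f<q_S$; (A6) if $q_f=1$, then $\frac{f'(u)^2}{f(u)f''(u)}\le1$ for all sufficiently large $u>0$. Then the Cauchy problem \[ \partial_t u-\Delta u=f(u)\ \ (x\in\mathbb{R}^N,\ t>0),\qquad u(x,0)=u^*(x), \] has at least two positive solutions in the integral sense defined in the context. One of them is $u(x,t)=u^*(x)$ a.e. in $\mathbb{R}^N\times[0,\infty)$. The other is a solution $u$ on $\mathbb{R}^N\times[0,t_0)$ for some $t_0>0$ satisfying $u\in L^\infty_{loc}((0,t_0),L^\infty(\mathbb{R}^N))$, $u$ is a classical solution of $\partial_tu-\Delta u=f(u)$ in $\mathbb{R}^N\times(0,t_0)$, and \[ \lim_{t\to0^+}\|u(t)-u^*\|_{L^\gamma_{ul}(\mathbb{R}^N)}=0\quad\text{for every }1\le\gamma<\gamma^*. \]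
   Context: Let $N>2$, $p_S:=(N+2)/(N-2)$, $q_S:=(N+2)/4$ and $q_{JL}:=\frac{N-2\sqrt{N-1}}{4}$. The function $f$ (extended by $0$ on $(-\infty,0)$) satisfies: (A1) $f\in C^1[0,\infty)\cap C^2(0,\infty)$, $f(0)=0$, $f'(0)=0$; (A2) $f'(u)>0$, $f''(u)>0$ for $u>0$; (A3) the finite limit $q_f:=\lim_{u\to\infty}\frac{f'(u)^2}{f(u)f''(u)}$ exists; (A4) $uf(u)-(p_S+1)\int_0^u f(s)\,ds\ge0$ for $u\ge0$. Under (A1)–(A4) and $q_f<q_S$ there is a unique $u^*\in C^2(\mathbb{R}^N\setminus\{0\})$ which is radial, nonnegative, solves $-\Delta u^*=f(u^* )$ in $\mathbb{R}^N\setminus\{0\}$ and satisfies $u^*(x)\to\infty$ as $|x|\to0^+$. $\gamma^*:=\frac{N}{2(q_f-1)}$ if $q_f>1$, $\gamma^*:=\infty$ if $q_f=1$. For $1\le p<\infty$, $\|u\|_{L^p_{ul}}:=\sup_{z\in\mathbb{R}^N}(\int_{B(z,1)}|u|^p)^{1/p}$ and $L^p_{ul}(\mathbb{R}^N)$ is the set of $u\in L^p_{loc}$ with finite norm. $G_t(x):=(4\pi t)^{-N/2}e^{-|x|^2/(4t)}$. Definition (solution): a nonnegative measurable $u$ on $\mathbb{R}^N\times[0,T)$, $T\in(0,\infty]$, is a solution with initial datum $u_0\ge0$ in $\mathbb{R}^N\times[0,T)$ if \[ \infty>u(x,t)=\int_{\mathbb{R}^N}G_t(x-y)u_0(y)\,dy+\int_0^t\int_{\mathbb{R}^N}G_{t-s}(x-y)f(u(y,s))\,dy\,ds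 \] for a.a. $(x,t)\in\mathbb{R}^N\times[0,T)$. *)

(* Defs.v *)
From HB Require Import structures.
From mathcomp Require Import all_boot all_order all_algebra.
From mathcomp Require Import all_classical all_reals all_analysis.
Set Implicit Arguments. Unset Strict Implicit. Unset Printing Implicit Defensive.
Import Order.TTheory GRing.Theory Num.Theory.
Import numFieldNormedType.Exports.
Local Open Scope classical_set_scope.
Local Open Scope ring_scope.

Section pmeas.
Local Open Scope ereal_scope.
Context d1 d2 (T1 : measurableType d1) (T2 : measurableType d2) (R : realType).
Variable m1 : {sigma_finite_measure set T1 -> \bar R}.
Variable m2 : {sigma_finite_measure set T2 -> \bar R}.
Definition pmeas := (m1 \x m2).
HB.instance Definition _ := Measure.copy pmeas (m1 \x m2).
Lemma pmeas_sigma_finite : sigma_finite setT pmeas.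
Proof.
have /sigma_finiteP[F [TF ndF Foo]] := sigma_finiteT m1.
have /sigma_finiteP[G [TG ndG Goo]] := sigma_finiteT m2.
exists (fun n => F n `*` G n).
 rewrite -setXTT TF TG predeqE => -[x y]; split.
    move=> [/= [n _ Fnx] [k _ Gky]]; exists (maxn n k) => //; split.
    - by move: x Fnx; exact/subsetPset/ndF/leq_maxl.
    - by move: y Gky; exact/subsetPset/ndG/leq_maxr.
  by move=> [n _ []/= ? ?]; split; exists n.
move=> k; have [? ?] := Foo k; have [? ?] := Goo k.
split; first exact: measurableX.
by rewrite /pmeas product_measure1E// lte_mul_pinfty// ge0_fin_numE.
Qed.
HB.instance Definition _ := Measure_isSigmaFinite.Build _ _ _ pmeas pmeas_sigma_finite.
End pmeas.

Record mspace (R : realType) := MSpace {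
  msd : measure_display;
  mst : measurableType msd;
  msm : {sigma_finite_measure set mst -> \bar R} }.

Fixpoint lebN (R : realType) (n : nat) : mspace R :=
  match n with
  | 0 => @MSpace R _ unit (@dirac _ unit tt R)
  | m.+1 => let P := lebN R m in
     @MSpace R _ _ (pmeas (@lebesgue_measure R) (msm P))
  end.

Fixpoint coords (R : realType) (n : nat) : mst (lebN R n) -> nat -> R :=
  match n return mst (lebN R n) -> nat -> R with
  | 0 => fun _ _ => 0
  | m.+1 => fun p i => match i with 0 => p.1 | j.+1 => coords p.2 j end
  end.

(* lebN R n : the space R^n (as R * (R * ... * unit)) with the n-fold product
   of one-dimensional Lebesgue measure, i.e. Lebesgue measure on the Borel
   sets of R^n.  coords recovers the coordinates; torow identifies a point
   with a row vector of 'rV[R]_n. *)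
Definition torow (R : realType) (n : nat) (p : mst (lebN R n)) : 'rV[R]_n :=
  \row_(i < n) coords p i.

Section defs.
Variable R : realType.
Local Open Scope ring_scope.

Definition enorm (N : nat) (x : 'rV[R]_N) : R :=
  Num.sqrt (\sum_(i < N) x ord0 i ^+ 2).

(* Lebesgue measure on R^N and on space-time R x R^N (points (t, y)). *)
Definition lebRN (N : nat) := msm (lebN R N).
Definition lebST (N : nat) := msm (lebN R N.+1).

Definition intN (N : nat) (A : set 'rV[R]_N) (g : 'rV[R]_N -> \bar R) : \bar R :=
  (\int[lebRN N]_(p in @torow R N @^-1` A) g (torow p))%E.

Definition aeN (N : nat) (P : 'rV[R]_N -> Prop) : Prop :=
  {ae lebRN N, forall p, P (@torow R N p)}.

Definition aeST (N : nat) (P : 'rV[R]_N -> R -> Prop) : Prop :=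
  {ae lebST N, forall p : mst (lebN R N.+1), P (@torow R N p.2) p.1}.

Definition heatG (N : nat) (t : R) (x y : 'rV[R]_N) : R :=
  (4 * pi * t) `^ (- (N%:R / 2)) * expR (- (enorm (x - y) ^+ 2) / (4 * t)).

Definition is_solution (N : nat) (f : R -> R) (u0 : 'rV[R]_N -> R)
    (u : 'rV[R]_N -> R -> R) (T : \bar R) : Prop :=
  [/\ forall x t, 0 <= t -> (t%:E < T)%E -> 0 <= u x t,
      measurable_fun [set p : mst (lebN R N.+1) | 0 <= p.1 /\ (p.1%:E < T)%E]
        (fun p => u (@torow R N p.2) p.1)
    & aeST (fun x t => 0 <= t -> (t%:E < T)%E ->
        (u x t)%:E =
          (intN setT (fun y => (heatG t x y * u0 y)%:E)
          + \int[@lebesgue_measure R]_(s in [set s | (0 <= s <= t)%R])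
               intN setT (fun y => (heatG (t - s) x y * f (u y s))%:E))%E)].

Definition evec (N : nat) (i : 'I_N) : 'rV[R]_N := delta_mx ord0 i.
Definition dpart (N : nat) (i : 'I_N) (g : 'rV[R]_N -> R) : 'rV[R]_N -> R :=
  fun x => 'D_(evec i) g x.
Definition laplacian (N : nat) (g : 'rV[R]_N -> R) : 'rV[R]_N -> R :=
  fun x => \sum_(i < N) dpart i (dpart i g) x.

Definition C2_on (N : nat) (U : set 'rV[R]_N) (g : 'rV[R]_N -> R) : Prop :=
  forall x, U x ->
    [/\ {for x, continuous g},
        forall i, derivable g x (evec i) /\ {for x, continuous (dpart i g)}
      & forall i j, derivable (dpart i g) x (evec j) /\
                    {for x, continuous (dpart j (dpart i g))}].

Definition classical_sol (N : nat) (f : R -> R) (u : 'rV[R]_N -> R -> R)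
    (t0 : R) : Prop :=
  forall x t, 0 < t -> t < t0 ->
    [/\ {for (x, t), continuous (fun p : 'rV[R]_N * R => u p.1 p.2)},
        derivable (u x) t 1 /\
          {for (x, t), continuous (fun p : 'rV[R]_N * R => derive1 (u p.1) p.2)},
        forall i, derivable (fun y => u y t) x (evec i) /\
          {for (x, t), continuous (fun p : 'rV[R]_N * R =>
                                     dpart i (fun y => u y p.2) p.1)},
        forall i j, derivable (dpart i (fun y => u y t)) x (evec j) /\
          {for (x, t), continuous (fun p : 'rV[R]_N * R =>
                                     dpart j (dpart i (fun y => u y p.2)) p.1)}
      & derive1 (u x) t - laplacian (fun y => u y t) x = f (u x t)].

Definition ulnorm (N : nat) (p : R) (g : 'rV[R]_N -> R) : \bar R :=
  ereal_sup (range (fun z : 'rV[R]_N =>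
    (poweR (intN [set y | enorm (y - z) < 1]
                 (fun y => (`|g y| `^ p)%:E)) p^-1))).

Definition Linfty_loc (N : nat) (u : 'rV[R]_N -> R -> R) (t0 : R) : Prop :=
  forall a b, 0 < a -> a <= b -> b < t0 ->
    exists C : R, forall t, a <= t -> t <= b -> aeN (fun x => `|u x t| <= C).

Definition pS (N : nat) : R := (N%:R + 2) / (N%:R - 2).
Definition qS (N : nat) : R := (N%:R + 2) / 4.
Definition qJL (N : nat) : R := (N%:R - 2 * Num.sqrt (N%:R - 1)) / 4.
Definition gamma_star (N : nat) (qf : R) : \bar R :=
  if 1 < qf then (N%:R / (2 * (qf - 1)))%:E else +oo%E.

End defs.

(* Main.v *)
(** With [F u := \int_u^oo 1/f] and [Q := f' F -> q_f], the variables [V = F(ustar)], [p = r V'/V] and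
 [zeta = r^2/V] satisfy an autonomous system in [log r], perturbed by [Q - q_f]. A Lyapunov function
 with a cross term shows [p -> 2] and [zeta -> zs = 2 N - 4 q_f] as [r -> 0]; in particular [ustar] is at
 most [r^(-2(q_f-1)-d)] near [0] for each [d > 0], and cutting off [ustar] shows that it is a mild solution.

 Since [q_f > q_JL], the linearisation at [(2, zs)] oscillates. Hence, with [L^2 = kappa (t + tau)],
 perturbing [V] by a damped cosine of [log (r/L)], capped in the region [r < L], gives a supersolution
 below [ustar] that is bounded for each [t > 0] uniformly in [tau -> 0+]. The monotone iteration from [0]
 with data [min(ustar, k)] stays below it by comparison, so its limit is bounded for [t > 0]: it is
 classical there and differs from [ustar]. Finally [G_t ustar <= u <= ustar] gives the convergence. *)
Require Import Defs.
From HB Require Import structures.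
From mathcomp Require Import all_boot all_order all_algebra.
From mathcomp Require Import all_classical all_reals all_analysis.
From mathcomp Require Import measurable_realfun ring lra.
Set Implicit Arguments. Unset Strict Implicit. Unset Printing Implicit Defensive.
Import Order.TTheory GRing.Theory Num.Theory.
Import numFieldNormedType.Exports.
Local Open Scope classical_set_scope.
Local Open Scope ring_scope.

(** If [u = H(V)] with [H] the inverse of [F], then [u_t - Lap u - f(u) = f(u) (Lap V - f'(u) |grad
    V|^2 - V_t - 1)] with [f'(u) = Q/V], so the nonlinearity acts almost only through [q_f]. As [H]
    decreases, a maximum of admissible functions [V] is a minimum of supersolutions, again a
    supersolution in the sense of test functions: the pieces of the barrier are glued without
    smoothing. In the variable [- log r] the equilibrium [(2, zs)] is a repeller, the sign being
    that of [q_S - q_f]. Convergence is therefore a consequence of boundedness: an orbit that stays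
    off the equilibrium would raise the Lyapunov function for ever. On the parabolic side the datum
    is unbounded, so comparison and regularity are applied to bounded iterates, with estimates on
    [t >= b > 0] that do not see the truncation. Regularity comes from Duhamel's formula cut off in
    time. With [y = x - sqrt (2 q) z] the kernel becomes a fixed Gaussian weight, and derivatives
    can be placed on the weight or on the source. Identities between nonnegative integrals stand in
    for growth conditions throughout. *)

Local Notation leb := (@lebesgue_measure _).
Local Notation measT := (measurable_fun setT).
Local Notation jcont h := (continuous (fun q : 'rV[_]_ _ * _ => h q.1 q.2)).

(** * Continuity along sequences and continuity of pairs *)

Section seq_cont.
Variable R : realType.

(** Dominated convergence speaks of sequences; this turns it into continuity of integrals depending
    on a parameter. *)
Lemma seq_continuous (X : pseudoMetricType R) (f : X -> R) (x : X) :
 (forall u : nat -> X, u n @[n --> \oo] --> x -> f (u n) @[n --> \oo] --> f x) ->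
 {for x, continuous f}.
Proof.
move=> H; apply/cvgrPdist_lt => e e0; apply: contrapT => nb.
have pick n : exists y, ball x (n.+1%:R^-1) y /\ ~ (`|f x - f y| < e).
 apply: contrapT => np; apply: nb; apply/nbhs_ballP; exists (n.+1%:R^-1) => //=.
 by move=> y By; apply: contrapT => ny; apply: np; exists y.
have [u Pu] := choice pick.
have ux : u n @[n --> \oo] --> x.
 apply/cvg_ballP => d d0; near=> n; apply: le_ball (proj1 (Pu n)).
 near: n; have [N _ HN] := near_infty_natSinv_lt (PosNum d0).
 by exists N => // n /= /HN /ltW.
have /cvgrPdist_lt /(_ _ e0)[N _ /(_ N (leqnn N))] := H _ ux.
exact: (proj2 (Pu N)).
Unshelve. all: by end_near. Qed.

Lemma seq_cvg_rV n (u : nat -> 'rV[R]_n) (x : 'rV[R]_n) :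
 (forall i, u k ord0 i @[k --> \oo] --> x ord0 i) -> u k @[k --> \oo] --> x.
Proof.
move=> H; apply/cvg_ballP => e e0.
have /filter_forall : forall i, \forall k \near \oo, ball (x ord0 i) e (u k ord0 i).
 by move=> i; move/cvg_ballP : (H i); exact.
apply: filterS => k Hk; split=> // i j; rewrite (ord1 i); exact: Hk.
Qed.

Lemma pair_cvg (T : Type) (F : set_system T) (X Y : topologicalType)
  (f : T -> X) (g : T -> Y) (a : X) (b : Y) : Filter F ->
 f x @[x --> F] --> a -> g x @[x --> F] --> b -> (f x, g x) @[x --> F] --> (a, b).
Proof.
move=> FF fa gb A [[B C] [/= nB nC] BC].
have h1 : F (f @^-1` B) := fa _ nB.
have h2 : F (g @^-1` C) := gb _ nC.
rewrite -[nbhs _ A]/(F ((fun x => (f x, g x)) @^-1` A)).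
apply: (@filterS _ F FF _ _ _ (filterI h1 h2)) => x [Bx Cx].
exact: (BC (f x, g x)).
Qed.

Lemma cont_pair (T X Y : topologicalType) (f : T -> X) (g : T -> Y) (x : T) :
 {for x, continuous f} -> {for x, continuous g} ->
 {for x, continuous (fun x => (f x, g x))}.
Proof. by move=> cf cg; apply: pair_cvg. Qed.

Lemma jcont_slice (X Y Z : topologicalType) (h : X -> Y -> Z) (t : Y) :
 continuous (fun q : X * Y => h q.1 q.2) -> continuous (h ^~ t).
Proof.
move=> c y; apply: (@continuous_comp _ _ _ (fun y => (y, t)) (fun q : X * Y => h q.1 q.2)); last exact: c.
by apply: cont_pair; [exact: cvg_id|exact: cst_continuous].
Qed.

End seq_cont.

(** * Affine changes of variables on the line *)

Section affine1.
Variable R : realType.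
Local Open Scope ereal_scope.
Local Notation mu := (@lebesgue_measure R).

(** The scaled pushforward agrees with Lebesgue measure on bounded half-open intervals, hence
    everywhere. The form [x - c * z] is the one that the convolution with the heat kernel calls
    for. *)
Lemma lebesgue_affine (x c : R) (k : R -> \bar R) : (0 < c)%R ->
 measurable_fun [set: R] k -> (forall y, 0 <= k y) ->
 \int[mu]_y k y = c%:E * \int[mu]_z k (x - c * z)%R.
Proof.
move=> c0 mk k0.
pose phi (z : measurableTypeR R) : measurableTypeR R := (x - c * z)%R.
have mphi : measT phi.
 by apply: measurable_funB => //; apply: measurable_funM.
pose pf := measure_function_pushforward__canonical__measure_function_Measure mu mphi.
pose nu := measure_function_mscale__canonical__measure_function_Measure (NngNum (ltW c0)) pf.
have E : forall A, measurable A -> mu A = nu A.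
 apply: (@lebesgue_measure_unique R nu) => _ [[a b]] _ <- /=.
 rewrite /nu /mscale/= /pushforward.
 rewrite (_ : phi @^-1` _ = `[(x - b) / c, (x - a) / c[%classic)%R; last first.
  apply/seteqP; split => z /=; rewrite !in_itv/= /phi => /andP[h1 h2]; apply/andP; split.
  - by rewrite ler_pdivrMr// mulrC; lra.
  - by rewrite ltr_pdivlMr// mulrC; lra.
  - by move: h2; rewrite ltr_pdivlMr// mulrC; lra.
  - by move: h1; rewrite ler_pdivrMr// mulrC; lra.
 rewrite !lebesgue_measure_itv/= !lte_fin ltr_pM2r ?invr_gt0//.
 have -> : (x - b < x - a)%R = (a < b)%R by rewrite ltrD2l ltrN2.
 case: ifPn => _; last by rewrite mule0.
 rewrite -!EFinB -EFinM; congr (_%:E); field; lra.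
rewrite (eq_measure_integral nu); last by move=> A mA _; exact: E.
rewrite ge0_integral_mscale//; congr (_ * _).
by rewrite ge0_integral_pushforward//= preimage_setT.
Qed.

Lemma lebesgue_reflect (t : R) (k : R -> \bar R) :
 measurable_fun [set: R] k -> (forall y, 0 <= k y) ->
 \int[mu]_y k y = \int[mu]_z k (t - z)%R.
Proof.
move=> mk k0; rewrite (lebesgue_affine t ltr01)// mul1e.
by apply: eq_integral => z _; rewrite mul1r.
Qed.

End affine1.

(** * Points of the product space and row vectors *)

Section rowspace.
Variable R : realType.
Local Notation E n := (mst (lebN R n)).

Fixpoint mkE (n : nat) (c : nat -> R) : E n :=
 match n return E n with
 | 0 => tt
 | m.+1 => (c 0%N, mkE m (fun i => c i.+1))
 end.

Lemma coords_mkE n (c : nat -> R) i : (i < n)%N -> coords (mkE n c) i = c i.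
Proof. by elim: n c i => [//|n IH] c [|i] //= h; rewrite IH. Qed.

Lemma mkE_coords n (p : E n) : mkE n (coords p) = p.
Proof. by elim: n p => [[]|n IH] //= [a b] /=; congr pair; rewrite -{2}(IH b). Qed.

(** Total on [nat], as [mkE] and [coords] are, so that recursion on the dimension handles no
    ordinals. *)
Definition rcoord n (x : 'rV[R]_n) (i : nat) : R :=
 if insub i is Some j then x ord0 j else 0.

Lemma rcoordE n (x : 'rV[R]_n) (i : 'I_n) : rcoord x i = x ord0 i.
Proof. by rewrite /rcoord valK. Qed.

Definition fromrow n (x : 'rV[R]_n) : E n := mkE n (rcoord x).

Lemma torowK n (x : 'rV[R]_n) : torow (fromrow x) = x.
Proof.
apply/rowP => i; rewrite /torow !mxE /fromrow coords_mkE// /rcoord.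
by rewrite valK.
Qed.

Lemma mkE_eq n (c c' : nat -> R) : (forall i, (i < n)%N -> c i = c' i) ->
 mkE n c = mkE n c'.
Proof.
elim: n c c' => [//|n IH] c c' h /=; rewrite h//; congr pair.
by apply: IH => i ilt; exact: h.
Qed.

Lemma fromrowK n (p : E n) : fromrow (torow p) = p.
Proof.
rewrite -[RHS]mkE_coords; apply: mkE_eq => i ilt.
by rewrite (_ : i = Ordinal ilt)// rcoordE mxE.
Qed.

Lemma measurable_coords n i : measT (fun p : E n => coords p i).
Proof.
elim: n i => [|n IH] i /=; first exact: measurable_cst.
case: i => [|i]; first exact: measurable_fst.
exact: (measurableT_comp (IH i) measurable_snd).
Qed.

Lemma measurable_mkE d (T : measurableType d) n (c : T -> nat -> R) :
 (forall i, measT (fun t => c t i)) ->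
 measT (fun t => mkE n (c t)).
Proof.
elim: n c => [|n IH] c mc /=; first exact: measurable_cst.
apply: measurable_fun_pair; first exact: mc.
by apply: (IH (fun t i => c t i.+1)) => i; exact: mc.
Qed.

(** The substitution [y = x - c z], built on the product side, where measurability and Tonelli's
    theorem are available. *)
Definition aff n (x : 'rV[R]_n) (c : R) (z : E n) : E n :=
 mkE n (fun i => rcoord x i - c * coords z i).

Lemma torow_aff n (x : 'rV[R]_n) c z : torow (aff x c z) = x - c *: torow z.
Proof. by apply/rowP => i; rewrite !mxE coords_mkE// rcoordE. Qed.

Lemma torow_coord n (p : E n) (i : 'I_n) : torow p ord0 i = coords p i.
Proof. by rewrite mxE. Qed.

Lemma measurable_torow_coord n (i : 'I_n) :
 measT (fun p : E n => torow p ord0 i).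
Proof. by under eq_fun do rewrite torow_coord; exact: measurable_coords. Qed.

Definition rtail n (x : 'rV[R]_n.+1) : 'rV[R]_n := \row_j x ord0 (lift ord0 j).

Lemma torow_tail n (p : E n.+1) : rtail (torow p) = torow p.2.
Proof. by apply/rowP => j; rewrite !mxE. Qed.

Lemma aff_tail n (x : 'rV[R]_n.+1) c (z : E n.+1) :
 aff x c z = (x ord0 ord0 - c * z.1, aff (rtail x) c z.2).
Proof.
rewrite /aff /=; congr pair; first by rewrite -(rcoordE x ord0).
apply: mkE_eq => i ilt; congr (_ - _).
rewrite (_ : i = Ordinal ilt)// rcoordE mxE -(rcoordE x).
by rewrite lift0.
Qed.

End rowspace.

(** * Measurability of continuous functions of row vectors *)

Section meas_cont.
Variable R : realType.

Definition rnd (m : nat) (a : R) : R := (Num.floor (a * m.+1%:R))%:~R / m.+1%:R.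

Lemma rnd_cvg (a : R) : rnd m a @[m --> \oo] --> a.
Proof.
apply/cvgrPdist_lt => e e0.
have [N _ HN] := near_infty_natSinv_lt (PosNum e0).
exists N => // m /= /HN /=; apply: le_lt_trans; rewrite /rnd.
set b := a * m.+1%:R.
have m0 : (0 : R) < m.+1%:R by rewrite ltr0n.
have ->: a = b / m.+1%:R by rewrite /b mulfK// gt_eqF.
rewrite -mulrBl normrM normfV (gtr0_norm m0) -[leRHS]mul1r.
rewrite ler_pM2r ?invr_gt0//.
have h1 := Num.Theory.floor_le_tmp b; have h2 := Num.Theory.floorD1_gt b.
rewrite intrD1 in h2.
by rewrite ger0_norm; lra.
Qed.

Lemma measurable_countable_comp d (T : measurableType d) (I : countType)
  (idx : T -> I) (F : I -> R) :
 (forall a, measurable (idx @^-1` [set a])) ->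
 measT (fun t => F (idx t)).
Proof.
move=> H _ Y mY; rewrite setTI.
rewrite (_ : _ @^-1` _ = \bigcup_a (if `[< Y (F a) >] then idx @^-1` [set a] else set0)).
 apply: countable_bigcupT_measurable => [|a]; first exact: countableP.
 by case: ifP.
apply/seteqP; split => t /=.
 by move=> h; exists (idx t) => //; rewrite asboolT.
by move=> [a _]; case: asboolP => // h /= ->.
Qed.

Lemma measurable_floor_eq d (T : measurableType d) (g : T -> R) (c : R) (b : int) :
 measT g -> measurable [set t | Num.floor (g t * c) = b].
Proof.
move=> mg.
rewrite (_ : [set _ | _] = (fun t => g t * c) @^-1` `[b%:~R, (b + 1)%:~R[%classic).
 rewrite -[X in measurable X]setTI; apply: (measurable_funM mg (measurable_cst _)) => //.
apply/seteqP; split => t /=; rewrite in_itv/=.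
 by move=> <-; rewrite Num.Theory.floor_le_tmp Num.Theory.floorD1_gt.
by move=> h; apply/esym/eqP; rewrite eq_sym; apply/eqP/Num.Theory.floor_def.
Qed.

(** Measurability is given for the coordinates only. Rounding them down to the grid of mesh
    [1/(m+1)] makes the composition factor through a countable set, and continuity makes the rounded
    functions converge pointwise. *)
Lemma measurable_comp_rV d (T : measurableType d) n (D : set T) (g : T -> 'rV[R]_n)
  (s : T -> R) (k : 'rV[R]_n -> R -> R) :
 (forall i, measT (fun t => g t ord0 i)) ->
 measT s ->
 (forall t, D t -> {for (g t, s t), jcont k}) ->
 measurable_fun D (fun t => k (g t) (s t)).
Proof.
move=> mg ms ck.
pose h m t := k (\row_i rnd m (g t ord0 i)) (rnd m (s t)).
apply: (@measurable_fun_cvg _ _ _ _ h) => [m|t Dt].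
- apply: measurable_funTS.
 pose idx t : 'rV[int]_n * int :=
  (\row_i Num.floor (g t ord0 i * m.+1%:R), Num.floor (s t * m.+1%:R)).
 pose F (a : 'rV[int]_n * int) := k (\row_i ((a.1 ord0 i)%:~R / m.+1%:R)) (a.2%:~R / m.+1%:R).
 rewrite (_ : h m = (fun t => F (idx t))); last first.
  apply/funext => t; rewrite /h /F /idx /=; congr (k _ _).
  by apply/rowP => i; rewrite !mxE.
 apply: measurable_countable_comp => a.
 rewrite (_ : _ @^-1` _ = (\bigcap_(i in [set: 'I_n]) [set t | Num.floor (g t ord0 i * m.+1%:R) = a.1 ord0 i])
   `&` [set t | Num.floor (s t * m.+1%:R) = a.2]); last first.
  apply/seteqP; split => t /=.
   by move=> <- /=; split => // i _; rewrite mxE.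
  case: a => a1 a2 [h1 h2] /=; rewrite /idx; congr pair => //.
  by apply/rowP => i; rewrite mxE (h1 i).
 apply: measurableI; last exact: measurable_floor_eq.
 apply: fin_bigcap_measurable; first exact: finite_finset.
 by move=> i _; exact: measurable_floor_eq.
- have c := ck t Dt.
 have : (\row_i rnd m (g t ord0 i), rnd m (s t)) @[m --> \oo] --> (g t, s t).
  have h1 : (\row_i rnd m (g t ord0 i)) @[m --> \oo] --> g t.
   apply: seq_cvg_rV => i; rewrite (_ : (fun _ => _) = (fun m => rnd m (g t ord0 i))); first exact: rnd_cvg.
   by apply/funext => m; rewrite mxE.
  by apply: pair_cvg => //; exact: rnd_cvg.
 by move=> h1; exact: (cvg_comp _ _ h1 c).
Qed.

Lemma measurable_torow n (D : set (mst (lebN R n))) (k : 'rV[R]_n -> R) :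
 (forall p, D p -> {for torow p, continuous k}) ->
 measurable_fun D (fun p => k (torow p)).
Proof.
move=> ck; apply: (@measurable_comp_rV _ _ n D (@torow R n) (fun=> 0) (fun x _ => k x)).
- by move=> i; exact: measurable_torow_coord.
- exact: measurable_cst.
- move=> t Dt; apply: (@cvg_comp _ _ _ fst k); [exact: cvg_fst|exact: ck].
Qed.

End meas_cont.

(** * The one-dimensional heat kernel *)

Section heat1.
Variable R : realType.
Local Notation mu := (@lebesgue_measure R).

Definition g1 (t a : R) : R := (Num.sqrt (4 * pi * t))^-1 * expR (- (a ^+ 2) / (4 * t)).

Lemma g1_ge0 t a : 0 <= g1 t a.
Proof. by rewrite mulr_ge0// ?expR_ge0// invr_ge0 sqrtr_ge0. Qed.

Lemma pi4_gt0 t : 0 < t -> (0 : R) < 4 * pi * t.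
Proof. by move=> t0; rewrite !mulr_gt0// pi_gt0. Qed.

Lemma g1_normal t x y : 0 < t -> g1 t (x - y) = normal_pdf x (Num.sqrt (2 * t)) y.
Proof.
move=> t0; have t2 : 0 < 2 * t by rewrite mulr_gt0.
rewrite normal_pdfE ?gt_eqF ?sqrtr_gt0//= /normal_peak /normal_fun sqr_sqrtr ?ltW//.
rewrite /g1; congr (_^-1 * expR (_ * _^-1)).
- by congr (Num.sqrt _); rewrite -mulr_natl; ring.
- by congr (- _); rewrite -sqrrN opprB.
- by rewrite -mulr_natl; ring.
Qed.

Lemma measurable_g1 t x : measurable_fun [set: R] (fun y => g1 t (x - y)).
Proof.
apply: measurable_funM => //; apply: measurableT_comp; first exact: measurable_expR.
apply: measurable_funM => //; apply: measurableT_comp => //.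
by apply: measurable_funX; exact: measurable_funB.
Qed.

Lemma g1_int x t : 0 < t -> (\int[mu]_y (g1 t (x - y))%:E = 1)%E.
Proof.
by move=> t0; under eq_integral do rewrite g1_normal//; exact: integral_normal_pdf.
Qed.

(** Completing the square in [y]: the last factor is a Gaussian in [y] of mass 1, which makes the
    semigroup law immediate. *)
Lemma g1_mul t s x y z : 0 < t -> 0 < s ->
 g1 t (x - y) * g1 s (y - z) =
 g1 (t + s) (x - z) * g1 (t * s / (t + s)) ((s * x + t * z) / (t + s) - y).
Proof.
move=> t0 s0; have ts : 0 < t + s by rewrite addr_gt0.
have tst : 0 < t * s / (t + s) by rewrite divr_gt0// mulr_gt0.
have hp := pi_gt0 R.
rewrite /g1 mulrACA [RHS]mulrACA -!expRD -!invfM; congr (_^-1 * expR _).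
 rewrite -!sqrtrM ?ltW ?pi4_gt0//; congr Num.sqrt; field; lra.
field; apply/and3P; split; lra.
Qed.

Lemma g1_semig t s x z : 0 < t -> 0 < s ->
 (\int[mu]_y (g1 t (x - y) * g1 s (y - z))%:E = (g1 (t + s) (x - z))%:E)%E.
Proof.
move=> t0 s0; have ts : 0 < t + s by rewrite addr_gt0.
have tst : 0 < t * s / (t + s) by rewrite divr_gt0// mulr_gt0.
under eq_integral do rewrite g1_mul// EFinM.
rewrite ge0_integralZl//=.
- by rewrite g1_int// mule1.
- by apply/measurable_EFinP; exact: measurable_g1.
- by move=> y _; rewrite lee_fin g1_ge0.
- by rewrite lee_fin g1_ge0.
Qed.

End heat1.

(** * The heat kernel in dimension n, by recursion on the dimension *)

Section heatN.
Variable R : realType.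
Local Notation E n := (mst (lebN R n)).

Lemma enorm2 n (x : 'rV[R]_n) : enorm x ^+ 2 = \sum_(i < n) x ord0 i ^+ 2.
Proof. by rewrite sqr_sqrtr// sumr_ge0// => i _; exact: sqr_ge0. Qed.

Lemma heatGE n t (x y : 'rV[R]_n) : 0 < t ->
 heatG t x y = \prod_(i < n) g1 t (x ord0 i - y ord0 i).
Proof.
move=> t0; rewrite /heatG enorm2 big_split/= prodr_const card_ord; congr (_ * _).
 rewrite powRN (mulrC n%:R) powRrM powR12_sqrt ?ltW ?pi4_gt0// powR_mulrn ?sqrtr_ge0//.
 by rewrite exprVn.
rewrite -expR_sum; congr expR; rewrite -mulr_suml -sumrN; congr (_ / _).
by apply: eq_bigr => i _; rewrite !mxE.
Qed.

Lemma heatG_recl n t (x y : 'rV[R]_n.+1) : 0 < t ->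
 heatG t x y = g1 t (x ord0 ord0 - y ord0 ord0) * heatG t (rtail x) (rtail y).
Proof.
move=> t0; rewrite !heatGE// big_ord_recl; congr (_ * _).
by apply: eq_bigr => i _; rewrite !mxE.
Qed.

Lemma heatG_ge0 n t (x y : 'rV[R]_n) : 0 <= heatG t x y.
Proof. by rewrite /heatG mulr_ge0// ?powR_ge0 ?expR_ge0. Qed.

Lemma int_pmeas d1 d2 (T1 : measurableType d1) (T2 : measurableType d2)
  (m1 : {sigma_finite_measure set T1 -> \bar R})
  (m2 : {sigma_finite_measure set T2 -> \bar R}) (K : T1 * T2 -> \bar R) :
 measT K -> (forall p, (0 <= K p)%E) ->
 (\int[pmeas m1 m2]_p K p = \int[m1]_x \int[m2]_y K (x, y))%E.
Proof. by move=> mK K0; rewrite /pmeas fubini_tonelli1. Qed.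

Lemma int_pmeas_mul d1 d2 (T1 : measurableType d1) (T2 : measurableType d2)
  (m1 : {sigma_finite_measure set T1 -> \bar R})
  (m2 : {sigma_finite_measure set T2 -> \bar R}) (a : T1 -> R) (b : T2 -> R) :
 measT a -> measT b ->
 (forall p, 0 <= a p) -> (forall p, 0 <= b p) ->
 (\int[pmeas m1 m2]_p (a p.1 * b p.2)%:E = \int[m1]_x (a x)%:E * \int[m2]_y (b y)%:E)%E.
Proof.
move=> ma mb a0 b0; rewrite int_pmeas/=; last 2 first.
- apply/measurable_EFinP; apply: measurable_funM.
 + exact: (measurableT_comp ma measurable_fst).
 + exact: (measurableT_comp mb measurable_snd).
- by move=> p; rewrite lee_fin mulr_ge0.
rewrite -ge0_integralZr//=.
- apply: eq_integral => x _; under eq_integral do rewrite EFinM.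
 rewrite ge0_integralZl//=; first exact/measurable_EFinP.
 + by move=> y _; rewrite lee_fin.
 + by rewrite lee_fin.
- exact/measurable_EFinP.
- by move=> x _; rewrite lee_fin.
- by apply: integral_ge0 => y _; rewrite lee_fin.
Qed.

Lemma torow0 n (p : E n.+1) : torow p ord0 ord0 = p.1.
Proof. by rewrite mxE. Qed.

End heatN.

Section heatNint.
Variable R : realType.
Local Notation E n := (mst (lebN R n)).

Lemma measurable_heatGy n t (x : 'rV[R]_n) : 0 < t ->
 measT (fun p : E n => heatG t x (torow p)).
Proof.
move=> t0; under eq_fun do rewrite heatGE//.
apply: measurable_prod => i _.
exact: (measurableT_comp (measurable_g1 t (x ord0 i)) (measurable_torow_coord i)).
Qed.

Lemma heatGC n t (x y : 'rV[R]_n) : 0 < t -> heatG t x y = heatG t y x.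
Proof.
by move=> t0; rewrite !heatGE//; apply: eq_bigr => i _; rewrite /g1 -sqrrN opprB.
Qed.

Lemma heatG_torow n t (x : 'rV[R]_n.+1) (p : E n.+1) : 0 < t ->
 heatG t x (torow p) = g1 t (x ord0 ord0 - p.1) * heatG t (rtail x) (torow p.2).
Proof.
move=> t0; rewrite (heatG_recl x (torow p) t0); congr (_ * _).
 exact: (f_equal (fun a => g1 t (x ord0 ord0 - a)) (torow0 p)).
exact: (f_equal (fun a => heatG t (rtail x) a) (torow_tail p)).
Qed.

Lemma heatG_torowr n t (x : 'rV[R]_n.+1) (p : E n.+1) : 0 < t ->
 heatG t (torow p) x = g1 t (p.1 - x ord0 ord0) * heatG t (torow p.2) (rtail x).
Proof.
move=> t0; rewrite (heatG_recl (torow p) x t0); congr (_ * _).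
 exact: (f_equal (fun a => g1 t (a - x ord0 ord0)) (torow0 p)).
exact: (f_equal (fun a => heatG t a (rtail x)) (torow_tail p)).
Qed.

Lemma heatG_int n t (x : 'rV[R]_n) : 0 < t ->
 (\int[lebRN R n]_p (heatG t x (torow p))%:E = 1)%E.
Proof.
move=> t0; elim: n x => [|n IH] x.
 rewrite /lebRN /= integral_dirac//=.
 by rewrite diracT mul1e heatGE// big_ord0.
rewrite /lebRN /=.
transitivity (\int[pmeas leb (msm (lebN R n))]_p
  (g1 t (x ord0 ord0 - p.1) * heatG t (rtail x) (torow p.2))%:E)%E.
 by apply: eq_integral => p _; congr EFin; exact: heatG_torow.
rewrite (@int_pmeas_mul _ _ _ _ _ leb (msm (lebN R n))
 (fun y => g1 t (x ord0 ord0 - y)) (fun q => heatG t (rtail x) (torow q))).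
- by rewrite g1_int// mul1e; exact: IH.
- exact: measurable_g1.
- exact: measurable_heatGy.
- by move=> p; exact: g1_ge0.
- by move=> p; exact: heatG_ge0.
Qed.

Lemma heatG_semig n t s (x z : 'rV[R]_n) : 0 < t -> 0 < s ->
 (\int[lebRN R n]_p (heatG t x (torow p) * heatG s (torow p) z)%:E =
  (heatG (t + s) x z)%:E)%E.
Proof.
move=> t0 s0; have ts : 0 < t + s by rewrite addr_gt0.
have mH m (y : 'rV[R]_m) : measT (fun p : E m => heatG s (torow p) y).
 by under eq_fun do rewrite heatGC//; exact: measurable_heatGy.
elim: n x z => [|n IH] x z.
 rewrite /lebRN /= integral_dirac//=.
 by rewrite diracT mul1e !heatGE// !big_ord0 mul1r.
rewrite /lebRN /=.
transitivity (\int[pmeas leb (msm (lebN R n))]_p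
  ((g1 t (x ord0 ord0 - p.1) * g1 s (p.1 - z ord0 ord0)) *
  (heatG t (rtail x) (torow p.2) * heatG s (torow p.2) (rtail z)))%:E)%E.
 apply: eq_integral => p _; congr EFin; rewrite [LHS](f_equal2 _ (heatG_torow x p t0) (heatG_torowr z p s0)).
 exact: mulrACA.
rewrite (@int_pmeas_mul _ _ _ _ _ leb (msm (lebN R n))
 (fun y => g1 t (x ord0 ord0 - y) * g1 s (y - z ord0 ord0))
 (fun q => heatG t (rtail x) (torow q) * heatG s (torow q) (rtail z))).
- by rewrite g1_semig// IH -EFinM heatG_recl.
- apply: measurable_funM; first exact: measurable_g1.
 rewrite (_ : (fun y => _) = (fun y => g1 s (z ord0 ord0 - y))); first exact: measurable_g1.
 by apply/funext => y; rewrite /g1 -sqrrN opprB.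
- by apply: measurable_funM => //; exact: measurable_heatGy.
- by move=> p; rewrite mulr_ge0// g1_ge0.
- by move=> p; rewrite mulr_ge0// heatG_ge0.
Qed.

Lemma measurable_aff n (x : 'rV[R]_n) c : measT (fun z : E n => aff x c z).
Proof.
apply: measurable_mkE => i; apply: measurable_funB => //.
by apply: measurable_funM => //; exact: measurable_coords.
Qed.

(** Induction on the dimension through Tonelli's theorem, each coordinate contributing one factor
    [c]. *)
Lemma lebN_affine n (x : 'rV[R]_n) (c : R) (K : E n -> \bar R) : 0 < c ->
 measT K -> (forall y, (0 <= K y)%E) ->
 (\int[lebRN R n]_y K y = (c ^+ n)%:E * \int[lebRN R n]_z K (aff x c z))%E.
Proof.
move=> c0; elim: n x K => [|n IH] x K mK K0.
 by rewrite expr0 mul1e; apply: eq_integral => -[] _.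
rewrite /lebRN /= !int_pmeas//; last first.
 exact: (measurableT_comp mK (measurable_aff x c)).
have mF : measT (fun a : R => \int[msm (lebN R n)]_y K (a, y))%E.
 exact: (measurable_fun_fubini_tonelli_F (m2 := msm (lebN R n)) K).
rewrite (lebesgue_affine (x ord0 ord0) c0)//; last first.
 by move=> y; exact: integral_ge0.
rewrite exprS EFinM -muleA; congr (_ * _)%E.
rewrite -ge0_integralZl//=; last 3 first.
- apply: (measurable_fun_fubini_tonelli_F (m2 := msm (lebN R n))
  (fun z => K (aff x c z))) => //.
 exact: (measurableT_comp mK (measurable_aff x c)).
- by move=> a _; exact: integral_ge0.
- by rewrite lee_fin exprn_ge0// ltW.
apply: eq_integral => a _.
under [in RHS]eq_integral do rewrite aff_tail/=.
rewrite -(IH (rtail x) (fun q => K (x ord0 ord0 - c * a, q)))//.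
exact: measurable_fun_pair2.
Qed.

(** The standard Gaussian density: at time 1/2 the heat kernel has variance 1 in each coordinate. *)
Definition gau n (z : E n) : R := heatG 2^-1 0 (torow z).

Lemma gau_ge0 n (z : E n) : 0 <= gau z. Proof. exact: heatG_ge0. Qed.

Lemma measurable_gau n : measT (@gau n).
Proof. by apply: measurable_heatGy; rewrite invr_gt0. Qed.

Lemma gau_int n : (\int[lebRN R n]_z (gau z)%:E = 1)%E.
Proof. by apply: heatG_int; rewrite invr_gt0. Qed.

Lemma heatG_gau n t (x : 'rV[R]_n) (z : E n) : 0 < t ->
 (Num.sqrt (2 * t)) ^+ n * heatG t x (torow (aff x (Num.sqrt (2 * t)) z)) = gau z.
Proof.
move=> t0; have h2 : (0 : R) < 2^-1 by rewrite invr_gt0.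
have t2 : 0 < 2 * t by rewrite mulr_gt0.
have -> : Num.sqrt (2 * t) ^+ n = \prod_(i < n) Num.sqrt (2 * t).
 by rewrite prodr_const card_ord.
rewrite /gau !heatGE// -big_split/=.
apply: eq_bigr => i _; rewrite torow_aff !mxE opprB addrCA subrr addr0 sub0r.
rewrite /g1 sqrrN exprMn sqr_sqrtr ?ltW// mulrA; congr (_ * expR _).
 rewrite -[RHS]mul1r -[4 * pi * t]/(4 * pi * t).
 rewrite (_ : 4 * pi * t = (2 * t) * (4 * pi * 2^-1)); last by field.
 rewrite [in LHS](sqrtrM (4 * pi / 2) (ltW t2)) invfM mulrA mulfV ?gt_eqF ?sqrtr_gt0//.
by field; lra.
Qed.

(* Change of variables y = x - sqrt(2t) z turning the heat kernel into the standard Gaussian. *)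
Lemma heatG_cv n t (x : 'rV[R]_n) (k : E n -> R) : 0 < t ->
 measT k -> (forall y, 0 <= k y) ->
 (\int[lebRN R n]_y (heatG t x (torow y) * k y)%:E =
  \int[lebRN R n]_z (gau z * k (aff x (Num.sqrt (2 * t)) z))%:E)%E.
Proof.
move=> t0 mk k0; have c0 : 0 < Num.sqrt (2 * t) by rewrite sqrtr_gt0 mulr_gt0.
have mK : measT (fun y : E n => (heatG t x (torow y) * k y)%:E).
 by apply/measurable_EFinP/measurable_funM => //; exact: measurable_heatGy.
have K0 y : (0 <= (heatG t x (torow y) * k y)%:E)%E.
 by rewrite lee_fin mulr_ge0// heatG_ge0.
rewrite (lebN_affine x c0)// -ge0_integralZl//=.
- by apply: eq_integral => z _; rewrite -EFinM mulrA heatG_gau.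
- exact: (measurableT_comp mK (measurable_aff x (Num.sqrt (2 * t)))).
Qed.

End heatNint.

(** * Differential calculus along lines and curves *)

Section calculus.
Variable R : realType.

(** Reduces a directional derivative to one real variable, so that the one-variable rules
    transfer. *)
Lemma is_derive_lineP (V : normedModType R) (g : V -> R) (x v : V) (d : R) :
 is_derive x v g d <-> is_derive (0 : R) 1 (fun s : R => g (s *: v + x)) d.
Proof.
have E : (fun s : R => s^-1 *: (g (s *: v + x) - g x)) =
  (fun s : R => s^-1 *: ((fun s : R => g (s *: v + x)) (s *: 1 + 0) - (fun s : R => g (s *: v + x)) 0)).
 by apply/funext => s; rewrite /= scale0r add0r addr0 [s *: 1]mulr1.
by split=> -[h1 h2]; split; move: h1 h2; rewrite /derivable /derive E.
Qed.

Lemma is_derive_shiftP (g : R -> R) (x d : R) :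
 is_derive x 1 g d <-> is_derive (0 : R) 1 (fun s => g (s + x)) d.
Proof.
rewrite is_derive_lineP; rewrite (_ : (fun s : R => g (s *: 1 + x)) = (fun s => g (s + x)))//.
by apply/funext => s; rewrite [s *: 1]mulr1.
Qed.

Lemma line_derive (V : normedModType R) (g : V -> R) (dg : V -> R) (x v : V) :
 (forall y, is_derive y v g (dg y)) ->
 forall s : R, is_derive s 1 (fun s : R => g (s *: v + x)) (dg (s *: v + x)).
Proof.
move=> H s; apply/is_derive_shiftP.
have /is_derive_lineP := H (s *: v + x).
rewrite (_ : (fun s0 : R => g (s0 *: v + (s *: v + x))) = (fun s0 => g ((s0 + s) *: v + x)))//.
by apply/funext => s0; rewrite addrA -scalerDl.
Qed.

Lemma der_cont (g : R -> R) (x d : R) :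
 is_derive x 1 g d -> {for x, continuous g}.
Proof. by move=> [h _]; apply: differentiable_continuous; apply/derivable1_diffP. Qed.

Lemma MVT_line (V : normedModType R) (g dg : V -> R) (x v : V) (a : R) :
 (forall y, is_derive y v g (dg y)) ->
 exists2 th : R, `|th| <= `|a| & g (a *: v + x) - g x = a * dg (th *: v + x).
Proof.
move=> H; have D := line_derive x H.
have C s : {for s, continuous (fun s : R => g (s *: v + x))}.
 exact: der_cont (D s).
have [a0|a0] := leP 0 a.
 have [|c] := @MVT_segment _ (fun s : R => g (s *: v + x)) _ 0 a a0 (fun s _ => D s).
  by apply: continuous_subspaceT => s; exact: C.
 rewrite in_itv/= => /andP[c0 ca]; rewrite scale0r add0r subr0 mulrC => ->.
 by exists c => //; rewrite !ger0_norm.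
have [|c] := @MVT_segment _ (fun s : R => g (s *: v + x)) _ a 0 (ltW a0) (fun s _ => D s).
 by apply: continuous_subspaceT => s; exact: C.
rewrite in_itv/= => /andP[ca c0]; rewrite scale0r add0r => e.
exists c; first by rewrite !ler0_norm ?lerN2// ltW.
by rewrite -[LHS]opprB e; ring.
Qed.

Lemma normr_coord n (x : 'rV[R]_n) i : `|x ord0 i| <= `|x|.
Proof.
rewrite -[`|x|]/(mx_norm x) mx_normrE.
by apply: (bigmax_sup (ord0, i)).
Qed.

Lemma normr_row_lt n (x : 'rV[R]_n) e : 0 < e -> (forall i, `|x ord0 i| < e) -> `|x| < e.
Proof.
move=> e0 H; rewrite -[`|x|]/(mx_norm x) mx_normrE.
apply/bigmax_ltP; split => // -[i j] _ /=; rewrite (ord1 i); exact: H.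
Qed.

(** The vertices of the path from 0 to [v] that follows the axes one after the other. *)
Definition vcut n (v : 'rV[R]_n) (k : nat) : 'rV[R]_n := \row_i (if (i < k)%N then v ord0 i else 0).

Lemma vcut0 n (v : 'rV[R]_n) : vcut v 0 = 0.
Proof. by apply/rowP => i; rewrite !mxE. Qed.

Lemma vcutn n (v : 'rV[R]_n) : vcut v n = v.
Proof. by apply/rowP => i; rewrite !mxE ltn_ord. Qed.

Lemma vcutS n (v : 'rV[R]_n) (k : 'I_n) : vcut v k.+1 = v ord0 k *: evec R k + vcut v k.
Proof.
apply/rowP => i; rewrite !mxE eqxx/= ltnS leq_eqVlt.
have [->|ik] := eqVneq i k; first by rewrite eqxx ltnn mulr1 addr0.
by rewrite mulr0 add0r; have -> : (i == k :> nat) = false by apply/negbTE.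
Qed.

(* Continuity of the partial derivatives upgrades them to a total differential. *)
Lemma total_diff n (g : 'rV[R]_n -> R) (dg : 'I_n -> 'rV[R]_n -> R) (y : 'rV[R]_n) :
 (forall i x, is_derive x (evec R i) g (dg i x)) ->
 (forall i, {for y, continuous (dg i)}) ->
 forall e, 0 < e -> exists2 d, 0 < d & forall v, `|v| < d ->
  `|g (v + y) - g y - \sum_i v ord0 i * dg i y| <= e * \sum_i `|v ord0 i|.
Proof.
move=> D C e e0.
have : \forall x \near y, forall i, `|dg i y - dg i x| < e.
 have F i : \forall x \near y, `|dg i y - dg i x| < e.
  by have /cvgrPdist_lt/(_ _ e0) := C i.
 by move/filter_forall : F; apply: filterS.
move=> /nbhs_ballP[d /= d0 Hd]; exists d => // v vd.
have vi i : `|v ord0 i| < d by apply: le_lt_trans vd; exact: normr_coord.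
have -> : g (v + y) - g y = \sum_(k < n) (g (vcut v k.+1 + y) - g (vcut v k + y)).
 rewrite -(big_mkord xpredT (fun k => g (vcut v k.+1 + y) - g (vcut v k + y))).
 by rewrite telescope_sumr// vcut0 vcutn add0r.
rewrite -sumrB mulr_sumr; apply: le_trans (ler_norm_sum _ _ _) _.
apply: ler_sum => k _.
have [th thk] := @MVT_line _ g (dg k) (vcut v k + y) (evec R k) (v ord0 k) (D k).
rewrite addrA -vcutS => ->.
rewrite -mulrBr normrM mulrC; apply: ler_wpM2r => //.
rewrite distrC ltW//; apply: Hd.
rewrite -ball_normE /= (_ : y - _ = - (th *: evec R k + vcut v k)); last first.
 by rewrite addrA opprD addrCA subrr addr0.
rewrite normrN; apply: normr_row_lt => // i; rewrite !mxE eqxx/=.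
have [->|ik] := eqVneq i k; first by rewrite ltnn addr0 mulr1; apply: le_lt_trans thk _.
by rewrite mulr0 add0r; case: ifP; rewrite ?normr0.
Qed.

Lemma is_derive_cvgP (f : R -> R) (s d : R) :
 is_derive s 1 f d <-> h^-1 * (f (h + s) - f s) @[h --> 0^'] --> d.
Proof.
have E : (fun h : R => h^-1 *: (f (h *: 1 + s) - f s)) = (fun h => h^-1 * (f (h + s) - f s)).
 by apply/funext => h; rewrite [h *: 1]mulr1.
split=> [[H <-]|H]; first by move: H; rewrite /derivable /derive E.
by split; [apply/cvg_ex; exists d; rewrite E|rewrite /derive E; apply/cvg_lim].
Qed.

Lemma der_val (f : R -> R) (x d d' : R) : is_derive x 1 f d -> d = d' -> is_derive x 1 f d'.
Proof. by move=> h <-. Qed.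

Lemma der_cst (c x : R) : is_derive x 1 (fun=> c) 0.
Proof. exact: is_derive_cst. Qed.

Lemma der_id (x : R) : is_derive x 1 (fun y : R => y) 1.
Proof. exact: is_derive_id. Qed.

Lemma der_add (f g : R -> R) (x df dg : R) : is_derive x 1 f df -> is_derive x 1 g dg ->
 is_derive x 1 (fun y => f y + g y) (df + dg).
Proof. by move=> hf hg; exact: is_deriveD. Qed.

Lemma der_opp (f : R -> R) (x df : R) : is_derive x 1 f df ->
 is_derive x 1 (fun y => - f y) (- df).
Proof. by move=> hf; exact: is_deriveN. Qed.

Lemma der_sub (f g : R -> R) (x df dg : R) : is_derive x 1 f df -> is_derive x 1 g dg ->
 is_derive x 1 (fun y => f y - g y) (df - dg).
Proof. by move=> hf hg; exact: is_deriveB. Qed.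

Lemma der_mul (f g : R -> R) (x df dg : R) : is_derive x 1 f df -> is_derive x 1 g dg ->
 is_derive x 1 (fun y => f y * g y) (df * g x + f x * dg).
Proof.
move=> hf hg; have := @is_deriveM _ _ f g x 1 df dg hf hg.
by move=> h; apply: der_val h _; rewrite ![_ *: _]mulrC addrC mulrC [g x * df]mulrC mulrC [dg * f x]mulrC.
Qed.

Lemma der_comp (f g : R -> R) (x a b : R) : is_derive (g x) 1 f a -> is_derive x 1 g b ->
 is_derive x 1 (fun y => f (g y)) (a * b).
Proof. by move=> hf hg; exact: is_derive1_comp. Qed.

Lemma der_scale (c : R) (f : R -> R) (x df : R) : is_derive x 1 f df ->
 is_derive x 1 (fun y => c * f y) (c * df).
Proof. by move=> hf; apply: der_val (der_mul (der_cst c x) hf) _; rewrite mul0r add0r. Qed.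

Lemma der_inv (f : R -> R) (x df : R) : f x != 0 -> is_derive x 1 f df ->
 is_derive x 1 (fun y => (f y)^-1) (- df / f x ^+ 2).
Proof.
move=> f0 hf; have [h1 h2] := hf; split; first exact: derivableV.
by have := deriveV f0 h1; rewrite h2 => ->; rewrite [_ *: _]mulrC mulrN mulNr.
Qed.

Lemma der_exp (f : R -> R) (x df : R) : is_derive x 1 f df ->
 is_derive x 1 (fun y => expR (f y)) (expR (f x) * df).
Proof. by move=> hf; apply: der_comp => //; exact: is_derive_expR. Qed.

Lemma der_ln (f : R -> R) (x df : R) : 0 < f x -> is_derive x 1 f df ->
 is_derive x 1 (fun y => ln (f y)) (df / f x).
Proof.
by move=> f0 hf; apply: der_val (der_comp (is_derive1_ln f0) hf) _; rewrite mulrC.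
Qed.

Lemma der_pow (f : R -> R) (x df : R) n : is_derive x 1 f df ->
 is_derive x 1 (fun y => f y ^+ n) (n%:R * f x ^+ n.-1 * df).
Proof.
move=> hf; have := @is_deriveX _ _ f n x 1 df hf.
rewrite (_ : f ^+ n = (fun y => f y ^+ n)); last by apply/funext => y; rewrite exprfctE.
by move=> h; apply: der_val h _; rewrite [_ *: _]mulrC mulr_natl mulrC.
Qed.

Lemma der_line (c x : R) : is_derive x 1 (fun y : R => c * y) c.
Proof. by apply: der_val (der_scale c (der_id x)) _; rewrite mulr1. Qed.

(** The increment along the diagonal splits into one in the first slot, with the second frozen at
    [s], and one in the second slot, which the mean value theorem evaluates as [Kb] at a point close
    to [(s, s)]. Joint continuity is asked of [Kb] alone. *)
Lemma diag_derive (K Kb : R -> R -> R) (s ka : R) :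
 is_derive s 1 (K ^~ s) ka -> (forall a b : R, is_derive b 1 (K a) (Kb a b)) ->
 {for (s, s), continuous (fun p : R * R => Kb p.1 p.2)} ->
 is_derive s 1 (fun s => K s s) (ka + Kb s s).
Proof.
move=> Da Db Cb; apply/is_derive_cvgP.
rewrite (_ : (fun h => _) = (fun h => h^-1 * (K (h + s) s - K s s)) \+
  (fun h => h^-1 * (K (h + s) (h + s) - K (h + s) s))); last first.
 by apply/funext => h /=; rewrite -mulrDr; congr (_ * _); ring.
apply: cvgD; first exact: (is_derive_cvgP _ _ _).1 Da.
apply/cvgrPdist_lt => e e0.
have /cvgrPdist_lt/(_ _ e0)/nbhs_ballP[d /= d0 Hd] := Cb.
near=> h.
have h0 : h != 0 by near: h; exact: nbhs_dnbhs_neq.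
have hd : `|h| < d by near: h; apply: dnbhs0_lt.
have [th thh] := @MVT_line R^o (K (h + s)) (Kb (h + s)) s 1 h (Db (h + s)).
rewrite ![_ *: 1]mulr1 => ->; rewrite mulrA mulVf// mul1r.
apply: (Hd (h + s, th + s)); split => /=; rewrite -ball_normE/=.
 by rewrite opprD addrCA subrr addr0 normrN.
by rewrite opprD addrCA subrr addr0 normrN; exact: le_lt_trans hd.
Unshelve. all: by end_near. Qed.

Lemma dir_derive n (g : 'rV[R]_n -> R) (dg : 'I_n -> 'rV[R]_n -> R) (y v : 'rV[R]_n) :
 (forall i x, is_derive x (evec R i) g (dg i x)) ->
 (forall i, {for y, continuous (dg i)}) ->
 is_derive y v g (\sum_i v ord0 i * dg i y).
Proof.
move=> D C; apply/is_derive_lineP/is_derive_cvgP.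
apply/cvgrPdist_le => e e0.
pose B := 1 + \sum_i `|v ord0 i|.
have B0 : 0 < B by rewrite ltr_wpDr// sumr_ge0.
have eB : 0 < e / B by rewrite divr_gt0.
have [d d0 Hd] := total_diff D C eB.
near=> h.
have h0 : h != 0 by near: h; exact: nbhs_dnbhs_neq.
have hd : `|h *: v| < d.
 rewrite normrZ; have v1 : 0 < `|v| + 1 by rewrite ltr_wpDl.
 have : `|h| < d / (`|v| + 1) by near: h; apply: dnbhs0_lt; rewrite divr_gt0.
 rewrite ltr_pdivlMr// => /(le_lt_trans _); apply.
 by rewrite ler_wpM2l// lerDl.
have := Hd _ hd; rewrite addr0 scale0r add0r.
have -> : \sum_i (h *: v) ord0 i * dg i y = h * \sum_i v ord0 i * dg i y.
 by rewrite mulr_sumr; apply: eq_bigr => i _; rewrite mxE mulrA.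
have -> : \sum_i `|(h *: v) ord0 i| = `|h| * \sum_i `|v ord0 i|.
 by rewrite mulr_sumr; apply: eq_bigr => i _; rewrite mxE normrM.
set G := g _ - g y; set S := \sum_i _; move=> H.
rewrite (_ : S - _ = - (h^-1 * (G - h * S))); last by field.
rewrite normrN normrM normfV ler_pdivrMl ?normr_gt0//.
apply: (le_trans H); rewrite mulrCA ler_wpM2l//.
rewrite mulrAC ler_pdivrMr// ler_wpM2l ?ltW//.
by rewrite /B ltrDr.
Unshelve. all: by end_near. Qed.

(** For [c s = sqrt (2 s)] this is the derivative of a space-time function along the paths that the
    heat kernel follows after the Gaussian change of variables. *)
Lemma chain_curve n (g : 'rV[R]_n -> R -> R) (dg : 'I_n -> 'rV[R]_n -> R -> R)
  (gt : 'rV[R]_n -> R -> R) (x0 z : 'rV[R]_n) (t0 : R) (c : R -> R) (s c' : R) :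
 (forall i x (t : R), is_derive x (evec R i) (g ^~ t) (dg i x t)) ->
 (forall x (t : R), is_derive t 1 (g x) (gt x t)) ->
 (forall i, jcont (dg i)) ->
 jcont gt ->
 is_derive s 1 c c' -> {for s, continuous c} ->
 is_derive s 1 (fun s => g (x0 - c s *: z) (t0 - s))
  (- c' * (\sum_i z ord0 i * dg i (x0 - c s *: z) (t0 - s)) - gt (x0 - c s *: z) (t0 - s)).
Proof.
move=> Dx Dt Cx Ct Dc Cc.
apply: (@diag_derive (fun a b => g (x0 - c a *: z) (t0 - b))
 (fun a b => - gt (x0 - c a *: z) (t0 - b))).
- have := @dir_derive n (g ^~ (t0 - s)) (fun i x => dg i x (t0 - s)) (x0 - c s *: z) (- z).
 move=> /(_ (fun i x => Dx i x _)) H.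
 have {}H : is_derive (x0 - c s *: z) (- z) (g ^~ (t0 - s))
   (\sum_i (- z) ord0 i * dg i (x0 - c s *: z) (t0 - s)).
  by apply: H => i; exact: (jcont_slice (h := dg i)).
 have H2 : is_derive (c s) 1 (fun a => g (x0 - a *: z) (t0 - s))
   (\sum_i (- z) ord0 i * dg i (x0 - c s *: z) (t0 - s)).
  apply/is_derive_shiftP; move/is_derive_lineP : H.
  rewrite (_ : (fun s0 : R => _) = (fun s0 => g (x0 - (s0 + c s) *: z) (t0 - s)))//.
  apply/funext => a; congr (g _ _).
  by rewrite scalerN scalerDl opprD addrCA.
 have := is_derive1_comp H2 Dc.
 rewrite (_ : _ * c' = - c' * \sum_i z ord0 i * dg i (x0 - c s *: z) (t0 - s))//.
 rewrite mulrC mulNr -mulrN; congr (_ * _); rewrite -sumrN; apply: eq_bigr => i _.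
 by rewrite mxE mulNr.
- move=> a b; have D1 : is_derive b 1 (fun b : R => t0 - b) (- 1).
  by apply: der_val (der_sub (der_cst t0 b) (der_id b)) _; rewrite sub0r.
 have := @der_comp (g (x0 - c a *: z)) (fun b => t0 - b) b _ _ (Dt _ _) D1.
 by rewrite mulrN1.
- apply: (@continuousN).
 apply: (@continuous_comp _ _ _ (fun p : R * R => (x0 - c p.1 *: z, t0 - p.2))
   (fun p : 'rV[R]_n * R => gt p.1 p.2)); last exact: Ct.
 apply: cont_pair => /=.
  apply: cvgB; first exact: cvg_cst.
  apply: cvgZr_tmp.
  by apply: (@continuous_comp _ _ _ fst c) => /=; [exact: cvg_fst|exact: Cc].
 by apply: cvgB; [exact: cvg_cst|exact: cvg_snd].
Qed.

End calculus.

(** * Domination, differentiation and finite sums under the integral *)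

Section generic_integrals.
Variable R : realType.
Context d (T : measurableType d) (mu : {measure set T -> \bar R}).

Lemma integrable_bddM (w k : T -> R) (M : R) (D : set T) : measurable D ->
 mu.-integrable D (EFin \o w) -> measurable_fun D k -> (forall p, D p -> `|k p| <= M) ->
 mu.-integrable D (EFin \o (fun p => w p * k p)).
Proof.
move=> mD iw mk kM.
have mw : measurable_fun D w by move/integrableP : iw => [/measurable_EFinP].
have iM : mu.-integrable D (fun p => (M%:E * (w p)%:E)%E).
 by apply: integrableZl.
apply: le_integrable iM => //.
 by apply/measurable_EFinP; exact: measurable_funM.
move=> p Dp /=; rewrite lee_fin normrM [leRHS]normrM mulrC ler_wpM2r//.
by apply: le_trans (kM _ Dp) _; exact: ler_norm.
Qed.

Lemma Rint_dct (f_ : nat -> T -> R) (f g : T -> R) (D : set T) : measurable D ->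
 (forall k, measurable_fun D (f_ k)) ->
 (forall p, D p -> f_ k p @[k --> \oo] --> f p) ->
 (forall k p, D p -> `|f_ k p| <= g p) -> mu.-integrable D (EFin \o g) ->
 \int[mu]_(p in D) f_ k p @[k --> \oo] --> \int[mu]_(p in D) f p.
Proof.
move=> mD mf ff fg ig.
have mlim : measurable_fun D f by apply: measurable_fun_cvg ff.
have := @dominated_convergence _ T R mu D mD (fun k p => (f_ k p)%:E) (EFin \o f) (EFin \o g).
case.
- by move=> k; apply/measurable_EFinP.
- exact/measurable_EFinP.
- by apply: aeW => p Dp; apply: cvg_EFin; [exact: nearW|exact: ff].
- exact: ig.
- by apply: aeW => p k Dp; rewrite lee_fin; exact: fg.
move=> if_ _ H; apply: fine_cvg; rewrite fineK; last exact: integrable_fin_num.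
exact: H.
Qed.

Lemma Rint_diff (f df : R -> T -> R) (G : T -> R) (D : set T) (a u v : R) : measurable D ->
 u < a -> a < v ->
 (forall s, u < s -> s < v -> mu.-integrable D (EFin \o f s)) ->
 (forall s p, u < s -> s < v -> D p -> is_derive s 1 (f ^~ p) (df s p)) ->
 (forall s p, u < s -> s < v -> D p -> `|df s p| <= G p) ->
 mu.-integrable D (EFin \o G) ->
 is_derive a 1 (fun s => \int[mu]_(p in D) f s p) (\int[mu]_(p in D) df a p).
Proof.
move=> mD ua av iF dF bF iG.
have E s p : u < s -> s < v -> D p -> partial1of2 f s p = df s p.
 by move=> us sv Dp; rewrite partial1of2E; case: (dF s p us sv Dp).
pose G' p := `|G p|.
have iG' : mu.-integrable D (EFin \o G').
 by rewrite (_ : EFin \o G' = (abse \o (EFin \o G)))//; apply/integrable_abse.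
have Ia : `]u, v[%classic a by rewrite /= in_itv/= ua av.
have h1 : forall x, `]u, v[%classic x -> mu.-integrable D (EFin \o f x).
 by move=> x /=; rewrite in_itv/= => /andP[ux xv]; exact: iF.
have h2 : forall x y, `]u, v[%classic x -> D y -> derivable (f ^~ y) x 1.
 by move=> x y /=; rewrite in_itv/= => /andP[ux xv] Dy; case: (dF x y ux xv Dy).
have h3 : forall x y, `]u, v[%classic x -> D y -> `|partial1of2 f x y| <= G' y.
 move=> x y /=; rewrite in_itv/= => /andP[ux xv] Dy; rewrite E//.
 by apply: le_trans (bF _ _ ux xv Dy) _; exact: ler_norm.
split; first exact: (@derivable_under_integral _ _ _ _ _ _ mD a u v Ia h1 h2 G' (fun=> normr_ge0 _) iG' h3).
have := @differentiation_under_integral _ _ _ _ _ _ mD a u v Ia h1 h2 G' (fun=> normr_ge0 _) iG' h3.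
rewrite derive1E => ->; apply: eq_Rintegral => p; rewrite inE => Dp; exact: E.
Qed.

Lemma Rint_sum n (f : 'I_n -> T -> R) (D : set T) : measurable D ->
 (forall i, mu.-integrable D (EFin \o f i)) ->
 \int[mu]_(p in D) (\sum_i f i p) = \sum_i \int[mu]_(p in D) f i p.
Proof.
move=> mD iF; rewrite /Rintegral.
under eq_integral do rewrite -sumEFin.
rewrite integral_sum//.
rewrite -sum_fine// => i _; apply: integrable_fin_num => //; exact: iF.
Qed.

Lemma integrable_sumR n (f : 'I_n -> T -> R) (D : set T) : measurable D ->
 (forall i, mu.-integrable D (EFin \o f i)) ->
 mu.-integrable D (EFin \o (fun p => \sum_i f i p)).
Proof.
move=> mD iF; rewrite (_ : EFin \o _ = (fun p => \sum_(i <- index_enum _) (f i p)%:E)%E); last first.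
 by apply/funext => p /=; rewrite -sumEFin.
by apply: integrable_sum => // i _; exact: iF.
Qed.

End generic_integrals.

(** * Integrals with a singularity of inverse square root type *)

Section halfpower.
Variable R : realType.

Lemma is_derive_sqrt2 (s : R) : 0 < s ->
 is_derive s 1 (fun s => Num.sqrt (2 * s)) (Num.sqrt (2 * s))^-1.
Proof.
move=> s0; have s2 : 0 < 2 * s by rewrite mulr_gt0.
have D1 : is_derive s 1 (fun s : R => 2 * s) 2 by exact: der_line.
have := is_derive1_comp (is_derive1_sqrt s2) D1.
by rewrite invfM mulrAC mulVf ?mul1r// pnatr_eq0.
Qed.

Lemma FTC_pos (F f : R -> R) (a b : R) : 0 < a -> a < b ->
 (forall s : R, 0 < s -> is_derive s 1 F (f s)) ->
 (forall s : R, 0 < s -> {for s, continuous f}) ->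
 (\int[leb]_(x in `[a, b]) (f x)%:E = (F b)%:E - (F a)%:E)%E.
Proof.
move=> a0 ab dF cf.
have cF s : 0 < s -> {for s, continuous F} by move=> s0; exact: der_cont (dF s s0).
apply: continuous_FTC2 => //.
- apply/continuous_within_itvP => //; split.
 + by move=> s; rewrite in_itv/= => /andP[/(lt_trans a0)? _]; exact: cf.
 + by apply: cvg_at_right_filter; exact: cf.
 + by apply: cvg_at_left_filter; apply: cf; exact: lt_trans ab.
- split.
 + by move=> s; rewrite in_itv/= => /andP[/(lt_trans a0)s0 _]; case: (dF s s0).
 + by apply: cvg_at_right_filter; exact: cF.
 + by apply: cvg_at_left_filter; apply: cF; exact: lt_trans ab.
- move=> s; rewrite in_itv/= => /andP[/(lt_trans a0)s0 _].
 by rewrite derive1E; case: (dF s s0).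
Qed.

Lemma bigcup_itv0 (S : R) : \bigcup_(k : nat) `[k.+1%:R^-1, S]%classic = `]0, S]%classic.
Proof.
apply/seteqP; split => s /=.
 by move=> [k _] /=; rewrite !in_itv/= => /andP[h ->]; rewrite (lt_le_trans _ h)// invr_gt0.
rewrite in_itv/= => /andP[s0 sS].
have [N _ HN] := near_infty_natSinv_lt (PosNum s0).
by exists N => //=; rewrite in_itv/= sS andbT ltW//; exact: (HN N (leqnn N)).
Qed.

Lemma measurable_sqrt : measurable_fun [set: R] (@Num.sqrt R).
Proof. by apply: continuous_measurable_fun; exact: sqrt_continuous. Qed.

Lemma measurable_isqrt2 : measurable_fun [set: R] (fun s => (Num.sqrt (2 * s))^-1).
Proof.
rewrite (_ : (fun s => _) = (fun s => Num.sqrt (2 * s) `^ (-1))); last first.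
 by apply/funext => s; rewrite powR_inv1// sqrtr_ge0.
apply: (@measurableT_comp _ _ _ _ _ _ (fun y => y `^ (-1))); first exact: measurable_powR.
by apply: (measurableT_comp measurable_sqrt); exact: measurable_funM.
Qed.

Lemma integral_isqrt2 (S : R) : 0 < S ->
 (\int[leb]_(s in `]0%R, S]) ((Num.sqrt (2 * s))^-1)%:E <= (Num.sqrt (2 * S))%:E)%E.
Proof.
move=> S0.
have m2 : measurable_fun [set: R] (fun s => ((Num.sqrt (2 * s))^-1)%:E).
 by apply/measurable_EFinP; exact: measurable_isqrt2.
have H : (\int[leb]_(s in `[(k.+1%:R^-1)%R, S]) ((Num.sqrt (2 * s))^-1)%:E @[k --> \oo] -->
  \int[leb]_(s in `]0%R, S]) ((Num.sqrt (2 * s))^-1)%:E)%E.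
 rewrite -bigcup_itv0; apply: ge0_nondecreasing_set_cvg_integral => //.
 - move=> i j ij; apply/subsetPset => s /=; rewrite !in_itv/= => /andP[h ->].
  by rewrite andbT (le_trans _ h)// lef_pV2 ?posrE ?ltr0n// ler_nat ltnS.
 - by move=> i; exact: measurable_funTS.
rewrite -(cvg_lim _ H)//; apply: lime_le.
 by apply/cvg_ex; eexists; exact: H.
apply: nearW => k; have k0 : 0 < (k.+1%:R : R)^-1 by rewrite invr_gt0.
have [kS|Sk] := ltP (k.+1%:R^-1) S.
 have h1 (s : R) : 0 < s -> {for s, continuous (fun s : R => (Num.sqrt (2 * s))^-1)}.
  move=> s0; apply: cvgV; first by rewrite gt_eqF// sqrtr_gt0 mulr_gt0.
  exact: der_cont (is_derive_sqrt2 s0).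
 have FT := @FTC_pos (fun s => Num.sqrt (2 * s)) (fun s => (Num.sqrt (2 * s))^-1) _ _ k0 kS
  is_derive_sqrt2 h1.
 by rewrite FT -EFinB lee_fin lerBlDr lerDl sqrtr_ge0.
rewrite (_ : `[_, S]%classic = if k.+1%:R^-1 == S then [set S] else set0); last first.
 case: eqP => [->|ne]; first by rewrite set_itv1.
 by rewrite set_itv_ge// -ltNge lt_neqAle Sk andbT eq_sym; apply/eqP.
by case: ifP => _; rewrite ?integral_set1 ?integral_set0// lee_fin sqrtr_ge0.
Qed.

(* Fundamental theorem of calculus with an integrable singularity of the derivative at 0. *)
Lemma FTC_sing (F f : R -> R) (S C : R) : 0 < S ->
 (forall s : R, 0 < s -> is_derive s 1 F (f s)) ->
 (forall s : R, 0 < s -> {for s, continuous f}) ->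
 F s @[s --> 0^'+] --> F 0 ->
 (forall s : R, 0 < s -> s <= S -> `|f s| <= C * (1 + (Num.sqrt (2 * s))^-1)) ->
 leb.-integrable `]0, S] (EFin \o f) /\ \int[leb]_(s in `]0, S]) f s = F S - F 0.
Proof.
move=> S0 dF cf cF bf.
have mf : measurable_fun `]0, S] f.
 apply: (@measurable_funS _ _ _ _ (`]0, +oo[%classic : set R)) => //.
  by move=> s /=; rewrite !in_itv/= andbT => /andP[].
 apply: open_continuous_measurable_fun; first exact: interval_open.
 by move=> s; rewrite inE/= in_itv/= andbT => s0; exact: cf.
have iS : leb.-integrable `]0, S] (EFin \o (fun s => (Num.sqrt (2 * s))^-1)).
 apply/integrableP; split.
  by apply: measurable_funTS; apply/measurable_EFinP; exact: measurable_isqrt2.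
 under eq_integral do rewrite /= ger0_norm ?invr_ge0 ?sqrtr_ge0//.
 by apply: le_lt_trans (integral_isqrt2 S0) _; rewrite ltry.
have i1 : leb.-integrable `]0, S] (EFin \o (fun=> 1 : R)).
 apply/integrableP; split; first exact: measurable_cst.
 under eq_integral do rewrite /= normr1.
 by rewrite integral_cst//= mul1e lebesgue_measure_itv/=; case: ifP => _; rewrite ltry.
have iG : leb.-integrable `]0, S] (EFin \o (fun s => C * (1 + (Num.sqrt (2 * s))^-1))).
 rewrite (_ : _ \o _ = (fun s => C%:E * (1%:E + ((Num.sqrt (2 * s))^-1)%:E))%E)//.
 by apply: integrableZl => //; apply: integrableD.
have iF : leb.-integrable `]0, S] (EFin \o f).
 apply: le_integrable iG => //; first exact/measurable_EFinP.
 move=> s /=; rewrite in_itv/= => /andP[s0 sS]; rewrite lee_fin.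
 by apply: le_trans (bf s s0 sS) _; exact: ler_norm.
split => //.
pose f_ k := f \_ `[k.+1%:R^-1, S].
have H1 : \int[leb]_(s in `]0, S]) f_ k s @[k --> \oo] --> \int[leb]_(s in `]0, S]) f s.
 apply: (@Rint_dct _ _ _ leb f_ f (fun s => C * (1 + (Num.sqrt (2 * s))^-1)) `]0, S]%classic) => //.
 - move=> k; rewrite /f_; apply/measurable_restrict => //.
  by apply: measurable_funS mf => // s [].
 - move=> s /=; rewrite in_itv/= => /andP[s0 sS].
  apply: cvg_near_cst; have [N _ HN] := near_infty_natSinv_lt (PosNum s0).
  exists N => // k /= Nk; rewrite /f_ patchE mem_set//= in_itv/= sS andbT ltW//.
  exact: HN.
 - move=> k s /=; rewrite in_itv/= => /andP[s0 sS]; rewrite /f_ patchE.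
  case: ifPn => _; first exact: bf.
  by rewrite normr0; apply: le_trans (bf s s0 sS).
have H2 : F S - F (k.+1%:R^-1) @[k --> \oo] --> F S - F 0.
 apply: cvgB; first exact: cvg_cst.
 move/cvg_at_rightP : cF; apply; split; first by move=> k; rewrite invr_gt0.
 exact: cvg_harmonic.
have E : \forall k \near \oo, \int[leb]_(s in `]0, S]) f_ k s = F S - F (k.+1%:R^-1).
 have [N _ HN] := near_infty_natSinv_lt (PosNum S0).
 exists N => // k /= Nk; have kS : k.+1%:R^-1 < S by exact: HN.
 have k0 : 0 < (k.+1%:R : R)^-1 by rewrite invr_gt0.
 rewrite /f_ -Rintegral_mkcondr (_ : `]0, S] `&` _ = `[k.+1%:R^-1, S]%classic); last first.
  apply/seteqP; split => s /=; first by case.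
  by rewrite !in_itv/= => /andP[h ->]; rewrite h/= (lt_le_trans k0 h).
 by rewrite /Rintegral (FTC_pos k0 kS dF cf).
have H3 : \int[leb]_(s in `]0, S]) f_ k s @[k --> \oo] --> F S - F 0.
 by apply: cvg_trans H2; apply: near_eq_cvg; move: E; apply: filterS => k ->.
exact: (cvg_unique _ H1 H3).
Unshelve. all: by end_near. Qed.

End halfpower.

(** * Averages over shifted space-time points *)

Section Wabs.
Variables (R : realType) (n : nat).
Context d (T : measurableType d) (mu : {measure set T -> \bar R}).
Variables (sg : T -> R) (zz : T -> 'rV[R]_n).
Hypotheses (msg : measT sg)
 (mzz : forall i, measT (fun p => zz p ord0 i)).

Definition shx (x : 'rV[R]_n) (p : T) : 'rV[R]_n := x - Num.sqrt (2 * sg p) *: zz p.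

Definition mST (h : 'rV[R]_n -> R -> R) := forall (x : 'rV[R]_n) (t : R),
 measT (fun p : T => h (shx x p) (t - sg p)).

Lemma cont_mST (h : 'rV[R]_n -> R -> R) :
 jcont h -> mST h.
Proof.
move=> ch x t; apply: (@measurable_comp_rV R _ T n setT (shx x) (fun p => t - sg p)).
- move=> i; under eq_fun do rewrite !mxE.
 apply: measurable_funB => //; apply: measurable_funM => //.
 apply: (measurableT_comp (@measurable_sqrt R)).
 exact: measurable_funM.
- exact: measurable_funB.
- by move=> p _; exact: ch.
Qed.

(** With [sg] the elapsed time [q] and [zz] a Gaussian variable [z], an average of [h] over the
    points [(x - sqrt (2 q) z, t - q)]. As [x] and [t] occur inside [h] only, derivatives pass to
    [h] and leave the weight alone. *)
Definition W (w : T -> R) (h : 'rV[R]_n -> R -> R) (x : 'rV[R]_n) (t : R) : R :=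
 \int[mu]_p (w p * h (shx x p) (t - sg p)).

Definition wint (w : T -> R) := mu.-integrable setT (EFin \o w).

Lemma wint_meas w : wint w -> measT w.
Proof. by move/integrableP => [/measurable_EFinP]. Qed.

Lemma W_int w h (M : R) x t : wint w -> mST h -> (forall y s, `|h y s| <= M) ->
 mu.-integrable setT (EFin \o (fun p => w p * h (shx x p) (t - sg p))).
Proof. by move=> ic mh hM; apply: (@integrable_bddM _ _ _ _ _ _ M). Qed.

Lemma wint_norm (w : T -> R) : wint w -> wint (fun p => `|w p|).
Proof.
move=> ic; rewrite /wint (_ : _ \o _ = (abse \o (EFin \o w)))//.
exact: integrable_abse.
Qed.

Lemma wintZ (M : R) (w : T -> R) : wint w -> wint (fun p => M * w p).
Proof.
move=> ic; rewrite /wint (_ : _ \o _ = (fun p => M%:E * (w p)%:E))%E//.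
exact: integrableZl.
Qed.

Lemma W_bound w h (M : R) x t : wint w -> mST h -> (forall y s, `|h y s| <= M) ->
 `|W w h x t| <= M * \int[mu]_p `|w p|.
Proof.
move=> ic mh hM; apply: le_trans (le_normr_Rintegral _ _) _ => //.
 exact: W_int ic mh hM.
rewrite -RintegralZl//; last exact: wint_norm.
apply: le_Rintegral => //.
- exact: wint_norm (W_int x t ic mh hM).
- exact: wintZ (wint_norm ic).
- by move=> p _; rewrite normrM mulrC ler_wpM2r.
Qed.

Lemma shx_cvg (u : nat -> 'rV[R]_n * R) (q : 'rV[R]_n * R) p : u k @[k --> \oo] --> q ->
 (shx (u k).1 p, (u k).2 - sg p) @[k --> \oo] --> (shx q.1 p, q.2 - sg p).
Proof.
move=> uq; apply: pair_cvg.
- by apply: cvgB; [apply: (cvg_comp u fst uq); exact: cvg_fst|exact: cvg_cst].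
- by apply: cvgB; [apply: (cvg_comp u snd uq); exact: cvg_snd|exact: cvg_cst].
Qed.

Lemma W_cont w h (M : R) : wint w -> jcont h ->
 (forall y s, `|h y s| <= M) ->
 jcont (W w h).
Proof.
move=> ic ch hM q; apply: seq_continuous => u uq.
have mh := cont_mST ch.
apply: (@Rint_dct _ _ _ mu (fun k p => w p * h (shx (u k).1 p) ((u k).2 - sg p))
 (fun p => w p * h (shx q.1 p) (q.2 - sg p)) (fun p => M * `|w p|) setT) => //.
- by move=> k; apply: measurable_funM; [exact: wint_meas|exact: mh].
- move=> p _; apply: cvgM; first exact: cvg_cst.
 have := cvg_comp _ _ (shx_cvg (p := p) uq) (ch (shx q.1 p, q.2 - sg p)).
 exact.
- by move=> k p _; rewrite normrM mulrC ler_wpM2r.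
- exact: wintZ (wint_norm ic).
Qed.

Lemma shxD x y p : shx (x + y) p = x + shx y p.
Proof. by rewrite /shx addrA. Qed.

Lemma W_dx w (h dh : 'rV[R]_n -> R -> R) i (M M' : R) x t : wint w -> mST h ->
 (forall y s, `|h y s| <= M) ->
 (forall y (s : R), is_derive y (evec R i) (h ^~ s) (dh y s)) ->
 (forall y s, `|dh y s| <= M') ->
 is_derive x (evec R i) (fun y => W w h y t) (W w dh x t).
Proof.
move=> ic mh hM Dh dhM; apply/is_derive_lineP.
have := @Rint_diff _ _ _ mu (fun s p => w p * h (shx (s *: evec R i + x) p) (t - sg p))
  (fun s p => w p * dh (shx (s *: evec R i + x) p) (t - sg p))
  (fun p => M' * `|w p|) setT 0 (-1) 1 measurableT.
rewrite ltrN10 ltr01 scale0r add0r; apply => //.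
- by move=> s _ _; exact: W_int ic mh hM.
- move=> s p _ _ _; apply: der_scale.
 have := @line_derive _ _ (h ^~ (t - sg p)) (fun y => dh y (t - sg p)) (shx x p) (evec R i) (fun y => Dh y _) s.
 by rewrite -shxD; under eq_fun do rewrite -shxD.
- by move=> s p _ _ _; rewrite normrM mulrC ler_wpM2r.
- exact: wintZ (wint_norm ic).
Qed.

Lemma W_dt w (h dh : 'rV[R]_n -> R -> R) (M M' : R) x (t : R) : wint w -> mST h ->
 (forall y s, `|h y s| <= M) ->
 (forall y (s : R), is_derive s 1 (h y) (dh y s)) ->
 (forall y s, `|dh y s| <= M') ->
 is_derive t 1 (W w h x) (W w dh x t).
Proof.
move=> ic mh hM Dh dhM.
have := @Rint_diff _ _ _ mu (fun s p => w p * h (shx x p) (s - sg p))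
  (fun s p => w p * dh (shx x p) (s - sg p))
  (fun p => M' * `|w p|) setT t (t - 1) (t + 1) measurableT.
apply => //.
- by rewrite ltrBlDr ltrDl.
- by rewrite ltrDl.
- by move=> s _ _; exact: W_int ic mh hM.
- move=> s p _ _ _; apply: der_scale.
 have D1 : is_derive s 1 (fun s : R => s - sg p) 1.
  by apply: der_val (der_sub (der_id s) (der_cst (sg p) s)) _; rewrite subr0.
 by have := @der_comp _ (h (shx x p)) (fun s => s - sg p) s _ _ (Dh _ _) D1; rewrite mulr1.
- by move=> s p _ _ _; rewrite normrM mulrC ler_wpM2r.
- exact: wintZ (wint_norm ic).
Qed.

End Wabs.

(** * The Duhamel operator and its gradient weight *)

Section Wop.
Variables (R : realType) (n : nat).
Local Notation E m := (mst (lebN R m)).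

Definition sgE (p : E n.+1) : R := p.1.
Definition zzE (p : E n.+1) : 'rV[R]_n := torow p.2.

Lemma measurable_sgE : measT sgE. Proof. exact: measurable_fst. Qed.

Lemma measurable_zzE i : measT (fun p => zzE p ord0 i).
Proof. exact: (measurableT_comp (@measurable_torow_coord R n i) measurable_snd). Qed.

(** With this weight [W] is the integral of [e^(q Lap) h(t - q)] over elapsed times [q] in
    [[0, S]]. *)
Definition om (S : R) (p : E n.+1) : R := \1_(`[0, S]%classic : set R) (sgE p) * gau p.2.

Lemma om_ge0 S p : 0 <= om S p.
Proof. by rewrite mulr_ge0// ?gau_ge0// indicE. Qed.

Lemma measurable_om S : measT (om S).
Proof.
apply: measurable_funM; last exact: (measurableT_comp (@measurable_gau R n) measurable_snd).
have h : measurable_fun [set: R] (\1_(`[0, S]%classic : set R) : R -> R) by exact: measurable_indic.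
exact: (measurableT_comp h measurable_sgE).
Qed.

Lemma leb_itv0 (S : R) : 0 <= S -> leb (`[0, S]%classic : set R) = S%:E.
Proof.
move=> S0; rewrite lebesgue_measure_itv/= lte_fin; case: ltP => h; rewrite ?sube0//.
by congr EFin; apply/eqP; rewrite eq_le S0 h.
Qed.

Lemma int_om S : 0 <= S -> (\int[lebST R n]_p (om S p)%:E = S%:E)%E.
Proof.
move=> S0; rewrite /lebST /= (@int_pmeas_mul _ _ _ _ _ leb (msm (lebN R n))
 (\1_(`[0, S]%classic : set R)) (@gau R n)).
- have -> : (\int[msm (lebN R n)]_y (gau y)%:E = 1)%E by exact: gau_int.
 by rewrite mule1 integral_indic// setIT; exact: leb_itv0.
- exact: measurable_indic.
- exact: measurable_gau.
- by move=> s; rewrite indicE.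
- by move=> s; exact: gau_ge0.
Qed.

Lemma wint_om S : 0 <= S -> wint (lebST R n) (om S).
Proof.
move=> S0; apply/integrableP; split.
 by apply/measurable_EFinP; exact: measurable_om.
under eq_integral do rewrite /= ger0_norm ?om_ge0//.
by rewrite int_om// ltry.
Qed.

(** The logarithmic derivative of the kernel, [- (x - y)_i / (2 q)], after the substitution
    [y = x - sqrt (2 q) z]. *)
Definition cW (i : 'I_n) (p : E n.+1) : R := - (zzE p ord0 i) / Num.sqrt (2 * sgE p).

(** Half of the Gaussian exponent absorbs the factor, through [|a| <= 1 + a^2/4 <= exp (|z|^2/4)];
    the other half is the kernel at time 1, up to normalisation. *)
Lemma zgau_le (z : E n) i :
 `|torow z ord0 i| * gau z <= (2 * pi) `^ (- (n%:R / 2)) / (4 * pi) `^ (- (n%:R / 2)) * heatG 1 0 (torow z).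
Proof.
have p2 : 0 < 2 * pi :> R by rewrite mulr_gt0// pi_gt0.
have p4 : 0 < 4 * pi :> R by rewrite mulr_gt0// pi_gt0.
rewrite /gau /heatG mulr1 (_ : 4 * pi / 2 = 2 * pi); last by field.
rewrite [leRHS]mulrA divfK ?gt_eqF ?powR_gt0// [leLHS]mulrCA ler_wpM2l ?powR_ge0//.
set N2 := enorm _ ^+ 2.
have zN : torow z ord0 i ^+ 2 <= N2.
 rewrite /N2 enorm2 (bigD1 i)//= !mxE sub0r sqrrN lerDl.
 by apply: sumr_ge0 => j _; exact: sqr_ge0.
rewrite (_ : - N2 / (4 / 2) = - N2 / (4 * 1) + - (N2 / 4)); last by field.
rewrite expRD mulrCA -[leRHS]mulr1 ler_wpM2l ?expR_ge0// expRN ler_pdivrMr ?expR_gt0// mul1r.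
apply: le_trans (expR_ge1Dx _).
have : 0 <= (`|torow z ord0 i| / 2 - 1) ^+ 2 by exact: sqr_ge0.
have e : `|torow z ord0 i| ^+ 2 = torow z ord0 i ^+ 2 by rewrite real_normK// num_real.
have : `|torow z ord0 i| ^+ 2 <= N2 by rewrite e.
move: (`|torow z ord0 i|) => a; nra.
Qed.

Lemma int_zgau i : (\int[lebRN R n]_z (`|torow z ord0 i| * gau z)%:E < +oo)%E.
Proof.
pose C : R := (2 * pi) `^ (- (n%:R / 2)) / (4 * pi) `^ (- (n%:R / 2)).
have C0 : 0 <= C :> R by rewrite mulr_ge0// ?invr_ge0 powR_ge0.
apply: (@le_lt_trans _ _ (\int[lebRN R n]_z (C%:E * (heatG 1 0 (torow z))%:E)))%E.
 apply: ge0_le_integral => //.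
 - by move=> z _; rewrite lee_fin mulr_ge0// gau_ge0.
 - apply/measurable_EFinP/measurable_funM; last exact: measurable_gau.
  by apply: measurableT_comp => //; exact: measurable_torow_coord.
 - apply/measurable_EFinP; apply: measurable_funM => //.
  exact: measurable_heatGy.
 - by move=> z _; rewrite -EFinM lee_fin; exact: zgau_le.
rewrite ge0_integralZl//=.
- by rewrite heatG_int// mule1 ltry.
- by apply/measurable_EFinP; exact: measurable_heatGy.
- by move=> z _; rewrite lee_fin heatG_ge0.
Qed.

(** A Gaussian first moment times [q^(-1/2)], and the latter is integrable down to [q = 0]. *)
Lemma wint_cW S i : 0 < S -> wint (lebST R n) (fun p => om S p * cW i p).
Proof.
move=> S0; apply/integrableP; split.
 apply/measurable_EFinP/measurable_funM; first exact: measurable_om.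
 apply: measurable_funM.
  by apply: measurableT_comp => //; exact: measurable_zzE.
 exact: (measurableT_comp (@measurable_isqrt2 R) measurable_sgE).
pose a (s : R) := \1_(`[0, S]%classic : set R) s * (Num.sqrt (2 * s))^-1.
pose b (z : E n) := `|torow z ord0 i| * gau z.
have a0 s : 0 <= a s by rewrite /a mulr_ge0 ?invr_ge0 ?sqrtr_ge0// indicE.
have b0 z : 0 <= b z by rewrite /b mulr_ge0// gau_ge0.
have mI : measurable_fun [set: R] a.
 apply: measurable_funM; last exact: measurable_isqrt2.
 exact: measurable_indic.
have mb : measT b.
 apply: measurable_funM; last exact: measurable_gau.
 by apply: measurableT_comp => //; exact: measurable_torow_coord.
have -> : (\int[lebST R n]_p `|(EFin \o (fun p => om S p * cW i p)%R) p| =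
  \int[pmeas leb (msm (lebN R n))]_p (a p.1 * b p.2)%:E)%E.
 apply: eq_integral => p _ /=; congr EFin.
 rewrite normrM (ger0_norm (om_ge0 S p)) /cW normrM normrN normfV (ger0_norm (sqrtr_ge0 _)).
 by rewrite /a /b /om /sgE /zzE; ring.
rewrite int_pmeas_mul//.
apply: lte_mul_pinfty; last exact: int_zgau.
 by apply: integral_ge0 => s _; rewrite lee_fin.
rewrite ge0_fin_numE; last by apply: integral_ge0 => s _; rewrite lee_fin.
apply: (@le_lt_trans _ _ (Num.sqrt (2 * S))%:E); last by rewrite ltry.
apply: le_trans (integral_isqrt2 S0).
rewrite [leRHS]integral_mkcond; apply: ge0_le_integral => //.
- by move=> s _; rewrite lee_fin.
- exact/measurable_EFinP.
- apply/measurable_restrict => //=; apply: measurable_funTS.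
 by apply/measurable_EFinP; exact: measurable_isqrt2.
- move=> s _; rewrite patchE; case: ifPn => h.
  rewrite lee_fin /a -[leRHS]mul1r; apply: ler_wpM2r; first by rewrite invr_ge0 sqrtr_ge0.
  by rewrite indicE lern1 leq_b1.
 rewrite lee_fin /a indicE; case: (boolP (s \in _)) => [|_]; last by rewrite mul0r.
 rewrite inE/= in_itv/= => /andP[s0 sS].
 (* The closed and the half-open interval differ at 0 only, where the inverse of [sqrt 0] is 0 by
    convention. *)
 have -> : s = 0.
  apply/eqP; rewrite eq_le s0 andbT leNgt; apply/negP => s1.
  by move: h; rewrite notin_setE/= in_itv/= s1 sS.
 by rewrite mulr0 sqrtr0 invr0 mulr0.
Qed.

Lemma cont_mSTE (h : 'rV[R]_n -> R -> R) : jcont h -> mST sgE zzE h.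
Proof. by move=> ch; apply: cont_mST; [exact: measurable_sgE|exact: measurable_zzE|exact: ch]. Qed.

Lemma cont_timecst (k : 'rV[R]_n -> R) : continuous k ->
 continuous (fun q : 'rV[R]_n * R => (fun y (_ : R) => k y) q.1 q.2).
Proof. by move=> ck q; apply: (@continuous_comp _ _ _ fst k); [exact: cvg_fst|exact: ck]. Qed.

Lemma cont_mSTc (k : 'rV[R]_n -> R) : continuous k -> mST sgE zzE (fun y _ => k y).
Proof. by move=> /cont_timecst; exact: cont_mSTE. Qed.

End Wop.

(** * Fubini's theorem for real-valued integrals *)

Section Rfubini.
Variable R : realType.
Context d1 d2 (T1 : measurableType d1) (T2 : measurableType d2).
Variables (m1 : {sigma_finite_measure set T1 -> \bar R})
 (m2 : {sigma_finite_measure set T2 -> \bar R}).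

Lemma Rfubini12 (f : T1 * T2 -> R) : (pmeas m1 m2).-integrable setT (EFin \o f) ->
 (forall x, m2.-integrable setT (EFin \o (fun y => f (x, y)))) ->
 \int[pmeas m1 m2]_p f p = \int[m1]_x \int[m2]_y f (x, y).
Proof.
move=> fi fx; rewrite /Rintegral; congr fine.
rewrite /pmeas -(integral12_prod_meas1 fi); apply: eq_integral => x _.
by rewrite fineK//; apply: integrable_fin_num => //; exact: fx.
Qed.

Lemma Rfubini21 (f : T1 * T2 -> R) : (pmeas m1 m2).-integrable setT (EFin \o f) ->
 (forall y, m1.-integrable setT (EFin \o (fun x => f (x, y)))) ->
 \int[pmeas m1 m2]_p f p = \int[m2]_y \int[m1]_x f (x, y).
Proof.
move=> fi fx; rewrite /Rintegral; congr fine.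
rewrite /pmeas -(integral21_prod_meas1 fi); apply: eq_integral => x _.
by rewrite fineK//; apply: integrable_fin_num => //; exact: fx.
Qed.

End Rfubini.

(** * Differentiating the heat semigroup of a bounded continuous function *)

Section kernel_derivative.
Variables (R : realType) (n : nat).
Local Notation E m := (mst (lebN R m)).

(** The nonnegative change of variables is applied to the positive and to the negative part; both
    sides are the same difference, so no integrability is assumed. *)
Lemma heatG_cv_signed t (x : 'rV[R]_n) (k : E n -> R) : 0 < t -> measT k ->
 \int[lebRN R n]_y (heatG t x (torow y) * k y) =
 \int[lebRN R n]_z (gau z * k (aff x (Num.sqrt (2 * t)) z)).
Proof.
move=> t0 mk; rewrite /Rintegral; congr fine.
rewrite integralE [RHS]integralE; congr (_ - _)%E.
- have mp : measT (fun y => Num.max (k y) 0) by exact: measurable_maxr.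
 have := @heatG_cv R n t x (fun y => Num.max (k y) 0) t0 mp.
 move=> /(_ (fun y => _)) H.
 transitivity (\int[lebRN R n]_y (heatG t x (torow y) * Num.max (k y) 0)%:E)%E.
  apply: eq_integral => y _; rewrite funeposE /= -EFin_max; congr EFin.
  by rewrite maxr_pMr ?heatG_ge0// mulr0.
 rewrite H; last by move=> y; rewrite le_max lexx orbT.
 apply: eq_integral => y _; rewrite funeposE /= -EFin_max; congr EFin.
 by rewrite maxr_pMr ?gau_ge0// mulr0.
- have mp : measT (fun y => Num.max (- k y) 0).
  by apply: measurable_maxr => //; exact: measurableT_comp.
 have := @heatG_cv R n t x (fun y => Num.max (- k y) 0) t0 mp.
 move=> /(_ (fun y => _)) H.
 transitivity (\int[lebRN R n]_y (heatG t x (torow y) * Num.max (- k y) 0)%:E)%E.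
  apply: eq_integral => y _; rewrite funenegE /= -EFin_max; congr EFin.
  by rewrite maxr_pMr ?heatG_ge0// mulr0 mulrN.
 rewrite H; last by move=> y; rewrite le_max lexx orbT.
 apply: eq_integral => y _; rewrite funenegE /= -EFin_max; congr EFin.
 by rewrite maxr_pMr ?gau_ge0// mulr0 mulrN.
Qed.

(** The heat semigroup [e^(s Lap) k] in the Gaussian variable. This form extends to [s <= 0], where
    the square root is 0 and the value is [k x]. *)
Definition Pz (s : R) (k : 'rV[R]_n -> R) (x : 'rV[R]_n) : R :=
 \int[lebRN R n]_z (gau z * k (x - Num.sqrt (2 * s) *: torow z)).

Lemma enorm2_line (s : R) (X : 'rV[R]_n) (i : 'I_n) :
 enorm (s *: evec R i + X) ^+ 2 = s ^+ 2 + 2 * s * X ord0 i + enorm X ^+ 2.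
Proof.
rewrite !enorm2 (bigD1 i)//= [in RHS](bigD1 i)//= !mxE !eqxx/= mulr1.
rewrite (eq_bigr (fun j => X ord0 j ^+ 2)); last first.
 by move=> j ji; rewrite !mxE eqxx (negbTE ji)/= mulr0 add0r.
ring.
Qed.

Lemma coord_le_enorm2 (X : 'rV[R]_n) i : X ord0 i ^+ 2 <= enorm X ^+ 2.
Proof.
rewrite enorm2 (bigD1 i)//= lerDl.
by apply: sumr_ge0 => j _; exact: sqr_ge0.
Qed.

(** A majorant of the kernel derivative that is uniform in [|s| < 1]. Moving the base point by [s]
    and absorbing the linear factor is paid for by passing from time [q] to time [4 q]. *)
Lemma gauss_tail (q s b N2 : R) : 0 < q -> `|s| < 1 -> b ^+ 2 <= N2 ->
 expR (- (s ^+ 2 + 2 * s * b + N2) / (4 * q)) * `|- (2 * s + 2 * b) / (4 * q)| <=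
 (2 + 16 * q) / (2 * q) * expR ((4 * q)^-1) * expR (- N2 / (16 * q)).
Proof.
move=> q0 s1 bN; have N0 : 0 <= N2 by apply: le_trans bN; exact: sqr_ge0.
set y := N2 / (16 * q).
have y0 : 0 <= y by rewrite divr_ge0// mulr_ge0// ltW.
have e1 : `|- (2 * s + 2 * b) / (4 * q)| <= (2 + 16 * q) / (2 * q) * expR y.
 rewrite normrM normrN normfV (gtr0_norm (_ : 0 < 4 * q)) ?mulr_gt0//.
 rewrite (_ : 2 * s + 2 * b = 2 * (s + b)); last by ring.
 rewrite normrM (gtr0_norm (ltr0Sn _ 1)).
 have h1 : `|s + b| <= 2 + b ^+ 2.
  apply: le_trans (ler_normD _ _) _.
  have : 0 <= (`|b| - 1) ^+ 2 by exact: sqr_ge0.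
  have : `|b| ^+ 2 = b ^+ 2 by rewrite real_normK// num_real.
  have : 0 <= `|b| by [].
  move: (`|b|) (b ^+ 2) => b' b2; nra.
 have h2 : b ^+ 2 <= 16 * q * expR y.
  apply: le_trans bN _; rewrite (_ : N2 = 16 * q * y); last by rewrite /y; field; lra.
  apply: ler_wpM2l; first by rewrite mulr_ge0// ltW.
  by apply: le_trans (expR_ge1Dx y); rewrite lerDr.
 have h3 : 1 <= expR y by rewrite -expR0 ler_expR.
 rewrite (_ : 2 * `|s + b| / (4 * q) = `|s + b| / (2 * q)); last by field; lra.
 rewrite mulrAC; apply: ler_wpM2r; first by rewrite invr_ge0 mulr_ge0// ltW.
 by apply: le_trans h1 _; rewrite mulrDl; nra.
have e2 : expR (- (s ^+ 2 + 2 * s * b + N2) / (4 * q)) <= expR ((4 * q)^-1 - 2 * y).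
 rewrite ler_expR.
 have -> : (4 * q)^-1 - 2 * y = - (N2 / 2 - 1) / (4 * q) by rewrite /y; field; lra.
 rewrite ler_pM2r ?invr_gt0 ?mulr_gt0// lerN2.
 have h1 : s ^+ 2 <= 1.
  rewrite -[leRHS](expr1n _ 2) -(real_normK (num_real s)).
  by rewrite ler_pXn2r// ?nnegrE// ltW.
 have : 0 <= (2 * s + b) ^+ 2 by exact: sqr_ge0.
 by move: bN h1; nra.
apply: le_trans (ler_pM _ _ e2 e1) _ => //.
have -> : expR ((4 * q)^-1 - 2 * y) = expR ((4 * q)^-1) * (expR (- y) * expR (- y)).
 by rewrite -!expRD; congr expR; ring.
have -> : - N2 / (16 * q) = - y by rewrite /y mulNr.
have ey : expR (- y) * expR y = 1 by rewrite -expRD addNr expR0.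
rewrite (_ : _ * (_ * expR y) =
 (2 + 16 * q) / (2 * q) * expR ((4 * q)^-1) * expR (- y) * (expR (- y) * expR y)); last by ring.
by rewrite ey mulr1.
Qed.

Lemma torow_sub (x : 'rV[R]_n) (y : E n) i : (x - torow y) ord0 i = x ord0 i - torow y ord0 i.
Proof. by rewrite !mxE. Qed.

Lemma cont_aff_measurable (k : 'rV[R]_n -> R) (x : 'rV[R]_n) (c : R) : continuous k ->
 measT (fun z : E n => k (x - c *: torow z)).
Proof.
move=> ck; have mk : measT (fun p : E n => k (torow p)).
 by apply: measurable_torow => p _; exact: ck.
have := measurableT_comp mk (measurable_aff x c).
by apply: eq_measurable_fun => z _; rewrite /= torow_aff.
Qed.

Lemma wint_gau : wint (lebRN R n) (@gau R n).
Proof.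
apply/integrableP; split; first by apply/measurable_EFinP; exact: measurable_gau.
under eq_integral do rewrite /= ger0_norm ?gau_ge0//.
by rewrite gau_int ltry.
Qed.

Lemma Rint_gau : \int[lebRN R n]_z gau z = 1.
Proof. by rewrite /Rintegral gau_int. Qed.

Lemma wint_zgau i : wint (lebRN R n) (fun z : E n => gau z * torow z ord0 i).
Proof.
apply/integrableP; split.
 apply/measurable_EFinP/measurable_funM; first exact: measurable_gau.
 exact: measurable_torow_coord.
apply: le_lt_trans (int_zgau R i); rewrite le_eqVlt; apply/orP; left; apply/eqP.
apply: eq_integral => z _ /=; congr EFin.
by rewrite normrM (ger0_norm (gau_ge0 z)) mulrC.
Qed.

Lemma heatG_wint t (x : 'rV[R]_n) : 0 < t -> wint (lebRN R n) (fun y => heatG t x (torow y)).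
Proof.
move=> t0; apply/integrableP; split; first by apply/measurable_EFinP; exact: measurable_heatGy.
under eq_integral do rewrite /= ger0_norm ?heatG_ge0//.
by rewrite heatG_int// ltry.
Qed.

Lemma Pz_heatG (s : R) k (x : 'rV[R]_n) : 0 < s -> continuous k ->
 Pz s k x = \int[lebRN R n]_y (heatG s x (torow y) * k (torow y)).
Proof.
move=> s0 ck; rewrite (@heatG_cv_signed s x (fun y => k (torow y)))//; last first.
 by apply: measurable_torow => p _; exact: ck.
by rewrite /Pz; apply: eq_Rintegral => z _; rewrite torow_aff.
Qed.

Lemma heatG_line (q s : R) (x y : 'rV[R]_n) i :
 heatG q (s *: evec R i + x) y = (4 * pi * q) `^ (- (n%:R / 2)) *
  expR (- (s ^+ 2 + 2 * s * (x - y) ord0 i + enorm (x - y) ^+ 2) / (4 * q)).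
Proof. by rewrite /heatG -addrA enorm2_line. Qed.

(** [k] is only continuous, so the derivative has to fall on the kernel: it is taken in the variable
    [y], where [x] sits in the kernel, and carried back to [z]. *)
Lemma Pz_dx (q : R) k (M : R) (x : 'rV[R]_n) i : 0 < q -> continuous k ->
 (forall y, `|k y| <= M) ->
 is_derive x (evec R i) (Pz q k)
  (\int[lebRN R n]_z (gau z * (- torow z ord0 i / Num.sqrt (2 * q)) *
    k (x - Num.sqrt (2 * q) *: torow z))).
Proof.
move=> q0 ck kM; apply/is_derive_lineP.
have mk : measT (fun p : E n => k (torow p)).
 by apply: measurable_torow => p _; exact: ck.
have q2 : 0 < Num.sqrt (2 * q) by rewrite sqrtr_gt0 mulr_gt0.
rewrite (_ : (fun s : R => _) = (fun s =>
  \int[lebRN R n]_y (heatG q (s *: evec R i + x) (torow y) * k (torow y)))); last first.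
 by apply/funext => s; exact: Pz_heatG.
pose df (s : R) (y : E n) := heatG q (s *: evec R i + x) (torow y) *
  (- (2 * s + 2 * (x - torow y) ord0 i) / (4 * q)) * k (torow y).
have -> : \int[lebRN R n]_z (gau z * (- torow z ord0 i / Num.sqrt (2 * q)) *
    k (x - Num.sqrt (2 * q) *: torow z)) = \int[lebRN R n]_y df 0 y.
 have := @heatG_cv_signed q x (fun y => - (x - torow y) ord0 i / (2 * q) * k (torow y)) q0.
 move=> H; rewrite [RHS](_ : _ = \int[lebRN R n]_y (heatG q x (torow y) *
   (- (x - torow y) ord0 i / (2 * q) * k (torow y)))); last first.
  apply: eq_Rintegral => y _; rewrite /df scale0r add0r -mulrA; congr (_ * (_ * _)).
  by field; lra.
 rewrite H; last first.
  apply: measurable_funM => //; apply: measurable_funM => //.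
  apply: measurableT_comp => //; under eq_fun do rewrite torow_sub.
  by apply: measurable_funB => //; exact: measurable_torow_coord.
 apply: eq_Rintegral => z _; rewrite torow_aff -mulrA; congr (_ * (_ * _)).
 rewrite opprB addrCA subrr addr0 !mxE.
 have e : 2 * q = Num.sqrt (2 * q) ^+ 2 by rewrite sqr_sqrtr// mulr_ge0// ltW.
 move: (coords z i) => a; set c := Num.sqrt (2 * q) in q2 e *; clearbody c.
 by rewrite e; field; rewrite gt_eqF.
apply: (@Rint_diff _ _ _ (lebRN R n)
  (fun s y => heatG q (s *: evec R i + x) (torow y) * k (torow y)) df
  (fun y => M * ((4 * pi * q) `^ (- (n%:R / 2)) / (4 * pi * (4 * q)) `^ (- (n%:R / 2)) *
   ((2 + 16 * q) / (2 * q) * expR ((4 * q)^-1))) * heatG (4 * q) x (torow y)) setT 0 (-1) 1) => //.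
- move=> s _ _; apply: (@integrable_bddM _ _ _ _ _ _ M) => //.
 exact: heatG_wint.
- move=> s y _ _ _; rewrite /df.
 have D1 : is_derive s 1 (fun s : R => heatG q (s *: evec R i + x) (torow y))
   (heatG q (s *: evec R i + x) (torow y) * (- (2 * s + 2 * (x - torow y) ord0 i) / (4 * q))).
  rewrite heatG_line; under eq_fun do rewrite heatG_line.
  apply: der_val (der_scale ((4 * pi * q) `^ (- (n%:R / 2))) (der_exp (der_mul (der_opp
   (der_add (der_add (der_pow 2 (der_id s)) (der_mul (der_line 2 s)
   (der_cst ((x - torow y) ord0 i) s))) (der_cst (enorm (x - torow y) ^+ 2) s)))
   (der_cst ((4 * q)^-1) s)))) _.
  by rewrite /=; ring.
 by apply: der_val (der_mul D1 (der_cst (k (torow y)) s)) _; rewrite mulr0 addr0.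
- move=> s y s1 s2 _; rewrite /df normrM mulrC -mulrA ler_pM//.
 rewrite heatG_line /heatG normrM normrM (ger0_norm (powR_ge0 _ _)) (ger0_norm (expR_ge0 _)).
 rewrite mulrACA divfK; last by rewrite gt_eqF// powR_gt0// !mulr_gt0// pi_gt0.
 rewrite -[leLHS]mulrA; apply: ler_wpM2l; first exact: powR_ge0.
 rewrite (_ : 4 * (4 * q) = 16 * q); last by ring.
 apply: gauss_tail => //; first by rewrite ltr_norml s1 s2.
 exact: coord_le_enorm2.
- by apply: wintZ; apply: heatG_wint; rewrite mulr_gt0.
Qed.

End kernel_derivative.

Local Notation Wn := (W (lebST _ _) (@sgE _ _) (@zzE _ _)).

(** * The space derivative of the Duhamel operator *)

Section Dop.
Variables (R : realType) (n : nat).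
Local Notation E m := (mst (lebN R m)).

(** Fubini in the elapsed time. The factor [c] is 1 for the operator itself and the weight of [cW]
    for its gradient. *)
Lemma W_slice (S : R) (c : R -> E n -> R) (h : 'rV[R]_n -> R -> R) (M : R) x t :
 wint (lebST R n) (fun p => om S p * c p.1 p.2) ->
 jcont h -> (forall y s, `|h y s| <= M) ->
 (forall q, wint (lebRN R n) (fun z => gau z * c q z)) ->
 leb.-integrable `]0, S] (EFin \o (fun q =>
   \int[lebRN R n]_z (gau z * c q z * h (x - Num.sqrt (2 * q) *: torow z) (t - q)))) /\
 Wn (fun p => om S p * c p.1 p.2) h x t = \int[leb]_(q in `]0, S])
   \int[lebRN R n]_z (gau z * c q z * h (x - Num.sqrt (2 * q) *: torow z) (t - q)).
Proof.
move=> ic ch hM iz.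
have hi := W_int x t ic (cont_mSTE ch) hM.
pose ind (q : R) : R := \1_(`[0, S]%classic : set R) q.
pose I q := \int[lebRN R n]_z (gau z * c q z * h (x - Num.sqrt (2 * q) *: torow z) (t - q)).
have chq q : continuous (fun y => h y (t - q)) by exact: (jcont_slice (h := h)).
have iI q : wint (lebRN R n) (fun z => gau z * c q z * h (x - Num.sqrt (2 * q) *: torow z) (t - q)).
 apply: (@integrable_bddM _ _ _ _ _ _ M) => //; first exact: iz q.
 exact: (cont_aff_measurable _ _ (chq q)).
have E q : (\int[lebRN R n]_z (om S (q, z) * c q z * h (x - Num.sqrt (2 * q) *: torow z) (t - q)) =
  ind q * I q).
 rewrite /I -RintegralZl//; last exact: iI.
 by apply: eq_Rintegral => z _; rewrite /om /ind /sgE /=; ring.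
have fx q : (msm (lebN R n)).-integrable setT (EFin \o (fun z =>
  om S (q, z) * c q z * h (x - Num.sqrt (2 * q) *: torow z) (t - q))).
 have := wintZ (ind q) (iI q); apply: eq_integrable => // z _ /=; congr EFin.
 by rewrite /om /ind /sgE /=; ring.
have iF : leb.-integrable setT (EFin \o (fun q => ind q * I q)).
 have := @integrable_fubini_F _ _ _ _ _ leb (msm (lebN R n)) _ hi.
 apply: eq_integrable => // q _; rewrite /fubini_F /= -E /Rintegral fineK//.
 by apply: integrable_fin_num => //; exact: fx.
have iI2 : leb.-integrable `]0, S] (EFin \o I).
 have := @integrableS _ _ _ leb setT `]0, S]%classic _ measurableT (measurable_itv _) (@subsetT _ _) iF.
 apply: eq_integrable => // q; rewrite inE/= in_itv/= => /andP[q0 qS]; congr EFin.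
 by rewrite /ind indicE mem_set ?mul1r//= in_itv/= (ltW q0).
split => //.
have -> : Wn (fun p => om S p * c p.1 p.2) h x t = \int[leb]_q (ind q * I q).
 rewrite /W /lebST /= (@Rfubini12 _ _ _ _ _ leb (msm (lebN R n)) _ hi fx).
 by apply: eq_Rintegral => q _; exact: E.
rewrite (Rintegral_itv_obnd_cbnd iI2) [RHS]Rintegral_mkcond.
apply: eq_Rintegral => q _; rewrite patchE /ind indicE; case: ifPn => _; first by rewrite mul1r.
by rewrite mul0r.
Qed.

Lemma Wom_slice (S : R) (h : 'rV[R]_n -> R -> R) (M : R) y t : 0 < S ->
 jcont h -> (forall y s, `|h y s| <= M) ->
 leb.-integrable `]0, S] (EFin \o (fun q => Pz q (fun y => h y (t - q)) y)) /\
 Wn (om S) h y t = \int[leb]_(q in `]0, S]) Pz q (fun y => h y (t - q)) y.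
Proof.
move=> S0 ch hM.
have w1 : wint (lebST R n) (fun p => om S p * (fun (_ : R) (_ : E n) => 1 : R) p.1 p.2).
 by have := wint_om n (ltW S0); apply: eq_integrable => // p _ /=; rewrite mulr1.
have w1z q : wint (lebRN R n) (fun z => gau z * (fun (_ : R) (_ : E n) => 1 : R) q z).
 by have := @wint_gau R n; apply: eq_integrable => // p _ /=; rewrite mulr1.
have [h1 h2] := @W_slice S (fun _ _ => 1) h M y t w1 ch hM w1z.
have e q : \int[lebRN R n]_z (gau z * 1 * h (y - Num.sqrt (2 * q) *: torow z) (t - q)) = Pz q (fun y => h y (t - q)) y.
 by apply: eq_Rintegral => z _; rewrite mulr1.
split; first by move: h1; apply: eq_integrable => // q _ /=; rewrite e.
rewrite (_ : om S = (fun p => om S p * 1)); last by apply/funext => p; rewrite mulr1.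
by rewrite h2; apply: eq_Rintegral => q _; rewrite e.
Qed.

Lemma cWE S i : (fun p : E n.+1 => om S p * cW i p) =
 (fun p => om S p * (fun q z => - torow z ord0 i / Num.sqrt (2 * q)) p.1 p.2).
Proof. by []. Qed.

Lemma wint_zq (i : 'I_n) (q : R) : wint (lebRN R n) (fun z : E n => gau z * (- torow z ord0 i / Num.sqrt (2 * q))).
Proof.
have := wintZ (- (Num.sqrt (2 * q))^-1) (wint_zgau R i); apply: eq_integrable => // z _ /=.
by congr EFin; ring.
Qed.

Lemma isqrt2_integrable (S C : R) : 0 < S ->
 leb.-integrable `]0, S] (EFin \o (fun q => C * (Num.sqrt (2 * q))^-1)).
Proof.
move=> S0; rewrite (_ : _ \o _ = (fun q => C%:E * ((Num.sqrt (2 * q))^-1)%:E))%E//.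
apply: integrableZl => //; apply/integrableP; split.
 by apply: measurable_funTS; apply/measurable_EFinP; exact: measurable_isqrt2.
under eq_integral do rewrite /= ger0_norm ?invr_ge0 ?sqrtr_ge0//.
by apply: le_lt_trans (integral_isqrt2 S0) _; rewrite ltry.
Qed.

(** One derivative is gained over a merely continuous source: the kernel derivative costs
    [q^(-1/2)], which stays integrable. *)
Lemma WD_dx (S : R) (h : 'rV[R]_n -> R -> R) (M : R) i x t : 0 < S ->
 jcont h -> (forall y s, `|h y s| <= M) ->
 is_derive x (evec R i) (fun y => Wn (om S) h y t) (Wn (fun p => om S p * cW i p) h x t).
Proof.
move=> S0 ch hM.
have chq q : continuous (fun y => h y (t - q)) by exact: (jcont_slice (h := h)).
pose P q y := Pz q (fun y => h y (t - q)) y.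
pose Q q y := \int[lebRN R n]_z (gau z * (- torow z ord0 i / Num.sqrt (2 * q)) *
 h (y - Num.sqrt (2 * q) *: torow z) (t - q)).
have E1 y := Wom_slice y t S0 ch hM.
have -> : Wn (fun p => om S p * cW i p) h x t = \int[leb]_(q in `]0, S]) Q q x.
 by rewrite cWE; have [_ ->] := W_slice x t (wint_cW i S0) ch hM (wint_zq i).
apply/is_derive_lineP.
rewrite (_ : (fun s : R => _) = (fun s => \int[leb]_(q in `]0, S]) P q (s *: evec R i + x))); last first.
 by apply/funext => s; have [_ ->] := E1 (s *: evec R i + x).
pose C1 := \int[lebRN R n]_z `|gau z * torow z ord0 i|.
have := @Rint_diff _ _ _ leb (fun s q => P q (s *: evec R i + x)) (fun s q => Q q (s *: evec R i + x))
 (fun q => (M * C1) * (Num.sqrt (2 * q))^-1) `]0, S]%classic 0 (-1) 1 (measurable_itv _).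
rewrite ltrN10 ltr01 scale0r add0r; apply => //.
- by move=> s _ _; have [] := E1 (s *: evec R i + x).
- move=> s q _ _ /=; rewrite in_itv/= => /andP[q0 _].
 exact: (@line_derive _ _ _ (Q q) x (evec R i) (fun y => Pz_dx y i q0 (chq q) (fun y => hM y (t - q))) s).
- move=> s q _ _ /=; rewrite in_itv/= => /andP[q0 _].
 set y := s *: evec R i + x.
 have iQ : wint (lebRN R n) (fun z => gau z * (- torow z ord0 i / Num.sqrt (2 * q)) *
   h (y - Num.sqrt (2 * q) *: torow z) (t - q)).
  apply: (@integrable_bddM _ _ _ _ _ _ M) => //; first exact: wint_zq.
  exact: (cont_aff_measurable _ _ (chq q)).
 apply: le_trans (le_normr_Rintegral _ iQ) _ => //.
 rewrite (_ : M * C1 / _ = (M / Num.sqrt (2 * q)) * C1); last by ring.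
 rewrite -RintegralZl//; last exact: wint_norm (wint_zgau R i).
 apply: le_Rintegral => //.
 + exact: wint_norm iQ.
 + exact: wintZ (wint_norm (wint_zgau R i)).
 + move=> z _; rewrite normrM mulrC -mulrA ler_pM//.
  rewrite (_ : gau z * (- torow z ord0 i / Num.sqrt (2 * q)) =
   - (Num.sqrt (2 * q))^-1 * (gau z * torow z ord0 i)); last by ring.
  by rewrite normrM normrN normfV (ger0_norm (sqrtr_ge0 _)).
- exact: isqrt2_integrable.
Qed.

End Dop.

(** * The heat equation integrated along Gaussian paths *)

Section Kid.
Variables (R : realType) (n : nat).
Local Notation E m := (mst (lebN R m)).

Lemma cvg_sumR (T : Type) (F : set_system T) (FF : Filter F) m (f : 'I_m -> T -> R) (l : 'I_m -> R) :
 (forall i, f i x @[x --> F] --> l i) -> \sum_i f i x @[x --> F] --> \sum_i l i.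
Proof.
move=> H; elim: (index_enum _) => [|i r IH].
 by rewrite big_nil; under eq_fun do rewrite big_nil; exact: cvg_cst.
by rewrite big_cons; under eq_fun do rewrite big_cons; exact: cvgD.
Qed.

Lemma ind_Rint (S : R) (k : R -> R) : leb.-integrable `]0, S] (EFin \o k) ->
 leb.-integrable setT (EFin \o (fun q => \1_(`[0, S]%classic : set R) q * k q)) /\
 \int[leb]_q (\1_(`[0, S]%classic : set R) q * k q) = \int[leb]_(q in `]0, S]) k q.
Proof.
move=> ik.
have e : (fun q => \1_(`[0, S]%classic : set R) q * k q) = k \_ `[0, S]%classic.
 by apply/funext => q; rewrite patchE indicE; case: ifPn => _; rewrite ?mul1r ?mul0r.
have ik' : leb.-integrable `[0, S] (EFin \o k).
 move/integrableP : ik => [mk ik]; apply/integrableP; split.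
  exact/emeasurable_fun_itv_obnd_cbndP.
 by rewrite -integral_itv_obnd_cbnd//; apply: measurableT_comp.
split; last by rewrite e -Rintegral_mkcond (Rintegral_itv_obnd_cbnd ik).
move: ik'; rewrite integrable_mkcond// => H; apply: eq_integrable H => // q _.
rewrite /= patchE indicE; by case: ifPn => _; rewrite ?mul1r ?mul0r.
Qed.

Lemma curve_cont (x z : 'rV[R]_n) (t : R) :
 continuous (fun q : R => (x - Num.sqrt (2 * q) *: z, t - q) : 'rV[R]_n * R).
Proof.
move=> q; apply: (@cont_pair R 'rV[R]_n R (fun q => x - Num.sqrt (2 * q) *: z) (fun q => t - q) q).
 apply: cvgB; first exact: cvg_cst.
 apply: cvgZr_tmp; apply: (@continuous_comp _ _ _ (fun q : R => 2 * q) (@Num.sqrt R)).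
  by apply: cvgM; [exact: cvg_cst|exact: cvg_id].
 exact: sqrt_continuous.
by apply: cvgB; [exact: cvg_cst|exact: cvg_id].
Qed.

(** The fundamental theorem of calculus along [q -> (x - sqrt (2 q) z, t - q)], averaged over [z].
    The path derivative contains [z . grad g / sqrt (2 q)], so the Laplacian of the usual identity
    appears as the weights [cW i] against the gradient, and one space derivative of [g] is
    enough. *)
Lemma W_K (S : R) (g gt : 'rV[R]_n -> R -> R) (dg : 'I_n -> 'rV[R]_n -> R -> R) (M : R) x t :
 0 < S -> jcont g ->
 (forall i x (t : R), is_derive x (evec R i) (g ^~ t) (dg i x t)) ->
 (forall x (t : R), is_derive t 1 (g x) (gt x t)) ->
 (forall i, jcont (dg i)) ->
 jcont gt ->
 (forall y s, `|g y s| <= M) -> (forall i y s, `|dg i y s| <= M) -> (forall y s, `|gt y s| <= M) ->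
 Wn (om S) gt x t - \sum_i Wn (fun p => om S p * cW i p) (dg i) x t =
 g x t - Pz S (g ^~ (t - S)) x.
Proof.
move=> S0 cg Dx Dt Cx Ct gM dgM gtM.
have i1 := W_int x t (wint_om n (ltW S0)) (cont_mSTE Ct) gtM.
have i2 i := W_int x t (wint_cW i S0) (cont_mSTE (Cx i)) (dgM i).
have i2s := integrable_sumR measurableT i2.
pose X q (z : E n) := x - Num.sqrt (2 * q) *: torow z.
pose k (z : E n) q := gt (X q z) (t - q) + (Num.sqrt (2 * q))^-1 * \sum_i torow z ord0 i * dg i (X q z) (t - q).
pose phi (p : E n.+1) := \1_(`[0, S]%classic : set R) p.1 * (gau p.2 * k p.2 p.1).
have ephi p : om S p * gt (shx (@sgE R n) (@zzE R n) x p) (t - sgE p) -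
  \sum_i om S p * cW i p * dg i (shx (@sgE R n) (@zzE R n) x p) (t - sgE p) = phi p.
 rewrite /phi mulrA -/(om S p) /k mulrDr; congr (_ + _).
 rewrite mulrA mulr_sumr -sumrN; apply: eq_bigr => i _.
 by rewrite /cW /shx /X /sgE /zzE; move: (om S p) => o; ring.
have iphi : (lebST R n).-integrable setT (EFin \o phi).
 have := integrableB measurableT i1 i2s; apply: eq_integrable => // p _ /=.
 by rewrite -ephi.
rewrite /W -Rint_sum// -RintegralB//.
under eq_Rintegral do rewrite ephi.
have Fz z : leb.-integrable `]0, S] (EFin \o (k z)) /\
  \int[leb]_(q in `]0, S]) k z q = g x t - g (X S z) (t - S).
 have := @FTC_sing R (fun q => - g (X q z) (t - q)) (k z) S (M * (1 + \sum_i `|torow z ord0 i|)) S0.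
 have X0 : X 0 z = x by rewrite /X mulr0 sqrtr0 scale0r subr0.
 rewrite opprK X0 subr0 [- _ + _]addrC.
 apply.
 - move=> q q0.
  have H := @chain_curve R n g dg gt x (torow z) t (fun q => Num.sqrt (2 * q)) q _ Dx Dt Cx Ct
   (is_derive_sqrt2 q0) (der_cont (is_derive_sqrt2 q0)).
  by apply: (der_val (der_opp H)); rewrite /k /X; ring.
 - move=> q q0; apply: cvgD.
   exact: (@continuous_comp _ _ _ _ (fun p : 'rV[R]_n * R => gt p.1 p.2) _ (@curve_cont x (torow z) t q) (Ct _)).
  apply: cvgM.
   apply: cvgV; first by rewrite gt_eqF// sqrtr_gt0 mulr_gt0.
   exact: der_cont (is_derive_sqrt2 q0).
  apply: cvg_sumR => i; apply: cvgM; first exact: cvg_cst.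
  exact: (@continuous_comp _ _ _ _ (fun p : 'rV[R]_n * R => dg i p.1 p.2) _ (@curve_cont x (torow z) t q) (Cx i _)).
 - apply: cvgN; apply: cvg_at_right_filter.
  have H : g (X q z) (t - q) @[q --> (0 : R)] --> g (X 0 z) (t - 0).
   exact: (@continuous_comp _ _ _ _ (fun p : 'rV[R]_n * R => g p.1 p.2) _ (@curve_cont x (torow z) t 0) (cg _)).
  by rewrite X0 subr0 in H.
 - move=> q q0 qS; rewrite /k; set T := \sum_(i < n) `|_|.
  have T0 : 0 <= T by apply: sumr_ge0.
  have sq0 : 0 <= (Num.sqrt (2 * q))^-1 by rewrite invr_ge0 sqrtr_ge0.
  have M0 : 0 <= M by apply: le_trans (gM x t).
  apply: le_trans (ler_normD _ _) _.
  apply: (@le_trans _ _ (M + (Num.sqrt (2 * q))^-1 * (T * M))).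
   apply: lerD; first exact: gtM.
   rewrite normrM (ger0_norm sq0); apply: ler_wpM2l => //.
   apply: le_trans (ler_norm_sum _ _ _) _; rewrite mulr_suml; apply: ler_sum => i _.
   by rewrite normrM; apply: ler_wpM2l.
  move: ((Num.sqrt (2 * q))^-1) sq0 => s s0; have := mulr_ge0 M0 T0; have := mulr_ge0 M0 s0; nra.
have fx z : leb.-integrable setT (EFin \o (fun q => phi (q, z))) /\
  \int[leb]_q phi (q, z) = gau z * (g x t - g (X S z) (t - S)).
 have [h1 h2] := Fz z; rewrite -h2 -RintegralZl//.
 have h3 : leb.-integrable `]0, S] (EFin \o (fun q => gau z * k z q)).
  by rewrite (_ : _ \o _ = (fun q => (gau z)%:E * (k z q)%:E))%E//; exact: integrableZl.
 by have [h4 h5] := ind_Rint h3; split => //; rewrite -h5.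
rewrite /lebST /= (@Rfubini21 _ _ _ _ _ leb (msm (lebN R n)) _ iphi (fun z => (fx z).1)).
have cgS : continuous (g ^~ (t - S)) by exact: jcont_slice.
have ig : wint (lebRN R n) (fun z => gau z * g (X S z) (t - S)).
 apply: (@integrable_bddM _ _ _ _ _ _ M) => //; first exact: wint_gau.
 exact: (cont_aff_measurable _ _ cgS).
have ig1 : wint (lebRN R n) (fun z => gau z * g x t).
 by apply: (@integrable_bddM _ _ _ _ _ _ M) => //; exact: wint_gau.
rewrite (_ : g x t = \int[lebRN R n]_z (gau z * g x t)); last first.
 by rewrite RintegralZr//; [rewrite Rint_gau mul1r|exact: wint_gau].
rewrite /Pz -RintegralB//; apply: eq_Rintegral => z _.
by rewrite (fx z).2 mulrBr.
Qed.

Lemma is_derive_uniq (V : normedModType R) (g : V -> R) (x v : V) (a b : R) :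
 is_derive x v g a -> is_derive x v g b -> a = b.
Proof. by move=> [_ <-] [_ <-]. Qed.

Lemma der_sum (V : normedModType R) m (g : 'I_m -> V -> R) (dg : 'I_m -> R) (x v : V) :
 (forall i, is_derive x v (g i) (dg i)) ->
 is_derive x v (fun y => \sum_i g i y) (\sum_i dg i).
Proof.
move=> H; rewrite (_ : (fun y => _) = \sum_i g i); first exact: is_derive_sum.
by apply/funext => y; rewrite fct_sumE.
Qed.

(** The path identity for a function constant in time. The weights [cW i] against [dg i] give the
    derivative of [W] of [dg i], which is also [W] of [ddg i]; by uniqueness of derivatives the
    Laplacian is recovered. *)
Lemma Pz_K (S : R) (g : 'rV[R]_n -> R) (dg ddg : 'I_n -> 'rV[R]_n -> R) (M : R) x :
 0 < S -> continuous g ->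
 (forall i x, is_derive x (evec R i) g (dg i x)) ->
 (forall i x, is_derive x (evec R i) (dg i) (ddg i x)) ->
 (forall i, continuous (dg i)) -> (forall i, continuous (ddg i)) ->
 (forall y, `|g y| <= M) -> (forall i y, `|dg i y| <= M) -> (forall i y, `|ddg i y| <= M) ->
 Pz S g x - g x = Wn (om S) (fun y _ => \sum_i ddg i y) x 0.
Proof.
move=> S0 cg Dg Ddg cdg cddg gM dgM ddgM.
have M0 : 0 <= M by apply: le_trans (gM x).
have := @W_K S (fun y _ => g y) (fun _ _ => 0) (fun i y _ => dg i y) M x 0 S0 (cont_timecst cg).
move=> /(_ (fun i x _ => Dg i x)) H.
have {}H := H (fun _ _ => der_cst _ _) (fun i => cont_timecst (cdg i)).
have {}H := H (fun _ => @cst_continuous _ _ _ _) (fun y _ => gM y) (fun i y _ => dgM i y).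
have {}H := H (fun y s => eq_ind_r (fun v => v <= M) M0 (normr0 _)).
have E0 : Wn (om S) (fun _ _ => 0) x 0 = 0.
 by rewrite /W /Rintegral integral0_eq// => p _; rewrite mulr0.
move: H; rewrite E0 sub0r => /(congr1 -%R); rewrite opprB opprK => <-.
have -> : Wn (om S) (fun y _ => \sum_i ddg i y) x 0 = \sum_i Wn (om S) (fun y _ => ddg i y) x 0.
 rewrite /W -Rint_sum//; first by apply: eq_Rintegral => p _; rewrite mulr_sumr.
 by move=> i; apply: (W_int x 0 (wint_om n (ltW S0)) (cont_mSTc (cddg i)) (fun y _ => ddgM i y)).
apply: eq_bigr => i _.
apply: (is_derive_uniq (WD_dx i x 0 S0 (cont_timecst (cdg i)) (fun y _ => dgM i y))).
exact: (W_dx x 0 (wint_om n (ltW S0)) (cont_mSTc (cdg i)) (fun y _ => dgM i y) (fun y _ => Ddg i y) (fun y _ => ddgM i y)).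
Qed.

End Kid.

(** * Time primitives of a source with compact support in time *)

Section primitive.
Variables (R : realType) (n : nat).

Lemma leb_itv_lt (a b : R) : (leb (`[a, b]%classic : set R) < +oo)%E.
Proof. by rewrite lebesgue_measure_itv/=; case: ifP => _; rewrite ltry. Qed.

Lemma leb_itvE (a b : R) : a <= b -> leb (`[a, b]%classic : set R) = (b - a)%:E.
Proof.
move=> ab; rewrite lebesgue_measure_itv/= lte_fin; case: ltP => h //.
by rewrite (_ : b = a) ?subrr//; apply/eqP; rewrite eq_le ab h.
Qed.

Lemma wint_ind (a b : R) : wint leb (\1_(`[a, b]%classic : set R) : R -> R).
Proof.
apply/integrableP; split; first by apply/measurable_EFinP; exact: measurable_indic.
under eq_integral do rewrite /= ger0_norm ?indicE//.
under eq_integral do rewrite -indicE.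
by rewrite integral_indic// setIT; exact: leb_itv_lt.
Qed.

Lemma integrable_ray (g : R -> R) (s : R) : wint leb g -> leb.-integrable `]-oo, s] (EFin \o g).
Proof.
move=> ig; have := @integrableS _ _ _ leb setT `]-oo, s]%classic (EFin \o g) measurableT.
by apply => //; exact: measurable_itv.
Qed.

Lemma supp_bound (k : R -> R) (a b M r : R) : (forall s, `|k s| <= M) -> (forall s, s < a \/ b < s -> k s = 0) ->
 `|k r| <= M * \1_(`[a, b]%classic : set R) r.
Proof.
move=> kM k0; rewrite indicE; case: (boolP (r \in _)) => [_|]; first by rewrite mulr1.
rewrite notin_setE/= in_itv/= => /negP; rewrite negb_and -!ltNge => /orP h.
by rewrite k0// normr0 mulr0.
Qed.

Lemma supp_integrable (k : R -> R) (a b M : R) : measT k ->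
 (forall s, `|k s| <= M) -> (forall s, s < a \/ b < s -> k s = 0) ->
 leb.-integrable setT (EFin \o k).
Proof.
move=> ck kM k0.
have := @integrable_bddM _ _ _ leb _ k M setT measurableT (wint_ind a b) ck (fun p _ => kM p).
apply: eq_integrable => // s _ /=; congr EFin; rewrite indicE.
case: (boolP (s \in _)) => [_|]; first by rewrite mul1r.
rewrite notin_setE/= in_itv/= => /negP; rewrite negb_and -!ltNge => /orP h.
by rewrite k0// mulr0.
Qed.

Lemma joint_cont (K : 'rV[R]_n -> R -> R) (M : R) :
 (forall y s s', `|K y s - K y s'| <= M * `|s - s'|) -> (forall s, continuous (K ^~ s)) ->
 jcont K.
Proof.
move=> L C q; apply: seq_continuous => u uq.
have u1 : (u k).1 @[k --> \oo] --> q.1 by apply: (cvg_comp u fst uq); exact: cvg_fst.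
have u2 : (u k).2 @[k --> \oo] --> q.2 by apply: (cvg_comp u snd uq); exact: cvg_snd.
have h1 : K (u k).1 q.2 @[k --> \oo] --> K q.1 q.2 by exact: (cvg_comp _ _ u1 (C q.2 q.1)).
have h2 : M * `|(u k).2 - q.2| @[k --> \oo] --> (0 : R).
 rewrite -[X in _ --> X](mulr0 M); apply: cvgM; first exact: cvg_cst.
 rewrite -[X in _ --> X](normr0 R); apply: cvg_norm; rewrite -(subrr q.2).
 by apply: cvgB => //; exact: cvg_cst.
have h3 : K (u k).1 (u k).2 - K (u k).1 q.2 @[k --> \oo] --> (0 : R).
 apply/norm_cvg0P; apply: (squeeze_cvgr _ (cvg_cst 0) h2).
 by near=> k; rewrite normr_ge0/= L.
rewrite -[X in _ --> X]add0r.
apply: cvg_trans (cvgD h3 h1); apply: near_eq_cvg.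
by near=> k; rewrite /= subrK.
Unshelve. all: by end_near. Qed.

Variables (k : 'rV[R]_n -> R -> R) (a b M : R).
Hypotheses (ab : a <= b) (ck : jcont k)
 (kM : forall y s, `|k y s| <= M) (k0 : forall y s, s < a \/ b < s -> k y s = 0).

Definition prim (y : 'rV[R]_n) (s : R) : R := \int[leb]_(r in `]-oo, s]) k y r.

Let cks y : continuous (k y).
Proof.
move=> s; apply: (@continuous_comp _ _ _ (fun s => (y, s)) (fun q : 'rV[R]_n * R => k q.1 q.2)).
 by apply: (@cont_pair R 'rV[R]_n R (fun=> y) id); [exact: cst_continuous|exact: cvg_id].
exact: ck.
Qed.

Let cky s : continuous (k ^~ s).
Proof. exact: jcont_slice. Qed.

Let mks y : measT (k y).
Proof. exact: continuous_measurable_fun (@cks y). Qed.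

Let iks y (s : R) : leb.-integrable `]-oo, s] (EFin \o k y).
Proof.
apply: integrable_ray.
exact: (supp_integrable (mks y) (kM y) (@k0 y)).
Qed.

Lemma prim_dt y (s : R) : is_derive s 1 (prim y) (k y s).
Proof.
have ss : s < s + 1 by rewrite ltrDl.
have hoo : (-oo%O < BRight s)%E by rewrite ltNyr.
have [h1 h2] := @continuous_FTC1 R (k y) -oo%O s (s + 1) ss (iks y (s + 1)) hoo (@cks y s).
by split; [exact: h1|rewrite -derive1E; exact: h2].
Qed.

Lemma prim_bound y s : `|prim y s| <= M * (b - a).
Proof.
have M0 : 0 <= M by apply: le_trans (kM y s).
apply: le_trans (le_normr_Rintegral _ (iks y s)) _; first exact: measurable_itv.
have iI := wintZ M (wint_ind a b).
have i1 : wint leb (fun r => `|k y r|) := wint_norm (supp_integrable (mks y) (kM y) (@k0 y)).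
apply: (@le_trans _ _ (\int[leb]_r `|k y r|)).
 rewrite /Rintegral fine_le//.
 - by apply: integrable_fin_num => //; exact: integrable_ray.
 - exact: integrable_fin_num.
 - by apply: ge0_subset_integral => //; case/integrableP : i1.
have -> : M * (b - a) = \int[leb]_r (M * \1_(`[a, b]%classic : set R) r).
 rewrite RintegralZl//; last exact: wint_ind.
 congr (M * _); rewrite /Rintegral integral_indic// setIT.
 by transitivity (fine (b - a)%:E) => //; congr fine; symmetry; exact: leb_itvE.
by apply: le_Rintegral => // r _; exact: (supp_bound r (kM y) (@k0 y)).
Qed.

Lemma prim_lip y s s' : `|prim y s - prim y s'| <= M * `|s - s'|.
Proof.
have := @MVT_line R R (prim y) (k y) s' 1 (s - s') (fun s => prim_dt y s).
move=> [th _]; rewrite /GRing.scale/= mulr1 subrK => ->.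
by rewrite normrM mulrC ler_wpM2r.
Qed.

Lemma prim_cont : jcont prim.
Proof.
apply: (joint_cont prim_lip) => s y; apply: seq_continuous => u uy.
apply: (@Rint_dct _ _ _ leb (fun j r => k (u j) r) (k y) (fun r => M * \1_(`[a, b]%classic : set R) r) `]-oo, s]%classic).
- exact: measurable_itv.
- by move=> j; apply: measurable_funTS; exact: mks.
- by move=> r _; exact: (cvg_comp _ _ uy (@cky r y)).
- by move=> j r _; exact: (supp_bound r (kM (u j)) (@k0 (u j))).
- apply: integrable_ray; exact: wintZ (wint_ind a b).
Qed.

Lemma prim0 y s : s < a -> prim y s = 0.
Proof.
move=> sa; rewrite /prim /Rintegral integral0_eq// => r /=; rewrite in_itv/= => rs.
by rewrite k0//; left; exact: le_lt_trans rs sa.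
Qed.

Lemma prim_dx (dk : 'rV[R]_n -> R -> R) i y (s : R) :
 (forall y (s : R), is_derive y (evec R i) (k ^~ s) (dk y s)) ->
 (forall y s, `|dk y s| <= M) -> (forall y s, s < a \/ b < s -> dk y s = 0) ->
 is_derive y (evec R i) (prim ^~ s) (\int[leb]_(r in `]-oo, s]) dk y r).
Proof.
move=> Dk dM d0; apply/is_derive_lineP.
have := @Rint_diff _ _ _ leb (fun th r => k (th *: evec R i + y) r) (fun th r => dk (th *: evec R i + y) r)
 (fun r => M * \1_(`[a, b]%classic : set R) r) `]-oo, s]%classic 0 (-1) 1 (measurable_itv _).
rewrite ltrN10 ltr01 scale0r add0r; apply => //.
- by move=> th r _ _ _; exact: (@line_derive _ _ (k ^~ r) (dk ^~ r) y (evec R i) (fun y => Dk y r) th).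
- by move=> th r _ _ _; exact: (supp_bound r (dM _) (d0 _)).
- apply: integrable_ray; exact: wintZ (wint_ind a b).
Qed.

End primitive.

(** * The time derivative of the Duhamel operator *)

Section LT2.
Variables (R : realType) (n : nat).

Lemma der_near (f g : R -> R) (x d : R) : (\forall y \near x, f y = g y) ->
 is_derive x 1 f d -> is_derive x 1 g d.
Proof. by move=> e; apply: near_eq_is_derive. Qed.

(** The source need not be differentiable in time, so the path identity is applied to its time
    primitive: it expresses [W h] through [prim h] and [prim (dh i)], which are. The boundary term
    at time [t - S] vanishes because [t < a + S]. *)
Lemma W_heat_dt (h : 'rV[R]_n -> R -> R) (dh : 'I_n -> 'rV[R]_n -> R -> R) (S a b M : R) x (t : R) :
 0 < S -> a <= b -> jcont h ->
 (forall i, jcont (dh i)) ->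
 (forall i y (s : R), is_derive y (evec R i) (h ^~ s) (dh i y s)) ->
 (forall y s, `|h y s| <= M) -> (forall i y s, `|dh i y s| <= M) ->
 (forall y s, s < a \/ b < s -> h y s = 0) -> (forall i y s, s < a \/ b < s -> dh i y s = 0) ->
 t < a + S ->
 is_derive t 1 (Wn (om S) h x) (h x t + \sum_i Wn (fun p => om S p * cW i p) (dh i) x t).
Proof.
move=> S0 ab ch cdh Dh hM dhM h0 dh0 taS.
pose M' := Num.max M (M * (b - a)).
have M1 : M <= M' by rewrite le_max lexx.
have M2 : M * (b - a) <= M' by rewrite le_max lexx orbT.
pose G i := prim (dh i).
have E t' : t' < a + S -> Wn (om S) h x t' =
  prim h x t' + \sum_i Wn (fun p => om S p * cW i p) (G i) x t'.
 move=> t's; have := @W_K R n S (prim h) h G M' x t' S0.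
 move=> /(_ (prim_cont ch hM h0) (fun i y s => prim_dx ch hM h0 y s (Dh i) (dhM i) (dh0 i))).
 move=> /(_ (fun y s => prim_dt ch hM h0 y s) (fun i => prim_cont (cdh i) (dhM i) (dh0 i)) ch).
 move=> /(_ (fun y s => le_trans (prim_bound ab ch hM h0 y s) M2)).
 move=> /(_ (fun i y s => le_trans (prim_bound ab (cdh i) (dhM i) (dh0 i) y s) M2)).
 move=> /(_ (fun y s => le_trans (hM y s) M1)).
 have -> : Pz S (prim h ^~ (t' - S)) x = 0.
  rewrite /Pz /Rintegral integral0_eq// => z _.
  by rewrite (prim0 h0) ?mulr0// ltrBlDr.
 by rewrite subr0 => /eqP; rewrite subr_eq => /eqP.
have D1 : is_derive t 1 (fun t' => prim h x t' + \sum_i Wn (fun p => om S p * cW i p) (G i) x t')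
  (h x t + \sum_i Wn (fun p => om S p * cW i p) (dh i) x t).
 apply: der_add; first exact: (prim_dt ch hM h0).
 apply: der_sum => i.
 have m1 := cont_mSTE (prim_cont (cdh i) (dhM i) (dh0 i)).
 have D2 y (s : R) : is_derive s 1 (G i y) (dh i y s) by exact: (prim_dt (cdh i) (dhM i) (dh0 i)).
 exact: (@W_dt R n _ _ (lebST R n) (@sgE R n) (@zzE R n) _ (G i) (dh i) _ _ x t (wint_cW i S0) m1
  (prim_bound ab (cdh i) (dhM i) (dh0 i)) D2 (dhM i)).
apply: (der_near _ D1).
by near=> t'; rewrite E//; near: t'; exact: lt_nbhsl.
Unshelve. all: by end_near. Qed.

End LT2.

(** * Powers of the positive part and a cutoff in time *)

Section pospart.
Variable R : realType.

Definition pp (k : nat) (s : R) : R := Num.max 0 s ^+ k.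

Lemma pp_ge0 k s : 0 <= pp k s.
Proof. by rewrite /pp exprn_ge0// le_max lexx. Qed.

Lemma pp0 k s : s <= 0 -> pp k.+1 s = 0.
Proof. by move=> s0; rewrite /pp max_l// expr0n. Qed.

Lemma ppE k s : 0 <= s -> pp k s = s ^+ k.
Proof. by move=> s0; rewrite /pp max_r. Qed.

Lemma max0_cont : continuous (fun s : R => Num.max 0 s).
Proof. by move=> s; apply: continuous_max; [exact: cvg_cst|exact: cvg_id]. Qed.

Lemma pp_cont k : continuous (pp k).
Proof.
move=> s; apply: (@continuous_comp R R R (fun s => Num.max 0 s) (fun y : R => y ^+ k)).
 exact: max0_cont.
exact: exprn_continuous.
Qed.

Lemma pp_derive k (s : R) : is_derive s 1 (pp k.+2) (k.+2%:R * pp k.+1 s).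
Proof.
have [s0|s0|->] := ltgtP s 0.
- have -> : k.+2%:R * pp k.+1 s = 0 by rewrite pp0 ?mulr0// ltW.
 apply: (der_near _ (der_cst 0 s)); near=> y; rewrite pp0//.
 by near: y; exact: nbhs_left_le_subproof || (apply: filterS (lt_nbhsl s0) => y; exact: ltW).
- rewrite ppE ?(ltW s0)//.
 apply: (@der_near _ (fun y => y ^+ k.+2)); last first.
  by apply: der_val (der_pow k.+2 (der_id s)) _; rewrite mulr1.
 near=> y; rewrite ppE//; near: y.
 by apply: filterS (lt_nbhsr s0) => y; exact: ltW.
- have -> : k.+2%:R * pp k.+1 0 = 0 :> R by rewrite pp0 ?mulr0.
 apply/is_derive_cvgP; rewrite pp0//.
 apply/norm_cvg0P.
 have H0 : (fun h : R => `|h|) h @[h --> (0 : R)] --> (0 : R).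
  by rewrite -[X in _ --> X](normr0 R); exact: (@norm_continuous R R).
 have H : (fun h : R => `|h|) h @[h --> 0^'] --> (0 : R) by apply: cvg_within_filter; exact: H0.
 apply: (squeeze_cvgr _ (cvg_cst 0) H); near=> h.
 rewrite normr_ge0/= subr0 addr0; have h0 : h != 0 by near: h; exact: nbhs_dnbhs_neq.
 have h1 : `|h| <= 1.
  near: h; apply: nbhs_dnbhs.
  by apply: filterS (@nbhs0_lt _ R 1 ltr01) => h /ltW.
 have [hn|hp] := leP h 0; first by rewrite pp0// mulr0 normr0.
 rewrite ppE ?(ltW hp)// exprS mulrA mulVf// mul1r normrX exprS ler_piMr//.
 by rewrite exprn_ile1.
Unshelve. all: by end_near. Qed.

Lemma FTC_cont (F f : R -> R) (a b : R) : a < b ->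
 (forall s : R, is_derive s 1 F (f s)) -> continuous f ->
 (\int[leb]_(x in `[a, b]) (f x)%:E = (F b)%:E - (F a)%:E)%E.
Proof.
move=> ab dF cf; apply: continuous_FTC2 => //.
- by apply: continuous_subspaceT.
- split.
 + by move=> x _; have [] := dF x.
 + by apply: cvg_at_right_filter; exact: der_cont (dF a).
 + by apply: cvg_at_left_filter; exact: der_cont (dF b).
- by move=> x _; rewrite derive1E; have [_] := dF x.
Qed.

Variables (a : R).
(** Continuously differentiable and zero up to time [a]: multiplying a solution by it erases the
    initial datum. *)
Definition chi (s : R) : R := pp 2 (s - a).
Definition chi' (s : R) : R := 2 * pp 1 (s - a).

Lemma chi_derive (s : R) : is_derive s 1 chi (chi' s).
Proof.
have D1 : is_derive s 1 (fun s : R => (s - a)) 1.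
 by apply: der_val (der_sub (der_id s) (der_cst a s)) _; rewrite subr0.
have := @der_comp _ (pp 2) (fun s => s - a) s _ _ (pp_derive 0 _) D1.
by rewrite mulr1.
Qed.

Lemma chi'_cont : continuous chi'.
Proof.
move=> s; apply: cvgM; first exact: cvg_cst.
apply: (@continuous_comp R R R (fun s : R => s - a) (pp 1)); last exact: pp_cont.
by apply: cvgB; [exact: cvg_id|exact: cvg_cst].
Qed.

Lemma chi_ge0 s : (0 <= chi s). Proof. exact: pp_ge0. Qed.
Lemma chi'_ge0 s : (0 <= chi' s). Proof. by rewrite mulr_ge0// pp_ge0. Qed.
Lemma chi0 s : (s <= a) -> chi s = 0. Proof. by move=> sa; rewrite /chi pp0// subr_le0. Qed.
Lemma chi'0 s : (s <= a) -> chi' s = 0.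
Proof. by move=> sa; rewrite /chi' pp0 ?mulr0// subr_le0. Qed.
Lemma chi_nd r t : r <= t -> chi r <= chi t.
Proof.
move=> rt; rewrite /chi /pp.
rewrite ler_pXn2r ?nnegrE//; [|by rewrite le_max lexx|by rewrite le_max lexx].
by rewrite ge_max !le_max lexx/= lerD2r rt orbT.
Qed.
Lemma measurable_chi' : measT chi'.
Proof. exact: continuous_measurable_fun chi'_cont. Qed.
Lemma measurable_chi : measT chi.
Proof. by apply: continuous_measurable_fun => s; exact: der_cont (chi_derive s). Qed.

Lemma chi_int (r t : R) : r < t ->
 (\int[leb]_s ((chi' s * \1_(`]r, t[%classic : set R) s)%:E) = (chi t - chi r)%:E)%E.
Proof.
move=> rt; have := FTC_cont rt chi_derive chi'_cont; rewrite -EFinB => <-.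
rewrite integral_itv_bndoo; last first.
 by apply: measurable_funTS; apply/measurable_EFinP; exact: measurable_chi'.
rewrite [RHS]integral_mkcond; apply: eq_integral => s _; rewrite patchE indicE.
by case: ifPn => _; rewrite ?mulr1 ?mulr0.
Qed.

End pospart.

(** * Duhamel's formula under a time cutoff, for an abstract semigroup kernel *)

Section abstract_duhamel.
Local Open Scope ereal_scope.
Context (R : realType) d (T : measurableType d) (m : {sigma_finite_measure set T -> \bar R}).
Variable K : R -> T -> T -> R.
Hypotheses (K0 : forall t x y, (0 <= K t x y)%R) (Kneg : forall t x y, (t <= 0)%R -> K t x y = 0%R)
 (mK : measT (fun p : R * T * T => K p.1.1 p.1.2 p.2))
 (Ksg : forall t s x z, (0 < t)%R -> (0 < s)%R ->
  \int[m]_y (K t x y * K s y z)%:E = (K (t + s) x z)%:E).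

Lemma measK d' (U : measurableType d') (t : U -> R) (a b : U -> T) :
 measT t -> measT a -> measT b ->
 measT (fun u => K (t u) (a u) (b u)).
Proof.
move=> mt ma mb.
apply: (measurableT_comp mK (_ : measT (fun u => (t u, a u, b u)))).
by apply: measurable_fun_pair => //; exact: measurable_fun_pair.
Qed.

Definition Pe (t : R) (u0 : T -> R) (x : T) : \bar R := \int[m]_y (K t x y * u0 y)%:E.
Definition Du (h : R -> T -> R) (x : T) (t : R) : \bar R :=
 \int[leb]_r \int[m]_y (K (t - r) x y * h r y)%:E.

Lemma Pe_ge0 t u0 x : (forall y, (0 <= u0 y)%R) -> 0 <= Pe t u0 x.
Proof. by move=> h; apply: integral_ge0 => y _; rewrite lee_fin mulr_ge0. Qed.

Lemma measurable_Pe d' (U : measurableType d') (t : U -> R) (x : U -> T) (h : U -> T -> R) :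
 measT t -> measT x ->
 measT (fun p : U * T => h p.1 p.2) -> (forall u y, (0 <= h u y)%R) ->
 measT (fun u => Pe (t u) (h u) (x u)).
Proof.
move=> mt mx mh h0.
apply: (@measurable_fun_fubini_tonelli_F _ _ U T R m (fun p => (K (t p.1) (x p.1) p.2 * h p.1 p.2)%:E)).
- apply/measurable_EFinP/measurable_funM => //; apply: measK => //.
 + exact: (measurableT_comp mt measurable_fst).
 + exact: (measurableT_comp mx measurable_fst).
- by move=> p; rewrite lee_fin mulr_ge0.
Qed.

Lemma Pe_Pe (t s : R) (u0 : T -> R) x : (0 < t)%R -> (0 < s)%R -> measT u0 -> (forall y, (0 <= u0 y)%R) ->
 \int[m]_y ((K t x y)%:E * Pe s u0 y) = Pe (t + s) u0 x.
Proof.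
move=> t0 s0 mu u00.
have mKy : measT (fun p : T * T => (K t x p.1 * (K s p.1 p.2 * u0 p.2))%:E).
 apply/measurable_EFinP/measurable_funM.
  by apply: measK => //; exact: measurable_fst.
 apply: measurable_funM; first by apply: measK.
 exact: (measurableT_comp mu measurable_snd).
transitivity (\int[m]_y \int[m]_z (K t x y * (K s y z * u0 z))%:E).
 apply: eq_integral => y _; rewrite -ge0_integralZl//.
 - by apply/measurable_EFinP/measurable_funM => //; exact: measK.
 - by move=> z _; rewrite lee_fin mulr_ge0.
 - by rewrite lee_fin.
rewrite (fubini_tonelli (fun p => (K t x p.1 * (K s p.1 p.2 * u0 p.2))%:E))//=; last by move=> p; rewrite lee_fin !mulr_ge0.
apply: eq_integral => z _; under eq_integral do rewrite mulrA EFinM.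
rewrite ge0_integralZr//.
- by rewrite Ksg.
- by apply/measurable_EFinP/measurable_funM; exact: measK.
- by move=> y _; rewrite lee_fin mulr_ge0.
- by rewrite lee_fin.
Qed.

Lemma measurable_slice (h : R -> T -> R) r : measT (fun p : R * T => h p.1 p.2) ->
 measT (h r).
Proof. by move=> mh; exact: (measurableT_comp mh (measurable_pair1 r)). Qed.

Lemma measurable_Pes (s : R) (h : R -> T -> R) : measT (fun p : R * T => h p.1 p.2) -> (forall r y, (0 <= h r y)%R) ->
 measT (fun p : T * R => Pe (s - p.2) (h p.2) p.1).
Proof.
move=> mh h0; apply: (@measurable_Pe _ (T * R)%type (fun p => s - p.2)%R fst (fun p => h p.2)) => //.
 by apply: measurable_funB => //; exact: measurable_snd.
have mq : measT (fun p : T * R * T => (p.1.2, p.2)).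
 apply: measurable_fun_pair; last exact: measurable_snd.
 exact: (measurableT_comp measurable_snd measurable_fst).
exact: (measurableT_comp mh mq).
Qed.

(** Tonelli's theorem and the semigroup law. Since [K] is 0 at nonpositive times, the upper limit of
    the inner integral becomes an indicator. *)
Lemma Pe_Du t s (h : R -> T -> R) x : (0 < s)%R -> (s < t)%R ->
 measT (fun p : R * T => h p.1 p.2) -> (forall r y, (0 <= h r y)%R) ->
 \int[m]_y ((K (t - s) x y)%:E * Du h y s) =
 \int[leb]_r ((\1_(`]-oo, s[%classic : set R) r)%:E * Pe (t - r) (h r) x).
Proof.
move=> s0 st mh h0.
have mB := measurable_Pes s mh h0.
have mKB : measT (fun p : T * R => (K (t - s) x p.1)%:E * Pe (s - p.2) (h p.2) p.1).
 apply: emeasurable_funM => //; apply/measurable_EFinP; by apply: measK.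
transitivity (\int[m]_y \int[leb]_r ((K (t - s) x y)%:E * Pe (s - r) (h r) y)).
 apply: eq_integral => y _; rewrite ge0_integralZl//.
 - exact: (measurableT_comp mB (measurable_pair1 y)).
 - by move=> r _; exact: Pe_ge0.
 - by rewrite lee_fin.
rewrite (@fubini_tonelli _ _ _ _ _ m leb (fun p : T * R => (K (t - s) x p.1)%:E * Pe (s - p.2) (h p.2) p.1))//=; last by move=> p; rewrite mule_ge0// ?lee_fin// Pe_ge0.
apply: eq_integral => r _; rewrite indicE; case: (boolP (r \in _)) => rs.
 rewrite mul1e; move: rs; rewrite inE/= in_itv/= => rs.
 rewrite Pe_Pe ?subr_gt0//; first by rewrite addrA subrK.
 exact: measurable_slice.
rewrite mul0e integral0_eq// => y _; rewrite /Pe integral0_eq ?mule0// => z _.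
rewrite Kneg ?mul0r// subr_le0 leNgt; apply: contra rs => rs.
by rewrite inE/= in_itv.
Qed.

Variables (a T0 : R) (u0 : T -> R) (h w : R -> T -> R).
Hypotheses (a0 : (0 <= a)%R) (mu0 : measT u0) (u00 : forall y, (0 <= u0 y)%R)
 (mh : measT (fun p : R * T => h p.1 p.2)) (h0 : forall r y, (0 <= h r y)%R)
 (mw : measT (fun p : R * T => w p.1 p.2)) (w0 : forall r y, (0 <= w r y)%R)
 (wE : forall s x, (0 < s)%R -> (s < T0)%R -> (w s x)%:E = Pe s u0 x + Du h x s).

Lemma measurable_Per (k : R -> T -> R) (t : R) x : measT (fun p : R * T => k p.1 p.2) ->
 (forall r y, (0 <= k r y)%R) -> measT (fun r : R => Pe (t - r) (k r) x).
Proof.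
move=> mk k0; apply: (@measurable_Pe _ _ (fun r : R => t - r)%R (fun _ : R => x) k) => //.
exact: measurable_funB.
Qed.

Lemma Pe_neg t k x : (t <= 0)%R -> Pe t k x = 0.
Proof. by move=> t0; rewrite /Pe integral0_eq// => y _; rewrite Kneg// mul0r. Qed.

Lemma Pe_w t s x : (0 < s)%R -> (s < t)%R -> (t < T0)%R ->
 Pe (t - s) (w s) x = Pe t u0 x +
  \int[leb]_r ((\1_(`]-oo, s[%classic : set R) r)%:E * Pe (t - r) (h r) x).
Proof.
move=> s0 st tT; rewrite -(Pe_Du x s0 st)//.
have -> : Pe t u0 x = \int[m]_y ((K (t - s) x y)%:E * Pe s u0 y).
 by rewrite Pe_Pe ?subr_gt0// subrK.
rewrite -ge0_integralD//.
- apply: eq_integral => y _; rewrite EFinM wE//; last exact: lt_trans tT.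
 by rewrite ge0_muleDr// ?Pe_ge0//; apply: integral_ge0 => r _; exact: Pe_ge0.
- by move=> y _; rewrite mule_ge0 ?lee_fin// Pe_ge0.
- apply: emeasurable_funM; first by apply/measurable_EFinP; exact: measK.
 apply: (@measurable_Pe _ _ (fun=> s) id (fun=> u0)) => //.
 exact: (measurableT_comp mu0 measurable_snd).
- by move=> y _; rewrite mule_ge0 ?lee_fin//; apply: integral_ge0 => r _; exact: Pe_ge0.
- apply: emeasurable_funM; first by apply/measurable_EFinP; exact: measK.
 apply: (@measurable_fun_fubini_tonelli_F _ _ T (g_sigma_algebraType R.-ocitv.-measurable) R leb (fun p => Pe (s - p.2) (h p.2) p.1)).
  exact: measurable_Pes.
 by move=> p; exact: Pe_ge0.
Qed.

Local Notation chi := (chi a).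
Local Notation chi' := (chi' a).

(** By the semigroup law, propagating [w s] to time [t] gives the datum term plus the part of the
    Duhamel integral before [s]. Weighting by [chi' s] and exchanging the integrals gives [h r] the
    weight [chi t - chi r], the integral of [chi'] from [r] to [t]. *)
Lemma cutoff_step t x : (t < T0)%R -> (a < t)%R ->
 \int[leb]_s ((chi' s)%:E * Pe (t - s) (w s) x) =
 (chi t)%:E * Pe t u0 x + \int[leb]_r ((chi t - chi r)%:E * Pe (t - r) (h r) x).
Proof.
move=> tT at_.
pose A r := Pe (t - r) (h r) x.
have A0 r : 0 <= A r by exact: Pe_ge0.
have mA : measT A by exact: measurable_Per.
pose c (s : R) : R := (chi' s * \1_(`]a, t[%classic : set R) s)%R.
have c0 s : (0 <= c s)%R by rewrite /c mulr_ge0 ?chi'_ge0// indicE.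
have mc : measT c.
 by apply: measurable_funM; [exact: measurable_chi'|exact: measurable_indic].
pose B (p : R * R) := (c p.1 * (p.2 < p.1)%R%:R)%:E * A p.2.
have mB : measT B.
 apply: emeasurable_funM.
  apply/measurable_EFinP; apply: measurable_funM.
   exact: (measurableT_comp mc measurable_fst).
  have H : measurable [set p : R * R | (p.2 < p.1)%R].
   have := @measurable_fun_ltr _ (R * R)%type R setT snd fst measurable_snd measurable_fst.
   by move=> /(_ measurableT [set true] Logic.I); rewrite setTI; congr measurable; apply/seteqP; split => p /=.
  have e : (fun p : R * R => (p.2 < p.1)%R%:R : R) = \1_[set p : R * R | (p.2 < p.1)%R].
   apply/funext => p; rewrite indicE; congr (_ %:R); congr nat_of_bool.
   by apply/idP/idP => [h1|]; [rewrite inE|rewrite inE].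
  by rewrite e; exact: measurable_indic.
 exact: (measurableT_comp mA measurable_snd).
have B0 p : 0 <= B p by rewrite mule_ge0// lee_fin mulr_ge0.
transitivity (\int[leb]_s ((c s)%:E * Pe t u0 x + \int[leb]_r B (s, r))).
 apply: eq_integral => s _.
 have -> : \int[leb]_r B (s, r) = (c s)%:E *
   \int[leb]_r ((\1_(`]-oo, s[%classic : set R) r)%:E * A r).
  rewrite -ge0_integralZl//.
  - apply: eq_integral => r _; rewrite /B /= EFinM -muleA; congr (_ * (_ * _)).
   congr EFin; rewrite indicE; congr (_ %:R); congr nat_of_bool.
   by apply/idP/idP; rewrite inE/= in_itv.
  - apply: emeasurable_funM => //; apply/measurable_EFinP; exact: measurable_indic.
  - by move=> r _; rewrite mule_ge0// lee_fin indicE.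
  - by rewrite lee_fin.
 rewrite -ge0_muleDr ?Pe_ge0//; last first.
  by apply: integral_ge0 => r _; rewrite mule_ge0// lee_fin indicE.
 have [sa|sa] := leP s a; first by rewrite /c chi'0// mul0r !mul0e.
 have [st|ts] := ltP s t.
  rewrite -(Pe_w _ _ st)//; last exact: le_lt_trans sa.
  by rewrite /c indicE mem_set ?mulr1//= in_itv/= sa st.
 rewrite Pe_neg ?subr_le0// mule0 /c indicE memNset ?mulr0 ?mul0e//= in_itv/=.
 by apply/negP; rewrite negb_and -!leNgt ts orbT.
have mFB : measT (fun s : R => \int[leb]_r B (s, r)).
 exact: (@measurable_fun_fubini_tonelli_F _ _ _ _ R leb B).
rewrite ge0_integralD//; last 3 first.
- by move=> s _; rewrite mule_ge0 ?lee_fin// Pe_ge0.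
- by apply: emeasurable_funM => //; exact/measurable_EFinP.
- by move=> s _; apply: integral_ge0.
congr (_ + _).
 rewrite ge0_integralZr ?Pe_ge0//; first by rewrite chi_int// (chi0 (lexx a)) subr0.
 - exact/measurable_EFinP.
 - by move=> s _; rewrite lee_fin.
transitivity (\int[leb]_r \int[leb]_s B (s, r)); first exact: (@fubini_tonelli _ _ _ _ R leb leb B mB B0).
apply: eq_integral => r _; rewrite /B /=.
rewrite ge0_integralZr//; last 2 first.
- apply/measurable_EFinP; apply: measurable_funM => //.
 rewrite (_ : (fun s : R => (r < s)%R%:R) = \1_(`]r, +oo[%classic : set R)).
  exact: measurable_indic.
 apply/funext => s; rewrite indicE; congr (_ %:R); congr nat_of_bool.
 by apply/idP/idP; rewrite inE/= in_itv/= andbT.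
- by move=> s _; rewrite lee_fin mulr_ge0.
have [tr|rt] := leP t r; first by rewrite /A Pe_neg ?subr_le0// !mule0.
congr (_ * _); rewrite -chi_int//; apply: eq_integral => s _; congr EFin.
rewrite /c !indicE -mulrA.
have [sa|sa] := leP s a; first by rewrite chi'0// !mul0r.
congr (_ * _)%R; rewrite -natrM mulnb; congr (_ %:R); congr nat_of_bool.
by rewrite !mem_setE !in_itv/= sa/= andbC.
Qed.

(** The weights [chi r] of the first source and [chi t - chi r] from the second add up to [chi t],
    so the right side is [chi t] times the mild formula, datum term included. All terms are
    nonnegative and may a priori be infinite. *)
Lemma cutoff_duhamel t x : (t < T0)%R -> (a < t)%R ->
 (chi t * w t x)%:E = Du (fun s y => chi s * h s y + chi' s * w s y)%R x t.
Proof.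
move=> tT at_.
have mA (k : R -> T -> R) : measT (fun p : R * T => k p.1 p.2) ->
 (forall r y, (0 <= k r y)%R) -> measT (fun r : R => Pe (t - r) (k r) x) by exact: measurable_Per.
have E r : \int[m]_y (K (t - r) x y * (chi r * h r y + chi' r * w r y))%:E =
  (chi r)%:E * Pe (t - r) (h r) x + (chi' r)%:E * Pe (t - r) (w r) x.
 have mr : measT (fun y => K (t - r) x y) by exact: measK.
 have mhr := measurable_slice r mh; have mwr := measurable_slice r mw.
 rewrite /Pe -!ge0_integralZl//; last 6 first.
 - by apply/measurable_EFinP; exact: measurable_funM.
 - by move=> y _; rewrite lee_fin mulr_ge0.
 - by rewrite lee_fin chi'_ge0.
 - by apply/measurable_EFinP; exact: measurable_funM.
 - by move=> y _; rewrite lee_fin mulr_ge0.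
 - by rewrite lee_fin chi_ge0.
 rewrite -ge0_integralD//.
 - by apply: eq_integral => y _; rewrite -!EFinM -EFinD; congr EFin; ring.
 - by move=> y _; rewrite mule_ge0 ?lee_fin ?chi_ge0// mulr_ge0.
 - by apply: emeasurable_funM => //; apply/measurable_EFinP; exact: measurable_funM.
 - by move=> y _; rewrite mule_ge0 ?lee_fin ?chi'_ge0// mulr_ge0.
 - by apply: emeasurable_funM => //; apply/measurable_EFinP; exact: measurable_funM.
rewrite /Du; under eq_integral do rewrite E.
have mchi : measurable_fun [set: R] (fun r => (chi r)%:E) by apply/measurable_EFinP; exact: measurable_chi.
have mchi' : measurable_fun [set: R] (fun r => (chi' r)%:E) by apply/measurable_EFinP; exact: measurable_chi'.
rewrite ge0_integralD//; last 4 first.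
- by move=> r _; rewrite mule_ge0 ?lee_fin ?chi_ge0// Pe_ge0.
- by apply: emeasurable_funM => //; exact: mA.
- by move=> r _; rewrite mule_ge0 ?lee_fin ?chi'_ge0// Pe_ge0.
- by apply: emeasurable_funM => //; exact: mA.
rewrite cutoff_step// addeCA -[X in _ = _ + X](_ : (chi t)%:E * Du h x t = _); last first.
 have d0 r : 0 <= (chi t - chi r)%:E * Pe (t - r) (h r) x.
  have [tr|rt] := leP t r; first by rewrite Pe_neg ?subr_le0// mule0.
  by rewrite mule_ge0 ?Pe_ge0// lee_fin subr_ge0 chi_nd// ltW.
 rewrite -ge0_integralD//; last 3 first.
 - by move=> r _; rewrite mule_ge0 ?lee_fin ?chi_ge0// Pe_ge0.
 - by apply: emeasurable_funM => //; exact: mA.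
 - apply: emeasurable_funM; last exact: mA.
  by apply/measurable_EFinP; apply: measurable_funB => //; exact: measurable_chi.
 rewrite -ge0_integralZl//; last 3 first.
 - exact: mA.
 - by move=> r _; exact: Pe_ge0.
 - by rewrite lee_fin chi_ge0.
 apply: eq_integral => r _; have [tr|rt] := leP t r.
  by rewrite -/(Pe _ _ _) Pe_neg ?subr_le0// !mule0 adde0.
 rewrite -ge0_muleDl ?lee_fin ?chi_ge0// ?subr_ge0 ?chi_nd ?(ltW rt)//.
 by rewrite -EFinD subrKC.
rewrite -ge0_muleDr ?Pe_ge0//; last by apply: integral_ge0 => r _; exact: Pe_ge0.
by rewrite -wE//; exact: le_lt_trans at_.
Qed.

End abstract_duhamel.

(** * The heat kernel as a semigroup kernel *)

Section concrete_duhamel.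
Variables (R : realType) (n : nat).
Local Notation E m := (mst (lebN R m)).

(** Zero at nonpositive times, so that Duhamel integrals run over the whole line. *)
Definition Kh (t : R) (x y : E n) : R := if 0 < t then heatG t (torow x) (torow y) else 0.

Lemma Kh_ge0 t x y : 0 <= Kh t x y.
Proof. by rewrite /Kh; case: ifP => // _; exact: heatG_ge0. Qed.

Lemma Kh_neg t x y : t <= 0 -> Kh t x y = 0.
Proof. by move=> t0; rewrite /Kh ltNge t0. Qed.

Lemma KhE t x y : 0 < t -> Kh t x y = heatG t (torow x) (torow y).
Proof. by move=> t0; rewrite /Kh t0. Qed.

Lemma sum_sqr_cont m : continuous (fun x : 'rV[R]_m => \sum_(i < m) x ord0 i ^+ 2).
Proof.
move=> x.
 apply: (@cvg_sumR _ _ (nbhs x) (nbhs_filter x) m (fun i x => x ord0 i ^+ 2) (fun i => x ord0 i ^+ 2)) => i.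
 apply: (@continuous_comp _ _ _ (fun x : 'rV[R]_m => x ord0 i) (fun y : R => y ^+ 2)).
  exact: coord_continuous.
 exact: exprn_continuous.
Qed.

Lemma enorm_cont m : continuous (@enorm R m).
Proof.
move=> x; apply: (@continuous_comp _ _ _ (fun x : 'rV[R]_m => \sum_(i < m) x ord0 i ^+ 2) (@Num.sqrt R)).
 exact: sum_sqr_cont.
exact: sqrt_continuous.
Qed.

Lemma enorm2_cont m : continuous (fun x : 'rV[R]_m => enorm x ^+ 2).
Proof. by under eq_fun do rewrite enorm2; exact: sum_sqr_cont. Qed.

Lemma near_eq_continuous_at (f g : R -> R) (x : R) : (\forall y \near x, f y = g y) ->
 {for x, continuous f} -> {for x, continuous g}.
Proof.
move=> e c; rewrite /prop_for /continuous_at -(nbhs_singleton e).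
by apply: cvg_trans c; apply: near_eq_cvg; apply: filterS e => y ->.
Qed.

Lemma heatG_cont (v : 'rV[R]_n) (t : R) : 0 < t ->
 {for (v, t), continuous (fun q : 'rV[R]_n * R => heatG q.2 q.1 0)}.
Proof.
move=> t0; have c2 : {for (v, t), continuous (snd : 'rV[R]_n * R -> R)} by exact: cvg_snd.
have p4 : 0 < 4 * pi * t by rewrite pi4_gt0.
rewrite /heatG; apply: cvgM.
 rewrite (_ : (fun q : 'rV[R]_n * R => _) =
  (fun q => (fun s : R => s `^ (- (n%:R / 2))) ((fun s : R => 4 * pi * s) q.2)))//.
 apply: (@continuous_comp _ _ _ (fun q : 'rV[R]_n * R => 4 * pi * q.2) (fun s : R => s `^ (- (n%:R / 2)))).
  by apply: cvgM; [exact: cvg_cst|exact: c2].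
 apply: (@near_eq_continuous_at (fun s => expR (- (n%:R / 2) * ln s))).
  near=> s; rewrite /powR gt_eqF//; near: s; exact: lt_nbhsr.
 apply: (@continuous_comp R R R (fun s => - (n%:R / 2) * ln s) (@expR R)); last exact: continuous_expR.
 by apply: cvgM; [exact: cvg_cst|exact: continuous_ln].
apply: (@continuous_comp _ _ _ (fun q : 'rV[R]_n * R => - enorm (q.1 - 0) ^+ 2 / (4 * q.2)) (@expR R)); last exact: continuous_expR.
apply: cvgM.
 apply: cvgN; under eq_fun do rewrite subr0; rewrite subr0.
 have := @continuous_comp _ _ _ (fst : 'rV[R]_n * R -> _) (fun x : 'rV[R]_n => enorm x ^+ 2) (v, t).
 by apply; [exact: cvg_fst|exact: enorm2_cont].
apply: cvgV; first by rewrite gt_eqF// mulr_gt0.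
by apply: cvgM; [exact: cvg_cst|exact: c2].
Unshelve. all: by end_near. Qed.

Lemma measurable_Kh : measT (fun p : R * E n * E n => Kh p.1.1 p.1.2 p.2).
Proof.
pose D := [set p : R * E n * E n | 0 < p.1.1].
have mt : measT (fun p : R * E n * E n => p.1.1).
 exact: (measurableT_comp measurable_fst measurable_fst).
have mD : measurable D.
 have := @measurable_fun_ltr _ (R * E n * E n)%type R setT (fun=> 0) (fun p => p.1.1) (measurable_cst _) mt.
 by move=> /(_ measurableT [set true] Logic.I); rewrite setTI.
rewrite (_ : (fun p => _) = (fun p => heatG p.1.1 (torow p.1.2 - torow p.2) 0) \_ D); last first.
 apply/funext => p; rewrite patchE /Kh /heatG subr0; case: ifPn => h.
  by rewrite mem_set.
 by rewrite memNset//; apply/negP.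
apply/(measurable_restrictT _ mD).
apply: (@measurable_comp_rV R _ (R * E n * E n)%type n D (fun p => torow p.1.2 - torow p.2) (fun p => p.1.1)
  (fun v t => heatG t v 0)) => //.
- move=> i; under eq_fun do rewrite !mxE.
 apply: measurable_funB.
  exact: (measurableT_comp (@measurable_coords R n i) (measurableT_comp measurable_snd measurable_fst)).
 exact: (measurableT_comp (@measurable_coords R n i) measurable_snd).
- by move=> p /= p0; exact: heatG_cont.
Qed.

Lemma Kh_sg t s x z : 0 < t -> 0 < s ->
 (\int[lebRN R n]_y (Kh t x y * Kh s y z)%:E = (Kh (t + s) x z)%:E)%E.
Proof.
move=> t0 s0; rewrite KhE ?addr_gt0// -heatG_semig//.
by apply: eq_integral => y _; rewrite !KhE.
Qed.

Definition PeE := @Pe R _ (E n) (lebRN R n) Kh.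
Definition DuE := @Du R _ (E n) (lebRN R n) Kh.

Lemma PeE_Pz t (k : 'rV[R]_n -> R) (M : R) x : 0 < t -> continuous k -> (forall y, `|k y| <= M) ->
 (forall y, 0 <= k y) -> PeE t (fun y => k (torow y)) (fromrow x) = (Pz t k x)%:E.
Proof.
move=> t0 ck kM k0; rewrite /PeE /Pe.
have mk : measT (fun p : E n => k (torow p)).
 by apply: measurable_torow => p _; exact: ck.
under eq_integral do rewrite KhE// torowK.
rewrite heatG_cv// /Pz /Rintegral fineK; last first.
 apply: integrable_fin_num => //.
 apply: (@integrable_bddM _ _ _ _ _ _ M) => //; first exact: wint_gau.
 exact: (cont_aff_measurable _ _ ck).
by apply: eq_integral => z _; rewrite torow_aff.
Qed.

(** Reflection of time turns the Duhamel integral into one over the elapsed time [q]. For [q > S]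
    the source is evaluated before [a], where it vanishes, so the window [[0, S]] loses nothing. *)
Lemma W_Du (S a M : R) (g : 'rV[R]_n -> R -> R) x t : 0 < S ->
 jcont g -> (forall y s, `|g y s| <= M) ->
 (forall y s, 0 <= g y s) -> (forall y s, s < a -> g y s = 0) -> t < a + S ->
 DuE (fun s y => g (torow y) s) (fromrow x) t = (Wn (om S) g x t)%:E.
Proof.
move=> S0 cg gM g0 ga taS.
have cgq q : continuous (fun y => g y q) by exact: (jcont_slice (h := g)).
have [i1 ->] := Wom_slice x t S0 cg gM.
rewrite /Rintegral fineK; last by apply: integrable_fin_num.
have mg : measT (fun p : R * E n => g (torow p.2) p.1).
 apply: (@measurable_comp_rV R _ (R * E n)%type n setT (fun p => torow p.2) fst g) => //.
 - move=> i; under eq_fun do rewrite !mxE.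
  exact: (measurableT_comp (@measurable_coords R n i) measurable_snd).
 - by move=> p _; exact: cg.
rewrite /DuE /Du (@lebesgue_reflect R t (fun r => \int[lebRN R n]_y (Kh (t - r) (fromrow x) y * g (torow y) r)%:E)%E); last 2 first.
- exact: (@measurable_Per R _ (E n) (lebRN R n) Kh Kh_ge0 measurable_Kh (fun r y => g (torow y) r) t (fromrow x) mg (fun r y => g0 _ _)).
- by move=> r; apply: integral_ge0 => y _; rewrite lee_fin mulr_ge0 ?Kh_ge0.
rewrite [RHS]integral_mkcond; apply: eq_integral => q _; rewrite patchE subKr.
case: ifPn.
 rewrite inE/= in_itv/= => /andP[q0 qS].
 exact: (@PeE_Pz q (fun y => g y (t - q)) M x q0 (cgq _) (fun y => gM _ _) (fun y => g0 _ _)).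
rewrite notin_setE/= in_itv/= => /negP; rewrite negb_and -leNgt -ltNge => /orP[q0|Sq].
 by rewrite integral0_eq// => y _; rewrite Kh_neg// mul0r.
rewrite integral0_eq// => y _; rewrite ga ?mulr0//.
by rewrite ltrBlDr (lt_trans taS)// ltrD2l.
Qed.

End concrete_duhamel.

(** * Rules for directional derivatives and for local continuity *)

Section derv.
Variables (R : realType) (V : normedModType R).

Lemma derv_scale (c : R) (g : V -> R) (x v : V) (d : R) : is_derive x v g d ->
 is_derive x v (fun y => c * g y) (c * d).
Proof. by move=> /is_derive_lineP D; apply/is_derive_lineP; exact: der_scale. Qed.

Lemma derv_add (f g : V -> R) (x v : V) (d e : R) : is_derive x v f d -> is_derive x v g e ->
 is_derive x v (fun y => f y + g y) (d + e).
Proof. by move=> /is_derive_lineP D /is_derive_lineP D'; apply/is_derive_lineP; exact: der_add. Qed.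

Lemma is_deriveE (g : V -> R) (x v : V) (d : R) : is_derive x v g d -> 'D_v g x = d.
Proof. by case. Qed.

Lemma is_deriveD (g : V -> R) (x v : V) (d : R) : is_derive x v g d -> is_derive x v g ('D_v g x).
Proof. by move=> D; rewrite (is_deriveE D). Qed.

End derv.

Lemma near_cont_at (R : realType) (X : topologicalType) (f g : X -> R) (x : X) :
 (\forall y \near x, f y = g y) -> {for x, continuous f} -> {for x, continuous g}.
Proof.
move=> e c; rewrite /prop_for /continuous_at -(nbhs_singleton e).
by apply: cvg_trans c; apply: near_eq_cvg; apply: filterS e => y ->.
Qed.

Lemma snd_near (R : realType) (X : topologicalType) (x : X) (t a b : R) : a < t -> t < b ->
 \forall q \near (x, t), a < q.2 < b.
Proof.
move=> h1 h2; exists (setT, [set s | a < s < b]).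
 split => /=; first exact: filterT.
 by near=> s; apply/andP; split; near: s; [exact: lt_nbhsr|exact: lt_nbhsl].
by move=> q [].
Unshelve. all: by end_near. Qed.

(** * Regularity of mild solutions *)

Section regularity.
Variables (R : realType) (n : nat).
Local Notation E m := (mst (lebN R m)).
Implicit Types (k w h : 'rV[R]_n -> R -> R) (y x : 'rV[R]_n).

Definition contW k (T0 : R) := forall y s, 0 < s -> s < T0 ->
 {for (y, s), jcont k}.

Definition clip (a b s : R) : R := Num.max a (Num.min s b).
Definition theta (b s : R) : R := Num.max 0 (1 - Num.max 0 (s - b)).

Lemma clip_in a b s : a <= b -> a <= clip a b s <= b.
Proof. by move=> ab; rewrite /clip le_max lexx/= ge_max ab ge_min lexx orbT. Qed.

Lemma clip_id a b s : a <= s -> s <= b -> clip a b s = s.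
Proof. by move=> h1 h2; rewrite /clip min_l// max_r. Qed.

Lemma theta1 b s : s <= b -> theta b s = 1.
Proof. by move=> h; rewrite /theta (max_l (_ : s - b <= 0)) ?subr_le0// subr0 max_r. Qed.

Lemma theta0 b s : b + 1 <= s -> theta b s = 0.
Proof.
move=> h; rewrite /theta max_l// subr_le0 le_max; apply/orP; right.
by rewrite lerBrDl.
Qed.

Lemma theta_ge0 b s : 0 <= theta b s. Proof. by rewrite /theta le_max lexx. Qed.
Lemma theta_le1 b s : theta b s <= 1.
Proof. by rewrite /theta ge_max ler01/= lerBlDr lerDl le_max lexx. Qed.

Lemma clip_cont a b : continuous (clip a b).
Proof.
move=> s; apply: (@continuous_max R R (fun=> a) (fun s => Num.min s b) s); first exact: cvg_cst.
by apply: (@continuous_min R R id (fun=> b) s); [exact: cvg_id|exact: cvg_cst].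
Qed.

Lemma theta_cont b : continuous (theta b).
Proof.
move=> s; apply: (@continuous_max R R (fun=> 0) (fun s => 1 - Num.max 0 (s - b)) s); first exact: cvg_cst.
apply: cvgB; first exact: cvg_cst.
apply: (@continuous_max R R (fun=> 0) (fun s => s - b) s); first exact: cvg_cst.
by apply: cvgB; [exact: cvg_id|exact: cvg_cst].
Qed.

Lemma snd_comp_cont (f : R -> R) : continuous f -> continuous (fun q : 'rV[R]_n * R => f q.2).
Proof. by move=> cf q; apply: (@continuous_comp _ _ _ snd f); [exact: cvg_snd|exact: cf]. Qed.

Lemma clip_comp_cont k T0 a b : contW k T0 -> 0 < a -> a <= b -> b < T0 ->
 continuous (fun q : 'rV[R]_n * R => k q.1 (clip a b q.2)).
Proof.
move=> ck a0 ab bT q.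
apply: (@continuous_comp _ _ _ (fun q : 'rV[R]_n * R => (q.1, clip a b q.2))
 (fun q : 'rV[R]_n * R => k q.1 q.2)).
 by apply: cont_pair; [exact: cvg_fst|exact: (snd_comp_cont (@clip_cont a b))].
have /andP[h1 h2] := clip_in q.2 ab.
by apply: ck; [exact: lt_le_trans h1|exact: le_lt_trans bT].
Qed.

(** The source of the cut-off equation, made bounded and continuous on all of space-time: [clip]
    freezes the time argument in [[a, b]] and [theta] switches the source off after [b + 1]. Sources
    later than [b] do not influence times up to [b]. *)
Definition gcut (a b : R) w h y (s : R) : R :=
 (chi a s * h y (clip a b s) + chi' a s * w y (clip a b s)) * theta b s.

Lemma chi_cont a : continuous (@chi R a).
Proof. by move=> s; exact: der_cont (chi_derive a s). Qed.

Lemma gcut_cont a b w h T0 : contW w T0 -> contW h T0 -> 0 < a -> a <= b -> b < T0 ->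
 jcont (gcut a b w h).
Proof.
move=> cw ch a0 ab bT q; apply: cvgM; last exact: (snd_comp_cont (@theta_cont b)).
apply: cvgD; apply: cvgM.
- exact: (snd_comp_cont (@chi_cont a)).
- exact: (clip_comp_cont ch a0 ab bT).
- exact: (snd_comp_cont (@chi'_cont R a)).
- exact: (clip_comp_cont cw a0 ab bT).
Qed.

(** The values of [chi a] and [chi' a] at time [b + 1], added. *)
Definition Cg (a b : R) : R := (b - a + 1) ^+ 2 + 2 * (b - a + 1).

Lemma gcut_bound a b w h (M : R) y s : a <= b ->
 (forall y s, a <= s -> s <= b -> `|w y s| <= M) ->
 (forall y s, a <= s -> s <= b -> `|h y s| <= M) ->
 `|gcut a b w h y s| <= Cg a b * M.
Proof.
move=> ab wM hM; have /andP[h1 h2] := clip_in s ab.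
have M0 : 0 <= M by exact: le_trans (wM y _ h1 h2).
have C0 : 0 <= Cg a b by rewrite /Cg addr_ge0 ?sqr_ge0// mulr_ge0// addr_ge0// subr_ge0.
rewrite /gcut; have [bs|sb] := leP (b + 1) s; first by rewrite theta0// mulr0 normr0 mulr_ge0.
have [sa|as_] := leP s a; first by rewrite chi0// chi'0// !mul0r addr0 mul0r normr0 mulr_ge0.
have d0 : 0 <= s - a by rewrite subr_ge0 ltW.
have d1 : s - a <= b - a + 1 by rewrite -addrA [- a + 1]addrC addrA lerD2r ltW.
rewrite normrM (ger0_norm (theta_ge0 _ _)).
apply: le_trans (ler_piMr _ (theta_le1 b s)) _ => //.
apply: le_trans (ler_normD _ _) _; rewrite /Cg mulrDl; apply: lerD.
 rewrite normrM; apply: ler_pM => //; last exact: hM.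
 by rewrite ger0_norm ?chi_ge0// /chi ppE// ler_pXn2r// nnegrE (le_trans d0).
rewrite normrM; apply: ler_pM => //; last exact: wM.
by rewrite ger0_norm ?chi'_ge0// /chi' ppE// expr1 ler_pM2l.
Qed.

Lemma gcut_zero a b w h y s : s < a \/ b + 1 < s -> gcut a b w h y s = 0.
Proof.
case=> [sa|bs]; last by rewrite /gcut theta0 ?mulr0// ltW.
by rewrite /gcut chi0 ?chi'0 ?(ltW sa)// !mul0r addr0 mul0r.
Qed.

Lemma gcut_ge0 a b w h y s : a <= b -> (forall y s, a <= s -> s <= b -> 0 <= w y s) ->
 (forall y s, a <= s -> s <= b -> 0 <= h y s) -> 0 <= gcut a b w h y s.
Proof.
move=> ab w0 h0; have /andP[h1 h2] := clip_in s ab.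
by rewrite /gcut mulr_ge0 ?theta_ge0// addr_ge0// mulr_ge0 ?chi_ge0 ?chi'_ge0 ?w0 ?h0.
Qed.

Lemma gcutE a b w h y s : a <= s -> s <= b ->
 gcut a b w h y s = chi a s * h y s + chi' a s * w y s.
Proof. by move=> h1 h2; rewrite /gcut clip_id// theta1// mulr1. Qed.

(** Vanishing outside []0, T0[] makes the source measurable and nonnegative on the whole line of
    times, as the abstract formula requires. *)
Definition trunc (T0 : R) k (r : R) (y : E n) : R :=
 if (0 < r) && (r < T0) then k (torow y) r else 0.

Lemma meas_trunc T0 k : contW k T0 -> measT (fun p : R * E n => trunc T0 k p.1 p.2).
Proof.
move=> ck; pose D := [set p : R * E n | (`]0, T0[%classic : set R) p.1].
have mD : measurable D.
 rewrite (_ : D = fst @^-1` (`]0, T0[%classic : set R))//.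
 rewrite -[X in measurable X]setTI; exact: measurable_fst.
rewrite (_ : (fun p => _) = (fun p => k (torow p.2) p.1) \_ D); last first.
 apply/funext => p; rewrite patchE /trunc; case: ifPn => h.
  by rewrite mem_set//= /D/= in_itv/= h.
 by rewrite memNset//= /D/= in_itv/=; apply/negP.
apply/(measurable_restrictT _ mD).
apply: (@measurable_comp_rV R _ (R * E n)%type n D (fun p => torow p.2) fst k) => //.
- move=> i; under eq_fun do rewrite !mxE.
 exact: (measurableT_comp (@measurable_coords R n i) measurable_snd).
- by move=> p; rewrite /D/= in_itv/= => /andP[h1 h2]; exact: ck.
Qed.

Definition mild (u0 : 'rV[R]_n -> R) w h (T0 : R) := forall x t, 0 < t -> t < T0 ->
 ((w x t)%:E = PeE t (fun y : E n => u0 (torow y)) (fromrow x) + DuE (trunc T0 h) (fromrow x) t)%E.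

Definition cI (i : 'I_n) (S : R) : R := \int[lebST R n]_p `|om S p * cW i p|.

Section window.
Variables (u0 : 'rV[R]_n -> R) (w h : 'rV[R]_n -> R -> R) (T0 : R).
Hypotheses (mu0 : measT (fun y : E n => u0 (torow y))) (u00 : forall y, 0 <= u0 y)
 (cw : contW w T0) (ch : contW h T0)
 (w0 : forall y s, 0 < s -> s < T0 -> 0 <= w y s) (h0 : forall y s, 0 < s -> s < T0 -> 0 <= h y s)
 (wm : mild u0 w h T0).

Lemma trunc_ge0 k r (Y : E n) : (forall y s, 0 < s -> s < T0 -> 0 <= k y s) -> 0 <= trunc T0 k r Y.
Proof. by move=> k0; rewrite /trunc; case: ifP => // /andP[h1 h2]; exact: k0. Qed.

Section ab.
Variables (a b M : R).
Hypotheses (a0 : 0 < a) (ab : a < b) (bT : b < T0)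
 (wM : forall y s, a <= s -> s <= b -> `|w y s| <= M)
 (hM : forall y s, a <= s -> s <= b -> `|h y s| <= M).

Local Notation g := (gcut a b w h).
Local Notation S := (b - a + 1).

Lemma S_gt0 : 0 < S. Proof. by rewrite addr_gt0// subr_gt0. Qed.

Lemma g_cont : jcont g.
Proof. exact: gcut_cont cw ch a0 (ltW ab) bT. Qed.

Lemma g_bound y s : `|g y s| <= Cg a b * M.
Proof. exact: gcut_bound (ltW ab) wM hM. Qed.

(** The start of the bootstrap: up to the factor [chi], the solution is the Duhamel operator of a
    bounded continuous function. The length [S = b - a + 1] lets the window of elapsed times cover
    the support of the source for every [t <= b]. *)
Lemma reg_repr x t : a < t -> t <= b -> chi a t * w x t = Wn (om S) g x t.
Proof.
move=> at_ tb; have tT : t < T0 by exact: le_lt_trans bT.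
have t0 : 0 < t by exact: lt_trans at_.
have g0 y s : 0 <= g y s.
 apply: gcut_ge0; first exact: ltW.
  by move=> y' s' h1 h2; apply: w0; [exact: lt_le_trans h1|exact: le_lt_trans bT].
 by move=> y' s' h1 h2; apply: h0; [exact: lt_le_trans h1|exact: le_lt_trans bT].
have taS : t < a + S by rewrite addrA subrKC; apply: le_lt_trans tb _; rewrite ltrDl.
have H1 := @W_Du R n S a (Cg a b * M) g x t S_gt0 g_cont g_bound g0
  (fun y s sa => gcut_zero w h y (or_introl sa)) taS.
have H2 := @cutoff_duhamel R _ (E n) (lebRN R n) (@Kh R n) (@Kh_ge0 R n) (@Kh_neg R n)
 (@measurable_Kh R n) (@Kh_sg R n) a T0 (fun Y => u0 (torow Y)) (trunc T0 h) (trunc T0 w)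
 (ltW a0) mu0 (fun Y => u00 _) (meas_trunc ch) (fun r Y => trunc_ge0 r Y h0)
 (meas_trunc cw) (fun r Y => trunc_ge0 r Y w0).
have H3 s (X : E n) : 0 < s -> s < T0 -> ((trunc T0 w s X)%:E =
  PeE s (fun y : E n => u0 (torow y)) X + DuE (trunc T0 h) X s)%E.
 move=> s0 sT; have -> : trunc T0 w s X = w (torow X) s by rewrite /trunc s0 sT.
 by have := wm (torow X) s0 sT; rewrite fromrowK.
have {}H2 := H2 H3 t (fromrow x) tT at_.
have e2 : trunc T0 w t (fromrow x) = w x t by rewrite /trunc t0 tT /= torowK.
rewrite e2 in H2.
apply: EFin_inj; rewrite H2 -H1 /DuE /Du; apply: eq_integral => r _; apply: eq_integral => y _.
congr EFin; have [tr|rt] := leP t r; first by rewrite Kh_neg ?subr_le0// !mul0r.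
congr (_ * _); have [ra|ar] := leP r a.
 by rewrite /gcut chi0// chi'0// !mul0r addr0 mul0r.
have rb : r <= b by apply: le_trans tb; exact: ltW.
rewrite gcutE ?(ltW ar)// /trunc.
by rewrite (lt_trans a0 ar) (lt_trans rt tT).
Qed.

Lemma chi_gt0 t : a < t -> 0 < chi a t.
Proof. by move=> ?; rewrite /chi ppE ?subr_ge0 ?ltW// exprn_gt0// subr_gt0. Qed.

Lemma reg_wE x t : a < t -> t <= b -> w x t = (chi a t)^-1 * Wn (om S) g x t.
Proof. by move=> h1 h2; rewrite -reg_repr// mulKf// gt_eqF// chi_gt0. Qed.

Lemma reg_dx i x t : a < t -> t <= b ->
 is_derive x (evec R i) (w ^~ t) ((chi a t)^-1 * Wn (fun p => om S p * cW i p) g x t).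
Proof.
move=> h1 h2; rewrite (_ : w ^~ t = fun y => (chi a t)^-1 * Wn (om S) g y t).
 apply: derv_scale; exact: WD_dx S_gt0 g_cont g_bound.
by apply/funext => y; exact: reg_wE.
Qed.

Lemma reg_dxE i x t : a < t -> t <= b ->
 'D_(evec R i) (w ^~ t) x = (chi a t)^-1 * Wn (fun p => om S p * cW i p) g x t.
Proof. by move=> h1 h2; have [_ ->] := reg_dx i x h1 h2. Qed.

Lemma reg_dx_bound i x t : a < t -> t <= b ->
 `|'D_(evec R i) (w ^~ t) x| <= (chi a t)^-1 * (Cg a b * M * cI i S).
Proof.
move=> h1 h2; rewrite reg_dxE// normrM gtr0_norm ?invr_gt0 ?chi_gt0//.
apply: ler_wpM2l; first by rewrite invr_ge0 chi_ge0.
apply: (W_bound x t (wint_cW i S_gt0) _ g_bound).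
exact: cont_mSTE g_cont.
Qed.

Lemma reg_dx_cont i x t : a < t -> t < b ->
 {for (x, t), continuous (fun q : 'rV[R]_n * R => 'D_(evec R i) (w ^~ q.2) q.1)}.
Proof.
move=> h1 h2; apply: (@near_cont_at _ _ (fun q : 'rV[R]_n * R => (chi a q.2)^-1 * Wn (fun p => om S p * cW i p) g q.1 q.2)).
 apply: filterS (snd_near x h1 h2) => q /andP[q1 q2].
 by rewrite reg_dxE// ltW.
apply: cvgM; last exact: (W_cont (@measurable_sgE R n) (@measurable_zzE R n) (wint_cW i S_gt0) g_cont g_bound).
apply: cvgV; first by rewrite gt_eqF// chi_gt0.
exact: (snd_comp_cont (@chi_cont a)).
Qed.

Variables (dh : 'I_n -> 'rV[R]_n -> R -> R) (M' : R).
Local Notation dw i := (fun y s => 'D_(evec R i) (w ^~ s) y).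
Hypotheses (cdh : forall i, contW (dh i) T0) (cdw : forall i, contW (dw i) T0)
 (Dh : forall i y (s : R), 0 < s -> s < T0 -> is_derive y (evec R i) (h ^~ s) (dh i y s))
 (Dw : forall i y (s : R), 0 < s -> s < T0 -> is_derive y (evec R i) (w ^~ s) (dw i y s))
 (dwM : forall i y s, a <= s -> s <= b -> `|dw i y s| <= M')
 (dhM : forall i y s, a <= s -> s <= b -> `|dh i y s| <= M').

Local Notation dg i := (gcut a b (dw i) (dh i)).

Lemma dg_cont i : jcont (dg i).
Proof. exact: gcut_cont (@cdw i) (@cdh i) a0 (ltW ab) bT. Qed.

Lemma dg_bound i y s : `|dg i y s| <= Cg a b * M'.
Proof. exact: gcut_bound (ltW ab) (@dwM i) (@dhM i). Qed.

Lemma g_dx i y (s : R) : is_derive y (evec R i) (g ^~ s) (dg i y s).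
Proof.
have /andP[h1 h2] := clip_in s (ltW ab).
have c0 : 0 < clip a b s by exact: lt_le_trans h1.
have cT : clip a b s < T0 by exact: le_lt_trans bT.
have D1 := derv_scale (theta b s) (derv_add (derv_scale (chi a s) (Dh i y c0 cT)) (derv_scale (chi' a s) (Dw i y c0 cT))).
rewrite (_ : g ^~ s = fun y => theta b s * (chi a s * h y (clip a b s) + chi' a s * w y (clip a b s))).
 by rewrite /gcut mulrC.
by apply/funext => y'; rewrite /gcut mulrC.
Qed.

(** One derivative falls on the weight and gives [cW i], the other on the source, whose gradient is
    known from the first stage. *)
Lemma reg_ddx i j x t : a < t -> t < b ->
 is_derive x (evec R j) (dw i ^~ t) ((chi a t)^-1 * Wn (fun p => om S p * cW i p) (dg j) x t).
Proof.
move=> h1 h2; rewrite (_ : dw i ^~ t = fun y => (chi a t)^-1 * Wn (fun p => om S p * cW i p) g y t).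
 apply: derv_scale; apply: (W_dx x t (wint_cW i S_gt0) _ g_bound (fun y s => g_dx j y s) (dg_bound j)).
 exact: cont_mSTE g_cont.
by apply/funext => y; rewrite reg_dxE// ltW.
Qed.

(** When [(chi a)^-1 W g] is differentiated, the term [chi' w / chi] coming from the source cancels
    the one coming from the quotient. *)
Lemma reg_dt x (t : R) : a < t -> t < b ->
 is_derive t 1 (w x) (h x t + \sum_i 'D_(evec R i) (dw i ^~ t) x).
Proof.
move=> h1 h2; have c0 := chi_gt0 h1.
have taS : t < a + S by rewrite addrA subrKC; apply: lt_trans h2 _; rewrite ltrDl.
pose M2 := Num.max (Cg a b * M) (Cg a b * M').
have D1 := @W_heat_dt R n g (fun i => dg i) S a (b + 1) M2 x t S_gt0 (le_trans (ltW ab) (ler_wpDr ler01 (lexx b)))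
 g_cont dg_cont (fun i y s => g_dx i y s).
have {}D1 : is_derive t 1 (Wn (om S) g x) (g x t + \sum_i Wn (fun p => om S p * cW i p) (dg i) x t).
 apply: D1 => //.
 - by move=> y s; apply: le_trans (g_bound y s) _; rewrite le_max lexx.
 - by move=> i y s; apply: le_trans (dg_bound i y s) _; rewrite le_max lexx orbT.
 - by move=> y s; exact: gcut_zero.
 - by move=> i y s; exact: gcut_zero.
have D2 := der_inv (lt0r_neq0 c0) (chi_derive a t).
have D3 := der_mul D2 D1.
apply: (@der_near R (fun s => (chi a s)^-1 * Wn (om S) g x s)).
 near=> s; rewrite reg_wE//.
  by near: s; exact: lt_nbhsr.
 by apply: ltW; near: s; exact: lt_nbhsl.
apply: der_val D3 _; rewrite -reg_repr ?(ltW h2)//.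
rewrite [in RHS](eq_bigr (fun i => (chi a t)^-1 * Wn (fun p => om S p * cW i p) (dg i) x t)); last first.
 by move=> i _; rewrite (is_deriveE (reg_ddx i i x h1 h2)).
rewrite -mulr_sumr gcutE ?(ltW h1) ?(ltW h2)//.
move: (\sum_i _) c0 (chi' a t) (h x t) (w x t) => X; move: (chi a t) => c c0 c' hh ww.
by field; rewrite gt_eqF.
Unshelve. all: by end_near. Qed.

Lemma reg_ddx_bound i j x t : a < t -> t < b ->
 `|'D_(evec R j) (dw i ^~ t) x| <= (chi a t)^-1 * (Cg a b * M' * cI i S).
Proof.
move=> h1 h2; rewrite (is_deriveE (reg_ddx i j x h1 h2)) normrM gtr0_norm ?invr_gt0 ?chi_gt0//.
apply: ler_wpM2l; first by rewrite invr_ge0 chi_ge0.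
apply: (W_bound x t (wint_cW i S_gt0) _ (dg_bound j)).
by apply: cont_mSTE; exact: dg_cont.
Qed.

Lemma reg_ddx_cont i j x t : a < t -> t < b ->
 {for (x, t), continuous (fun q : 'rV[R]_n * R => 'D_(evec R j) (dw i ^~ q.2) q.1)}.
Proof.
move=> h1 h2; apply: (@near_cont_at _ _ (fun q : 'rV[R]_n * R => (chi a q.2)^-1 * Wn (fun p => om S p * cW i p) (dg j) q.1 q.2)).
 apply: filterS (snd_near x h1 h2) => q /andP[q1 q2].
 by rewrite (is_deriveE (reg_ddx i j _ q1 q2)).
have H : continuous (fun q : 'rV[R]_n * R => Wn (fun p => om S p * cW i p) (dg j) q.1 q.2).
 exact: (W_cont (@measurable_sgE R n) (@measurable_zzE R n) (wint_cW i S_gt0) (@dg_cont j) (dg_bound j)).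
apply: (@continuousM _ _ (fun q : 'rV[R]_n * R => (chi a q.2)^-1)); last exact: H.
apply: cvgV; first by rewrite gt_eqF// chi_gt0.
exact: (snd_comp_cont (@chi_cont a)).
Qed.


End ab.

Definition bddW k := forall a b, 0 < a -> a < b -> b < T0 ->
 exists M : R, forall y s, a <= s -> s <= b -> `|k y s| <= M.

Lemma bddW2 k1 k2 a b : bddW k1 -> bddW k2 -> 0 < a -> a < b -> b < T0 ->
 exists2 M : R, (forall y s, a <= s -> s <= b -> `|k1 y s| <= M) &
  (forall y s, a <= s -> s <= b -> `|k2 y s| <= M).
Proof.
move=> B1 B2 a0 ab bT; have [M1 H1] := B1 a b a0 ab bT; have [M2 H2] := B2 a b a0 ab bT.
exists (Num.max M1 M2) => y s h1 h2; first by apply: le_trans (H1 y s h1 h2) _; rewrite le_max lexx.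
by apply: le_trans (H2 y s h1 h2) _; rewrite le_max lexx orbT.
Qed.

Hypotheses (wB : bddW w) (hB : bddW h).

Lemma half_lt (t : R) : 0 < t -> 0 < t / 2 < t.
Proof. by move=> t0; apply/andP; split; lra. Qed.

Lemma mid_lt (t u : R) : t < u -> t < (t + u) / 2 < u.
Proof. by move=> tu; apply/andP; split; lra. Qed.

Local Notation dw i := (fun y s => 'D_(evec R i) (w ^~ s) y).

Lemma reg1 i :
 [/\ contW (dw i) T0, bddW (dw i) &
  forall y (s : R), 0 < s -> s < T0 -> is_derive y (evec R i) (w ^~ s) (dw i y s)].
Proof.
split.
- move=> x t t0 tT; have /andP[p0 pt] := half_lt t0; have /andP[tm mT] := mid_lt tT.
 have [M h1 h2] := bddW2 wB hB p0 (lt_trans pt tm) mT.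
 exact: (reg_dx_cont p0 (lt_trans pt tm) mT h1 h2).
- move=> a b a0 ab bT; have /andP[p0 pa] := half_lt a0.
 have [M h1 h2] := bddW2 wB hB p0 (lt_trans pa ab) bT.
 exists ((chi (a / 2) a)^-1 * (Cg (a / 2) b * M * cI i (b - a / 2 + 1))) => y s as_ sb.
 have ps : a / 2 < s by exact: lt_le_trans as_.
 apply: le_trans (reg_dx_bound p0 (lt_trans pa ab) bT h1 h2 i y ps sb) _.
 apply: ler_wpM2r.
  have M0 : 0 <= M by apply: le_trans (h1 y s (ltW ps) sb).
  rewrite mulr_ge0 ?mulr_ge0//; first by rewrite /Cg addr_ge0 ?sqr_ge0// mulr_ge0//; lra.
  by apply: Rintegral_ge0.
 rewrite lef_pV2 ?posrE ?chi_gt0//; exact: chi_nd.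
- move=> x t t0 tT; have /andP[p0 pt] := half_lt t0; have /andP[tm mT] := mid_lt tT.
 have [M h1 h2] := bddW2 wB hB p0 (lt_trans pt tm) mT.
 exact: is_deriveD (reg_dx p0 (lt_trans pt tm) mT h1 h2 i x pt (ltW tm)).
Qed.

Variable dh : 'I_n -> 'rV[R]_n -> R -> R.
Hypotheses (cdh : forall i, contW (dh i) T0) (dhB : forall i, bddW (dh i))
 (Dh : forall i y (s : R), 0 < s -> s < T0 -> is_derive y (evec R i) (h ^~ s) (dh i y s)).

Lemma bddW_all (k : 'I_n -> 'rV[R]_n -> R -> R) a b : (forall i, bddW (k i)) ->
 0 < a -> a < b -> b < T0 -> exists M : R, forall i y s, a <= s -> s <= b -> `|k i y s| <= M.
Proof.
move=> B a0 ab bT.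
have [F HF] := choice (fun i => B i a b a0 ab bT).
exists (\sum_i `|F i|) => i y s h1 h2; apply: le_trans (HF i y s h1 h2) _.
rewrite (bigD1 i)//=; apply: le_trans (ler_norm _) _; rewrite lerDl.
by apply: sumr_ge0.
Qed.

Lemma reg2 x t : 0 < t -> t < T0 ->
 is_derive t 1 (w x) (h x t + \sum_i 'D_(evec R i) (dw i ^~ t) x) /\
 forall i j, is_derive x (evec R j) (dw i ^~ t) ('D_(evec R j) (dw i ^~ t) x) /\
  {for (x, t), continuous (fun q : 'rV[R]_n * R => 'D_(evec R j) (dw i ^~ q.2) q.1)}.
Proof.
move=> t0 tT; have /andP[p0 pt] := half_lt t0; have /andP[tm mT] := mid_lt tT.
have ptm := lt_trans pt tm.
have [M h1 h2] := bddW2 wB hB p0 ptm mT.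
have [M1 h3] := bddW_all dhB p0 ptm mT.
have [M2 h4] := @bddW_all (fun i => dw i) _ _ (fun i => let: And3 _ B _ := reg1 i in B) p0 ptm mT.
pose M' := Num.max M1 M2.
have h3' i y s : t / 2 <= s -> s <= (t + T0) / 2 -> `|dh i y s| <= M'.
 by move=> s1 s2; apply: le_trans (h3 i y s s1 s2) _; rewrite le_max lexx.
have h4' i y s : t / 2 <= s -> s <= (t + T0) / 2 -> `|dw i y s| <= M'.
 by move=> s1 s2; apply: le_trans (h4 i y s s1 s2) _; rewrite le_max lexx orbT.
have cdw i : contW (dw i) T0 by have [] := reg1 i.
have Dw i y (s : R) : 0 < s -> s < T0 -> is_derive y (evec R i) (w ^~ s) (dw i y s).
 by have [_ _] := reg1 i; apply.
split; first exact: (reg_dt p0 ptm mT h1 h2 cdh cdw Dh Dw h4' h3' x pt tm).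
move=> i j; split.
 exact: is_deriveD (reg_ddx p0 ptm mT h1 h2 Dh Dw h4' h3' i j x pt tm).
exact: (reg_ddx_cont p0 ptm mT h1 h2 cdh cdw Dh Dw h4' h3' pt tm).
Qed.

End window.
End regularity.

(** * Rules for continuity at a point *)

Section continuity_kit.
Variables (R : realType) (T : topologicalType).
Implicit Types (g h : T -> R) (x : T).

Lemma cfM g h x : {for x, continuous g} -> {for x, continuous h} -> {for x, continuous (fun y => g y * h y)}.
Proof. by move=> h1 h2; have H := cvgM h1 h2; exact: H. Qed.

Lemma cfD g h x : {for x, continuous g} -> {for x, continuous h} -> {for x, continuous (fun y => g y + h y)}.
Proof. by move=> h1 h2; have H := cvgD h1 h2; exact: H. Qed.

Lemma cfB g h x : {for x, continuous g} -> {for x, continuous h} -> {for x, continuous (fun y => g y - h y)}.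
Proof. by move=> h1 h2; have H := cvgB h1 h2; exact: H. Qed.

Lemma cfC (c : R) x : {for x, continuous (fun _ : T => c)}.
Proof. exact: cst_continuous. Qed.

Lemma cfV g x : g x != 0 -> {for x, continuous g} -> {for x, continuous (fun y => (g y)^-1)}.
Proof. by move=> h1 h2; have H := cvgV h1 h2; exact: H. Qed.

Lemma cfcomp (P : R -> R) g x : {for g x, continuous P} -> {for x, continuous g} -> {for x, continuous (fun y => P (g y))}.
Proof. by move=> h1 h2; have H := @continuous_comp T R R g P x h2 h1; exact: H. Qed.

Lemma cfmax g h x : {for x, continuous g} -> {for x, continuous h} -> {for x, continuous (fun y => Num.max (g y) (h y))}.
Proof. by move=> h1 h2; exact: (@continuous_max R T g h x). Qed.

Lemma cf_gt g x c : {for x, continuous g} -> c < g x -> \forall y \near x, c < g y.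
Proof. by move=> h1 h2; exact: (@cvgr_gt _ _ (nbhs x) (nbhs_filter _) _ (g x)). Qed.

Lemma cf_lt g x c : {for x, continuous g} -> g x < c -> \forall y \near x, g y < c.
Proof. by move=> h1 h2; exact: (@cvgr_lt _ _ (nbhs x) (nbhs_filter _) _ (g x)). Qed.

End continuity_kit.
Arguments cfC {R T} c x.

(** * Monotonicity and trapping for functions of one variable *)

Section monotone_tools.
Variable R : realType.
Implicit Types (F dF : R -> R).

Lemma MVT_itv F dF (a b : R) : a < b -> (forall s : R, a <= s -> s <= b -> is_derive s 1 F (dF s)) ->
 exists c, [/\ a < c, c < b & F b - F a = dF c * (b - a)].
Proof.
move=> ab D.
have [||c cab e] := @MVT R F dF a b ab.
- by move=> x; rewrite in_itv/= => /andP[/ltW h1 /ltW h2]; exact: D.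
- apply/continuous_within_itvP => //.
 have C s : a <= s -> s <= b -> {for s, continuous F}.
  by move=> h1 h2; exact: der_cont (D s h1 h2).
 split.
 + by move=> s; rewrite in_itv/= => /andP[/ltW h1 /ltW h2]; exact: C.
 + by apply: cvg_at_right_filter; apply: C => //; exact: ltW.
 + by apply: cvg_at_left_filter; apply: C => //; exact: ltW.
- by exists c; move: cab; rewrite in_itv/= => /andP[].
Qed.

Lemma der_nd F dF (a b : R) : a <= b -> (forall s : R, a <= s -> s <= b -> is_derive s 1 F (dF s)) ->
 (forall s, a <= s -> s <= b -> 0 <= dF s) -> F a <= F b.
Proof.
rewrite le_eqVlt => /orP[/eqP -> //|ab] D d0.
have [c [h1 h2 e]] := MVT_itv ab D.
by rewrite -subr_ge0 e mulr_ge0 ?d0 ?subr_ge0 ?ltW.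
Qed.

Lemma der_ni F dF (a b : R) : a <= b -> (forall s : R, a <= s -> s <= b -> is_derive s 1 F (dF s)) ->
 (forall s, a <= s -> s <= b -> dF s <= 0) -> F b <= F a.
Proof.
move=> ab D d0; rewrite -lerN2.
apply: (@der_nd (fun s => - F s) (fun s => - dF s)) => // s h1 h2.
 exact: der_opp (D s h1 h2).
by rewrite oppr_ge0 d0.
Qed.

Lemma der_inc F dF (a b : R) : a < b -> (forall s : R, a <= s -> s <= b -> is_derive s 1 F (dF s)) ->
 (forall s, a <= s -> s <= b -> 0 < dF s) -> F a < F b.
Proof.
move=> ab D d0; have [c [h1 h2 e]] := MVT_itv ab D.
by rewrite -subr_gt0 e mulr_gt0 ?d0 ?subr_gt0// ltW.
Qed.

Lemma pos_der_right F (s d : R) : is_derive s 1 F d -> 0 < d ->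
 forall e, 0 < e -> exists2 h, 0 < h < e & F s < F (h + s).
Proof.
move=> D d0 e e0; have /is_derive_cvgP C := D.
have H : \forall h \near 0^', 0 < h^-1 * (F (h + s) - F s).
 by have /cvgrPdist_lt/(_ _ d0) := C; apply: filterS => h; rewrite ltr_distlC => /andP[]; rewrite subrr.
have [r /= r0 Hr] := H.
exists (Num.min r e / 2).
 have h1 : 0 < Num.min r e by rewrite lt_min r0.
 have h2 : Num.min r e <= e by rewrite ge_min lexx orbT.
 by apply/andP; split; lra.
have h1 : 0 < Num.min r e by rewrite lt_min r0.
have h2 : Num.min r e <= r by rewrite ge_min lexx.
have h0 : 0 < Num.min r e / 2 by lra.
have := Hr (Num.min r e / 2); rewrite /ball_/= sub0r normrN gtr0_norm// => /(_ _ _).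
rewrite pmulr_rgt0 ?invr_gt0// subr_gt0; apply; first by lra.
by rewrite gt_eqF.
Qed.

(** At the last time with [F >= B] the value is exactly [B], and the positive derivative there lifts
    [F] above [B] at a slightly later time. *)
Lemma crossing F dF (s0 B : R) : (forall s : R, s0 <= s -> is_derive s 1 F (dF s)) ->
 B <= F s0 -> (forall s, s0 <= s -> F s = B -> 0 < dF s) -> forall t, s0 <= t -> B <= F t.
Proof.
move=> D B0 HB t st; rewrite leNgt; apply/negP => tB.
have C s : s0 <= s -> {for s, continuous F} by move=> h; exact: der_cont (D s h).
pose A := [set s | s0 <= s <= t /\ B <= F s].
have sA : has_sup A.
 split; first by exists s0; split => //; rewrite lexx.
 by exists t => s [/andP[]].
pose u := sup A.
have s0u : s0 <= u by apply: ub_le_sup => //; [exact: sA.2|split => //; rewrite lexx].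
have ut : u <= t by apply: ge_sup => //; [exact: sA.1|move=> s [/andP[]]].
have Fu1 : B <= F u.
 rewrite leNgt; apply/negP => uB.
 have /cvgr_lt/(_ _ uB)[r /= r0 Hr] := C u s0u.
 have [s [/andP[h1 h2] h3] h4] := sup_adherent r0 sA.
 have su : s <= u by apply: ub_le_sup => //; [exact: sA.2|split => //; rewrite h1].
 have : F s < B by apply: Hr; rewrite /ball_/= ger0_norm ?subr_ge0// -/u in h4 *; lra.
 by rewrite ltNge h3.
have utl : u < t by rewrite lt_neqAle ut andbT; apply/eqP => e; move: tB; rewrite ltNge -e Fu1.
have Fu2 : F u = B.
 apply/eqP; rewrite eq_le Fu1 andbT leNgt; apply/negP => uB.
 have /cvgr_gt/(_ _ uB)[r /= r0 Hr] := C u s0u.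
 pose h := Num.min r (t - u) / 2.
 have m0 : 0 < Num.min r (t - u) by rewrite lt_min r0 subr_gt0.
 have m1 : Num.min r (t - u) <= r by rewrite ge_min lexx.
 have m2 : Num.min r (t - u) <= t - u by rewrite ge_min lexx orbT.
 have h0 : 0 < h by rewrite /h; lra.
 have Fh : B < F (u + h).
  by apply: Hr; rewrite /ball_/= opprD addrA subrr sub0r normrN gtr0_norm// /h; lra.
 have : u + h <= u.
  by apply: ub_le_sup; [exact: sA.2|split; [apply/andP; split; rewrite /h; lra|exact: ltW]].
 by rewrite gerDl leNgt h0.
have [h /andP[h0 he] Fh] := pos_der_right (D u s0u) (HB u s0u Fu2) (eq_ind_r (fun b => is_true b) utl (subr_gt0 _ _)).
have : h + u <= u.
 apply: ub_le_sup; first exact: sA.2.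
 by split; [apply/andP; split; lra|rewrite -Fu2 ltW].
by rewrite gerDr leNgt h0.
Qed.

End monotone_tools.

(** * Asymptotics of the nonlinearity *)

Section nonlinearity.
Variables (R : realType) (f f1 f2 : R -> R) (q : R).
Hypotheses (Df : forall u : R, 0 < u -> is_derive u 1 f (f1 u))
 (Df1 : forall u : R, 0 < u -> is_derive u 1 f1 (f2 u))
 (f_gt0 : forall u, 0 < u -> 0 < f u) (f1_gt0 : forall u, 0 < u -> 0 < f1 u)
 (f2_gt0 : forall u, 0 < u -> 0 < f2 u)
 (cvR : forall e : R, 0 < e -> exists2 A : R, 0 < A & forall u : R, A <= u -> `|f1 u ^+ 2 / (f u * f2 u) - q| <= e).

Local Notation Rf u := (f1 u ^+ 2 / (f u * f2 u)).

Lemma Rf_gt0 u : 0 < u -> 0 < Rf u.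
Proof. by move=> u0; rewrite divr_gt0 ?exprn_gt0 ?mulr_gt0 ?f_gt0 ?f1_gt0 ?f2_gt0. Qed.

Lemma ff1_derive (u : R) : 0 < u -> is_derive u 1 (fun u => f u / f1 u) (1 - (Rf u)^-1).
Proof.
move=> u0; have h1 := f1_gt0 u0; have h2 := f_gt0 u0; have h3 := f2_gt0 u0.
apply: der_val (der_mul (Df u0) (der_inv (lt0r_neq0 h1) (Df1 u0))) _.
by field; rewrite !gt_eqF.
Qed.

(** For [q < 1] the derivative [1 - 1/Rf] of [f/f1] is eventually below a negative constant, and the
    positive quotient [f/f1] would become negative. *)
Lemma q_ge1 : 1 <= q.
Proof.
rewrite leNgt; apply/negP => q1.
have e0 : 0 < (1 - q) / 2 by lra.
have [A A0 HA] := cvR e0.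
have H u : A <= u -> Rf u <= (1 + q) / 2.
 by move=> /HA; rewrite ler_norml => /andP[_]; lra.
have q2 : 0 < (1 + q) / 2 by apply: lt_le_trans (H A (lexx A)); exact: Rf_gt0.
pose c := ((1 + q) / 2)^-1 - 1.
have c0 : 0 < c by rewrite /c subr_gt0 -[ltLHS]invr1 ltf_pV2 ?posrE//; lra.
have K u : A <= u -> f u / f1 u <= f A / f1 A - c * (u - A).
 move=> Au.
 have : f u / f1 u + c * u <= f A / f1 A + c * A; last by lra.
 apply: (@der_ni R (fun u => f u / f1 u + c * u) (fun u => 1 - (Rf u)^-1 + c)) => // s As us.
  have s0 : 0 < s by exact: lt_le_trans As.
  by apply: der_add (ff1_derive s0) (der_line c s).
 have s0 : 0 < s by exact: lt_le_trans As.
 rewrite /c; have : ((1 + q) / 2)^-1 <= (Rf s)^-1 by rewrite lef_pV2 ?posrE ?Rf_gt0// H.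
 by lra.
pose u := A + (f A / f1 A) / c + 1.
have fA0 : 0 < f A / f1 A by rewrite divr_gt0 ?f_gt0 ?f1_gt0.
have Au : A <= u by rewrite /u -addrA lerDl addr_ge0// divr_ge0// ltW.
have : 0 < f u / f1 u by rewrite divr_gt0 ?f_gt0 ?f1_gt0// (lt_le_trans A0).
have := K u Au; rewrite /u (_ : c * _ = f A / f1 A + c); last first.
 move: (f A / f1 A) => z; rewrite (_ : A + z / c + 1 - A = z / c + 1); last by ring.
 by rewrite mulrDr mulr1 mulrCA mulfV ?mulr1// gt_eqF.
by lra.
Qed.

(** The derivative [1 - 1/Rf] of [f/f1] tends to [1 - 1/q]. One half of [d] pays for the limit, the
    other for the constant of integration. *)
Lemma ff1_le (d : R) : 0 < d -> exists2 A : R, 0 < A &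
 forall u : R, A <= u -> f u / f1 u <= (1 - q^-1 + d) * u.
Proof.
move=> d0; have q1 := q_ge1; have q0 : 0 < q by lra.
have e0 : 0 < d / 2 by lra.
have [A A0 HA] := cvR e0.
have H u : A <= u -> 1 - (Rf u)^-1 <= 1 - q^-1 + d / 2.
 move=> Au; have := HA u Au; rewrite ler_norml => /andP[_ h].
 have r0 : 0 < Rf u by apply: Rf_gt0; exact: lt_le_trans Au.
 have : q^-1 - d / 2 <= (Rf u)^-1.
  have : (q + d / 2)^-1 <= (Rf u)^-1 by rewrite lef_pV2 ?posrE//; lra.
  have : q^-1 - (q + d / 2)^-1 <= d / 2.
   rewrite (_ : q^-1 - _ = (d / 2) * (q * (q + d / 2))^-1); last by field; rewrite !gt_eqF//; lra.
   rewrite -[leRHS]mulr1; apply: ler_wpM2l; first by lra.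
   by rewrite invf_le1 ?mulr_gt0//; [nra|lra].
  lra.
 lra.
have K u : A <= u -> f u / f1 u <= f A / f1 A + (1 - q^-1 + d / 2) * (u - A).
 move=> Au.
 have : f u / f1 u - (1 - q^-1 + d / 2) * u <= f A / f1 A - (1 - q^-1 + d / 2) * A; last by lra.
 apply: (@der_ni R (fun u => f u / f1 u - (1 - q^-1 + d / 2) * u) (fun u => 1 - (Rf u)^-1 - (1 - q^-1 + d / 2))) => // s As us.
  have s0 : 0 < s by exact: lt_le_trans As.
  by apply: der_sub (ff1_derive s0) (der_line _ s).
 by rewrite subr_le0 H.
have iq : 0 <= 1 - q^-1 by rewrite subr_ge0 invf_le1.
have fA0 : 0 < f A / f1 A by rewrite divr_gt0 ?f_gt0 ?f1_gt0.
exists (A + 2 * (f A / f1 A) / d); first by rewrite addr_gt0// divr_gt0// mulr_gt0.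
move=> u Hu; have Au : A <= u by apply: le_trans Hu; rewrite lerDl; apply: divr_ge0; [apply: mulr_ge0 => //|]; exact: ltW.
apply: le_trans (K u Au) _.
have : 2 * (f A / f1 A) <= d * u.
 have -> : 2 * (f A / f1 A) = d * (2 * (f A / f1 A) / d) by field; rewrite !gt_eqF ?f1_gt0.
 rewrite ler_pM2l//; apply: le_trans Hu; rewrite lerDr; exact: ltW.
nra.
Qed.

Variable th : R.
Hypotheses (th0 : 0 < th) (th1 : th < 1) (qth : 1 - q^-1 < th).

Lemma ff1_th : exists2 A : R, 0 < A & forall u : R, A <= u -> f u / f1 u <= th * u.
Proof.
have e0 : 0 < th - (1 - q^-1) by rewrite subr_gt0.
have [A A0 HA] := ff1_le e0.
by exists A => // u Au; apply: le_trans (HA u Au) _; rewrite subrKC.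
Qed.

Lemma clipinv_cont (A : R) : 0 < A -> continuous (fun s : R => (f (Num.max A s))^-1).
Proof.
move=> A0 s; have m0 : 0 < Num.max A s by rewrite lt_max A0.
apply: cvgV; first by rewrite gt_eqF// f_gt0.
apply: (@continuous_comp R R R (fun s => Num.max A s) f).
 by apply: (@continuous_max R R (fun=> A) id s); [exact: cvg_cst|exact: cvg_id].
exact: der_cont (Df m0).
Qed.

Lemma prim_inv (A : R) : 0 < A -> exists G : R -> R, forall u : R, A < u -> is_derive u 1 G (f u)^-1.
Proof.
move=> A0; pose g s := (f (Num.max A s))^-1.
exists (fun u => \int[@lebesgue_measure R]_(t in `[A, u]) g t) => u Au.
have uu : u < u + 1 by rewrite ltrDl.
have ig : (@lebesgue_measure R).-integrable `[A, u + 1] (EFin \o g).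
 apply: continuous_compact_integrable; first exact: segment_compact.
 by apply: continuous_subspaceT => s; exact: clipinv_cont.
have [h1 h2] := @continuous_FTC1_closed R g A u (u + 1) uu ig Au (clipinv_cont A0 (x := u)).
have -> : (f u)^-1 = g u by rewrite /g max_r// ltW.
by split; [exact: h1|rewrite -derive1E; exact: h2].
Qed.

Lemma uf_derive (u : R) : 0 < u -> is_derive u 1 (fun u => u / f u) ((f u)^-1 * (1 - u * f1 u / f u)).
Proof.
move=> u0; have h := f_gt0 u0.
apply: der_val (der_mul (der_id u) (der_inv (lt0r_neq0 h) (Df u0))) _.
by field; rewrite gt_eqF.
Qed.

(* The primitive of 1/f is bounded because u/f decreases at rate at least (1/th - 1)/f. *)
Lemma ex_F : exists (F : R -> R) (A : R), [/\ 0 < A,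
 forall u : R, A <= u -> is_derive u 1 F (- (f u)^-1), forall u : R, A <= u -> 0 < F u &
 forall e : R, 0 < e -> exists2 B : R, A <= B & forall u : R, B <= u -> F u <= e].
Proof.
have [A A0 HA] := ff1_th.
have [G HG] := prim_inv A0.
have DG (u : R) : A + 1 <= u -> is_derive u 1 G (f u)^-1 by move=> h; apply: HG; lra.
(* Then [k (1/th - 1) = 1], which makes [G u + k u / f u] nonincreasing. *)
pose k := th / (1 - th).
have t1 := th1; have t0 := th0.
have k0 : 0 < k by rewrite divr_gt0// subr_gt0.
have Gb u : A + 1 <= u -> G u <= G (A + 1) + k * ((A + 1) / f (A + 1)).
 move=> Au.
 have : G u + k * (u / f u) <= G (A + 1) + k * ((A + 1) / f (A + 1)).
  apply: (@der_ni R (fun u => G u + k * (u / f u))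
    (fun u => (f u)^-1 + k * ((f u)^-1 * (1 - u * f1 u / f u)))) => // s As us.
   by apply: der_add; [exact: DG|apply: der_scale; apply: uf_derive; lra].
  have s0 : 0 < s by lra.
  have fs := f_gt0 s0; have f1s := f1_gt0 s0.
  have h : th^-1 <= s * f1 s / f s.
   have As' : A <= s by lra.
   have := HA s As'; rewrite ler_pdivrMr// => h.
   rewrite ler_pdivlMr// ler_pdivrMl//; nra.
  rewrite (_ : _ + _ = (f s)^-1 * (1 + k * (1 - s * f1 s / f s))); last by ring.
  rewrite pmulr_rle0 ?invr_gt0//.
  have : k * (1 - s * f1 s / f s) <= k * (1 - th^-1) by rewrite ler_pM2l// lerD2l lerN2.
  have : k * (1 - th^-1) = -1 by rewrite /k; field; rewrite !gt_eqF// subr_gt0.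
  lra.
 have : 0 < k * (u / f u) by rewrite mulr_gt0// divr_gt0 ?f_gt0//; lra.
 by lra.
have Ginc u v : A + 1 <= u -> u < v -> G u < G v.
 move=> Au uv; apply: (@der_inc R G (fun u => (f u)^-1)) => // s us sv; first by apply: DG; lra.
 by rewrite invr_gt0 f_gt0//; lra.
pose B := [set G u | u in [set u | A + 1 <= u]].
have sB : has_sup B.
 split; first by exists (G (A + 1)); exists (A + 1) => //=.
 by exists (G (A + 1) + k * ((A + 1) / f (A + 1))) => _ [u /= Au <-]; exact: Gb.
have supB u : A + 1 <= u -> G u <= sup B by move=> Au; apply: ub_le_sup; [exact: sB.2|exists u].
exists (fun u => sup B - G u), (A + 1); split.
- lra.
- by move=> u Au; apply: der_val (der_sub (der_cst _ u) (DG u Au)) _; rewrite sub0r.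
- move=> u Au; rewrite subr_gt0; apply: lt_le_trans (supB (u + 1) _); last by lra.
 by apply: Ginc => //; lra.
- move=> e e0; have [_ [v /= Av <-] h] := sup_adherent e0 sB.
 exists v => // u vu; have : G v <= G u.
  by move: vu; rewrite le_eqVlt => /orP[/eqP -> //|vu]; apply/ltW/Ginc.
 lra.
Qed.

Section withF.
Variables (F : R -> R) (A : R).
Hypotheses (A_gt0 : 0 < A) (DF : forall u : R, A <= u -> is_derive u 1 F (- (f u)^-1))
 (F_gt0 : forall u : R, A <= u -> 0 < F u)
 (F_cv : forall e : R, 0 < e -> exists2 B : R, A <= B & forall u : R, B <= u -> F u <= e).

Lemma F_dec u v : A <= u -> u < v -> F v < F u.
Proof.
move=> Au uv; rewrite -ltrN2; apply: (@der_inc R (fun u => - F u) (fun u => (f u)^-1)) => // s us sv.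
 by apply: der_val (der_opp (DF (le_trans Au us))) _; rewrite opprK.
rewrite invr_gt0 f_gt0//; have := A_gt0; lra.
Qed.

Lemma F_le u v : A <= u -> u <= v -> F v <= F u.
Proof.
by move=> Au; rewrite le_eqVlt => /orP[/eqP -> //|uv]; apply/ltW/F_dec.
Qed.

Lemma f_nd u v : 0 < u -> u <= v -> f u <= f v.
Proof.
move=> u0 uv; apply: (@der_nd R f f1) => // s us sv; first by apply: Df; lra.
by apply/ltW/f1_gt0; lra.
Qed.

(** Integrating [1/f] over [[u/2, u]] gives [u/2 <= F (u/2) f u], and [f u <= th u f1 u]; hence
    [1/f1] is controlled by [F (u/2)], which tends to 0. *)
Lemma f1_cv (e : R) : 0 < e -> exists2 B : R, A <= B & forall u : R, B <= u -> (f1 u)^-1 <= e.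
Proof.
move=> e0; have [A' A'0 HA'] := ff1_th; have t0 := th0; have a0 := A_gt0.
have e1 : 0 < e / (2 * th) by rewrite divr_gt0// mulr_gt0.
have [B AB HB] := F_cv e1.
exists (2 * Num.max B A').
 have : B <= Num.max B A' by rewrite le_max lexx.
 lra.
move=> u Bu.
have m1 : B <= Num.max B A' by rewrite le_max lexx.
have m2 : A' <= Num.max B A' by rewrite le_max lexx orbT.
have u0 : 0 < u by lra.
have h2 : 0 < u / 2 by lra.
have fu := f_gt0 u0; have f1u := f1_gt0 u0.
have Au2 : A <= u / 2 by lra.
have [|c [c1 c2 c3]] := @MVT_itv R F (fun u => - (f u)^-1) (u / 2) u _ (fun s s1 s2 => DF (le_trans Au2 s1)); first by lra.
have h3 : u / 2 / f u <= F (u / 2).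
 have : F (u / 2) - F u = (f c)^-1 * (u / 2) by rewrite -[LHS]opprB c3; field; rewrite gt_eqF// f_gt0//; lra.
 have : (f u)^-1 <= (f c)^-1 by rewrite lef_pV2 ?posrE ?f_gt0 ?f_nd//; lra.
 have := F_gt0 (_ : A <= u); rewrite (_ : (A <= u) = true) => [/(_ isT) Fu|]; last by apply/idP; lra.
 by move=> h4 h5; rewrite mulrC; nra.
have h4 : F (u / 2) <= e / (2 * th) by apply: HB; lra.
have h5 : f u <= th * u * f1 u.
 by have := HA' u; rewrite ler_pdivrMr//; apply; lra.
have h6 : u / 2 <= e / (2 * th) * f u by rewrite -ler_pdivrMr//; lra.
have h7 : u <= e * u * f1 u.
 have : e / (2 * th) * f u <= e / (2 * th) * (th * u * f1 u) by rewrite ler_pM2l.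
 have -> : e / (2 * th) * (th * u * f1 u) = e * u * f1 u / 2 by field; rewrite gt_eqF.
 lra.
rewrite -[leLHS]mul1r ler_pdivrMr//.
by rewrite -(ler_pM2r u0) mul1r mulrAC.
Qed.

(** L'Hopital's rule by monotonicity: [F - c/f1] has derivative [(c/Rf - 1)/f], which has a constant
    sign at large arguments for [c = q + e] and for [c = q - e], and it tends to 0 at infinity. *)
Lemma Q_cv (e : R) : 0 < e -> exists2 B : R, A <= B & forall u : R, B <= u -> `|f1 u * F u - q| <= e.
Proof.
move=> e0; have [B B0 HB] := cvR e0; have a0 := A_gt0.
exists (Num.max A B); first by rewrite le_max lexx.
move=> u; rewrite ge_max => /andP[Au Bu].
have DQ c (s : R) : A <= s -> is_derive s 1 (fun u => F u - c * (f1 u)^-1)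
  ((f s)^-1 * (c / (f1 s ^+ 2 / (f s * f2 s)) - 1)).
 move=> As; have s0 : 0 < s by lra.
 have h1 := f_gt0 s0; have h2 := f1_gt0 s0; have h3 := f2_gt0 s0.
 apply: der_val (der_sub (DF As) (der_scale c (der_inv (lt0r_neq0 h2) (Df1 s0)))) _.
 by field; rewrite !gt_eqF.
have u0 : 0 < u by lra.
have f1u := f1_gt0 u0.
have HR s : u <= s -> q - e <= f1 s ^+ 2 / (f s * f2 s) <= q + e.
 move=> us; have := HB s (le_trans Bu us); rewrite ler_norml => /andP[h1 h2].
 by apply/andP; split; lra.
have q1 := q_ge1.
have up : F u <= (q + e) * (f1 u)^-1.
 rewrite leNgt; apply/negP => h.
 have d0 : 0 < F u - (q + e) * (f1 u)^-1 by lra.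
 have e2 : 0 < (F u - (q + e) * (f1 u)^-1) / 2 by lra.
 have [B2 AB2 HB2] := F_cv e2.
 pose v := Num.max u B2.
 have uv : u <= v by rewrite le_max lexx.
 have Bv : B2 <= v by rewrite le_max lexx orbT.
 have := HB2 v Bv.
 have : F u - (q + e) * (f1 u)^-1 <= F v - (q + e) * (f1 v)^-1.
  apply: (der_nd uv (fun s us _ => DQ (q + e) s (le_trans Au us))) => s us _.
  have s0 : 0 < s by lra.
  rewrite mulr_ge0 ?invr_ge0 ?(ltW (f_gt0 s0))// subr_ge0 ler_pdivlMr ?mul1r; last exact: Rf_gt0.
  by have /andP[] := HR s us.
 have : 0 < (q + e) * (f1 v)^-1 by rewrite mulr_gt0 ?invr_gt0 ?f1_gt0//; lra.
 lra.
have lo : (q - e) * (f1 u)^-1 <= F u.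
 have [qe|qe] := leP (q - e) 0.
  apply: le_trans (ltW (F_gt0 Au)); rewrite mulr_le0_ge0// invr_ge0; exact: ltW.
 rewrite leNgt; apply/negP => h.
 have e2 : 0 < ((q - e) * (f1 u)^-1 - F u) / 2 / (q - e) by rewrite divr_gt0//; lra.
 have [B2 AB2 HB2] := f1_cv e2.
 pose v := Num.max u B2.
 have uv : u <= v by rewrite le_max lexx.
 have Bv : B2 <= v by rewrite le_max lexx orbT.
 have := HB2 v Bv; rewrite ler_pdivlMr// => h1.
 have : F v - (q - e) * (f1 v)^-1 <= F u - (q - e) * (f1 u)^-1.
  apply: (der_ni uv (fun s us _ => DQ (q - e) s (le_trans Au us))) => s us _.
  have s0 : 0 < s by lra.
  rewrite mulr_ge0_le0 ?invr_ge0 ?(ltW (f_gt0 s0))// subr_le0 ler_pdivrMr ?mul1r; last exact: Rf_gt0.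
  by have /andP[] := HR s us.
 have := F_gt0 (le_trans Au uv).
 lra.
rewrite ler_norml mulrC.
by move: up lo; rewrite ler_pdivlMr// ler_pdivrMr// => h1 h2; apply/andP; split; lra.
Qed.

(** With [Q = f1 F] one has [Q' = Q (Q/Rf - 1)/(f F)], while [(ln F)' = - 1/(f F)]. As [Q] and [Rf]
    have the same limit, [Q] varies slowly compared with [ln F]. In the barrier this bounds the
    change of [Q] by a small multiple of the relative perturbation of [V]. *)
Lemma Q_slow (eta : R) : 0 < eta -> exists2 B : R, A <= B & forall u v : R, B <= u -> u <= v ->
 `|f1 u * F u - f1 v * F v| <= eta * (ln (F u) - ln (F v)).
Proof.
move=> e0; have q1 := q_ge1; have a0 := A_gt0.
(* [d <= 1/4] keeps [Rf >= 1/2]; then [4 (q + 1) d <= eta] gives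
   [|Q (Q - Rf)| <= 2 d (q + 1) <= eta Rf]. *)
pose d := Num.min (eta / (4 * (q + 1))) (1 / 4).
have d0 : 0 < d by rewrite lt_min; apply/andP; split; [rewrite divr_gt0//; lra|lra].
have d1 : d <= 1 / 4 by rewrite ge_min lexx orbT.
have d2 : 4 * (q + 1) * d <= eta.
 by rewrite mulrC -ler_pdivlMr; [rewrite ge_min lexx|lra].
have [B1 AB1 HB1] := Q_cv d0.
have [B2 B20 HB2] := cvR d0.
exists (Num.max B1 B2); first by rewrite le_max AB1.
move=> u v; rewrite ge_max => /andP[Bu1 Bu2] uv.
have DQ (s : R) : A <= s -> is_derive s 1 (fun u => f1 u * F u) (f2 s * F s - f1 s / f s).
 move=> As; have s0 : 0 < s by lra.
 by apply: der_val (der_mul (Df1 s0) (DF As)) _; ring.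
have DL (s : R) : A <= s -> is_derive s 1 (fun u => ln (F u)) (- (f s)^-1 / F s).
 by move=> As; exact: der_ln (F_gt0 As) (DF As).
have key s : u <= s -> `|f2 s * F s - f1 s / f s| <= eta * ((f s)^-1 / F s).
 move=> us; have As : A <= s by lra.
 have s0 : 0 < s by lra.
 have h1 := f_gt0 s0; have h2 := f1_gt0 s0; have h3 := f2_gt0 s0; have h4 := F_gt0 As.
 have := HB1 s (le_trans Bu1 us); set Q := f1 s * F s => HQ.
 have := HB2 s (le_trans Bu2 us); set Rs := f1 s ^+ 2 / (f s * f2 s) => HR.
 have R0 : 0 < Rs by exact: Rf_gt0.
 have -> : f2 s * F s - f1 s / f s = ((f s)^-1 / F s) * (Q * (Q / Rs - 1)).
  by rewrite /Q /Rs; field; rewrite !gt_eqF.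
 have g0 : 0 < (f s)^-1 / F s by rewrite divr_gt0// invr_gt0.
 rewrite normrM gtr0_norm// mulrC ler_pM2r//.
 have -> : Q * (Q / Rs - 1) = (Q * (Q - Rs)) / Rs by field; rewrite gt_eqF.
 rewrite normrM normfV (gtr0_norm R0) ler_pdivrMr//.
 move: HQ HR; rewrite !ler_norml => /andP[a1 a2] /andP[b1 b2].
 clear DQ DL HB1 HB2 h1 h2 h3 h4 g0 Bu1 Bu2 AB1 B20 a0 As s0.
 have QR : `|Q - Rs| <= 2 * d by rewrite ler_norml; apply/andP; split; lra.
 have Qq : `|Q| <= q + 1 by rewrite ler_norml; apply/andP; split; lra.
 rewrite -ler_norml normrM; apply: le_trans (ler_pM _ _ Qq QR) _ => //.
 have r2 : 1 / 2 <= Rs by lra.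
 have : eta * (1 / 2) <= eta * Rs by rewrite ler_pM2l.
 by move: d2; lra.
have M c : `|c| <= 1 -> eta * ln (F v) + c * (f1 v * F v) <= eta * ln (F u) + c * (f1 u * F u).
 move=> c1; apply: (@der_ni R (fun u => eta * ln (F u) + c * (f1 u * F u))
  (fun s => eta * (- (f s)^-1 / F s) + c * (f2 s * F s - f1 s / f s))) => // s us _.
  have As : A <= s by lra.
  by apply: der_add; apply: der_scale; [exact: DL|exact: DQ].
 have h1 := key s us; have : c * (f2 s * F s - f1 s / f s) <= `|f2 s * F s - f1 s / f s|.
  apply: le_trans (ler_norm _) _; rewrite normrM -[leRHS]mul1r; exact: ler_wpM2r.
 by rewrite mulNr mulrN; lra.
rewrite ler_norml; apply/andP; split.
- by have := M 1 (eq_ind_r (fun x => x <= 1) (lexx _) (normr1 _)); lra.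
- by have := M (-1) (eq_ind_r (fun x => x <= 1) (lexx _) (normrN1 _)); lra.
Qed.

End withF.

End nonlinearity.

(** * The perturbed autonomous system in the time t = - log r *)

Section core.
Variables (R : realType) (nn q t0 : R) (p z Qf lV : R -> R).
Hypotheses (nn3 : 3 <= nn) (q1 : 1 <= q) (qS : q < (nn + 2) / 4)
 (Dp : forall t : R, t0 <= t -> is_derive t 1 p ((nn - 2) * p t - z t - (Qf t - 1) * p t ^+ 2))
 (Dz : forall t : R, t0 <= t -> is_derive t 1 z ((p t - 2) * z t))
 (DV : forall t : R, t0 <= t -> is_derive t 1 lV (- p t))
 (z_gt0 : forall t : R, t0 <= t -> 0 < z t) (z_le : forall t : R, t0 <= t -> z t <= 2 * nn)
 (p_ge0 : forall t : R, t0 <= t -> 0 <= p t)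
 (Qcv : forall e : R, 0 < e -> exists2 T : R, t0 <= T & forall t : R, T <= t -> `|Qf t - q| <= e)
 (Vcv : forall K : R, exists2 T : R, t0 <= T & forall t : R, T <= t -> lV t <= K).

Lemma Dy (t : R) : t0 <= t -> is_derive t 1 (fun t => ln (z t)) (p t - 2).
Proof.
move=> ht; have z0 := z_gt0 ht.
by apply: der_val (der_ln z0 (Dz ht)) _; rewrite mulfK// gt_eqF.
Qed.

Lemma y_le t : t0 <= t -> ln (z t) <= ln (2 * nn).
Proof.
by move=> ht; have n3 := nn3; rewrite ler_ln ?posrE ?z_gt0 ?z_le//; lra.
Qed.

(** [ln z] would grow at the rate [c], against the upper bound of [z]. *)
Lemma no_growth (s c : R) : t0 <= s -> 0 < c -> ~ (forall t, s <= t -> c <= p t - 2).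
Proof.
move=> hs c0 H.
pose t := s + (ln (2 * nn) - ln (z s)) / c + 1.
have dd : 0 <= (ln (2 * nn) - ln (z s)) / c by rewrite divr_ge0 ?(ltW c0)// subr_ge0 y_le.
have st : s <= t by rewrite /t; lra.
have : ln (z s) - c * s <= ln (z t) - c * t.
 apply: (@der_nd R (fun t => ln (z t) - c * t) (fun t => p t - 2 - c)) => // u us _.
  by apply: der_sub (Dy (le_trans hs us)) (der_line c u).
 by rewrite subr_ge0 H.
have := y_le (le_trans hs st).
have -> : c * t = c * s + (ln (2 * nn) - ln (z s)) + c by rewrite /t; field; rewrite gt_eqF.
lra.
Qed.

(** For [q > 1] the damping [- (Q - 1) p^2] makes a high level impassable upwards. For [q = 1] that
    term has no definite sign; instead, a value above [7 nn] would trap [p] above that level, which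
    [no_growth] forbids. *)
Lemma p_bdd : exists B T : R, [/\ 2 <= B, t0 <= T & forall t, T <= t -> p t <= B].
Proof.
have n3 := nn3; have qq := q1.
have [q1'|q1'] := ltP 1 q.
 have e0 : 0 < (q - 1) / 2 by lra.
 have [T hT HT] := Qcv e0.
 pose B := Num.max (p T) (2 * (nn - 2) / (q - 1)) + 2.
 have B1 : p T <= Num.max (p T) (2 * (nn - 2) / (q - 1)) by rewrite le_max lexx.
 have B2 : 2 * (nn - 2) / (q - 1) <= Num.max (p T) (2 * (nn - 2) / (q - 1)) by rewrite le_max lexx orbT.
 have B0 : 2 <= B by have := p_ge0 hT; rewrite /B; lra.
 exists B, T; split => // t Tt; rewrite -lerN2.
 apply: (@crossing R (fun t => - p t) (fun t => - ((nn - 2) * p t - z t - (Qf t - 1) * p t ^+ 2)) T) => //.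
 - by move=> s Ts; apply: der_opp; apply: Dp; exact: le_trans Ts.
 - by rewrite lerN2 /B; lra.
 - move=> s Ts /oppr_inj ->; have z0 := z_gt0 (le_trans hT Ts).
  have := HT s Ts; rewrite ler_norml => /andP[h1 _].
  have : (nn - 2) <= (q - 1) / 2 * B.
   rewrite (_ : nn - 2 = (q - 1) / 2 * (2 * (nn - 2) / (q - 1))); last by field; rewrite gt_eqF//; lra.
   by rewrite ler_pM2l// /B; lra.
  have h2 : (q - 1) / 2 <= Qf s - 1 by lra.
  by nra.
have {q1'}qe : q = 1 by apply/eqP; rewrite eq_le q1' qq.
(* At [p = 7 nn] the quadratic term is then at most [nn], and [7 nn (nn - 2) > 2 nn + nn] since
   [nn >= 3]. *)
have e0 : 0 < (49 * nn)^-1 by rewrite invr_gt0; lra.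
have [T hT HT] := Qcv e0.
exists (7 * nn), T; split => //; first by lra.
move=> t Tt; rewrite leNgt; apply/negP => Bt.
apply: (@no_growth t 1) => //; first exact: le_trans Tt.
move=> u tu.
suff : 7 * nn <= p u by lra.
apply: (@crossing R p (fun t => (nn - 2) * p t - z t - (Qf t - 1) * p t ^+ 2) t) => //.
- by move=> s ts; apply: Dp; lra.
- exact: ltW.
- move=> s ts ->; have z1 : z s <= 2 * nn by apply: z_le; lra.
 have := HT s (le_trans Tt ts); rewrite ler_norml qe => /andP[_ h1].
 have : (Qf s - 1) * (7 * nn) ^+ 2 <= (49 * nn)^-1 * (7 * nn) ^+ 2 by rewrite ler_wpM2r ?sqr_ge0.
 have -> : (49 * nn)^-1 * (7 * nn) ^+ 2 = nn by field; rewrite gt_eqF//; lra.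
 nra.
Qed.

(** The coefficient of [p - 2] in the linearisation of the equation of [p] at the equilibrium. It is
    positive exactly when [q < q_S], and the equilibrium then repels. *)
Definition aa : R := nn + 2 - 4 * q.
(** The value of [z] that makes [p' = 0] at [p = 2] and [Q = q]. *)
Definition zs : R := 2 * nn - 4 * q.

Lemma aa_gt0 : 0 < aa. Proof. by rewrite /aa; have := qS; lra. Qed.
Lemma zs_gt0 : 0 < zs. Proof. by rewrite /zs; have := qS; have := nn3; lra. Qed.
Lemma zs_le : zs <= 2 * nn. Proof. by rewrite /zs; have := q1; lra. Qed.

(* If zeta tends to 0 then p is eventually at most zeta, so ln V stays bounded below. *)
Lemma z_not0 : ~ (forall Y : R, exists2 T : R, t0 <= T & forall t, T <= t -> ln (z t) <= - Y).
Proof.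
move=> H; have n3 := nn3; have qq := q1; have qs := qS.
have zsmall d : 0 < d -> exists2 T : R, t0 <= T & forall t, T <= t -> z t <= d.
 move=> d0; have [T hT HT] := H (- ln d); exists T => // t Tt.
 have := HT t Tt; rewrite opprK ler_ln ?posrE// z_gt0//; exact: le_trans Tt.
(* With this choice [(nn - 2) - (q - 1) (2 + k) = (1 + q) k > 0]: up to the level [2 + k] the linear
   growth of [p] beats the quadratic term, and a level above 2 is what [no_growth] can exclude. *)
pose k := (nn - 2 * q) / (2 * q).
have q0 : 0 < q by lra.
have k0 : 0 < k by rewrite /k divr_gt0//; lra.
pose ps := 2 + k.
have kq : k * (2 * q) = nn - 2 * q by rewrite /k mulfVK// gt_eqF//; lra.
have key : 0 < (nn - 2) - (q - 1) * ps by rewrite /ps; nra.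
pose c := ((nn - 2) - (q - 1) * ps) / 2.
have c0 : 0 < c by rewrite /c; lra.
have e0 : 0 < c / ps by rewrite divr_gt0// /ps; lra.
have [T1 hT1 HT1] := Qcv e0.
have d0 : 0 < Num.min c (c / 2) by rewrite lt_min c0/=; lra.
have [T2 hT2 HT2] := zsmall _ d0.
pose T := Num.max T1 T2.
have TT1 : T1 <= T by rewrite le_max lexx.
have TT2 : T2 <= T by rewrite le_max lexx orbT.
have ps0 : 0 < ps by rewrite addr_gt0.
have tT s : T <= s -> t0 <= s := le_trans (le_trans hT1 TT1).
have est t : T <= t -> p t <= ps -> c * p t - z t <= (nn - 2) * p t - z t - (Qf t - 1) * p t ^+ 2.
 move=> Tt pt; have p0 := p_ge0 (tT _ Tt).
 have := HT1 t (le_trans TT1 Tt); rewrite ler_norml => /andP[_ h1].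
 have h2 : (Qf t - 1) * p t <= (q - 1 + c / ps) * ps.
  have [neg|pos] := leP (Qf t - 1) 0.
   apply: (@le_trans _ _ 0); first by rewrite mulr_le0_ge0.
   by rewrite mulr_ge0 ?(ltW ps0)//; lra.
  by apply: ler_pM => //; lra.
 have h3 : (q - 1 + c / ps) * ps = (q - 1) * ps + c by field; rewrite gt_eqF.
 have h4 : c + (Qf t - 1) * p t <= nn - 2 by rewrite /c in h3 h2 *; lra.
 by rewrite expr2 mulrA; nra.
have pl t : T <= t -> p t <= ps.
 move=> Tt; rewrite leNgt; apply/negP => pt.
 apply: (@no_growth t k) => //; first exact: tT.
 move=> u tu; suff : ps <= p u by rewrite /ps; lra.
 apply: (@crossing R p (fun t => (nn - 2) * p t - z t - (Qf t - 1) * p t ^+ 2) t) => //.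
 - by move=> s ts; exact: Dp (tT _ (le_trans Tt ts)).
 - exact: ltW.
 - move=> s ts e; apply: lt_le_trans (est s _ _); [|exact: le_trans ts|by rewrite e].
  rewrite e; have := HT2 s (le_trans TT2 (le_trans Tt ts)); rewrite le_min => /andP[h1 h2].
  by rewrite /ps; nra.
(* Otherwise the difference [p - z] would grow exponentially, at rate [c / 2], against [p <= ps]. *)
have pz t : T <= t -> p t <= z t.
 move=> Tt; rewrite leNgt; apply/negP => pt.
 pose c2 := c / 2.
 have c20 : 0 < c2 by rewrite /c2; lra.
 have Dm (s : R) : t <= s -> is_derive s 1 (fun s => expR (- c2 * s) * (p s - z s))
   (expR (- c2 * s) * ((nn - 2) * p s - z s - (Qf s - 1) * p s ^+ 2 - (p s - 2) * z s - c2 * (p s - z s))).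
  move=> ts; have hs := tT _ (le_trans Tt ts).
  apply: der_val (der_mul (der_exp (der_line (- c2) s)) (der_sub (Dp hs) (Dz hs))) _.
  ring.
 have grow u : t <= u -> expR (- c2 * t) * (p t - z t) <= expR (- c2 * u) * (p u - z u).
  move=> tu; apply: (der_nd tu (fun s ts _ => Dm s ts)) => s ts su.
  rewrite mulr_ge0 ?expR_ge0//.
  have := est s (le_trans Tt ts) (pl s (le_trans Tt ts)).
  have := HT2 s (le_trans TT2 (le_trans Tt ts)); rewrite le_min => /andP[h1 h2].
  have z0 := z_gt0 (tT _ (le_trans Tt ts)).
  have p0 := p_ge0 (tT _ (le_trans Tt ts)).
  by rewrite /c2; nra.
 pose m := p t - z t.
 have m0 : 0 < m by rewrite /m subr_gt0.
 pose u := t + ps / (c2 * m).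
 have tu : t <= u by rewrite lerDl divr_ge0 ?mulr_ge0// ?ltW.
 have := grow u tu.
 have -> : expR (- c2 * t) * (p t - z t) = expR (- c2 * u) * (expR (ps / m) * m).
  rewrite mulrA -expRD; congr (expR _ * _); rewrite /u; field.
  by rewrite !gt_eqF.
 rewrite ler_pM2l ?expR_gt0//.
 have := pl u (le_trans Tt tu); have := z_gt0 (tT _ (le_trans Tt tu)).
 have : (1 + ps / m) * m <= expR (ps / m) * m by rewrite ler_pM2r// expR_ge1Dx.
 have -> : (1 + ps / m) * m = m + ps by field; rewrite gt_eqF.
 lra.
have [T3 hT3 HT3] := zsmall 1 ltr01.
clear est pl zsmall H HT1 HT2 e0 d0 key kq c0 ps0 k0 q0 qs qq n3.
pose T' := Num.max T T3.
have TT : T <= T' by rewrite le_max lexx.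
have TT3 : T3 <= T' by rewrite le_max lexx orbT.
(* Now [p <= z <= 1], so [ln z] falls at rate at least 1; [z], and with it [p], becomes
   integrable. *)
have zdec t : T' <= t -> z t <= expR (T' - t).
 move=> Tt; have zt := z_gt0 (tT _ (le_trans TT Tt)).
 rewrite -(lnK (_ : z t \is Num.pos)) ?posrE// ler_expR.
 have : ln (z t) + 1 * t <= ln (z T') + 1 * T'.
  apply: (@der_ni R (fun t => ln (z t) + 1 * t) (fun t => p t - 2 + 1)) => // s s1 s2.
   exact: der_add (Dy (tT _ (le_trans TT s1))) (der_line 1 s).
  have := pz s (le_trans TT s1); have := HT3 s (le_trans TT3 s1); lra.
 have : ln (z T') <= 0 by apply: ln_le0; apply: HT3.
 lra.
have [T4 hT4 HT4] := Vcv (lV T' - 2).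
pose t := Num.max T' T4.
have t1 : T' <= t by rewrite le_max lexx.
have t2 : T4 <= t by rewrite le_max lexx orbT.
have := HT4 t t2.
have : lV T' - expR (T' - T') <= lV t - expR (T' - t).
 apply: (@der_nd R (fun t => lV t - expR (T' - t)) (fun t => - p t + expR (T' - t))) => // s s1 s2.
  apply: der_val (der_sub (DV (tT _ (le_trans TT s1))) (der_exp (der_sub (der_cst T' s) (der_id s)))) _.
  by rewrite sub0r mulrN1 opprK.
 have := pz s (le_trans TT s1); have := zdec s s1; lra.
rewrite subrr expR0; have := expR_gt0 (T' - t); lra.
Qed.

(** * The Lyapunov function with a cross term *)

Section lyapunov.
Variables (b eps B T : R).
Hypotheses (b0 : 0 < b) (eps0 : 0 < eps) (hT : t0 <= T) (B2 : 2 <= B)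
 (bP : `|b / 2 - (q - 1)| * (B + 2) <= aa / 4) (pB : forall t, T <= t -> p t <= B)
 (epsC : eps * (`|b - (q - 1)| * (2 * nn) + aa ^+ 2 + 2 * nn) <= aa / 4)
 (epsD : 2 * eps ^+ 2 * (2 * nn * (b + 2)) <= 1 / 2).

(** The power [x^b]. In the derivative of the energy the exponent [b = 2 (q - 1)] removes the cubic
    term in [P]. *)
Definition wz (x : R) : R := expR (b * ln x).
(** The primitive of [x^b (x - zs) / x], minimal at [zs]: the potential matching the weight
    [x^b]. *)
Definition Psi (x : R) : R := wz x * x / (b + 1) - zs * wz x / b.
(** The derivative of the weighted energy alone controls [P^2] only; the cross term contributes the
    missing [(zs - x)^2]. *)
Definition Lf (P x : R) : R := wz x * (P ^+ 2 / 2) + Psi x + eps * wz x * P * (zs - x).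
Definition DD (P x : R) : R := P ^+ 2 + (zs - x) ^+ 2.

Lemma wz_gt0 x : 0 < wz x. Proof. exact: expR_gt0. Qed.

Lemma wz_derive (x : R) : 0 < x -> is_derive x 1 wz (b * wz x / x).
Proof.
move=> x0; apply: der_val (der_exp (der_scale b (der_ln x0 (der_id x)))) _.
by rewrite /wz; field; rewrite gt_eqF.
Qed.

Lemma wz_le x x' : 0 < x -> x <= x' -> wz x <= wz x'.
Proof.
move=> x0 xx; rewrite /wz ler_expR ler_pM2l ?b0// ler_ln// posrE//; exact: lt_le_trans xx.
Qed.

Lemma Psi_derive (x : R) : 0 < x -> is_derive x 1 Psi (wz x * (x - zs) / x).
Proof.
move=> x0; have b1 := b0.
apply: der_val (der_sub (der_mul (der_mul (wz_derive x0) (der_id x)) (der_cst (b + 1)^-1 x))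
  (der_mul (der_scale zs (wz_derive x0)) (der_cst b^-1 x))) _.
by field; rewrite !gt_eqF//; lra.
Qed.

Lemma kf_derive (x : R) : 0 < x -> is_derive x 1 (fun x => Psi x - 2 * eps ^+ 2 * (wz x * (x - zs) ^+ 2))
 (wz x / x * ((x - zs) * (1 - 2 * eps ^+ 2 * (b * (x - zs) + 2 * x)))).
Proof.
move=> x0.
apply: der_val (der_sub (Psi_derive x0) (der_scale (2 * eps ^+ 2) (der_mul (wz_derive x0)
 (der_pow 2 (der_sub (der_id x) (der_cst zs x)))))) _.
by field; rewrite gt_eqF.
Qed.

(** For small [eps] the function [Psi - 2 eps^2 x^b (x - zs)^2] still decreases before [zs] and
    increases after it. This leaves room in the potential for absorbing the cross term. *)
Lemma Psi_low x : 0 < x -> x <= 2 * nn -> 2 * eps ^+ 2 * (wz x * (x - zs) ^+ 2) <= Psi x - Psi zs.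
Proof.
move=> x0 xn; have z0 := zs_gt0; have zn := zs_le; have b1 := b0; have e1 := eps0; have ed := epsD; have n3 := nn3.
have fac s : 0 < s -> s <= 2 * nn -> 0 <= 1 - 2 * eps ^+ 2 * (b * (s - zs) + 2 * s).
 move=> s0 sn; rewrite subr_ge0; apply: (@le_trans _ _ (2 * eps ^+ 2 * (2 * nn * (b + 2)))); last by lra.
 apply: ler_wpM2l; first by rewrite mulr_ge0// sqr_ge0.
 by nra.
have [xz|zx] := leP x zs.
 have := @der_ni R _ _ x zs xz (fun s s1 s2 => kf_derive (lt_le_trans x0 s1)).
 rewrite subrr expr0n/= mulr0 mulr0 subr0 => /(_ _) H.
 suff : Psi zs <= Psi x - 2 * eps ^+ 2 * (wz x * (x - zs) ^+ 2) by lra.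
 apply: H => s s1 s2; have s0 : 0 < s by lra.
 rewrite mulr_ge0_le0 ?divr_ge0 ?(ltW (wz_gt0 _)) ?(ltW s0)//.
 by rewrite mulr_le0_ge0 ?subr_le0// fac//; lra.
have := @der_nd R _ _ zs x (ltW zx) (fun s s1 s2 => kf_derive (lt_le_trans z0 s1)).
rewrite subrr expr0n/= mulr0 mulr0 subr0 => /(_ _) H.
suff : Psi zs <= Psi x - 2 * eps ^+ 2 * (wz x * (x - zs) ^+ 2) by lra.
apply: H => s s1 s2; have s0 : 0 < s by lra.
rewrite mulr_ge0 ?divr_ge0 ?(ltW (wz_gt0 _)) ?(ltW s0)//.
by rewrite mulr_ge0 ?subr_ge0// -subr_ge0 fac//; lra.
Qed.

Lemma Lf_low P x : 0 < x -> x <= 2 * nn ->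
 wz x * P ^+ 2 / 4 + (Psi x - Psi zs) / 2 <= Lf P x - Psi zs.
Proof.
move=> x0 xn; have := Psi_low x0 xn; have w0 := wz_gt0 x; rewrite /Lf.
move: (Psi x) (Psi zs) (wz x) w0 => a c w w0 h.
have : 0 <= w * (P / 2 + eps * (zs - x)) ^+ 2 by rewrite mulr_ge0 ?(ltW w0)// sqr_ge0.
have -> : w * (P / 2 + eps * (zs - x)) ^+ 2 = w * P ^+ 2 / 4 + eps * w * P * (zs - x) + eps ^+ 2 * (w * (x - zs) ^+ 2) by field.
lra.
Qed.

(** For [x >= zs/2] the weight is bounded below. Towards [x = 0] it degenerates, but there
    [Psi - Psi zs] stays above a positive constant while [DD] is bounded. *)
Lemma Lf_lowD : exists2 c : R, 0 < c & forall P x : R, 0 < x -> x <= 2 * nn -> `|P| <= B ->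
 c * DD P x <= Lf P x - Psi zs.
Proof.
have z0 := zs_gt0; have zn := zs_le; have b1 := b0; have e1 := eps0; have n3 := nn3; have b2 := B2.
pose w0 := wz (zs / 2); have w00 : 0 < w0 by exact: wz_gt0.
pose c1 := Num.min (w0 / 4) (w0 * eps ^+ 2).
have c10 : 0 < c1 by rewrite lt_min !divr_gt0// mulr_gt0// exprn_gt0.
pose Dm := B ^+ 2 + (2 * nn) ^+ 2.
have Dm0 : 0 < Dm by rewrite /Dm; nra.
pose l0 := w0 * eps ^+ 2 * (zs / 2) ^+ 2.
have l00 : 0 < l0 by rewrite !mulr_gt0// exprn_gt0//; lra.
exists (Num.min c1 (l0 / Dm)); first by rewrite lt_min c10 divr_gt0.
move=> P x x0 xn PB; apply: le_trans (Lf_low P x0 xn).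
have m1 : Num.min c1 (l0 / Dm) <= c1 by rewrite ge_min lexx.
have m2 : Num.min c1 (l0 / Dm) <= l0 / Dm by rewrite ge_min lexx orbT.
have D0 : 0 <= DD P x by rewrite addr_ge0 ?sqr_ge0.
have P2 : 0 <= P ^+ 2 by exact: sqr_ge0.
have Y2 : 0 <= (zs - x) ^+ 2 by exact: sqr_ge0.
have [zx|xz] := leP (zs / 2) x.
 apply: (@le_trans _ _ (c1 * DD P x)); first exact: ler_wpM2r.
 have ww : w0 <= wz x by apply: wz_le => //; lra.
 have := Psi_low x0 xn; rewrite -[(x - zs) ^+ 2]sqrrN opprB => h.
 have h1 : c1 <= w0 / 4 by rewrite ge_min lexx.
 have h2 : c1 <= w0 * eps ^+ 2 by rewrite ge_min lexx orbT.
 have h3 : w0 * eps ^+ 2 * (zs - x) ^+ 2 <= (Psi x - Psi zs) / 2.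
  have : eps ^+ 2 * (w0 * (zs - x) ^+ 2) <= eps ^+ 2 * (wz x * (zs - x) ^+ 2).
   by apply: ler_wpM2l; [exact: sqr_ge0|exact: ler_wpM2r].
  lra.
 have h4 : c1 * P ^+ 2 <= wz x * P ^+ 2 / 4.
  have : c1 * P ^+ 2 <= w0 / 4 * P ^+ 2 by exact: ler_wpM2r.
  have : w0 * P ^+ 2 <= wz x * P ^+ 2 by exact: ler_wpM2r.
  lra.
 have h5 : c1 * (zs - x) ^+ 2 <= w0 * eps ^+ 2 * (zs - x) ^+ 2 by exact: ler_wpM2r.
 by rewrite /DD mulrDr; lra.
apply: (@le_trans _ _ (l0 / Dm * DD P x)); first exact: ler_wpM2r.
have h1 : l0 / Dm * DD P x <= l0.
 rewrite -{2}(divfK (lt0r_neq0 Dm0) l0) ler_pM2l ?divr_gt0// /DD /Dm; apply: lerD.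
  by rewrite -[P ^+ 2](real_normK (num_real P)) ler_pXn2r// nnegrE; lra.
 have g1 : 0 <= zs - x by lra.
 have g2 : zs - x <= 2 * nn by lra.
 by rewrite !expr2; apply: ler_pM.
have h2 : Psi (zs / 2) <= Psi x.
 apply: (@der_ni R Psi (fun x => wz x * (x - zs) / x)); first exact: ltW.
  by move=> s s1 s2; apply: Psi_derive; lra.
 move=> s s1 s2; rewrite mulr_le0_ge0 ?invr_ge0//; last by lra.
 by rewrite mulr_ge0_le0 ?(ltW (wz_gt0 _))//; lra.
have z2 : 0 < zs / 2 by lra.
have z3 : zs / 2 <= 2 * nn by lra.
have := Psi_low z2 z3; rewrite -/w0 (_ : zs / 2 - zs = - (zs / 2)); last by field.
rewrite sqrrN => h3.
have : 0 <= wz x * P ^+ 2 / 4 by rewrite divr_ge0// mulr_ge0// ltW// wz_gt0.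
by rewrite /l0 in h1 *; lra.
Qed.

Lemma Lf_near (lam : R) : 0 < lam -> exists2 d : R, 0 < d & forall P x : R, DD P x < d -> Lf P x - Psi zs < lam.
Proof.
move=> l0; have z0 := zs_gt0.
have c1 : {for ((0, zs) : R * R), continuous (fun y : R * R => y.1)} by exact: cvg_fst.
have c2 : {for ((0, zs) : R * R), continuous (fun y : R * R => y.2)} by exact: cvg_snd.
have cw := cfcomp (g := fun y : R * R => y.2) (x := (0, zs)) (der_cont (wz_derive z0)) c2.
have cP := cfcomp (g := fun y : R * R => y.2) (x := (0, zs)) (der_cont (Psi_derive z0)) c2.
have c := cfD (cfD (cfM cw (cfM (cfM c1 c1) (cfC 2^-1 _))) cP) (cfM (cfM (cfM (cfC eps _) cw) c1) (cfB (cfC zs _) c2)).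
have : \forall y \near ((0, zs) : R * R), Lf y.1 y.2 < Psi zs + lam.
 by apply: (@cvgr_lt _ _ (nbhs (0, zs)) (nbhs_filter _) _ _ c); rewrite /= !mul0r !mulr0 !mul0r add0r addr0 ltrDl.
move=> /nbhs_ballP[r /= r0 H]; exists (r ^+ 2) => [|P x]; first exact: exprn_gt0.
have sq (y : R) : y ^+ 2 < r ^+ 2 -> `|y| < r.
 by move=> h; rewrite -(@ltr_pXn2r _ 2)// ?nnegrE ?(ltW r0)// real_normK ?num_real.
rewrite /DD => h; rewrite ltrBlDl; apply: (H (P, x)); have := sqr_ge0 P; have := sqr_ge0 (zs - x).
by split; rewrite /= -ball_normE /=; apply: sq; rewrite ?sub0r ?sqrrN; lra.
Qed.

Lemma Lf_max : exists C : R, forall P x : R, 0 < x -> x <= 2 * nn -> `|P| <= B -> Lf P x <= C.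
Proof.
have z0 := zs_gt0; have zn := zs_le; have b1 := b0; have e1 := eps0; have n3 := nn3; have b2 := B2.
pose w1 := wz (2 * nn); have w10 : 0 < w1 by exact: wz_gt0.
exists (w1 * (B ^+ 2 / 2) + w1 * (2 * nn) / (b + 1) + eps * w1 * (B * (2 * nn))) => P x x0 xn PB.
have wx : wz x <= w1 by exact: wz_le.
have wx0 := wz_gt0 x.
have P2 : P ^+ 2 <= B ^+ 2 by rewrite -[P ^+ 2](real_normK (num_real P)) ler_pXn2r// nnegrE; lra.
rewrite /Lf /Psi; apply: lerD; first apply: lerD.
- by apply: ler_pM => //; [exact: ltW|rewrite divr_ge0 ?sqr_ge0|lra].
- have : 0 <= zs * wz x / b by rewrite divr_ge0 ?mulr_ge0// ltW.
 have : wz x * x / (b + 1) <= w1 * (2 * nn) / (b + 1).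
  by apply: ler_wpM2r; [rewrite invr_ge0; lra|apply: ler_pM => //; exact: ltW].
 lra.
- have PY : `|P * (zs - x)| <= B * (2 * nn).
  by rewrite normrM ler_pM// ler_norml; apply/andP; split; lra.
 rewrite -mulrA; apply: le_trans (ler_wpM2l _ (ler_norm _)) _; first by rewrite mulr_ge0// ltW.
 by apply: ler_pM => //; [rewrite mulr_ge0// ltW|rewrite ler_pM2l].
Qed.

(** The derivative of [Lf] along the system divided by the weight; [e] stands for the error
    [(Q - q) p^2]. *)
Definition JJ (P x e : R) : R := aa * P ^+ 2 + (b / 2 - (q - 1)) * P ^+ 3 - e * P +
 eps * ((zs - x) ^+ 2 + (b * P ^+ 2 + aa * P - (q - 1) * P ^+ 2 - e) * (zs - x) - P ^+ 2 * x).

Lemma L_derive (t : R) : t0 <= t -> is_derive t 1 (fun t => Lf (p t - 2) (z t))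
 (wz (z t) * JJ (p t - 2) (z t) ((Qf t - q) * p t ^+ 2)).
Proof.
move=> ht; have x0 := z_gt0 ht; have b1 := b0.
have DP := der_sub (Dp ht) (der_cst 2 t).
have Dw := @der_comp R wz z t _ _ (wz_derive x0) (Dz ht).
have DPs := @der_comp R Psi z t _ _ (Psi_derive x0) (Dz ht).
apply: der_val (der_add (der_add (der_mul Dw (der_mul (der_pow 2 DP) (der_cst 2^-1 t))) DPs)
 (der_mul (der_mul (der_scale eps Dw) DP) (der_sub (der_cst zs t) (Dz ht)))) _.
rewrite /JJ /zs /aa /=; move: (wz (z t)) (Qf t) (p t) (z t) x0 => w Q p' x x0.
by field; rewrite gt_eqF.
Qed.

(** Young's inequality term by term: [bP] bounds the cubic term, and [epsC] bounds what the cross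
    term costs in [P^2], each by a quarter of [aa P^2]. *)
Lemma JJ_low : exists c C : R, [/\ 0 < c, 0 < C & forall P x e : R, 0 < x -> x <= 2 * nn -> `|P| <= B ->
 c * DD P x - C * e ^+ 2 <= JJ P x e].
Proof.
have a0 := aa_gt0; have e1 := eps0; have n3 := nn3; have z0 := zs_gt0; have zn := zs_le.
have ec := epsC; have bp := bP; have b2 := B2.
exists (Num.min (aa / 4) (eps / 2)), (aa^-1 + eps); split.
- by rewrite lt_min !divr_gt0.
- by rewrite addr_gt0// invr_gt0.
move=> P x e x0 xn PB.
have P2 : 0 <= P ^+ 2 by exact: sqr_ge0.
have Y2 : 0 <= (zs - x) ^+ 2 by exact: sqr_ge0.
have e2 : 0 <= e ^+ 2 by exact: sqr_ge0.
have c1 : Num.min (aa / 4) (eps / 2) * DD P x <= aa / 4 * P ^+ 2 + eps / 2 * (zs - x) ^+ 2.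
 by rewrite mulrDr; apply: lerD; apply: ler_wpM2r => //; rewrite ge_min lexx ?orbT.
have t1 : - (aa / 4) * P ^+ 2 <= (b / 2 - (q - 1)) * P ^+ 3.
 have : `|(b / 2 - (q - 1)) * P| <= aa / 4.
  rewrite normrM; apply: le_trans bp; apply: ler_wpM2l => //; lra.
 rewrite ler_norml => /andP[h _].
 have -> : (b / 2 - (q - 1)) * P ^+ 3 = (b / 2 - (q - 1)) * P * P ^+ 2 by ring.
 exact: ler_wpM2r.
have t2 : - (aa / 4) * P ^+ 2 - aa^-1 * e ^+ 2 <= - (e * P).
 have : 0 <= aa^-1 * (aa / 2 * P - e) ^+ 2 by rewrite mulr_ge0 ?invr_ge0 ?sqr_ge0// ltW.
 have -> : aa^-1 * (aa / 2 * P - e) ^+ 2 = aa / 4 * P ^+ 2 - e * P + aa^-1 * e ^+ 2 by field; rewrite gt_eqF.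
 lra.
set Y := zs - x in Y2 c1 *.
have Yn : `|Y| <= 2 * nn by rewrite /Y ler_norml; apply/andP; split; lra.
have t3 : - (`|b - (q - 1)| * (2 * nn)) * P ^+ 2 <= (b * P ^+ 2 - (q - 1) * P ^+ 2) * Y.
 rewrite -mulrBl mulrAC; apply: ler_wpM2r => //.
 have : `|(b - (q - 1)) * Y| <= `|b - (q - 1)| * (2 * nn) by rewrite normrM ler_wpM2l.
 by rewrite ler_norml => /andP[].
have t4 : - (aa ^+ 2 * P ^+ 2) - Y ^+ 2 / 4 <= aa * P * Y.
 have : 0 <= (aa * P + Y / 2) ^+ 2 by exact: sqr_ge0.
 have -> : (aa * P + Y / 2) ^+ 2 = aa ^+ 2 * P ^+ 2 + aa * P * Y + Y ^+ 2 / 4 by field.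
 lra.
have t5 : - e ^+ 2 - Y ^+ 2 / 4 <= - e * Y.
 have : 0 <= (e - Y / 2) ^+ 2 by exact: sqr_ge0.
 have -> : (e - Y / 2) ^+ 2 = e ^+ 2 - e * Y + Y ^+ 2 / 4 by field.
 lra.
have t6 : - (2 * nn) * P ^+ 2 <= - (P ^+ 2 * x) by nra.
have t7 : eps * (Y ^+ 2 / 2 - (`|b - (q - 1)| * (2 * nn) + aa ^+ 2 + 2 * nn) * P ^+ 2 - e ^+ 2) <=
  eps * (Y ^+ 2 + (b * P ^+ 2 + aa * P - (q - 1) * P ^+ 2 - e) * Y - P ^+ 2 * x).
 by rewrite ler_pM2l//; lra.
have t8 : eps * (`|b - (q - 1)| * (2 * nn) + aa ^+ 2 + 2 * nn) * P ^+ 2 <= aa / 4 * P ^+ 2 by exact: ler_wpM2r.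
rewrite /JJ -/Y; move: t7 t8; move: (`|b - (q - 1)| * (2 * nn) + aa ^+ 2 + 2 * nn) => K t7 t8.
lra.
Qed.

(** The growth rate carries the weight of [z], which might fade away. But by [z_not0] the orbit
    returns again and again to [ln z > - Y], and since [ln z] falls at rate at most 2, each return
    yields a fixed gain within one unit of time. *)
Lemma growth_unbounded (Lh dL : R -> R) (t k M : R) : t0 <= t -> 0 < k ->
 (forall s : R, t <= s -> is_derive s 1 Lh (dL s)) -> (forall s, t <= s -> wz (z s) * k <= dL s) ->
 ~ (forall s, t <= s -> Lh s <= M).
Proof.
move=> ht k0 DL Lup LM.
have Lnd s u : t <= s -> s <= u -> Lh s <= Lh u.
 move=> ts su; apply: (@der_nd R Lh _ s u su (fun v v1 v2 => DL v (le_trans ts v1))) => v v1 v2.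
 by apply: le_trans (Lup v (le_trans ts v1)); rewrite mulr_ge0// ltW// wz_gt0.
apply: z_not0 => Y; apply: contrapT => HY.
have inf T3 : t <= T3 -> exists2 s, T3 <= s & - Y < ln (z s).
 move=> tT3; apply: contrapT => H; apply: HY; exists T3; first exact: le_trans tT3.
 by move=> s T3s; rewrite leNgt; apply/negP => hs; apply: H; exists s.
pose g := expR (b * (- Y - 2)) * k.
have g0 : 0 < g by rewrite mulr_gt0 ?expR_gt0.
have jump s : t <= s -> - Y < ln (z s) -> Lh s + g <= Lh (s + 1).
 move=> ts hs; have ss : s < s + 1 by rewrite ltrDl.
 have yl u : s <= u -> u <= s + 1 -> - Y - 2 <= ln (z u).
  move=> su us; suff : ln (z s) + 2 * s <= ln (z u) + 2 * u by lra.
  apply: (@der_nd R (fun u => ln (z u) + 2 * u) (fun u => p u - 2 + 2)) => // v v1 v2.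
   by apply: der_add (Dy _) (der_line 2 v); lra.
  by rewrite subrK; apply: p_ge0; lra.
 have [v [v1 v2 e]] := @MVT_itv R Lh _ s (s + 1) ss (fun v v1 v2 => DL v (le_trans ts v1)).
 rewrite -lerBrDl e addrAC subrr add0r mulr1; apply: le_trans (Lup v (le_trans ts (ltW v1))).
 by rewrite /g ler_pM2r// /wz ler_expR ler_pM2l// yl// ltW.
pose S := [set Lh s | s in [set s | t <= s]].
have sS : has_sup S by split; [exists (Lh t); exists t => /=|exists M => _ [s /= ts <-]; exact: LM].
have [_ [s /= ts <-] h1] := sup_adherent g0 sS.
have [u su uY] := inf s ts; have tu := le_trans ts su.
have h2 := jump u tu uY; have h3 := Lnd s u ts su.
have : Lh (u + 1) <= sup S by apply: ub_le_sup; [exact: sS.2|exists (u + 1) => //=; lra].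
lra.
Qed.

(** A late state with [DD > d] puts [Lf] above a level which it cannot cross downwards, because off
    the equilibrium the derivative beats the error. The growth then never ends, and [Lf] is bounded
    on the orbit. *)
Lemma lyap_cv (d : R) : 0 < d -> exists2 T1 : R, T <= T1 & forall t, T1 <= t -> DD (p t - 2) (z t) <= d.
Proof.
move=> d0; have ht := hT; have b2 := B2.
have [c3 c30 low] := Lf_lowD; have [Lm LM] := Lf_max; have [c [C [c0 C0 Jl]]] := JJ_low.
have Pb t : T <= t -> `|p t - 2| <= B.
 move=> Tt; have := p_ge0 (le_trans ht Tt); have := pB Tt.
 by rewrite ler_norml => h1 h2; apply/andP; split; lra.
have lam0 : 0 < c3 * d by rewrite mulr_gt0.
have [d' d'0 near] := Lf_near lam0.
(* Keeps the error [C e^2] below one half of [c * d'], given [p <= B]. *)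
pose eta := Num.min 1 (c * d' / (2 * C * B ^+ 4)).
have B4 : 0 < B ^+ 4 by rewrite exprn_gt0//; lra.
have eta0 : 0 < eta by rewrite lt_min ltr01/=; rewrite (divr_gt0 (mulr_gt0 c0 d'0) (mulr_gt0 (mulr_gt0 _ C0) B4)).
have [T1 hT1 HT1] := Qcv eta0.
exists (Num.max T T1) => [|t]; first by rewrite le_max lexx.
rewrite ge_max => /andP[Tt T1t]; rewrite leNgt; apply/negP => Dt.
pose Lh s := Lf (p s - 2) (z s) - Psi zs.
have zb s : t <= s -> 0 < z s /\ z s <= 2 * nn.
 by move=> ts; have h := le_trans ht (le_trans Tt ts); split; [exact: z_gt0|exact: z_le].
have Jpos s : t <= s -> c3 * d <= Lh s -> c * d' / 2 <= JJ (p s - 2) (z s) ((Qf s - q) * p s ^+ 2).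
 move=> ts Hs; have hs := le_trans Tt ts; have [z1 z2] := zb s ts.
 have h1 := Jl (p s - 2) (z s) ((Qf s - q) * p s ^+ 2) z1 z2 (Pb s hs).
 have h2 : c * d' <= c * DD (p s - 2) (z s).
  by rewrite ler_pM2l// leNgt; apply/negP => /near; rewrite ltNge Hs.
 suff : C * ((Qf s - q) * p s ^+ 2) ^+ 2 <= c * d' / 2 by lra.
 have q2 : (Qf s - q) ^+ 2 <= eta.
  have h := HT1 s (le_trans T1t ts); rewrite -(real_normK (num_real _)) -[leRHS]mulr1 expr2 ler_pM//.
  by apply: le_trans h _; rewrite ge_min lexx.
 have p4 : p s ^+ 4 <= B ^+ 4.
  by rewrite ler_pXn2r ?nnegrE ?pB//; [exact: p_ge0 (le_trans ht hs)|lra].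
 rewrite exprMn -exprM; apply: (@le_trans _ _ (C * (eta * B ^+ 4))).
  by rewrite ler_pM2l// ler_pM// ?sqr_ge0// exprn_ge0// p_ge0// (le_trans ht).
 rewrite mulrCA -(ler_pdivlMr _ _ (mulr_gt0 C0 B4)).
 rewrite (_ : c * d' / 2 / _ = c * d' / (2 * C * B ^+ 4)); last by field; rewrite !gt_eqF//; lra.
 by rewrite /eta ge_min lexx orbT.
have lamt : c3 * d <= Lh t.
 have [zt0 ztn] := zb t (lexx t); apply: le_trans (low _ _ zt0 ztn (Pb t Tt)).
 by rewrite ler_pM2l// ltW.
have DLh (s : R) : t <= s -> is_derive s 1 Lh (wz (z s) * JJ (p s - 2) (z s) ((Qf s - q) * p s ^+ 2)).
 move=> ts; apply: der_val (der_sub (L_derive (le_trans ht (le_trans Tt ts))) (der_cst (Psi zs) s)) _.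
 by rewrite subr0.
have k0 : 0 < c * d' / 2 by rewrite divr_gt0// mulr_gt0.
have stay s : t <= s -> c3 * d <= Lh s.
 apply: (crossing DLh) => // u tu e; rewrite mulr_gt0 ?wz_gt0//.
 by apply: lt_le_trans (Jpos u tu _); rewrite ?e.
apply: (growth_unbounded (M := Lm - Psi zs) (le_trans ht Tt) k0 DLh) => s ts.
 by rewrite ler_pM2l ?wz_gt0// Jpos// stay.
by have [zt0 ztn] := zb s ts; rewrite lerD2r; exact: LM zt0 ztn (Pb s (le_trans Tt ts)).
Qed.

End lyapunov.

Theorem core_cv (e : R) : 0 < e -> exists2 T : R, t0 <= T &
 forall t, T <= t -> `|p t - 2| <= e /\ `|z t - zs| <= e.
Proof.
move=> e0; have n3 := nn3; have qq := q1; have a0 := aa_gt0.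
have [B [T [B2 hT pB]]] := p_bdd.
(* For [q > 1] the cubic term cancels exactly. For [q = 1] the cancelling exponent is 0, where the
   quotient by [b] in [Psi] degenerates; a small positive [b] leaves a cubic remainder that [aa]
   absorbs. *)
have [b b0 bP] : exists2 b : R, 0 < b & `|b / 2 - (q - 1)| * (B + 2) <= aa / 4.
 have [q1'|q1'] := ltP 1 q.
  exists (2 * (q - 1)); first by lra.
  rewrite (_ : 2 * (q - 1) / 2 - (q - 1) = 0); last by field.
  by rewrite normr0 mul0r divr_ge0// ltW.
 have -> : q = 1 by apply/eqP; rewrite eq_le q1' qq.
 exists (aa / (2 * (B + 2))); first by rewrite divr_gt0//; lra.
 rewrite subrr subr0 ger0_norm; last by rewrite !divr_ge0// ?ltW//; lra.
 rewrite (_ : aa / _ / 2 * _ = aa / 4)//; field; rewrite gt_eqF//; lra.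
pose K1 := `|b - (q - 1)| * (2 * nn) + aa ^+ 2 + 2 * nn.
have K10 : 0 < K1.
 rewrite /K1; have : 0 <= `|b - (q - 1)| * (2 * nn) by rewrite mulr_ge0//; lra.
 by have := sqr_ge0 aa; lra.
pose K2 := 2 * (2 * nn * (b + 2)).
have K20 : 0 < K2 by rewrite /K2; nra.
pose eps := Num.min (aa / 4 / K1) (Num.min 1 (1 / 2 / K2)).
have eps0 : 0 < eps by rewrite !lt_min ltr01 !divr_gt0.
have e1 : eps * K1 <= aa / 4 by rewrite -ler_pdivlMr// ge_min lexx.
have e2 : 2 * eps ^+ 2 * (2 * nn * (b + 2)) <= 1 / 2.
 have h1 : eps <= 1 by rewrite !ge_min lexx/= orbT.
 have h2 : eps * K2 <= 1 / 2 by rewrite -ler_pdivlMr// !ge_min lexx !orbT.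
 rewrite (_ : 2 * eps ^+ 2 * _ = eps * (eps * K2)); last by rewrite /K2; ring.
 have h3 : 0 <= eps * K2 by rewrite mulr_ge0// ltW.
 by nra.
have ee : 0 < e ^+ 2 by rewrite exprn_gt0.
have [T1 hT1 HT1] := lyap_cv b0 eps0 hT B2 bP pB e1 e2 ee.
exists T1; first exact: le_trans hT1.
move=> t Tt; have := HT1 t Tt; rewrite /DD => h.
have h1 := sqr_ge0 (p t - 2); have h2 := sqr_ge0 (zs - z t).
split.
 rewrite -(@ler_pXn2r _ 2)// ?nnegrE ?(ltW e0)//.
 by rewrite real_normK ?num_real//; lra.
rewrite distrC -(@ler_pXn2r _ 2)// ?nnegrE ?(ltW e0)//.
by rewrite real_normK ?num_real//; lra.
Qed.

End core.

(** * Calculus of radial functions in the variable log |x| *)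

Section radial.
Variables (R : realType) (n : nat).
Implicit Types (x y : 'rV[R]_n) (i j : 'I_n).

Definition rho x : R := \sum_(i < n) x ord0 i ^+ 2.
(** [log |x|], taken from the polynomial [rho] so that its derivatives involve no square root. *)
Definition ell x : R := ln (rho x) / 2.

Lemma rho_enorm x : rho x = enorm x ^+ 2. Proof. by rewrite enorm2. Qed.

Lemma rho_ge0 x : 0 <= rho x.
Proof. by apply: sumr_ge0 => i _; exact: sqr_ge0. Qed.

Lemma rho_gt0 x : x != 0 -> 0 < rho x.
Proof.
move=> x0; rewrite lt_neqAle rho_ge0 andbT eq_sym; apply: contra x0 => /eqP h.
apply/eqP/rowP => i; rewrite mxE.
have /eqP := h; rewrite psumr_eq0; last by move=> j _; exact: sqr_ge0.
by move=> /allP/(_ i (mem_index_enum _)); rewrite sqrf_eq0 => /eqP.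
Qed.

Lemma rho_neq0 x : 0 < rho x -> x != 0.
Proof.
apply: contraTneq => ->; rewrite -leNgt /rho big1// => i _.
by rewrite mxE expr0n.
Qed.

Lemma rho_line (s : R) x i : rho (s *: evec R i + x) = s ^+ 2 + 2 * s * x ord0 i + rho x.
Proof. by rewrite !rho_enorm enorm2_line. Qed.

Lemma line_coord (s : R) x i : (s *: evec R i + x) ord0 i = s + x ord0 i.
Proof. by rewrite !mxE !eqxx mulr1. Qed.

Lemma rho_cont : continuous rho.
Proof.
move=> x; apply: (@cvg_sumR _ _ (nbhs x) (nbhs_filter x) n (fun i x => x ord0 i ^+ 2) (fun i => x ord0 i ^+ 2)) => i.
apply: (@continuous_comp _ _ _ (fun x : 'rV[R]_n => x ord0 i) (fun y : R => y ^+ 2)).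
 exact: coord_continuous.
exact: exprn_continuous.
Qed.

Lemma ell_exp x : x != 0 -> expR (ell x) = enorm x.
Proof.
move=> x0; have r0 := rho_gt0 x0; rewrite /enorm -/(rho x).
have s0 : 0 < Num.sqrt (rho x) by rewrite sqrtr_gt0.
have -> : ell x = ln (Num.sqrt (rho x)).
 by rewrite /ell -{1}(sqr_sqrtr (ltW r0)) lnXn// mulr2n; field.
by rewrite lnK// posrE.
Qed.

Lemma exp2_ell x : x != 0 -> expR (2 * ell x) = rho x.
Proof. by move=> x0; rewrite /ell mulrCA mulfV// mulr1 lnK// posrE rho_gt0. Qed.

Lemma ell_cont x : x != 0 -> {for x, continuous ell}.
Proof.
move=> x0; apply: (@continuous_comp _ _ _ rho (fun s : R => ln s / 2)); first exact: rho_cont.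
have D := der_mul (der_ln (rho_gt0 x0) (der_id (rho x))) (der_cst 2^-1 (rho x)).
exact: der_cont D.
Qed.

Lemma rho_derive i x : is_derive x (evec R i) rho (2 * x ord0 i).
Proof.
apply/is_derive_lineP; under eq_fun do rewrite rho_line.
apply: der_val (der_add (der_add (der_pow 2 (der_id 0)) (der_mul (der_line 2 0) (der_cst (x ord0 i) 0))) (der_cst (rho x) 0)) _.
by rewrite /=; ring.
Qed.

Lemma comp_derive (g : R -> R) (h : 'rV[R]_n -> R) i x (a b : R) :
 is_derive (h x) 1 g a -> is_derive x (evec R i) h b ->
 is_derive x (evec R i) (fun y => g (h y)) (a * b).
Proof.
move=> D1 /is_derive_lineP D2; apply/is_derive_lineP.
have e : h (0 *: evec R i + x) = h x by rewrite scale0r add0r.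
by apply: (@der_comp R g (fun s => h (s *: evec R i + x)) 0); rewrite ?e.
Qed.

Lemma ell_derive i x : x != 0 -> is_derive x (evec R i) ell (x ord0 i / rho x).
Proof.
move=> x0; have r0 := rho_gt0 x0.
have D1 : is_derive (rho x) 1 (fun s => ln s / 2) ((rho x)^-1 / 2).
 by apply: der_val (der_mul (der_ln r0 (der_id (rho x))) (der_cst 2^-1 (rho x))) _; rewrite mulr0 addr0 mul1r.
have := comp_derive D1 (rho_derive i x).
rewrite (_ : _ * _ = x ord0 i / rho x)//.
by field; rewrite gt_eqF.
Qed.

Lemma radial1 (P : R -> R) i x (d : R) : x != 0 -> is_derive (ell x) 1 P d ->
 is_derive x (evec R i) (fun y => P (ell y)) (d * (x ord0 i / rho x)).
Proof. by move=> x0 D; exact: comp_derive D (ell_derive i x0). Qed.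

Lemma derv_mul (f g : 'rV[R]_n -> R) x v (a b : R) : is_derive x v f a -> is_derive x v g b ->
 is_derive x v (fun y => f y * g y) (a * g x + f x * b).
Proof.
move=> /is_derive_lineP D1 /is_derive_lineP D2; apply/is_derive_lineP.
by have := der_mul D1 D2; rewrite scale0r add0r.
Qed.

Lemma coord_derive i x : is_derive x (evec R i) (fun y => y ord0 i) 1.
Proof.
apply/is_derive_lineP; under eq_fun do rewrite line_coord.
by apply: der_val (der_add (der_id 0) (der_cst (x ord0 i) 0)) _; rewrite addr0.
Qed.

Lemma radial2 (P1 : R -> R) i x (d : R) : x != 0 -> is_derive (ell x) 1 P1 d ->
 is_derive x (evec R i) (fun y => P1 (ell y) * (y ord0 i / rho y))
  (d * (x ord0 i / rho x) ^+ 2 + P1 (ell x) * ((rho x)^-1 - 2 * x ord0 i ^+ 2 / rho x ^+ 2)).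
Proof.
move=> x0 D; have r0 := rho_gt0 x0.
have DV : is_derive x (evec R i) (fun y => (rho y)^-1) (- (rho x) ^- 2 * (2 * x ord0 i)).
 apply: comp_derive (rho_derive i x).
 by apply: der_val (der_inv (lt0r_neq0 r0) (der_id (rho x))) _; rewrite mulN1r.
have := derv_mul (radial1 i x0 D) (derv_mul (coord_derive i x) DV).
rewrite (_ : _ + _ = d * (x ord0 i / rho x) ^+ 2 + P1 (ell x) * ((rho x)^-1 - 2 * x ord0 i ^+ 2 / rho x ^+ 2))//.
by field; rewrite gt_eqF.
Qed.

Lemma derv_near (f g : 'rV[R]_n -> R) x v (d : R) : (\forall y \near x, f y = g y) ->
 is_derive x v f d -> is_derive x v g d.
Proof. by move=> e; apply: near_eq_is_derive. Qed.

Lemma near_neq0 x : x != 0 -> \forall y \near x, y != 0.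
Proof.
move=> x0; have r0 := rho_gt0 x0.
have /cvgr_gt/(_ _ r0) := @rho_cont x.
by apply: filterS => y; exact: rho_neq0.
Qed.

Lemma radial_sum x (a b : R) : x != 0 -> (0 < n)%N ->
 \sum_i (a * (x ord0 i / rho x) ^+ 2 + b * ((rho x)^-1 - 2 * x ord0 i ^+ 2 / rho x ^+ 2)) =
 (a + (n%:R - 2) * b) / rho x.
Proof.
move=> x0 n0; have r0 := rho_gt0 x0.
rewrite (eq_bigr (fun i => (a - 2 * b) / rho x ^+ 2 * x ord0 i ^+ 2 + b / rho x)); last first.
 by move=> i _; field; rewrite gt_eqF.
rewrite big_split/= -mulr_sumr -/(rho x) sumr_const card_ord -mulr_natl.
by field; rewrite gt_eqF.
Qed.

End radial.

(** * The ordinary differential equation of the radial solution *)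

Section radial_ode.
Variables (R : realType) (m : nat) (f : R -> R) (ustar : 'rV[R]_m.+1 -> R).
Local Notation n := m.+1.
Hypotheses (rad : exists phi : R -> R, forall x, x != 0 -> ustar x = phi (enorm x))
 (C2 : C2_on [set x | x != 0] ustar)
 (eqn : forall x, x != 0 -> - laplacian ustar x = f (ustar x)).

Definition e0 : 'rV[R]_n := evec R ord0.

Lemma rho_e0 (s : R) : rho (s *: e0) = s ^+ 2.
Proof.
rewrite -[_ *: _]addr0 rho_line mxE mulr0 addr0 /rho big1 ?addr0// => i _.
by rewrite mxE expr0n.
Qed.

Lemma e0_neq0 (s : R) : 0 < s -> s *: e0 != 0.
Proof. by move=> s0; apply: rho_neq0; rewrite rho_e0 exprn_gt0. Qed.

Definition Ur (l : R) : R := ustar (expR l *: e0).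
Definition Ur1 (l : R) : R := dpart ord0 ustar (expR l *: e0) * expR l.

Lemma ustarE x : x != 0 -> ustar x = Ur (ell x).
Proof.
move=> x0; have [phi H] := rad; rewrite /Ur !H//; last exact/e0_neq0/expR_gt0.
congr phi; rewrite /enorm -/(rho (_ *: e0)) rho_e0 sqrtr_sqr gtr0_norm ?expR_gt0//.
by rewrite ell_exp.
Qed.

Lemma ray_derive (g : 'rV[R]_n -> R) (s : R) : 0 < s -> derivable g (s *: e0) e0 ->
 is_derive s 1 (fun s => g (s *: e0)) (dpart ord0 g (s *: e0)).
Proof.
move=> s0 dg; have D : is_derive (s *: e0) e0 g (dpart ord0 g (s *: e0)) by split.
apply/is_derive_shiftP; move/is_derive_lineP : D.
by under eq_fun do rewrite -scalerDl.
Qed.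

Lemma Ur_derive (l : R) : is_derive l 1 Ur (Ur1 l).
Proof.
have [_ /(_ ord0)[d _] _] := C2 (e0_neq0 (expR_gt0 l)).
have D := @der_comp R (fun s => ustar (s *: e0)) (@expR R) l _ _ (ray_derive (expR_gt0 l) d) (is_derive_expR l).
exact: D.
Qed.

Lemma Ur1_derive_ex (l : R) : exists d : R, is_derive l 1 Ur1 d.
Proof.
have [_ _ /(_ ord0 ord0)[d _]] := C2 (e0_neq0 (expR_gt0 l)).
have D := @der_comp R (fun s => dpart ord0 ustar (s *: e0)) (@expR R) l _ _ (ray_derive (expR_gt0 l) d) (is_derive_expR l).
exact: ex_intro (der_mul D (is_derive_expR l)).
Qed.

Lemma dpart_ustar i x : x != 0 -> is_derive x (evec R i) ustar (Ur1 (ell x) * (x ord0 i / rho x)).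
Proof.
move=> x0; apply: (@derv_near R n (fun y => Ur (ell y))).
 by apply: filterS (near_neq0 x0) => y y0; rewrite ustarE.
exact: radial1 (Ur_derive _).
Qed.

(** The [C2_on] hypothesis provides some derivative of [Ur1]; the equation, evaluated on the axis
    with the radial form of the Laplacian, then identifies it. *)
Lemma Ur1_derive (l : R) : is_derive l 1 Ur1 (- (n%:R - 2) * Ur1 l - expR (2 * l) * f (Ur l)).
Proof.
have [d D] := Ur1_derive_ex l.
pose x := expR l *: e0.
have x0 : x != 0 by exact/e0_neq0/expR_gt0.
have el : ell x = l.
 by rewrite /ell rho_e0 lnXn ?expR_gt0// expRK mulr2n; field.
have rx : rho x = expR (2 * l) by rewrite -{1}el exp2_ell.
have D2 i : dpart i (dpart i ustar) x =
  d * (x ord0 i / rho x) ^+ 2 + Ur1 (ell x) * ((rho x)^-1 - 2 * x ord0 i ^+ 2 / rho x ^+ 2).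
 rewrite -{1}el in D.
 apply: is_deriveE; apply: (@derv_near R n (fun y => Ur1 (ell y) * (y ord0 i / rho y))).
  by apply: filterS (near_neq0 x0) => y y0; rewrite /dpart (is_deriveE (dpart_ustar i y0)).
 exact: radial2.
have := eqn x0; rewrite /laplacian (eq_bigr _ (fun i _ => D2 i)) radial_sum// el rx.
rewrite (_ : ustar x = Ur l)//.
move=> h; apply: der_val D _; rewrite -h; by field; rewrite gt_eqF ?expR_gt0.
Qed.

End radial_ode.

(** * The singular profile near the origin *)

Section singular_profile.
Variables (R : realType) (nn : R) (f f1 U U1 : R -> R).
Hypotheses (nn3 : 3 <= nn) (f_ge0 : forall u, 0 <= f u) (f_mono : forall u v : R, u <= v -> f u <= f v)
 (Df : forall u : R, 0 < u -> is_derive u 1 f (f1 u)) (f_gt0 : forall u : R, 0 < u -> 0 < f u)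
 (f1_gt0 : forall u : R, 0 < u -> 0 < f1 u)
 (DU : forall l : R, is_derive l 1 U (U1 l))
 (DU1 : forall l : R, is_derive l 1 U1 (- (nn - 2) * U1 l - expR (2 * l) * f (U l)))
 (Ucv : forall K : R, exists l0 : R, forall l, l <= l0 -> K < U l)
 (fgrow : exists2 A : R, 0 < A & forall u, A <= u -> f u / f1 u <= (nn - 2) / nn * u).

(** The flux [- r^(nn-1) u_r]. By the equation its derivative is nonnegative. *)
Definition Mf (l : R) : R := - (expR ((nn - 2) * l) * U1 l).

Lemma exp_lin_derive (c l : R) : is_derive l 1 (fun l => expR (c * l)) (c * expR (c * l)).
Proof. by apply: der_val (der_exp (der_line c l)) _; rewrite mulrC. Qed.

Lemma Mf_derive (l : R) : is_derive l 1 Mf (expR (nn * l) * f (U l)).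
Proof.
apply: der_val (der_opp (der_mul (exp_lin_derive (nn - 2) l) (DU1 l))) _.
have -> : expR (nn * l) = expR ((nn - 2) * l) * expR (2 * l) by rewrite -expRD; congr expR; ring.
ring.
Qed.

Lemma U1E l : U1 l = - (Mf l * expR (- (nn - 2) * l)).
Proof.
rewrite /Mf mulNr opprK mulrAC -expRD (_ : _ + _ = 0) ?expR0 ?mul1r//; ring.
Qed.

Lemma Mf_nd l l' : l <= l' -> Mf l <= Mf l'.
Proof.
move=> ll; apply: (der_nd ll (fun s _ _ => Mf_derive s)) => s _ _.
by rewrite mulr_ge0 ?expR_ge0.
Qed.

(** A positive slope means a negative flux, which stays negative at all smaller radii; [U] would
    then not exceed [U l] there, against its blow-up. *)
Lemma U1_le0 l : U1 l <= 0.
Proof.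
rewrite leNgt; apply/negP => U0.
have Ml : Mf l < 0 by rewrite oppr_lt0 mulr_gt0// expR_gt0.
have Upos s : s <= l -> 0 <= U1 s.
 move=> sl; have := le_lt_trans (Mf_nd sl) Ml.
 by rewrite /Mf oppr_lt0 pmulr_rgt0 ?expR_gt0// => /ltW.
have [l0 H] := Ucv (U l).
pose s := Num.min l l0.
have sl : s <= l by rewrite ge_min lexx.
have s0 : s <= l0 by rewrite ge_min lexx orbT.
have : U s <= U l by apply: (der_nd sl (fun s _ _ => DU s)) => u _ ul; exact: Upos.
by rewrite leNgt H.
Qed.

Lemma Mf_ge0 l : 0 <= Mf l.
Proof. by rewrite /Mf oppr_ge0 mulr_ge0_le0 ?expR_ge0 ?U1_le0. Qed.

Lemma U_ni l l' : l <= l' -> U l' <= U l.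
Proof. by move=> ll; apply: (der_ni ll (fun s _ _ => DU s)) => s _ _; exact: U1_le0. Qed.

Lemma exp_small (c e : R) : 0 < c -> 0 < e -> exists l0 : R, forall l, l <= l0 -> expR (c * l) <= e.
Proof.
move=> c0 e0; exists (ln e / c) => l ll.
rewrite -(lnK (_ : e \is Num.pos)) ?posrE// ler_expR mulrC -ler_pdivlMr//.
Qed.

(** A positive limit of the flux would force [U >= k r^(-(nn-2))]. By [fgrow], [f] grows at least as
    [u^(nn/(nn-2))], so [r^nn f(U)] would be bounded below and the flux, decreasing linearly as [l]
    goes to minus infinity, would become negative. *)
Lemma Mf_cv (e : R) : 0 < e -> exists l0 : R, forall l, l <= l0 -> Mf l <= e.
Proof.
move=> e0; apply: contrapT => H; have n3 := nn3.
have Mlow l : e <= Mf l.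
 rewrite leNgt; apply/negP => Ml; apply: H; exists l => s sl.
 by apply: le_trans (Mf_nd sl) (ltW Ml).
have [A A0 HA] := fgrow.
pose c := e / (nn - 2).
have c0 : 0 < c by rewrite divr_gt0//; lra.
have U1l l : U1 l <= - (e * expR (- (nn - 2) * l)).
 by rewrite U1E lerN2; apply: ler_wpM2r; [exact: expR_ge0|exact: Mlow].
have Ulow l : l <= 0 -> U 0 + c * (expR (- (nn - 2) * l) - 1) <= U l.
 move=> l0.
 have : U 0 - c * expR (- (nn - 2) * 0) <= U l - c * expR (- (nn - 2) * l).
  apply: (@der_ni R (fun l => U l - c * expR (- (nn - 2) * l))
   (fun l => U1 l - c * (- (nn - 2) * expR (- (nn - 2) * l)))) => // s _ _.
   by apply: der_sub (DU s) (der_scale c (exp_lin_derive _ s)).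
  have := U1l s; rewrite (_ : c * _ = - (e * expR (- (nn - 2) * s))); first by lra.
  rewrite /c; field; rewrite gt_eqF//; lra.
 rewrite mulr0 expR0; lra.
pose k := c / 2.
have [l1 Hl1] : exists l1 : R, forall l, l <= l1 -> k * expR (- (nn - 2) * l) <= U l /\ A <= U l.
 have [l2 H2] := Ucv A.
 have d0 : 0 < nn - 2 by lra.
 pose K := (c + `|U 0|) / k.
 have k0 : 0 < k by rewrite /k; lra.
 have K0 : 0 < K by rewrite divr_gt0// ltr_pwDl.
 have Kv : 0 < K^-1 by rewrite invr_gt0.
 have [l3 H3] := exp_small d0 Kv.
 exists (Num.min 0 (Num.min l2 l3)) => l; rewrite !le_min => /and3P[h1 h2 h3].
 split; last exact/ltW/H2.
 have := Ulow l h1; have : K <= expR (- (nn - 2) * l).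
  rewrite mulNr expRN -[K]invrK lef_pV2 ?posrE ?expR_gt0 ?invr_gt0//; exact: H3.
 rewrite /K ler_pdivrMr// => hK.
 have := lerNnormlW (lexx `|U 0|); rewrite /k in hK *; lra.
have [k0] : 0 < k by rewrite /k; lra.
(* [fgrow] amounts to the monotonicity of [f^(nn-2) / u^nn], used here through its logarithm. *)
have DG (u : R) : A <= u -> is_derive u 1 (fun u => (nn - 2) * ln (f u) - nn * ln u)
  ((nn - 2) * (f1 u / f u) - nn * u^-1).
 move=> Au; have u0 : 0 < u by lra.
 apply: der_sub; apply: der_scale; first exact: der_ln (f_gt0 u0) (Df u0).
 by apply: der_val (der_ln u0 (der_id u)) _; rewrite mul1r.
have grow u : A <= u -> (nn - 2) * ln (f A) - nn * ln A <= (nn - 2) * ln (f u) - nn * ln u.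
 move=> Au; apply: (der_nd Au (fun s As _ => DG s As)) => s As _.
 have s0 : 0 < s by lra.
 have fs := f_gt0 s0; have f1s := f1_gt0 s0.
 have := HA s As; rewrite ler_pdivrMr// => h.
 rewrite subr_ge0 -(ler_pM2r s0) -mulrA mulVf ?gt_eqF// mulr1.
 rewrite (_ : _ * s = (nn - 2) * s * f1 s / f s); last by ring.
 rewrite ler_pdivlMr//; have n0 : 0 < nn by lra.
 have := ler_wpM2l (ltW n0) h.
 by rewrite (_ : nn * (_ * s * f1 s) = (nn - 2) * s * f1 s)//; field; rewrite gt_eqF.
pose C := (nn - 2) * ln (f A) - nn * ln A + nn * ln k.
have flow l : l <= l1 -> expR (C / (nn - 2)) <= expR (nn * l) * f (U l).
 move=> ll; have [h1 h2] := Hl1 l ll.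
 have U0 : 0 < U l by lra.
 have fU := f_gt0 U0.
 rewrite -(lnK (_ : f (U l) \is Num.pos)) ?posrE// -expRD ler_expR.
 have := grow _ h2.
 have : ln k - (nn - 2) * l <= ln (U l).
  rewrite (_ : ln k - _ = ln (k * expR (- (nn - 2) * l))); last first.
   by rewrite lnM ?posrE ?expR_gt0// expRK mulNr.
  by rewrite ler_ln ?posrE// mulr_gt0 ?expR_gt0.
 move=> h3 h4; rewrite ler_pdivrMr; last by lra.
 have : nn * (ln k - (nn - 2) * l) <= nn * ln (U l) by rewrite ler_pM2l//; lra.
 rewrite /C; lra.
pose g := expR (C / (nn - 2)).
have g0 : 0 < g by exact: expR_gt0.
pose l := l1 - Mf l1 / g - 1.
have Mg : 0 <= Mf l1 / g by rewrite divr_ge0 ?Mf_ge0// ltW.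
have ll : l <= l1 by rewrite /l; lra.
have : Mf l - g * l <= Mf l1 - g * l1.
 apply: (@der_nd R (fun l => Mf l - g * l) (fun l => expR (nn * l) * f (U l) - g)) => // s _ sl.
  by apply: der_sub (Mf_derive s) (der_line g s).
 by rewrite subr_ge0 flow.
have := Mf_ge0 l.
have -> : g * l = g * l1 - Mf l1 - g by rewrite /l; field; rewrite gt_eqF.
lra.
Qed.

(** Integrating the vanishing flux once. Below the size of the fundamental solution, the singularity
    leaves no point mass at the origin; the cutoff argument for the mild formula relies on this. *)
Lemma U_small (e : R) : 0 < e -> exists l0 : R, forall l, l <= l0 -> U l * expR ((nn - 2) * l) <= e.
Proof.
move=> e0; have n3 := nn3; have d0 : 0 < nn - 2 by lra.
pose e' := e * (nn - 2) / 2.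
have e'0 : 0 < e' by rewrite /e' divr_gt0// mulr_gt0.
have [l1 H1] := Mf_cv e'0.
pose c := e' / (nn - 2).
have [K K0 UK] : exists2 K : R, 0 < K & U l1 <= K.
 by exists (`|U l1| + 1); [rewrite ltr_wpDl|apply: le_trans (ler_norm _) _; rewrite lerDl].
have Ke : 0 < e / 2 / K by rewrite !divr_gt0.
have [l2 H2] := exp_small d0 Ke.
exists (Num.min l1 l2) => l; rewrite le_min => /andP[h1 h2].
have E : expR ((nn - 2) * l) * expR (- (nn - 2) * l) = 1.
 by rewrite -expRD (_ : _ + _ = 0) ?expR0//; ring.
have : U l - c * expR (- (nn - 2) * l) <= U l1 - c * expR (- (nn - 2) * l1).
 apply: (@der_nd R (fun l => U l - c * expR (- (nn - 2) * l))
   (fun l => U1 l - c * (- (nn - 2) * expR (- (nn - 2) * l)))) => // s _ sl.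
  by apply: der_sub (DU s) (der_scale c (exp_lin_derive _ s)).
 rewrite U1E (_ : c * _ = - (e' * expR (- (nn - 2) * s))).
  by rewrite opprK addrC subr_ge0; apply: ler_wpM2r; [exact: expR_ge0|exact: H1].
 rewrite /c; field; rewrite gt_eqF//; lra.
have c0 : 0 <= c * expR (- (nn - 2) * l1) by rewrite mulr_ge0 ?expR_ge0// divr_ge0// ltW.
move=> h; have {}h : U l <= K + c * expR (- (nn - 2) * l) by lra.
have := ler_wpM2r (expR_ge0 ((nn - 2) * l)) h.
rewrite (_ : (K + _) * _ = K * expR ((nn - 2) * l) + c * (expR ((nn - 2) * l) * expR (- (nn - 2) * l))); last by ring.
rewrite E mulr1.
have : K * expR ((nn - 2) * l) <= e / 2 by rewrite mulrC -ler_pdivlMr//; exact: H2.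
rewrite /c /e' (_ : e * _ / 2 / _ = e / 2); last by field; rewrite gt_eqF.
lra.
Qed.

(** * The profile in the transformed variables *)

Section transformed.
Variables (q A : R) (F : R -> R).
Hypotheses (q1 : 1 <= q) (qS : q < (nn + 2) / 4)
 (A_gt0 : 0 < A) (DF : forall u : R, A <= u -> is_derive u 1 F (- (f u)^-1))
 (F_gt0 : forall u : R, A <= u -> 0 < F u)
 (F_cv : forall e : R, 0 < e -> exists2 B : R, A <= B & forall u : R, B <= u -> F u <= e)
 (Qcv : forall e : R, 0 < e -> exists2 B : R, A <= B & forall u : R, B <= u -> `|f1 u * F u - q| <= e)
 (lA : R) (UA : forall l : R, l <= lA -> A <= U l).

Definition Vf (l : R) : R := F (U l).
Definition pf (l : R) : R := - U1 l / f (U l) / Vf l.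
Definition zf (l : R) : R := expR (2 * l) / Vf l.
Definition Qf (l : R) : R := f1 (U l) * Vf l.

Lemma Vf_gt0 l : l <= lA -> 0 < Vf l.
Proof. by move=> ll; apply: F_gt0; exact: UA. Qed.

Lemma U_gt0 l : l <= lA -> 0 < U l.
Proof. by move=> ll; apply: lt_le_trans (UA ll). Qed.

Lemma Vf_derive (l : R) : l <= lA -> is_derive l 1 Vf (pf l * Vf l).
Proof.
move=> ll; have v0 := Vf_gt0 ll; have fU := f_gt0 (U_gt0 ll).
apply: der_val (@der_comp R F U l _ _ (DF (UA ll)) (DU l)) _.
by rewrite /pf; field; rewrite !gt_eqF.
Qed.

Lemma pf_ge0 l : l <= lA -> 0 <= pf l.
Proof.
move=> ll; have v0 := Vf_gt0 ll; have fU := f_gt0 (U_gt0 ll).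
by rewrite /pf !divr_ge0 ?oppr_ge0 ?U1_le0// ltW.
Qed.

Lemma pf_derive (l : R) : l <= lA -> is_derive l 1 pf (zf l - (nn - 2) * pf l + (Qf l - 1) * pf l ^+ 2).
Proof.
move=> ll; have v0 := Vf_gt0 ll; have fU := f_gt0 (U_gt0 ll).
have DfU := @der_comp R f U l _ _ (Df (U_gt0 ll)) (DU l).
apply: der_val (der_mul (der_mul (der_opp (DU1 l)) (der_inv (lt0r_neq0 fU) DfU)) (der_inv (lt0r_neq0 v0) (Vf_derive ll))) _.
rewrite /zf /Qf /pf; field; by rewrite !gt_eqF.
Qed.

Lemma zf_derive (l : R) : l <= lA -> is_derive l 1 zf ((2 - pf l) * zf l).
Proof.
move=> ll; have v0 := Vf_gt0 ll.
apply: der_val (der_mul (exp_lin_derive 2 l) (der_inv (lt0r_neq0 v0) (Vf_derive ll))) _.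
by rewrite /zf; field; rewrite gt_eqF.
Qed.

Lemma zf_gt0 l : l <= lA -> 0 < zf l.
Proof. by move=> ll; rewrite divr_gt0 ?expR_gt0 ?Vf_gt0. Qed.

Lemma le_limit0 (a b C c : R) : 0 < c -> (forall s, s <= a -> b - C * expR (c * s) <= 0) -> b <= 0.
Proof.
move=> c0 H; rewrite leNgt; apply/negP => b0.
have Cn : 0 < `|C| + 1 by rewrite ltr_wpDl.
have b2 : 0 < b / 2 / (`|C| + 1) by rewrite divr_gt0//; lra.
have [l Hl] := exp_small c0 b2.
pose s := Num.min a l.
have sa : s <= a by rewrite ge_min lexx.
have := H s sa; have := Hl s (_ : s <= l); rewrite ge_min lexx orbT => /(_ isT).
rewrite ler_pdivlMr// => h; have e0 := expR_ge0 (c * s).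
have : C * expR (c * s) <= expR (c * s) * (`|C| + 1).
 by rewrite mulrC; apply: ler_wpM2l => //; apply: le_trans (ler_norm _) _; rewrite lerDl.
lra.
Qed.

Lemma Mf_low l : f (U l) * expR (nn * l) / nn <= Mf l.
Proof.
have n3 := nn3; have n0 : 0 < nn by lra.
rewrite -subr_le0; apply: (@le_limit0 l _ (f (U l) / nn) nn n0) => s sl.
have : Mf s - f (U l) / nn * expR (nn * s) <= Mf l - f (U l) / nn * expR (nn * l).
 apply: (@der_nd R (fun s => Mf s - f (U l) / nn * expR (nn * s))
  (fun s => expR (nn * s) * f (U s) - f (U l) / nn * (nn * expR (nn * s)))) => // u _ ul.
  by apply: der_sub (Mf_derive u) (der_scale _ (exp_lin_derive nn u)).
 rewrite (_ : _ - _ = expR (nn * u) * (f (U u) - f (U l))); last by field; rewrite gt_eqF.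
 by rewrite mulr_ge0 ?expR_ge0// subr_ge0 f_mono// U_ni.
have := Mf_ge0 s; rewrite [f (U l) * _ / _]mulrAC; lra.
Qed.

(** The bound [Mf_low] of the flux, integrated once more from the origin, gives
    [V >= r^2 / (2 nn)]. *)
Lemma zf_le l : l <= lA -> zf l <= 2 * nn.
Proof.
move=> ll; have n3 := nn3; have v0 := Vf_gt0 ll; have n0 : 0 < nn by lra.
rewrite /zf ler_pdivrMr//.
have V1 s : s <= lA -> expR (2 * s) / nn <= pf s * Vf s.
 move=> sl; have vs := Vf_gt0 sl; have fU := f_gt0 (U_gt0 sl).
 rewrite /pf divfK ?gt_eqF// ler_pdivlMr// U1E opprK.
 have := ler_wpM2r (expR_ge0 (- (nn - 2) * s)) (Mf_low s); apply: le_trans.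
 rewrite (_ : f (U s) * expR (nn * s) / nn * _ = expR (nn * s) * expR (- (nn - 2) * s) / nn * f (U s)); last by ring.
 by rewrite -expRD (_ : nn * s + _ = 2 * s)//; ring.
have c2 : 0 < 2 :> R by [].
have : expR (2 * l) / (2 * nn) - Vf l <= 0.
 apply: (@le_limit0 l _ (2 * nn)^-1 2 c2) => s sl.
 have : Vf s - (2 * nn)^-1 * expR (2 * s) <= Vf l - (2 * nn)^-1 * expR (2 * l).
  apply: (@der_nd R (fun s => Vf s - (2 * nn)^-1 * expR (2 * s))
   (fun s => pf s * Vf s - (2 * nn)^-1 * (2 * expR (2 * s)))) => // u _ ul.
   by apply: der_sub (Vf_derive _) (der_scale _ (exp_lin_derive 2 u)); exact: le_trans ll.
  have := V1 u (le_trans ul ll); rewrite (_ : (2 * nn)^-1 * _ = expR (2 * u) / nn); last by field; rewrite gt_eqF.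
  lra.
 have := Vf_gt0 (le_trans sl ll); rewrite [expR (2 * l) / _]mulrC; lra.
rewrite subr_le0 ler_pdivrMr; last by lra.
by rewrite [leRHS]mulrC.
Qed.

Lemma U_large (B : R) : exists2 l0 : R, l0 <= lA & forall l, l <= l0 -> B <= U l.
Proof.
have [l0 H] := Ucv B; exists (Num.min lA l0); first by rewrite ge_min lexx.
by move=> l; rewrite le_min => /andP[_ h]; exact/ltW/H.
Qed.

(** The orbit is read in the reversed time [t = - l], in which the system takes the form of
    [core_cv]. *)
Lemma profile_cv (e : R) : 0 < e -> exists2 l0 : R, l0 <= lA &
 forall l, l <= l0 -> `|pf l - 2| <= e /\ `|zf l - (2 * nn - 4 * q)| <= e.
Proof.
move=> e0.
have flip (g : R -> R) (dg : R -> R) : (forall l : R, l <= lA -> is_derive l 1 g (dg l)) ->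
  forall t : R, - lA <= t -> is_derive t 1 (fun t => g (- t)) (- dg (- t)).
 move=> H t tA; have tl : - t <= lA by rewrite lerNl.
 by apply: der_val (@der_comp R g (fun t => - t) t _ _ (H _ tl) (der_opp (der_id t))) _; rewrite mulrN1.
have Hp := flip _ _ pf_derive; have Hz := flip _ _ zf_derive.
have HV := flip _ _ (fun l ll => der_ln (Vf_gt0 ll) (Vf_derive ll)).
have tl t : - lA <= t -> - t <= lA by rewrite lerNl.
have Hp' (t : R) : - lA <= t -> is_derive t 1 (fun t => pf (- t))
  ((nn - 2) * pf (- t) - zf (- t) - (Qf (- t) - 1) * pf (- t) ^+ 2).
 by move=> /Hp D; apply: der_val D _; ring.
have Hz' (t : R) : - lA <= t -> is_derive t 1 (fun t => zf (- t)) ((pf (- t) - 2) * zf (- t)).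
 by move=> /Hz D; apply: der_val D _; ring.
have HV' (t : R) : - lA <= t -> is_derive t 1 (fun t => ln (Vf (- t))) (- pf (- t)).
 by move=> ht; apply: der_val (HV t ht) _; rewrite mulfK// gt_eqF// Vf_gt0//; exact: tl.
have HQ (d : R) : 0 < d -> exists2 T : R, - lA <= T & forall t : R, T <= t -> `|Qf (- t) - q| <= d.
 move=> d0; have [B AB HB] := Qcv d0; have [l0 l0A Hl0] := U_large B.
 exists (- l0); first by rewrite lerN2.
 by move=> t ht; apply: HB; apply: Hl0; rewrite lerNl.
have HVv (K : R) : exists2 T : R, - lA <= T & forall t : R, T <= t -> ln (Vf (- t)) <= K.
 have [B AB HB] := F_cv (expR_gt0 K); have [l0 l0A Hl0] := U_large B.
 exists (- l0); first by rewrite lerN2.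
 move=> t ht; have tl0 : - t <= l0 by rewrite lerNl.
 rewrite -(expRK K) ler_ln ?posrE ?expR_gt0// ?Vf_gt0//; last exact: le_trans l0A.
 by apply: HB; exact: Hl0.
have [T hT HT] := @core_cv R nn q (- lA) (fun t => pf (- t)) (fun t => zf (- t)) (fun t => Qf (- t))
 (fun t => ln (Vf (- t))) nn3 q1 qS Hp' Hz' HV' (fun t ht => zf_gt0 (tl t ht))
 (fun t ht => zf_le (tl t ht)) (fun t ht => pf_ge0 (tl t ht)) HQ HVv e e0.
exists (- T); first by rewrite lerNl.
by move=> l ll; have := HT (- l); rewrite opprK; apply; rewrite lerNr.
Qed.

(* (ln U)' = - p Q f/(U f'), which tends to -2(q-1). *)
Lemma U_power (al : R) : 2 * (q - 1) < al ->
 (forall d : R, 0 < d -> exists2 A : R, 0 < A & forall u : R, A <= u -> f u / f1 u <= (1 - q^-1 + d) * u) ->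
 exists C l0 : R, forall l, l <= l0 -> U l <= C * expR (- al * l).
Proof.
move=> alq Hf; have qq := q1; have q0 : 0 < q by lra.
(* The product of upper bounds for [p], [Q] and [f/(U f1)]; its value at [d = 0] is
   [2 (q - 1) < al], and continuity provides [d]. *)
pose g d := (2 + d) * ((q + d) * (1 - q^-1 + d)).
have [d d0 gd] : exists2 d : R, 0 < d & g d <= al.
 have g0 : g 0 = 2 * (q - 1) by rewrite /g; field; rewrite gt_eqF.
 have cg : {for 0, continuous g}.
  have D : is_derive (0 : R) 1 g _ := der_mul (der_add (der_cst 2 0) (der_id 0))
   (der_mul (der_add (der_cst q 0) (der_id 0)) (der_add (der_cst (1 - q^-1) 0) (der_id 0))).
  exact: der_cont D.
 have /cvgr_lt/(_ _ (_ : g 0 < al)) : g x @[x --> (0 : R)] --> g 0 by exact: cg.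
 rewrite g0 => /(_ alq)[r /= r0 Hr]; exists (r / 2); first by lra.
 by apply/ltW/Hr; rewrite /ball_/= sub0r normrN gtr0_norm; lra.
have [A1 A10 H1] := Hf d d0.
have [B AB HB] := Qcv d0.
have [l1 l1A H2] := profile_cv d0.
have [l2 l2A H3] := U_large (Num.max A1 B).
pose l0 := Num.min l1 l2.
have l01 : l0 <= l1 by rewrite ge_min lexx.
have l02 : l0 <= l2 by rewrite ge_min lexx orbT.
have key l : l <= l0 -> - U1 l <= al * U l.
 move=> ll; have lA' : l <= lA by lra.
 have U0 := U_gt0 lA'; have fU := f_gt0 U0; have f1U := f1_gt0 U0; have v0 := Vf_gt0 lA'.
 have := H3 l (le_trans ll l02); rewrite ge_max => /andP[UA1 UB].
 have [] := H2 l (le_trans ll l01); rewrite ler_norml => /andP[_ p2] _.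
 have := HB _ UB; rewrite ler_norml => /andP[_ q2].
 have h1 := H1 _ UA1.
 have -> : - U1 l = pf l * (f1 (U l) * F (U l)) * (f (U l) / f1 (U l)).
  by rewrite /pf /Vf; field; rewrite !gt_eqF//; rewrite /Vf in v0.
 have iq : 0 <= 1 - q^-1 by rewrite subr_ge0 invf_le1.
 apply: (@le_trans _ _ ((2 + d) * (q + d) * ((1 - q^-1 + d) * U l))).
  apply: ler_pM => //.
  - by rewrite mulr_ge0 ?pf_ge0// mulr_ge0 ?ltW// F_gt0// UA.
  - by rewrite divr_ge0// ltW.
  - by apply: ler_pM; [exact: pf_ge0|rewrite mulr_ge0 ?ltW// F_gt0// UA|lra|lra].
 by rewrite mulrA ler_pM2r// -mulrA.
exists (U l0 * expR (al * l0)), l0 => l ll.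
have : U l * expR (al * l) <= U l0 * expR (al * l0).
 apply: (@der_nd R (fun l => U l * expR (al * l)) (fun l => U1 l * expR (al * l) + U l * (al * expR (al * l)))) => // s _ sl.
  by apply: der_mul (DU s) (exp_lin_derive al s).
 rewrite (_ : _ + _ = (U1 s + al * U s) * expR (al * s)); last by ring.
 by rewrite mulr_ge0 ?expR_ge0//; have := key s sl; lra.
move=> h; have := ler_wpM2r (expR_ge0 (- al * l)) h.
by rewrite -[U l * _ * _]mulrA -expRD (_ : al * l + _ = 0) ?expR0 ?mulr1//; ring.
Qed.

End transformed.

End singular_profile.

(** * Supersolutions in the sense of test functions *)

Section test_functions.
Variables (R : realType) (nn : R) (f : R -> R).

(* A viscosity-type supersolution condition at (l, t), in the radial variable l = log |x|. *)
Definition test_super (Z : R -> R -> R) (l t : R) : Prop :=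
 exists (P P1 T : R -> R) (P2 d : R),
 [/\ \forall l' \near l, Z l' t <= P l' /\ is_derive l' 1 P (P1 l'),
   is_derive l 1 P1 P2 /\ is_derive t 1 T d,
   \forall t' \near t, Z l t' <= T t',
   P l = Z l t /\ T t = Z l t
  & f (Z l t) <= d - expR (- 2 * l) * (P2 + (nn - 2) * P1 l)].

(** The index [tau] is the time shift. A higher truncation level [k] of the datum asks for a smaller
    [tau], while the last bound is uniform in [tau] and hence survives every truncation. *)
Definition barrier_family (U : R -> R) (t0 : R) (Z : R -> R -> R -> R) : Prop := [/\
 forall tau : R, 0 < tau -> tau <= t0 -> forall l t : R, 0 <= t -> t < t0 ->
  {for (l, t), continuous (fun x : R * R => Z tau x.1 x.2)},
 forall tau : R, 0 < tau -> tau <= t0 -> forall l t : R, 0 < t -> t < t0 -> test_super (Z tau) l t,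
 forall tau : R, 0 < tau -> tau <= t0 -> forall l t : R, 0 <= t -> t < t0 -> 0 <= Z tau l t,
 forall k : R, exists tau : R, [/\ 0 < tau, tau <= t0 & forall l : R, Num.min (U l) k <= Z tau l 0] &
 forall b : R, 0 < b -> exists C : R, forall tau l t : R, 0 < tau -> tau <= t0 -> b <= t -> t < t0 -> Z tau l t <= C].

End test_functions.

(** * Inequalities behind the barrier *)

Section barrier_algebra.
Variables (R : realType).

(** For [W = (1 + eps) V + (eps / 2) (t + tau)]: the factor [1 + eps] creates an excess [eps]. One
    half pays for the time derivative, the other for the variation of [Q]. *)
Lemma inner_alg (z zs Q Qv p V W eps e : R) : 0 < V -> 0 < z -> 0 < zs -> zs / 2 <= z -> 0 <= Qv -> 0 < eps -> eps <= 1 ->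
 (1 + eps) * V <= W -> `|Q - Qv| <= e -> 0 <= p -> p <= 3 -> 72 * e <= zs * eps ->
 0 <= (z * V)^-1 * ((1 + eps) * V * (z + Q * p ^+ 2) - Qv / W * ((1 + eps) * (p * V)) ^+ 2) - eps / 2 - 1.
Proof.
move=> V0 z0 zs0 zz Q0 e0 e1 hW hQ p0 p3 he.
have W0 : 0 < W by apply: lt_le_trans hW; nra.
have h1 : Qv / W * ((1 + eps) * (p * V)) ^+ 2 <= Qv * p ^+ 2 * ((1 + eps) * V).
 have -> : Qv / W * ((1 + eps) * (p * V)) ^+ 2 = (Qv * p ^+ 2 * ((1 + eps) * V)) * ((1 + eps) * V / W).
  by field; rewrite gt_eqF.
 rewrite ler_piMr//; first by rewrite !mulr_ge0// ?sqr_ge0//; nra.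
 by rewrite ler_pdivrMr// mul1r.
have zV : 0 < z * V by rewrite mulr_gt0.
suff : (1 + eps / 2) * (z * V) <= (1 + eps) * V * (z + Q * p ^+ 2) - Qv / W * ((1 + eps) * (p * V)) ^+ 2.
 move=> h; have : 1 + eps / 2 <= (z * V)^-1 * ((1 + eps) * V * (z + Q * p ^+ 2) - Qv / W * ((1 + eps) * (p * V)) ^+ 2).
  by rewrite [leRHS]mulrC ler_pdivlMr.
 lra.
suff : 0 <= V * (eps / 2 * z + (1 + eps) * ((Q - Qv) * p ^+ 2)) by move: h1; lra.
apply: mulr_ge0; first exact: ltW.
have h2 : - (e * 9) <= (Q - Qv) * p ^+ 2.
 have hp : p ^+ 2 <= 9 by nra.
 have hp0 : 0 <= p ^+ 2 by exact: sqr_ge0.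
 move: hQ; rewrite ler_norml => /andP[hq1 hq2].
 have e00 : 0 <= e by lra.
 have : - e * p ^+ 2 <= (Q - Qv) * p ^+ 2 by rewrite ler_wpM2r.
 nra.
have h3 : zs * eps / 4 <= eps / 2 * z by nra.
have h4 : - (e * 9) * 2 <= (1 + eps) * ((Q - Qv) * p ^+ 2).
 have e00 : 0 <= e by apply: le_trans hQ.
 nra.
lra.
Qed.

(** For [W = V (1 + eps g)] the factor [eps / z] is taken out of the defect; what is left is the
    linearised operator applied to [g], plus errors. *)
Lemma outer_alg (z Q Qv p V eps g g1 g2 K n2 : R) : 0 < V -> 0 < z -> 0 < 1 + eps * g -> 0 < eps ->
 0 <= z * g + g2 + (n2 + 2 * p - 2 * p * Qv) * g1 + (Q - Qv) * p ^+ 2 * (1 + eps * g) / eps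
    - Qv * eps * g1 ^+ 2 / (1 + eps * g) + K / 2 * g1 ->
 0 <= (z * V)^-1 * (V * ((z + Q * p ^+ 2) * (1 + eps * g) + 2 * p * eps * g1 + eps * g2 + n2 * eps * g1)
   - Qv / (V * (1 + eps * g)) * (V * (p * (1 + eps * g) + eps * g1)) ^+ 2) - (- (K / (2 * z) * eps * g1)) - 1.
Proof.
move=> V0 z0 g0 e0 H.
set X := (X in 0 <= X).
suff -> : X = eps / z * (z * g + g2 + (n2 + 2 * p - 2 * p * Qv) * g1 + (Q - Qv) * p ^+ 2 * (1 + eps * g) / eps
    - Qv * eps * g1 ^+ 2 / (1 + eps * g) + K / 2 * g1).
 by rewrite mulr_ge0// divr_ge0 ?ltW.
by rewrite /X; field; rewrite !gt_eqF.
Qed.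

(** The linearised operator [zs g + g'' + a g'] on a damped cosine. Here [nu^2] is half the square
    of the natural frequency and [m] exceeds the natural damping [a / 2] by [mu / 2]; both choices
    leave a positive surplus. *)
Lemma main_alg (nu a zs m mu c s X : R) : 2 * nu ^+ 2 = zs - a ^+ 2 / 4 -> 2 * m = a + mu ->
 zs * (X * c) + X * ((m ^+ 2 - nu ^+ 2) * c + 2 * m * nu * s) + a * (X * (- m * c - nu * s)) =
 X * ((nu ^+ 2 + mu ^+ 2 / 4) * c + mu * nu * s).
Proof.
move=> h1 h2; have -> : zs = 2 * nu ^+ 2 + a ^+ 2 / 4 by lra.
have -> : m = (a + mu) / 2 by lra.
by field.
Qed.

(** Where sine and cosine are nonnegative their sum is at least 1 and [mu <= nu] suffices. Where the
    sine is negative the cosine term has to win alone, hence the threshold [c0]. *)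
Lemma main_low (nu mu c s c0 : R) : 0 < nu -> 0 < mu -> 0 < c0 -> c0 <= 1 -> 2 * mu <= nu * c0 -> c ^+ 2 + s ^+ 2 = 1 ->
 0 <= c -> (0 <= s \/ c0 <= c) -> mu * nu <= (nu ^+ 2 + mu ^+ 2 / 4) * c + mu * nu * s.
Proof.
move=> nu0 mu0 c00 c01 hmu cs cc.
have mn : mu <= nu by nra.
have h0 : mu * nu <= nu ^+ 2 by nra.
have h5 : 0 <= mu ^+ 2 / 4 * c by rewrite mulr_ge0// divr_ge0 ?sqr_ge0.
case=> h.
 have h1 : 1 <= c + s by rewrite -(@ler_pXn2r _ 2)// ?nnegrE; nra.
 have : mu * nu * c <= nu ^+ 2 * c by rewrite ler_wpM2r.
 have : 0 <= mu * nu * (c + s - 1) by rewrite mulr_ge0 ?subr_ge0// mulr_ge0 ?ltW.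
 lra.
have h1 : - 1 <= s by nra.
have : nu ^+ 2 * c0 <= nu ^+ 2 * c by rewrite ler_wpM2l ?sqr_ge0.
have : 0 <= mu * nu * (s + 1) by apply: mulr_ge0; [rewrite mulr_ge0 ?ltW|lra].
have : 2 * mu * nu <= nu ^+ 2 * c0 by nra.
lra.
Qed.

(** Five errors, each at most an eighth of the main term [c1 * X]: the deviation of [z], that of the
    drift coefficient, the variation of [Q], the term quadratic in [g1], and the time derivative.
    [X] is the amplitude of the damped cosine. *)
Lemma err_alg (z zs Q Qv p eps g g1 g2 K n2 a q X c1 B e eta L : R) :
 0 < X -> 0 <= g -> g <= X -> `|g1| <= B * X -> 0 < eps -> X <= L -> eps * L <= 1 ->
 c1 * X <= zs * g + g2 + a * g1 -> a = n2 + 4 - 4 * q -> 0 < B -> 1 <= q ->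
 `|z - zs| <= e -> `|p - 2| <= e -> `|Qv - q| <= e -> e <= 1 -> `|Q - Qv| <= eta * (eps * g) ->
 8 * e <= c1 -> 8 * (12 * q * e * B) <= c1 -> 8 * (18 * eta) <= c1 -> 0 <= eta ->
 8 * ((q + 1) * eps * B ^+ 2 * L) <= c1 -> 0 <= K -> 8 * (K / 2 * B) <= c1 -> 0 < c1 ->
 0 <= z * g + g2 + (n2 + 2 * p - 2 * p * Qv) * g1 + (Q - Qv) * p ^+ 2 * (1 + eps * g) / eps
    - Qv * eps * g1 ^+ 2 / (1 + eps * g) + K / 2 * g1.
Proof.
move=> X0 g0 gX g1B e0 XL eL main aE B0 q1 hz hp hQv e1 hQ c1e c1p c1eta eta0 c1eps K0 c1K c10.
have ee0 : 0 <= e by apply: le_trans hz.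
have E1 : - (c1 / 8 * X) <= (z - zs) * g.
 move: hz; rewrite ler_norml => /andP[h1 h2].
 have : - e * g <= (z - zs) * g by rewrite ler_wpM2r.
 have : e * g <= e * X by rewrite ler_wpM2l.
 have : 8 * e * X <= c1 * X by rewrite ler_wpM2r// ltW.
 clear; lra.
have hco : `|n2 + 2 * p - 2 * p * Qv - a| <= 12 * q * e.
 rewrite aE (_ : n2 + 2 * p - 2 * p * Qv - _ = 2 * (p - 2) * (1 - q) + - (2 * (p - 2) * (Qv - q)) + - (4 * (Qv - q))); last by ring.
 apply: le_trans (ler_normD _ _) _; apply: le_trans (lerD (ler_normD _ _) (lexx _)) _.
 rewrite !normrN !normrM.
 have -> : `|1 - q| = q - 1 by rewrite ler0_norm; lra.
 rewrite (@ger0_norm _ 2)// (@ger0_norm _ 4)//.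
 set x := `|p - 2| in hp *; set y := `|Qv - q| in hQv *.
 have x0 : 0 <= x by exact: normr_ge0.
 have y0 : 0 <= y by exact: normr_ge0.
 have : x * (q - 1) <= e * (q - 1) by rewrite ler_wpM2r// subr_ge0.
 have : x * y <= 1 * e by apply: ler_pM => //; exact: le_trans e1.
 have : e * 1 <= e * q by rewrite ler_wpM2l.
 clear -hQv ee0; lra.
have E2 : - (c1 / 8 * X) <= (n2 + 2 * p - 2 * p * Qv - a) * g1.
 have : `|(n2 + 2 * p - 2 * p * Qv - a) * g1| <= 12 * q * e * (B * X) by rewrite normrM ler_pM.
 rewrite ler_norml => /andP[h _].
 have : 8 * (12 * q * e * B) * X <= c1 * X by rewrite ler_wpM2r// ltW.
 clear -h; lra.
have eg : eps * g <= 1.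
 by apply: le_trans eL; apply: ler_wpM2l; [exact: ltW|exact: le_trans XL].
have eg0 : 0 <= eps * g by rewrite mulr_ge0// ltW.
have p2 : 0 <= p ^+ 2 <= 9.
 by move: hp; rewrite ler_norml => /andP[h1 h2]; rewrite sqr_ge0/=; nra.
have E3 : - (c1 / 8 * X) <= (Q - Qv) * p ^+ 2 * (1 + eps * g) / eps.
 have h1 : `|(Q - Qv) * p ^+ 2 * (1 + eps * g) / eps| <= eta * (eps * g) * 9 * 2 / eps.
  case/andP: p2 => hp0 hp9.
  rewrite (normrM _ eps^-1) normfV (gtr0_norm e0) ler_pM2r ?invr_gt0//.
  rewrite (normrM _ (1 + _)) (normrM (Q - Qv)) (ger0_norm hp0).
  apply: ler_pM => //; first by rewrite mulr_ge0.
   by apply: ler_pM.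
  by rewrite ger0_norm; clear -eg eg0; lra.
 have h2 : eta * (eps * g) * 9 * 2 / eps = 18 * eta * g by field; rewrite gt_eqF.
 move: h1; rewrite h2 ler_norml => /andP[h1 _].
 have : 8 * (18 * eta) * g <= c1 * g by rewrite ler_wpM2r.
 have : c1 * g <= c1 * X by rewrite ler_wpM2l// ltW.
 clear -h1; lra.
have E4 : Qv * eps * g1 ^+ 2 / (1 + eps * g) <= c1 / 8 * X.
 have q0 : Qv <= q + 1 by move: hQv; rewrite ler_norml => /andP[_]; clear -e1; lra.
 have q00 : 0 <= Qv by move: hQv; rewrite ler_norml => /andP[h _]; clear -h e1 q1; lra.
 have g12 : g1 ^+ 2 <= (B * X) ^+ 2.
  by rewrite -[g1 ^+ 2]real_normK ?num_real// ler_pXn2r ?nnegrE ?mulr_ge0// ltW.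
 have h0 : 0 <= Qv * eps * g1 ^+ 2 by apply: mulr_ge0; [rewrite mulr_ge0// ltW|exact: sqr_ge0].
 have h1 : Qv * eps * g1 ^+ 2 / (1 + eps * g) <= Qv * eps * g1 ^+ 2.
  by rewrite ler_pdivrMr; [rewrite ler_peMr//|]; clear -eg0; lra.
 apply: le_trans h1 _.
 have h2 : Qv * eps * g1 ^+ 2 <= (q + 1) * eps * (B * X) ^+ 2.
  apply: ler_pM => //; [by rewrite mulr_ge0// ltW|exact: sqr_ge0|by rewrite ler_wpM2r// ltW].
 apply: le_trans h2 _.
 have h3 : (q + 1) * eps * (B * X) ^+ 2 <= (q + 1) * eps * B ^+ 2 * L * X.
  have -> : (q + 1) * eps * (B * X) ^+ 2 = (q + 1) * eps * B ^+ 2 * X * X by ring.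
  rewrite ler_wpM2r ?(ltW X0)// ler_wpM2l//.
  apply: mulr_ge0; last exact: sqr_ge0.
  by apply: mulr_ge0; [clear -q1; lra|exact: ltW].
 have : 8 * ((q + 1) * eps * B ^+ 2 * L) * X <= c1 * X by rewrite ler_wpM2r// ltW.
 clear -h3; lra.
have E5 : - (c1 / 8 * X) <= K / 2 * g1.
 have : `|K / 2 * g1| <= K / 2 * (B * X) by rewrite normrM ger0_norm ?divr_ge0// ler_wpM2l ?divr_ge0.
 rewrite ler_norml => /andP[h _].
 have : 8 * (K / 2 * B) * X <= c1 * X by rewrite ler_wpM2r// ltW.
 clear -h; lra.
have : 0 < c1 * X by rewrite mulr_gt0.
clear -main E1 E2 E3 E4 E5; lra.
Qed.

Lemma min_pos (x y : R) : 0 < x -> 0 < y -> 0 < Num.min x y.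
Proof. by move=> h1 h2; rewrite lt_min h1. Qed.

Lemma slope_bound (zs wm v z e t0 : R) : 0 < zs -> 0 < v -> 2 * e <= zs -> - e <= z - zs ->
 z * v <= wm * zs / 8 -> t0 <= wm / 4 -> 2 * v + 2 * t0 <= wm.
Proof.
move=> zs0 v0 ez h1 h2 h3.
have h4 : zs / 2 * v <= z * v by apply: ler_wpM2r; [exact: ltW|lra].
have h5 : v <= wm / 4 by rewrite -(ler_pM2l zs0); lra.
lra.
Qed.

Lemma scale_le (kap t0 E : R) : 0 < kap -> t0 <= E / (2 * kap) -> kap * (2 * t0) <= E.
Proof. by move=> k0; rewrite ler_pdivlMr ?mulr_gt0//; lra. Qed.

Lemma half_shift (x y s : R) : x <= 2 * (y - s) -> x / 2 + s <= y.
Proof. by lra. Qed.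

End barrier_algebra.

(** * Construction of the barrier *)

Section barrier_function.
Variables (R : realType) (nn : R) (f f1 F : R -> R) (A : R).
Hypotheses (Df : forall u : R, 0 < u -> is_derive u 1 f (f1 u))
 (f_gt0 : forall u : R, 0 < u -> 0 < f u)
 (A_gt0 : 0 < A) (DF : forall u : R, A <= u -> is_derive u 1 F (- (f u)^-1))
 (F_gt0 : forall u : R, A <= u -> 0 < F u)
 (F_cv : forall e : R, 0 < e -> exists2 B : R, A <= B & forall u : R, B <= u -> F u <= e).

(** The inverse of [F] by choice; on []0, F A]] a preimage exists, so the default [A] is not what
    gets picked there. *)
Definition Hi (v : R) : R := xget A [set u | A <= u /\ F u = v].

Lemma HiP v : 0 < v -> v <= F A -> A <= Hi v /\ F (Hi v) = v.
Proof.
move=> v0 vA; have [B AB HB] := F_cv v0.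
have C : {within `[A, B], continuous F}.
 apply: continuous_in_subspaceT => s; rewrite inE/= in_itv/= => /andP[h _].
 exact: der_cont (DF h).
have hB := HB B (lexx B).
have [|c] := @IVT R F A B v AB C.
 by rewrite ge_min hB orbT le_max vA.
rewrite in_itv/= => /andP[h1 h2] e.
by rewrite /Hi; case: xgetP => [u -> []|/(_ c)[]].
Qed.

Lemma HiF u : A <= u -> Hi (F u) = u.
Proof.
move=> Au; have Fd := F_dec f_gt0 A_gt0 DF.
have [||h1 h2] := @HiP (F u); [exact: F_gt0|exact: (F_le f_gt0 A_gt0 DF (lexx A) Au)|].
apply/eqP; case: (ltgtP (Hi (F u)) u) => // h.
 by have := Fd _ _ h1 h; rewrite h2 ltxx.
by have := Fd _ _ Au h; rewrite h2 ltxx.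
Qed.

Lemma Hi_anti v w : 0 < v -> v <= w -> w <= F A -> Hi w <= Hi v.
Proof.
move=> v0 vw wA; rewrite leNgt; apply/negP => h.
have [h1 h2] := HiP v0 (le_trans vw wA).
by have := F_dec f_gt0 A_gt0 DF h1 h; rewrite h2 (HiP (lt_le_trans v0 vw) wA).2 ltNge vw.
Qed.

Lemma Hi_gt v : 0 < v -> v < F A -> A < Hi v.
Proof.
move=> v0 vA; have [h1 h2] := HiP v0 (ltW vA).
by rewrite lt_neqAle h1 andbT; apply/eqP => e; move: vA; rewrite e h2 ltxx.
Qed.

Lemma Hi_derive (v : R) : 0 < v -> v < F A -> is_derive v 1 Hi (- f (Hi v)).
Proof.
move=> v0 vA; have AH := Hi_gt v0 vA; have [h1 h2] := HiP v0 (ltW vA).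
have fH : 0 < f (Hi v) by apply: f_gt0; exact: lt_trans AH.
have N : \forall u \near Hi v, A <= u.
 by near=> u; apply: ltW; near: u; exact: lt_nbhsr.
have := @is_derive_inverse R F Hi (- (f (Hi v))^-1) (Hi v).
rewrite invrN invrK h2; apply.
- by near=> u; apply: HiF; near: u.
- by near=> u; apply: der_cont (DF _); near: u.
- exact: DF.
- by rewrite oppr_eq0 invr_eq0 gt_eqF.
Unshelve. all: by end_near. Qed.

(** [Hi] decreases, so functions touching the transformed barrier from below become test functions
    from above. Space and time are tested separately, hence the two functions [w] and [wt] that
    agree at the point. *)
Lemma test_of_W (Z : R -> R -> R) (w w1 wt : R -> R) (w2 d l t : R) :
 (\forall l' \near l, is_derive (l' : R) 1 w (w1 l')) -> is_derive l 1 w1 w2 -> is_derive t 1 wt d ->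
 w l = wt t -> 0 < w l -> w l < F A -> Z l t = Hi (w l) ->
 (\forall l' \near l, Z l' t <= Hi (w l')) -> (\forall t' \near t, Z l t' <= Hi (wt t')) ->
 0 <= expR (- 2 * l) * (w2 + (nn - 2) * w1 l - f1 (Hi (w l)) * w1 l ^+ 2) - d - 1 ->
 test_super nn f Z l t.
Proof.
move=> Dw Dw1 Dt wE w0 wA ZE Zl Zt S.
have H0 : 0 < Hi (w l) by apply: lt_trans (Hi_gt w0 wA).
have Dwl := nbhs_singleton Dw.
have cw : {for l, continuous w} by exact: der_cont Dwl.
have N : \forall l' \near l, 0 < w l' < F A.
 near=> l'; apply/andP; split; near: l'; [exact: (cvgr_gt (w l))|exact: (cvgr_lt (w l))].
have D1 (s : R) : 0 < w s -> w s < F A -> is_derive s 1 w (w1 s) ->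
  is_derive s 1 (fun s => Hi (w s)) (- f (Hi (w s)) * w1 s).
 by move=> h1 h2 h3; exact: der_comp (Hi_derive h1 h2) h3.
exists (fun s => Hi (w s)), (fun s => - f (Hi (w s)) * w1 s), (fun s => Hi (wt s)),
 (- (f1 (Hi (w l)) * (- f (Hi (w l)) * w1 l)) * w1 l + - f (Hi (w l)) * w2), (- f (Hi (wt t)) * d).
have wt0 : 0 < wt t by rewrite -wE.
have wtA : wt t < F A by rewrite -wE.
split => //.
- near=> l'; split; first by near: l'.
 have /andP[h1 h2] : 0 < w l' < F A by near: l'.
 by apply: D1 => //; near: l'.
- split; last exact: der_comp (Hi_derive wt0 wtA) Dt.
 by apply: der_mul Dw1; apply: der_opp; exact: (@der_comp R f (fun s => Hi (w s)) l _ _ (Df H0) (D1 l w0 wA Dwl)).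
- by rewrite -wE ZE.
rewrite ZE -wE; have fH := f_gt0 H0.
set E := expR _ in S *; set fh := f _ in fH *; set g1 := f1 _ in S *.
have : 0 <= fh * (E * (w2 + (nn - 2) * w1 l - g1 * w1 l ^+ 2) - d - 1) by rewrite mulr_ge0// ltW.
lra.
Unshelve. all: by end_near. Qed.

Variables (U U1 p z Q : R -> R) (lA : R).
Hypotheses (DU : forall l : R, is_derive l 1 U (U1 l))
 (DU1 : forall l : R, is_derive l 1 U1 (- (nn - 2) * U1 l - expR (2 * l) * f (U l)))
 (U_ni : forall l l' : R, l <= l' -> U l' <= U l) (U_ge0 : forall l : R, 0 <= U l)
 (UA : forall l : R, l <= lA -> A <= U l).
Local Notation V := (fun l : R => F (U l)).
Hypotheses (DV : forall l : R, l <= lA -> is_derive l 1 V (p l * V l))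
 (Dp : forall l : R, l <= lA -> is_derive l 1 p (z l - (nn - 2) * p l + (Q l - 1) * p l ^+ 2))
 (zE : forall l : R, l <= lA -> z l * V l = expR (2 * l))
 (QE : forall l : R, Q l = f1 (U l) * V l).

(** * The pieces of the barrier and their gluing *)

Section barrier.
Variables (q zs a nu s1 c0 mu m c1 kap Gam Ag sg Pp eps e eta ls wm t0 : R).
Local Notation L := (Ag * expR (m * s1)).
Local Notation H := Hi.
Hypotheses (q1 : 1 <= q) (zs0 : 0 < zs) (aE : a = nn - 2 + 4 - 4 * q) (nu0 : 0 < nu) (m0 : 0 < m)
 (nuE : 2 * nu ^+ 2 = zs - a ^+ 2 / 4) (s1E : nu * s1 = pi / 2)
 (c00 : 0 < c0) (c01 : c0 <= 1) (c0m : 8 * c0 <= expR (- (m * s1))) (mu0 : 0 < mu) (muc : 2 * mu <= nu * c0)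
 (mE : 2 * m = a + mu) (c1E : c1 = mu * nu)
 (kap0 : 0 < kap) (kapc : 8 * (kap * expR (2 * s1) / 2 * (m + nu)) <= c1)
 (GamE : Gam = 1 + zs / kap) (AgE : Ag = 2 * Gam)
 (sg0 : 0 < sg) (sgs : sg < s1) (sgP : forall s : R, 0 <= s -> s <= sg -> 1 / 2 < expR (- (m * s)) * cos (nu * s))
 (PpE : Pp = 2 * Gam / sg)
 (eps0 : 0 < eps) (eps1 : eps <= 1) (epsL : eps * L <= 1)
 (epsc : 8 * ((q + 1) * eps * (m + nu) ^+ 2 * L) <= c1)
 (e1 : e <= 1) (ez : 2 * e <= zs) (ec : 8 * e <= c1) (ep : 8 * (12 * q * e * (m + nu)) <= c1)
 (ei : 72 * (2 * e) <= zs * eps) (eta0 : 0 <= eta) (etac : 8 * (18 * eta) <= c1)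
 (lsA : ls <= lA) (prof : forall l : R, l <= ls -> `|p l - 2| <= e /\ `|z l - zs| <= e)
 (wmA : wm < F A)
 (Q1 : forall w : R, 0 < w -> w <= wm -> `|f1 (H w) * w - q| <= e)
 (Q2 : forall v w : R, 0 < v -> v <= w -> w <= wm -> `|f1 (H v) * v - f1 (H w) * w| <= eta * (ln w - ln v))
 (t00 : 0 < t0) (Vwm : forall l : R, l <= ls -> 2 * V l + 2 * t0 <= wm)
 (t0ls : ln (kap * (2 * t0)) / 2 + s1 <= ls - 1).
Section shift.
Variable tau : R.
Hypotheses (tau0 : 0 < tau) (taut : tau <= t0).

Definition sv (l t : R) : R := l - ln (kap * (t + tau)) / 2.
(** Stops the cosine at its zeros [s1] and [- s1], so that [gt] vanishes beyond them. *)
Definition clp (s : R) : R := Num.max (- s1) (Num.min s1 s).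
Definition gq (s : R) : R := Ag * expR (- (m * s)) * cos (nu * s).
Definition gt (s : R) : R := Ag * expR (- (m * s)) * cos (nu * clp s).
(** The cap: [V (1 + eps gin) = (1 + eps) V + (eps / 2) (t + tau)], which stays away from 0 at the
    origin. *)
Definition gin (l t : R) : R := 1 + (t + tau) / (2 * V l).
(** The cap must play no part outside [r = L]. The slope [Pp] pushes it below the cosine just
    outside and below 0 farther out. *)
Definition gi (l t : R) : R := gin l t - Pp * Num.max 0 (sv l t).
Definition Gb (l t : R) : R := Num.max 0 (Num.max (gt (sv l t)) (gi l t)).
Definition Wb (l t : R) : R := V l * (1 + eps * Gb l t).
(** On [[ls - 1, ls[] the perturbation [Gb] already vanishes for the times in question, so the two
    branches agree on an overlap. *)
Definition Zb (l t : R) : R := if l < ls then H (Wb l t) else U l.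

Let V0 (l : R) : l <= ls -> 0 < V l.
Proof. by move=> ll; apply: F_gt0; apply: UA; exact: le_trans lsA. Qed.

Let s10 : 0 < s1. Proof. have := sg0; have := sgs; lra. Qed.

Let Gam1 : 1 <= Gam.
Proof. by rewrite GamE lerDl divr_ge0// ltW. Qed.

Let tt (t : R) : 0 < t -> 0 < t + tau.
Proof. by have := tau0; lra. Qed.

Let zlow (l : R) : l <= ls -> zs / 2 <= z l.
Proof. by move=> /prof[_]; rewrite ler_norml => /andP[h _]; have := ez; lra. Qed.

Let zup (l : R) : l <= ls -> z l <= 2 * zs.
Proof. by move=> /prof[_]; rewrite ler_norml => /andP[_]; have := ez; have := zs0; lra. Qed.

Let z0 (l : R) : l <= ls -> 0 < z l.
Proof. by move=> /zlow; have := zs0; lra. Qed.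

Let p_bd (l : R) : l <= ls -> 0 <= p l <= 3.
Proof. by move=> /prof[+ _]; rewrite ler_norml => /andP[h1 h2]; apply/andP; have := e1; split; lra. Qed.

Let sv_exp (l t : R) : 0 < t + tau -> expR (2 * sv l t) = expR (2 * l) / (kap * (t + tau)).
Proof.
move=> th; have h : 0 < kap * (t + tau) by rewrite mulr_gt0.
have -> : 2 * sv l t = 2 * l - ln (kap * (t + tau)) by rewrite /sv; field.
by rewrite expRD expRN lnK.
Qed.

Lemma ginE (l t : R) : l <= ls -> 0 < t + tau -> gin l t = 1 + z l * expR (- (2 * sv l t)) / (2 * kap).
Proof.
move=> ll th; have v0 := V0 ll; have h := th.
rewrite /gin expRN sv_exp// -zE; last exact: le_trans lsA.
have zz := z0 ll.
by congr (_ + _); field; rewrite !gt_eqF.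
Qed.

Lemma gin_le (l t : R) : l <= ls -> 0 < t + tau -> 0 <= sv l t -> gin l t <= Gam.
Proof.
move=> ll th s0; rewrite ginE// GamE lerD2l.
have -> : zs / kap = 2 * zs * 1 / (2 * kap) by field; rewrite gt_eqF.
rewrite ler_pM2r ?invr_gt0 ?mulr_gt0//; apply: ler_pM => //.
- exact: ltW (z0 ll).
- exact: zup.
- by rewrite -[leRHS]expR0 ler_expR; lra.
Qed.

Lemma gin_low (l t : R) : l <= ls -> 0 < t + tau -> sv l t <= 0 -> Gam / 4 <= gin l t.
Proof.
move=> ll th s0; rewrite ginE// GamE.
have h1 : zs / 2 * 1 / (2 * kap) <= z l * expR (- (2 * sv l t)) / (2 * kap).
 rewrite ler_pM2r ?invr_gt0 ?mulr_gt0//; apply: ler_pM => //.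
 - by have := zs0; lra.
 - exact: zlow.
 - by rewrite -[leLHS]expR0 ler_expR; lra.
have -> : (1 + zs / kap) / 4 = 1 / 4 + zs / 2 * 1 / (2 * kap) by field; rewrite gt_eqF.
lra.
Qed.

Lemma gt_out s : s1 <= `|s| -> gt s = 0.
Proof.
move=> hs; rewrite /gt /clp.
have [s0|s0] := leP 0 s.
 move: hs; rewrite ger0_norm// => hs.
 rewrite min_l// max_r; last by have := s10; lra.
 by rewrite s1E cos_pihalf mulr0.
move: hs; rewrite ltr0_norm// => hs.
rewrite min_r; last by have := s10; lra.
rewrite max_l; last by lra.
by rewrite mulrN s1E cosN cos_pihalf mulr0.
Qed.

Lemma clp_in s : `|s| < s1 -> clp s = s.
Proof.
rewrite ltr_norml => /andP[h1 h2]; rewrite /clp min_r ?(ltW h2)// max_r// ltW//; lra.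
Qed.

Let Ag0 : 0 < Ag. Proof. by rewrite AgE; have := Gam1; lra. Qed.

Lemma gt_le s : eps * gt s <= 1.
Proof.
have [h|h] := leP s1 `|s|; first by rewrite gt_out// mulr0.
apply: le_trans epsL; rewrite ler_pM2l//.
apply: (@le_trans _ _ (Ag * expR (- (m * s)))).
 by rewrite /gt ler_piMr ?cos_le1// mulr_ge0 ?expR_ge0// ltW.
rewrite ler_pM2l// ler_expR; move: h; rewrite ltr_norml => /andP[h1 h2]; have := m0; nra.
Qed.

Lemma Gb_far (l t : R) : l <= ls -> 0 < t + tau -> s1 <= sv l t -> Gb l t = 0.
Proof.
move=> ll th hs; have s0 : 0 <= sv l t by have := s10; lra.
rewrite /Gb gt_out ?ger0_norm// /gi (max_r s0).
have h1 := gin_le ll th s0; have G1 := Gam1.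
have h2 : 2 * Gam <= Pp * sv l t.
 rewrite PpE mulrAC ler_pdivlMr//; apply: ler_wpM2l; first by lra.
 by have := sgs; lra.
by rewrite (max_l (_ : gin l t - Pp * sv l t <= 0)) ?maxxx//; lra.
Qed.

Lemma Wb_bd (l t : R) : l <= ls -> 0 < t + tau -> V l <= Wb l t <= 2 * V l + (t + tau).
Proof.
move=> ll th; have v0 := V0 ll; have th' := th.
have G0 : 0 <= Gb l t by rewrite /Gb le_max lexx.
apply/andP; split; first by rewrite /Wb ler_peMr ?(ltW v0)// lerDl mulr_ge0// ltW.
rewrite /Wb; have e0' := eps0; have e1' := eps1.
have gi_le : gi l t <= gin l t.
 by rewrite /gi gerBl mulr_ge0 ?le_max ?lexx// PpE divr_ge0 ?ltW//; have := Gam1; lra.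
have hin : V l * (1 + eps * gin l t) <= 2 * V l + (t + tau).
 have -> : V l * (1 + eps * gin l t) = (1 + eps) * V l + eps / 2 * (t + tau).
  by rewrite /gin; field; rewrite gt_eqF.
 by nra.
rewrite /Gb; case: (leP (gt (sv l t)) (gi l t)) => _.
 case: (leP 0 (gi l t)) => h; last by rewrite mulr0; lra.
 by apply: le_trans hin; rewrite ler_pM2l// lerD2l ler_pM2l.
have h1 : eps * Num.max 0 (gt (sv l t)) <= 1.
 by case: (leP 0 (gt (sv l t))) => _; rewrite ?mulr0// gt_le.
by nra.
Qed.

Lemma Wb_wm (l t : R) : l <= ls -> 0 < t + tau -> t <= t0 -> 0 < Wb l t <= wm.
Proof.
move=> ll th tt0; have /andP[h1 h2] := Wb_bd ll th; have := V0 ll; have := Vwm ll; have := taut.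
by move=> *; apply/andP; split; lra.
Qed.

Let HV (l : R) : l <= ls -> H (V l) = U l.
Proof. by move=> ll; apply: HiF; apply: UA; exact: le_trans lsA. Qed.

Lemma Zb_leU (l t : R) : 0 < t + tau -> t <= t0 -> Zb l t <= U l.
Proof.
move=> th tt0; rewrite /Zb; case: ifP => // /ltW ll.
have /andP[h1 h2] := Wb_bd ll th; have /andP[h3 h4] := Wb_wm ll th tt0.
rewrite -HV//; apply: Hi_anti => //; first exact: V0.
by have := wmA; lra.
Qed.

Lemma Zb_ge0 (l t : R) : 0 < t + tau -> t <= t0 -> 0 <= Zb l t.
Proof.
move=> th tt0; rewrite /Zb; case: ifP => // /ltW ll.
have /andP[h3 h4] := Wb_wm ll th tt0.
have wA := wmA; have a0 := A_gt0.
have wA' : Wb l t <= F A by lra.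
by have [+ _] := HiP h3 wA'; lra.
Qed.

Lemma sv_far (l t : R) : ls - 1 <= l -> 0 < t + tau -> t <= t0 -> s1 <= sv l t.
Proof.
move=> ll th tt0; rewrite /sv.
have : ln (kap * (t + tau)) <= ln (kap * (2 * t0)).
 rewrite ler_ln ?posrE ?mulr_gt0//.
 by apply: ler_wpM2l; [exact: ltW|have := taut; lra].
by have := t0ls; lra.
Qed.

Lemma Zb_far (l t : R) : 0 < t + tau -> t <= t0 -> s1 <= sv l t -> Zb l t = U l.
Proof.
move=> th tt0 hs; rewrite /Zb; case: ifP => // /ltW ll.
by rewrite /Wb Gb_far// mulr0 addr0 mulr1 HV.
Qed.

(** A smooth lower bound of [Wb] that is exact at the point suffices, since a larger [W] means a
    smaller [Z]. *)
Lemma test_piece (w w1 wt : R -> R) (w2 d l t : R) : l < ls -> 0 < t -> t < t0 ->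
 (\forall l' \near l, is_derive (l' : R) 1 w (w1 l')) -> is_derive l 1 w1 w2 -> is_derive t 1 wt d ->
 w l = Wb l t -> wt t = Wb l t ->
 (\forall l' \near l, w l' <= Wb l' t) -> (\forall t' \near t, wt t' <= Wb l t') ->
 0 <= expR (- 2 * l) * (w2 + (nn - 2) * w1 l - f1 (H (w l)) * w1 l ^+ 2) - d - 1 ->
 test_super nn f Zb l t.
Proof.
move=> ll tt0 tt1 Dw Dw1 Dt wE wtE hl ht S.
have /andP[W0 W1] := Wb_wm (ltW ll) (tt tt0) (ltW tt1).
have wA := wmA.
apply: (test_of_W Dw Dw1 Dt) => //.
- by rewrite wE wtE.
- by rewrite wE.
- by rewrite wE; lra.
- by rewrite /Zb ll wE.
- have cw : {for l, continuous w} by exact: der_cont (nbhs_singleton Dw).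
 near=> l'.
 have h1 : l' < ls by near: l'; exact: lt_nbhsl.
 rewrite /Zb h1.
 have /andP[h3 h4] := Wb_wm (ltW h1) (tt tt0) (ltW tt1).
 apply: Hi_anti; [|by near: l'|by lra].
 by near: l'; apply: (cvgr_gt (w l)) => //; rewrite wE.
- have cw : {for t, continuous wt} by exact: der_cont Dt.
 near=> t'.
 have h1 : 0 < t' by near: t'; exact: lt_nbhsr.
 have h2 : t' < t0 by near: t'; exact: lt_nbhsl.
 rewrite /Zb ll.
 have /andP[h3 h4] := Wb_wm (ltW ll) (tt h1) (ltW h2).
 apply: Hi_anti; [|by near: t'|by lra].
 by near: t'; apply: (cvgr_gt (wt t)) => //; rewrite wtE.
Unshelve. all: by end_near. Qed.

(** The barrier lies below [U], so where they touch the stationary solution itself serves as test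
    function. *)
Lemma test_U (l t : R) : 0 < t -> t < t0 -> Zb l t = U l -> test_super nn f Zb l t.
Proof.
move=> tt0 tt1 ZU.
exists U, U1, (fun=> U l), (- (nn - 2) * U1 l - expR (2 * l) * f (U l)), 0.
split => //.
- by near=> l'; split => //; apply: Zb_leU; [exact: tt|exact: ltW].
- by split => //; exact: der_cst.
- near=> t'; apply: Zb_leU; [apply: tt|apply: ltW]; near: t'; [exact: lt_nbhsr|exact: lt_nbhsl].
rewrite ZU (_ : - (nn - 2) * U1 l - expR (2 * l) * f (U l) + (nn - 2) * U1 l = - (expR (2 * l) * f (U l))); last by ring.
rewrite sub0r mulrN opprK mulrA -expRD.
by rewrite (_ : -2 * l + 2 * l = 0) ?expR0 ?mul1r//; lra.
Unshelve. all: by end_near. Qed.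

Let expE (l : R) : l <= ls -> expR (- 2 * l) = (z l * V l)^-1.
Proof. by move=> ll; rewrite zE ?(le_trans ll)// mulNr expRN. Qed.

Let V1_derive (l : R) : l <= ls -> is_derive l 1 (fun l => p l * V l)
 (V l * (z l + Q l * p l ^+ 2) - (nn - 2) * (p l * V l)).
Proof.
move=> ll; have lA' := le_trans ll lsA.
by apply: der_val (der_mul (Dp lA') (DV lA')) _; ring.
Qed.

Let sv_dl (l t : R) : is_derive l 1 (sv ^~ t) 1.
Proof. by apply: der_val (der_sub (der_id l) (der_cst _ _)) _; rewrite subr0. Qed.

Let sv_dt (l t : R) : 0 < t -> is_derive t 1 (sv l) (- ((2 * (t + tau))^-1)).
Proof.
move=> t1; have tp := tt t1; have ktp : 0 < kap * (t + tau) by rewrite mulr_gt0.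
have D := @der_ln R (fun t => kap * (t + tau)) t _ ktp (der_scale kap (der_add (der_id t) (der_cst tau t))).
apply: der_val (der_sub (der_cst l t) (der_mul D (der_cst _ t))) _.
by rewrite addr0 mulr0 addr0; field; rewrite !gt_eqF.
Qed.

(** [sv < 0] is an open condition: near the point the penalty is absent and [Wb] is bounded below by
    the smooth cap. The supersolution inequality is then [inner_alg]. *)
Lemma test_in (l t : R) : l < ls -> 0 < t -> t < t0 -> Gb l t = gi l t -> sv l t < 0 -> test_super nn f Zb l t.
Proof.
move=> ll tt0 tt1 GE s0; have ll' := ltW ll.
have Wi l' t' : l' <= ls -> 0 < t' + tau -> sv l' t' <= 0 -> (1 + eps) * V l' + eps / 2 * (t' + tau) <= Wb l' t' /\
  (Gb l' t' = gi l' t' -> Wb l' t' = (1 + eps) * V l' + eps / 2 * (t' + tau)).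
 move=> h1 h2 h3; have v0 := V0 h1.
 have -> : (1 + eps) * V l' + eps / 2 * (t' + tau) = V l' * (1 + eps * gi l' t').
  by rewrite /gi /gin max_l// mulr0 subr0; field; rewrite gt_eqF.
 split; last by move=> h; rewrite /Wb h.
 by rewrite /Wb ler_pM2l// lerD2l ler_pM2l// /Gb !le_max lexx !orbT.
have WE := (Wi l t ll' (tt tt0) (ltW s0)).2 GE.
have /andP[W0 W1] := Wb_wm ll' (tt tt0) (ltW tt1).
have csv_l := der_cont (sv_dl l t); have csv_t := der_cont (sv_dt l tt0).
apply: (@test_piece (fun l' => (1 + eps) * V l' + eps / 2 * (t + tau)) (fun l' => (1 + eps) * (p l' * V l'))
  (fun t' => (1 + eps) * V l + eps / 2 * (t' + tau))
  ((1 + eps) * (V l * (z l + Q l * p l ^+ 2) - (nn - 2) * (p l * V l))) (eps / 2)) => //.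
- near=> l'; have h : l' <= lA.
  by apply: le_trans lsA; apply: ltW; near: l'; exact: lt_nbhsl.
 by apply: der_val (der_add (der_scale (1 + eps) (DV h)) (der_cst _ _)) _; rewrite addr0.
- exact: der_scale (V1_derive ll').
- apply: der_val (der_add (der_cst _ _) (der_scale _ (der_add (der_id t) (der_cst _ _)))) _.
 by rewrite add0r addr0 mulr1.
- near=> l'; apply: (Wi _ _ _ _ _).1; [|exact: tt|].
  by apply: ltW; near: l'; exact: lt_nbhsl.
 by apply: ltW; near: l'; exact: (cvgr_lt (sv l t)).
- near=> t'; apply: (Wi _ _ _ _ _).1; [by []| |].
  by apply: tt; near: t'; exact: lt_nbhsr.
 by apply: ltW; near: t'; exact: (cvgr_lt (sv l t)).
rewrite -WE.
have v0 := V0 ll'; have zz := z0 ll'.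
have /andP[p0 p3] := p_bd ll'.
have hQ1 : `|Q l - f1 (H (Wb l t)) * Wb l t| <= 2 * e.
 have /andP[VW _] := Wb_bd ll' (tt tt0).
 have := Q1 v0 (le_trans VW W1); rewrite HV// -QE => h1; have h2 := Q1 W0 W1.
 have -> : Q l - f1 (H (Wb l t)) * Wb l t = (Q l - q) - (f1 (H (Wb l t)) * Wb l t - q) by ring.
 by apply: le_trans (ler_normB _ _) _; lra.
have Qv0 : 0 <= f1 (H (Wb l t)) * Wb l t.
 by have := Q1 W0 W1; rewrite ler_norml => /andP[h _]; have := e1; have := q1; lra.
have VW : (1 + eps) * V l <= Wb l t.
 by rewrite WE lerDl mulr_ge0// ?divr_ge0 ?ltW// tt.
have := inner_alg v0 zz zs0 (zlow ll') Qv0 eps0 eps1 VW hQ1 p0 p3 ei.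
rewrite expE// (mulfK (lt0r_neq0 W0)) (_ : (1 + eps) * V l * (z l + Q l * p l ^+ 2) =
 (1 + eps) * (V l * (z l + Q l * p l ^+ 2) - (nn - 2) * (p l * V l)) + (nn - 2) * ((1 + eps) * (p l * V l)))//; last by ring.
Unshelve. all: by end_near. Qed.

Let gq1 (s : R) : R := Ag * expR (- (m * s)) * (- m * cos (nu * s) - nu * sin (nu * s)).
Let gq2 (s : R) : R := Ag * expR (- (m * s)) * ((m ^+ 2 - nu ^+ 2) * cos (nu * s) + 2 * m * nu * sin (nu * s)).

Let cos_der (s : R) : is_derive s 1 (fun s => cos (nu * s)) (- sin (nu * s) * nu).
Proof. exact: (@der_comp R (@cos R) (fun s => nu * s) s _ _ (is_derive_cos _) (der_line nu s)). Qed.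

Let sin_der (s : R) : is_derive s 1 (fun s => sin (nu * s)) (cos (nu * s) * nu).
Proof. exact: (@der_comp R (@sin R) (fun s => nu * s) s _ _ (is_derive_sin _) (der_line nu s)). Qed.

Let X_der (s : R) : is_derive s 1 (fun s => Ag * expR (- (m * s))) (- m * (Ag * expR (- (m * s)))).
Proof. by apply: der_val (der_scale Ag (der_exp (der_opp (der_line m s)))) _; ring. Qed.

Let gq_der (s : R) : is_derive s 1 gq (gq1 s).
Proof. by apply: der_val (der_mul (X_der s) (cos_der s)) _; rewrite /gq1; ring. Qed.

Let gq1_der (s : R) : is_derive s 1 gq1 (gq2 s).
Proof.
apply: der_val (der_mul (X_der s) (der_sub (der_scale (- m) (cos_der s)) (der_scale nu (sin_der s)))) _.
by rewrite /gq2; ring.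
Qed.

(** Main part from [main_alg], errors from [err_alg]. For [sv < 0] the cosine is the active piece
    only where it exceeds the cap, hence [gq >= gin >= Gam / 4 = Ag / 8]; this keeps the cosine
    above [c0], out of the region where [main_low] fails. *)
Lemma test_out (l t : R) : l < ls -> 0 < t -> t < t0 -> Gb l t = gt (sv l t) -> 0 < gt (sv l t) -> test_super nn f Zb l t.
Proof.
move=> ll tt0 tt1 GE g0; have ll' := ltW ll; have lA' := le_trans ll' lsA.
have s_in : `|sv l t| < s1.
 by rewrite ltNge; apply/negP => h; move: g0; rewrite gt_out// ltxx.
have v0 := V0 ll'; have zz := z0 ll'.
have tp : 0 < t + tau by rewrite tt.
have Dst := sv_dt l tt0; have csv_l := der_cont (sv_dl l t); have csv_t := der_cont Dst.
have cnl : {for l, continuous (fun l => `|sv l t|)} by apply: (@cvg_norm _ _ _ _ _ (fun l => sv l t)).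
have cnt : {for t, continuous (fun t => `|sv l t|)} by apply: (@cvg_norm _ _ _ _ _ (sv l)).
have gqE s : `|s| < s1 -> gt s = gq s by move=> h; rewrite /gt clp_in.
have Wo l' t' : l' <= ls -> `|sv l' t'| < s1 -> V l' * (1 + eps * gq (sv l' t')) <= Wb l' t'.
 move=> h1 h2; rewrite /Wb ler_pM2l ?V0// lerD2l ler_pM2l// /Gb gqE//.
 by rewrite !le_max lexx orbT.
have WE : Wb l t = V l * (1 + eps * gq (sv l t)) by rewrite /Wb GE gqE.
have /andP[W0 W1] := Wb_wm ll' (tt tt0) (ltW tt1).
have Dgl l' : is_derive (l' : R) 1 (fun l => gq (sv l t)) (gq1 (sv l' t)).
 by apply: der_val (@der_comp R gq (fun l => sv l t) l' _ _ (gq_der _) (sv_dl l' t)) _; rewrite mulr1.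
have Dgl1 : is_derive l 1 (fun l => gq1 (sv l t)) (gq2 (sv l t)).
 by apply: der_val (@der_comp R gq1 (fun l => sv l t) l _ _ (gq1_der _) (sv_dl l t)) _; rewrite mulr1.
set s := sv l t in s_in g0 GE WE Dgl1 *.
set g := gq s in WE *.
have gp : 0 < g by rewrite /g -gqE.
(* This is [r^2 / (t + tau)]; by [zE], the time derivative of [sv] times [V] equals
   [- K / (2 z)]. *)
pose K := kap * expR (2 * s).
have KE : K / (2 * z l) = V l / (2 * (t + tau)).
 rewrite /K sv_exp ?tt// -zE//; by field; rewrite !gt_eqF.
pose w1 l' := p l' * V l' * (1 + eps * gq (sv l' t)) + V l' * (eps * gq1 (sv l' t)).
apply: (@test_piece (fun l' => V l' * (1 + eps * gq (sv l' t))) w1 (fun t' => V l * (1 + eps * gq (sv l t')))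
  ((V l * (z l + Q l * p l ^+ 2) - (nn - 2) * (p l * V l)) * (1 + eps * g) + p l * V l * (eps * gq1 s)
   + (p l * V l * (eps * gq1 s) + V l * (eps * gq2 s))) (- (K / (2 * z l) * eps * gq1 s))) => //.
- near=> l'; have h : l' <= lA.
  by apply: le_trans lsA; apply: ltW; near: l'; exact: lt_nbhsl.
 apply: der_val (der_mul (DV h) (der_add (der_cst 1 _) (der_scale eps (Dgl l')))) _.
 by rewrite add0r.
- apply: der_val (der_add (der_mul (V1_derive ll') (der_add (der_cst 1 _) (der_scale eps (Dgl l)))) (der_mul (DV lA') (der_scale eps Dgl1))) _.
 by rewrite add0r.
- apply: der_val (der_scale (V l) (der_add (der_cst 1 _) (der_scale eps (@der_comp R gq (sv l) t _ _ (gq_der _) Dst)))) _.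
 by rewrite add0r KE; field; rewrite gt_eqF.
- near=> l'; apply: Wo; first by apply: ltW; near: l'; exact: lt_nbhsl.
 by near: l'; apply: (cvgr_lt `|sv l t|).
- near=> t'; apply: Wo => //.
 by near: t'; apply: (cvgr_lt `|sv l t|).
rewrite -/s -/g -WE /w1 -/s -/g.
pose Qv := f1 (H (Wb l t)) * Wb l t.
have g10 : 0 < 1 + eps * g by rewrite addr_gt0// mulr_gt0.
have HQ : f1 (H (Wb l t)) = Qv / (V l * (1 + eps * g)) by rewrite /Qv WE mulfK// gt_eqF// mulr_gt0.
rewrite HQ expE//.
have X0 : 0 < Ag * expR (- (m * s)) by rewrite mulr_gt0 ?expR_gt0.
have := s_in; rewrite ltr_norml => /andP[s_lo s_hi].
have cos0 : 0 <= cos (nu * s).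
 apply: cos_ge0_pihalf; rewrite -s1E -mulrN !ler_pM2l//; apply/andP; split; exact: ltW.
have hmain : c1 * (Ag * expR (- (m * s))) <= zs * g + gq2 s + a * gq1 s.
 rewrite (main_alg _ _ _ nuE mE) mulrC ler_pM2l// c1E.
 apply: (main_low nu0 mu0 c00 c01 muc (cos2Dsin2 _) cos0).
 have [s0|s0] := leP 0 s.
  left; apply: sin_ge0_pi; rewrite mulr_ge0 ?(ltW nu0)//=.
  have : nu * s <= nu * s1 by apply: ler_wpM2l; apply: ltW.
  by have := pi_gt0 R; have := s1E; lra.
 right.
 have h1 := gin_low ll' (tt tt0) (ltW s0).
 have h2 : gin l t <= g.
  have : gi l t <= Gb l t by rewrite /Gb !le_max lexx !orbT.
  by rewrite GE gqE// /gi -/s (max_l (ltW s0)) mulr0 subr0.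
 have h3 : Ag / 8 <= g by rewrite AgE; lra.
 have h4 : 8 * c0 <= expR (m * s).
  by apply: le_trans c0m _; rewrite ler_expR -mulrN ler_pM2l// ltW.
 have h5 : expR (m * s) * expR (- (m * s)) = 1 by rewrite -expRD subrr expR0.
 have h6 : 1 / 8 <= expR (- (m * s)) * cos (nu * s).
  by rewrite -(ler_pM2l Ag0) mulrA; move: h3; rewrite /g /gq; lra.
 have h7 : expR (m * s) * (1 / 8) <= expR (m * s) * (expR (- (m * s)) * cos (nu * s)).
  by rewrite ler_pM2l ?expR_gt0.
 by move: h7; rewrite mulrA h5 mul1r; lra.
have B0 : 0 < m + nu by rewrite addr_gt0.
have [hp hz] := prof ll'.
have gX : g <= Ag * expR (- (m * s)) by rewrite /g /gq ler_piMr ?cos_le1// ltW.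
have XL : Ag * expR (- (m * s)) <= L by rewrite ler_pM2l// ler_expR -mulrN ler_pM2l// lerNl ltW.
have g1B : `|gq1 s| <= (m + nu) * (Ag * expR (- (m * s))).
 rewrite /gq1 normrM gtr0_norm// mulrC ler_pM2r//.
 apply: le_trans (ler_normB _ _) _; rewrite !normrM normrN (gtr0_norm m0) (gtr0_norm nu0).
 by apply: lerD; rewrite ler_piMr ?(ltW m0) ?(ltW nu0)// ler_norml ?cos_geN1 ?cos_le1 ?sin_geN1 ?sin_le1.
(* Here [W / V = 1 + eps g], so the logarithmic bound [Q2] becomes proportional to [eps g]. *)
have hQQ : `|Q l - Qv| <= eta * (eps * g).
 have /andP[VW _] := Wb_bd ll' (tt tt0).
 have := Q2 v0 VW W1; rewrite HV// -QE => h; apply: le_trans h _.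
 apply: ler_wpM2l => //.
 rewrite WE lnM ?posrE// addrAC subrr add0r.
 have eg1 : -1 < eps * g by apply: lt_trans (mulr_gt0 eps0 gp); rewrite oppr_lt0.
 exact: le_ln1Dx.
have K0 : 0 <= K by rewrite mulr_ge0 ?expR_ge0// ltW.
have cK : 8 * (K / 2 * (m + nu)) <= c1.
 apply: le_trans kapc; rewrite ler_pM2l//; apply: ler_wpM2r; first exact: ltW.
 apply: ler_wpM2r => //; apply: ler_wpM2l; first exact: ltW.
 by rewrite ler_expR ler_pM2l// ltW.
have c10 : 0 < c1 by rewrite c1E mulr_gt0.
have HH := err_alg X0 (ltW gp) gX g1B eps0 XL epsL hmain aE B0 q1 hz hp (Q1 W0 W1) e1 hQQ ec ep etac eta0 epsc K0 cK c10.
have := outer_alg v0 zz g10 eps0 HH.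
set a1 := (X in 0 <= X -> _); set a2 := (X in _ -> 0 <= X).
suff -> : a1 = a2 by [].
rewrite /a1 /a2 /Qv; ring.
Unshelve. all: by end_near. Qed.

Lemma Zb_test (l t : R) : 0 < t -> t < t0 -> test_super nn f Zb l t.
Proof.
move=> tt0 tt1.
have [ll|ll] := leP ls l.
 by apply: test_U => //; rewrite /Zb ltNge ll.
have [s_far|s_near] := leP s1 (sv l t).
 by apply: test_U => //; apply: Zb_far => //; [exact: tt|exact: ltW].
have ll' := ltW ll.
have [G0|G0] := leP (Gb l t) 0.
 apply: test_U => //; rewrite /Zb ll /Wb.
 have -> : Gb l t = 0 by apply/eqP; rewrite eq_le G0 /Gb le_max lexx.
 by rewrite mulr0 addr0 mulr1 HV.
have [h|h] := leP (gi l t) (gt (sv l t)).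
 have GE : Gb l t = gt (sv l t).
  move: G0; rewrite /Gb (max_l h).
  by case: (leP 0 (gt (sv l t))) => // _; rewrite ltxx.
 by apply: test_out => //; rewrite -GE.
have GE : Gb l t = gi l t.
 move: G0; rewrite /Gb (max_r (ltW h)).
 by case: (leP 0 (gi l t)) => // _; rewrite ltxx.
(* For [sv >= 0] the cap cannot be the maximum: on [[0, sg]] the cosine exceeds [Gam], and beyond
   [sg] the penalty is at least [2 Gam]. *)
apply: test_in => //; rewrite ltNge; apply/negP => s0.
have hin := gin_le ll' (tt tt0) s0.
move: h G0; rewrite GE /gi (max_r s0) => h G0.
have [h1|h1] := leP (sv l t) sg.
 have := sgP s0 h1; move: h; rewrite /gt clp_in ?ger0_norm// => h h2.
 have h3 : Gam < Ag * expR (- (m * sv l t)) * cos (nu * sv l t).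
  have -> : Gam = Ag * (1 / 2) by rewrite AgE; field.
  by rewrite -mulrA ltr_pM2l.
 have : 0 <= Pp * sv l t by rewrite mulr_ge0// PpE divr_ge0 ?ltW//; have := Gam1; lra.
 lra.
have h2 : 2 * Gam <= Pp * sv l t.
 rewrite PpE mulrAC ler_pdivlMr//; apply: ler_wpM2l; first by have := Gam1; lra.
 exact: ltW.
by have := Gam1; lra.
Qed.

(** If [sv >= s1] the barrier is [U]. Otherwise [r^2] is at most a multiple of [tau], so [W] is too,
    and the hypothesis on [tau] puts [Z] above [k]. *)
Lemma Zb_init (l : R) (k : R) : (4 * kap * expR (2 * s1) / zs + 1) * tau <= F (Num.max k A) ->
 Num.min (U l) k <= Zb l 0.
Proof.
move=> hk; have tn : (0 : R) <= t0 by exact: ltW.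
have t0t : 0 < 0 + tau by rewrite add0r.
have [s_far|s_near] := leP s1 (sv l 0).
 by rewrite Zb_far// ge_min lexx.
have ll : l <= ls.
 rewrite leNgt; apply/negP => h.
 have h1 : ls - 1 <= l by lra.
 by have := sv_far h1 t0t tn; lra.
have [h|h] := ltP l ls; last by rewrite /Zb ltNge h/= ge_min lexx.
rewrite /Zb h ge_min; apply/orP; right.
have /andP[h3 h4] := Wb_wm ll t0t tn.
have /andP[_ h5] := Wb_bd ll t0t.
have Ak : A <= Num.max k A by rewrite le_max lexx orbT.
have v0 := V0 ll; have zz := z0 ll.
have h6 : V l <= 2 * kap * expR (2 * s1) / zs * tau.
 have -> : V l = expR (2 * sv l 0) * (kap * tau) / z l.
  by rewrite sv_exp// add0r -zE ?(le_trans ll)//; field; rewrite !gt_eqF.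
 rewrite ler_pdivrMr//.
 have -> : 2 * kap * expR (2 * s1) / zs * tau * z l = expR (2 * s1) * (kap * tau) * (2 * z l / zs).
  by field; rewrite gt_eqF.
 rewrite -[leLHS]mulr1; apply: ler_pM => //.
 - by rewrite mulr_ge0 ?expR_ge0// mulr_ge0 ?ltW.
 - by apply: ler_wpM2r; [rewrite mulr_ge0 ?ltW|rewrite ler_expR; lra].
 - by rewrite ler_pdivlMr// mul1r; have := zlow ll; lra.
have h7 : Wb l 0 <= F (Num.max k A) by lra.
apply: (@le_trans _ _ (Num.max k A)); first by rewrite le_max lexx.
rewrite -(HiF Ak).
apply: Hi_anti => //.
exact: (F_le f_gt0 A_gt0 DF (lexx A) Ak).
Qed.

(** Outside [r = L] the barrier is below [U] at a radius of at least [sqrt (kap b)]; inside, the cap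
    gives [W >= (eps / 2) b]. Neither bound sees [tau]. *)
Lemma Zb_bound (l t : R) (b : R) : 0 < b -> b <= t -> t <= t0 -> Zb l t <= Num.max (H (eps / 2 * b)) (U (ln (kap * b) / 2)).
Proof.
move=> b0 bt tt0; have th : 0 < t + tau by have := tau0; lra.
have [s0|s0] := leP 0 (sv l t).
 rewrite le_max; apply/orP; right; apply: le_trans (Zb_leU l th tt0) _; apply: U_ni.
 have : ln (kap * b) <= ln (kap * (t + tau)).
  rewrite ler_ln ?posrE ?mulr_gt0//; apply: ler_wpM2l; first exact: ltW.
  by have := tau0; lra.
 by move: s0; rewrite /sv; lra.
have ll : l < ls.
 rewrite ltNge; apply/negP => h; have h1 : ls - 1 <= l by lra.
 by have := sv_far h1 th tt0; have := s10; lra.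
rewrite le_max; apply/orP; left; rewrite /Zb ll.
have /andP[h3 h4] := Wb_wm (ltW ll) th tt0; have v0 := V0 (ltW ll).
apply: Hi_anti; [by rewrite mulr_gt0// divr_gt0| |by have := wmA; lra].
have h1 : V l * (1 + eps * gi l t) <= Wb l t.
 by rewrite /Wb ler_pM2l// lerD2l ler_pM2l// /Gb !le_max lexx !orbT.
apply: le_trans h1.
have -> : V l * (1 + eps * gi l t) = (1 + eps) * V l + eps / 2 * (t + tau).
 by rewrite /gi /gin max_l ?(ltW s0)// mulr0 subr0; field; rewrite gt_eqF.
have : eps / 2 * b <= eps / 2 * (t + tau).
 by apply: ler_wpM2l; [rewrite divr_ge0// ltW|have := tau0; lra].
have : 0 <= (1 + eps) * V l by rewrite mulr_ge0 ?ltW//; have := eps0; lra.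
lra.
Qed.

Lemma Zb_cont (l t : R) : 0 < t + tau -> t < t0 -> {for (l, t), continuous (fun x : R * R => Zb x.1 x.2)}.
Proof.
move=> th tt1; pose y : R * R := (l, t).
have c1l : {for y, continuous (fun x : R * R => x.1)} by exact: cvg_fst.
have c2t : {for y, continuous (fun x : R * R => x.2)} by exact: cvg_snd.
have ctt := cfD c2t (cfC tau y); have nt := cf_gt ctt th; have nt0 := cf_lt c2t tt1.
have [ll|ll] := leP ls l.
 have nl : \forall x \near y, ls - 1 < x.1 by apply: (cf_gt c1l); rewrite /y /=; lra.
 apply: (@near_cont_at R (R * R)%type (fun x : R * R => U x.1)); last exact: (cfcomp (der_cont (DU l)) c1l).
 near=> x; rewrite Zb_far//; [near: x => //|by apply: ltW; near: x|].
 by apply: sv_far; [apply: ltW; near: x|near: x|apply: ltW; near: x].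
have nl : \forall x \near y, x.1 < ls := cf_lt c1l ll.
have v0 := V0 (ltW ll); have v2 : 2 * V y.1 != 0 by rewrite mulf_neq0// gt_eqF.
have cV := cfcomp (P := V) (x := y) (der_cont (DV (le_trans (ltW ll) lsA))) c1l.
have kt : 0 < kap * (y.2 + tau) by rewrite mulr_gt0.
have csv := cfB c1l (cfM (cfcomp (g := fun x : R * R => kap * (x.2 + tau)) (x := y) (continuous_ln kt) (cfM (cfC kap y) ctt)) (cfC 2^-1 y)).
have cgi := cfB (cfD (cfC 1 y) (cfM ctt (cfV (g := fun x => 2 * V x.1) (x := y) v2 (cfM (cfC 2 y) cV)))) (cfM (cfC Pp y) (cfmax (cfC 0 y) csv)).
have cgt : continuous gt.
 move=> s; apply: cvgM; first exact: der_cont (X_der s).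
 apply: (@continuous_comp R R R clp (fun s => cos (nu * s))); last exact: der_cont (cos_der _).
 apply: (@continuous_max R R (fun=> - s1) (fun s => Num.min s1 s) s); first exact: cvg_cst.
 by apply: (@continuous_min R R (fun=> s1) id s); [exact: cvg_cst|exact: cvg_id].
have cG := cfmax (cfC 0 y) (cfmax (cfcomp (P := gt) (g := fun x : R * R => sv x.1 x.2) (x := y) (@cgt _) csv) cgi).
have cW : {for y, continuous (fun x => Wb x.1 x.2)} := cfM cV (cfD (cfC 1 y) (cfM (cfC eps y) cG)).
have /andP[W0 W1] := Wb_wm (ltW ll) th (ltW tt1); have wA' := le_lt_trans W1 wmA.
apply: (@near_cont_at R (R * R)%type (fun x : R * R => H (Wb x.1 x.2))).
 by near=> x; rewrite /Zb ifT//; near: x.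
exact: (cfcomp (P := H) (g := fun x : R * R => Wb x.1 x.2) (x := y) (der_cont (Hi_derive W0 wA')) cW).
Unshelve. all: by end_near. Qed.

End shift.

Lemma barrier_all : exists Z, barrier_family nn f U t0 Z.
Proof.
have st (tau t : R) : 0 < tau -> 0 <= t -> 0 < t + tau by lra.
exists (fun tau => Zb tau); split.
- by move=> tau h1 h2 l t h3 h4; apply: Zb_cont => //; exact: st.
- by move=> tau h1 h2 l t h3 h4; exact: Zb_test.
- by move=> tau h1 h2 l t h3 h4; apply: Zb_ge0 => //; [exact: st|exact: ltW].
- move=> k.
 pose C := 4 * kap * expR (2 * s1) / zs + 1.
 have C0 : 0 < C.
  have : 0 <= 4 * kap * expR (2 * s1) / zs by rewrite divr_ge0 ?(ltW zs0)// !mulr_ge0 ?expR_ge0 ?(ltW kap0).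
  by rewrite /C; lra.
 have Fk : 0 < F (Num.max k A) by apply: F_gt0; rewrite le_max lexx orbT.
 have tp : 0 < Num.min t0 (F (Num.max k A) / C) by rewrite lt_min t00 divr_gt0.
 exists (Num.min t0 (F (Num.max k A) / C)); split => //; first by rewrite ge_min lexx.
 move=> l; apply: Zb_init => //; first by rewrite ge_min lexx.
 by rewrite -/C mulrC -ler_pdivlMr// ge_min lexx orbT.
- move=> b b0; exists (Num.max (H (eps / 2 * b)) (U (ln (kap * b) / 2))).
 by move=> tau l t h1 h2 h3 h4; apply: Zb_bound => //; exact: ltW.
Qed.

End barrier.

Variable q : R.
Hypotheses (nn3 : 3 <= nn) (q1 : 1 <= q) (qS : q < (nn + 2) / 4)
 (JL : (nn + 2 - 4 * q) ^+ 2 < 4 * (2 * nn - 4 * q))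
 (prof : forall e : R, 0 < e -> exists2 l0 : R, l0 <= lA &
   forall l : R, l <= l0 -> `|p l - 2| <= e /\ `|z l - (2 * nn - 4 * q)| <= e)
 (Qcv : forall e : R, 0 < e -> exists2 B : R, A <= B & forall u : R, B <= u -> `|f1 u * F u - q| <= e)
 (Qslow : forall eta : R, 0 < eta -> exists2 B : R, A <= B & forall u v : R, B <= u -> u <= v ->
   `|f1 u * F u - f1 v * F v| <= eta * (ln (F u) - ln (F v))).

(** The constants are fixed in the order [nu], [c0], [mu], [kap], [sg], [eps], [e] and [eta], [wm],
    [ls], [t0], each depending on earlier ones only. *)
Theorem barrier_exists : exists t0 Z, 0 < t0 /\ barrier_family nn f U t0 Z.
Proof.
have q1' := q1; have qS' := qS; have JL' := JL; have nn3' := nn3.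
pose a := nn - 2 + 4 - 4 * q; pose zs := 2 * nn - 4 * q.
have a0 : 0 < a by rewrite /a; lra.
have zs0 : 0 < zs by rewrite /zs; lra.
(* [JL] says that the characteristic roots of the linearisation are not real; the quantity is half
   the square of their frequency. *)
have nus : 0 < (zs - a ^+ 2 / 4) / 2.
 by have -> : a = nn + 2 - 4 * q by [rewrite /a; ring]; rewrite /zs; lra.
pose nu := Num.sqrt ((zs - a ^+ 2 / 4) / 2).
have nu0 : 0 < nu by rewrite sqrtr_gt0.
have nuE : 2 * nu ^+ 2 = zs - a ^+ 2 / 4 by rewrite sqr_sqrtr ?ltW//; field.
pose s1 := pi / 2 / nu : R.
have s1E : nu * s1 = pi / 2 by rewrite /s1; field; rewrite gt_eqF.
have s10 : 0 < s1 by rewrite !divr_gt0 ?pi_gt0.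
(* [mu], and hence [m], is chosen after [c0]; as [mu <= 1], the exponent [(a + 1) / 2] is an upper
   bound of [m]. *)
pose c0 := expR (- ((a + 1) / 2 * s1)) / 8.
have c00 : 0 < c0 by rewrite divr_gt0 ?expR_gt0.
have c01 : c0 <= 1.
 have : expR (- ((a + 1) / 2 * s1)) <= 1 by rewrite -[leRHS]expR0 ler_expR oppr_le0 mulr_ge0 ?ltW//; lra.
 by rewrite /c0; lra.
pose mu := Num.min 1 (nu * c0 / 2).
have mu0 : 0 < mu by apply: min_pos => //; apply: divr_gt0 => //; exact: mulr_gt0.
have mu1 : mu <= 1 by rewrite ge_min lexx.
have muc : 2 * mu <= nu * c0.
 have : mu <= nu * c0 / 2 by rewrite ge_min lexx orbT.
 lra.
pose m := (a + mu) / 2; pose c1 := mu * nu.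
have m0 : 0 < m by rewrite /m; lra.
have c10 : 0 < c1 by rewrite mulr_gt0.
have mE : 2 * m = a + mu by rewrite /m; field.
have c0m : 8 * c0 <= expR (- (m * s1)).
 rewrite /c0 mulrC divfK// ler_expR lerN2; apply: ler_wpM2r; first exact: ltW.
 by rewrite /m; lra.
have B0 : 0 < m + nu by rewrite addr_gt0.
pose kap := c1 / (4 * expR (2 * s1) * (m + nu)).
have kap0 : 0 < kap by rewrite divr_gt0 ?mulr_gt0 ?expR_gt0.
have kapc : 8 * (kap * expR (2 * s1) / 2 * (m + nu)) <= c1.
 by rewrite /kap le_eqVlt; apply/orP; left; apply/eqP; field; rewrite !gt_eqF ?expR_gt0.
pose Gam := 1 + zs / kap; pose Ag := 2 * Gam.
have Ag0 : 0 < Ag by rewrite mulr_gt0// addr_gt0// divr_gt0.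
have [sg [sg0 sgs sgP]] : exists sg : R, [/\ 0 < sg, sg < s1 &
  forall s : R, 0 <= s -> s <= sg -> 1 / 2 < expR (- (m * s)) * cos (nu * s)].
 have c : {for 0, continuous (fun s => expR (- (m * s)) * cos (nu * s))}.
  have D := @der_comp R (@cos R) (fun s => nu * s) 0 _ _ (is_derive_cos _) (der_line nu 0).
  exact: der_cont (der_mul (der_exp (der_opp (der_line m 0))) D).
 have h12 : 1 / 2 < expR (- (m * 0)) * cos (nu * 0) by rewrite !mulr0 oppr0 expR0 cos0; lra.
 have /cvgr_gt/(_ _ h12)[r /= r0 Hr] := c.
 have mp : 0 < Num.min r s1 by exact: min_pos.
 have mr : Num.min r s1 <= r by rewrite ge_min lexx.
 have ms : Num.min r s1 <= s1 by rewrite ge_min lexx orbT.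
 have mh : Num.min r s1 / 2 < Num.min r s1 by rewrite ltr_pdivrMr// ltr_pMr// ltr1n.
 exists (Num.min r s1 / 2); split; [exact: divr_gt0|exact: lt_le_trans ms|move=> s h1 h2].
 by apply: Hr; rewrite /ball_/= sub0r normrN ger0_norm//; exact: le_lt_trans h2 (lt_le_trans mh mr).
pose Pp := 2 * Gam / sg; pose L := Ag * expR (m * s1).
have L0 : 0 < L by rewrite mulr_gt0 ?expR_gt0.
have D0 : 0 < 8 * ((q + 1) * (m + nu) ^+ 2 * L).
 apply: mulr_gt0 => //; apply: mulr_gt0 => //; apply: mulr_gt0; first by lra.
 exact: exprn_gt0.
pose eps := Num.min 1 (Num.min L^-1 (c1 / (8 * ((q + 1) * (m + nu) ^+ 2 * L)))).
have eps0 : 0 < eps by apply: min_pos => //; apply: min_pos; [rewrite invr_gt0|exact: divr_gt0].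
have eps1 : eps <= 1 by rewrite ge_min lexx.
have epsL : eps * L <= 1 by rewrite -ler_pdivlMr// div1r !ge_min lexx !orbT.
have epsc : 8 * ((q + 1) * eps * (m + nu) ^+ 2 * L) <= c1.
 rewrite (_ : 8 * _ = eps * (8 * ((q + 1) * (m + nu) ^+ 2 * L))); last by clear; ring.
 by rewrite -ler_pdivlMr// !ge_min lexx !orbT.
pose e := Num.min 1 (Num.min (zs / 2) (Num.min (c1 / 8) (Num.min (c1 / (96 * q * (m + nu))) (zs * eps / 144)))).
have q0 : 0 < q := lt_le_trans ltr01 q1.
have e0 : 0 < e.
 apply: min_pos => //; apply: min_pos; first exact: divr_gt0.
 apply: min_pos; first exact: divr_gt0.
 by apply: min_pos; apply: divr_gt0 => //; rewrite !mulr_gt0.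
have e1 : e <= 1 by rewrite ge_min lexx.
have ez : 2 * e <= zs by rewrite mulrC -ler_pdivlMr// !ge_min lexx !orbT.
have ec : 8 * e <= c1 by rewrite mulrC -ler_pdivlMr// !ge_min lexx !orbT.
have ep : 8 * (12 * q * e * (m + nu)) <= c1.
 rewrite (_ : 8 * _ = e * (96 * q * (m + nu))); last by clear; ring.
 by rewrite -ler_pdivlMr ?mulr_gt0// !ge_min lexx !orbT.
have ei : 72 * (2 * e) <= zs * eps.
 rewrite (_ : 72 * _ = e * 144); last by clear; ring.
 by rewrite -ler_pdivlMr// !ge_min lexx !orbT.
pose eta := c1 / 144.
have eta0 : 0 < eta by rewrite divr_gt0.
have etac : 8 * (18 * eta) <= c1 by rewrite /eta le_eqVlt; apply/orP; left; apply/eqP; field.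
have [l1 l1A Hl1] := prof e0.
have [B1 AB1 HB1] := Qcv e0; have [B2 AB2 HB2] := Qslow eta0.
(* The added 1 makes [wm < F A] strict, as needed to differentiate [Hi] on the range of [Wb]. *)
pose Bm := Num.max B1 B2 + 1.
have hB1 : B1 <= Num.max B1 B2 by rewrite le_max lexx.
have hB2 : B2 <= Num.max B1 B2 by rewrite le_max lexx orbT.
have ABm : A < Bm by apply: le_lt_trans (le_trans AB1 hB1) _; rewrite ltrDl.
pose wm := F Bm.
have wm0 : 0 < wm by apply: F_gt0; exact: ltW.
have wmA : wm < F A by exact: (F_dec f_gt0 A_gt0 DF (lexx A) ABm).
have Hw w : 0 < w -> w <= wm -> [/\ B1 <= Hi w, B2 <= Hi w & F (Hi w) = w].
 move=> w0 ww; have [h1 h2] := HiP w0 (le_trans ww (ltW wmA)).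
 have := Hi_anti w0 ww (ltW wmA).
 by rewrite /wm (HiF (ltW ABm)) /Bm => h; split => //; apply: le_trans (_ : Num.max B1 B2 + 1 <= _) => //; rewrite -[leLHS]addr0 lerD.
have Q1 (w : R) : 0 < w -> w <= wm -> `|f1 (Hi w) * w - q| <= e.
 by move=> w0 ww; have [h1 _ h2] := Hw _ w0 ww; have := HB1 _ h1; rewrite h2.
have Q2 (v w : R) : 0 < v -> v <= w -> w <= wm ->
  `|f1 (Hi v) * v - f1 (Hi w) * w| <= eta * (ln w - ln v).
 move=> v0 vw ww; have w0 := lt_le_trans v0 vw.
 have [_ h1 h2] := Hw _ w0 ww; have [_ _ h4] := Hw _ v0 (le_trans vw ww).
 have h := Hi_anti v0 vw (le_trans ww (ltW wmA)).
 by have := HB2 _ _ h1 h; rewrite h2 h4 distrC.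
have wz : 0 < wm * zs / 8 by rewrite divr_gt0// mulr_gt0.
have two0 : (0 : R) < 2 by [].
have [l2 Hl2] := exp_small two0 wz.
pose ls := Num.min l1 l2.
have lsl1 : ls <= l1 by rewrite ge_min lexx.
have lsl2 : ls <= l2 by rewrite ge_min lexx orbT.
have lsA : ls <= lA by exact: le_trans l1A.
pose t0 := Num.min (wm / 4) (expR (2 * (ls - 1 - s1)) / (2 * kap)).
have t00 : 0 < t0.
 by apply: min_pos; apply: divr_gt0 => //; [exact: expR_gt0|exact: mulr_gt0].
have Vwm (l : R) : l <= ls -> 2 * F (U l) + 2 * t0 <= wm.
 move=> ll; have [_] := Hl1 l (le_trans ll lsl1); rewrite -/zs ler_norml => /andP[h1 _].
 have lA' : l <= lA by exact: le_trans lsA.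
 have V0 : 0 < F (U l) by apply: F_gt0; exact: UA.
 have h2 := Hl2 l (le_trans ll lsl2); rewrite -(zE lA') in h2.
 by apply: (slope_bound zs0 V0 ez h1 h2); rewrite ge_min lexx.
have t0ls : ln (kap * (2 * t0)) / 2 + s1 <= ls - 1.
 have k2 : 0 < kap * (2 * t0) by apply: mulr_gt0 => //; exact: mulr_gt0.
 apply: half_shift; rewrite -[leRHS]expRK ler_ln ?posrE ?expR_gt0//.
 by apply: scale_le => //; rewrite ge_min lexx orbT.
have [Z HZ] := @barrier_all q zs a nu s1 c0 mu m c1 kap Gam Ag sg Pp eps e eta ls wm t0 q1 zs0 erefl nu0 m0 nuE s1E c00 c01 c0m mu0 muc mE erefl
 kap0 kapc erefl erefl sg0 sgs sgP erefl eps0 eps1 epsL epsc e1 ez ec ep ei (ltW eta0) etac lsA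
 (fun l ll => Hl1 l (le_trans ll lsl1)) wmA Q1 Q2 t00 Vwm t0ls.
by exists t0, Z.
Qed.

End barrier_function.

(** * Derivative tests at a maximum *)

Section maximum_tests.
Variable R : realType.

Lemma left_max_der (G : R -> R) (t g : R) : is_derive t 1 G g ->
 (\forall s \near t, s <= t -> G s <= G t) -> 0 <= g.
Proof.
move=> D [r /= r0 Hr]; rewrite leNgt; apply/negP => g0.
have D' : is_derive (- t) 1 (fun s => G (- s)) (- g).
 have D0 : is_derive (- - t) 1 G g by rewrite opprK.
 by apply: der_val (@der_comp R G (fun s => - s) (- t) _ _ D0 (der_opp (der_id _))) _; rewrite mulrN1.
have ng : 0 < - g by rewrite oppr_gt0.
have [h /andP[h0 hr]] := pos_der_right D' ng r0.
rewrite opprK opprD opprK addrC ltNge Hr//=.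
 by rewrite opprB addrC subrK gtr0_norm.
by rewrite gerBl ltW.
Qed.

(** At the maximum [G1] vanishes; with [g2 > 0] it would be positive just to the right, and the mean
    value theorem would contradict maximality. A second derivative is used at the point 0 alone. *)
Lemma max_second_der (G G1 : R -> R) (g2 : R) : (\forall s \near (0 : R), is_derive (s : R) 1 G (G1 s)) ->
 is_derive (0 : R) 1 G1 g2 -> (\forall s \near (0 : R), G s <= G 0) -> g2 <= 0.
Proof.
move=> ND D2 NM.
have D0 := nbhs_singleton ND.
have G10 : G1 0 = 0.
 apply/eqP; rewrite eq_le; apply/andP; split; last first.
  by apply: left_max_der D0 _; apply: filterS NM.
 rewrite leNgt; apply/negP => h; have [r /= r0 Hr] := NM.
 have [e /andP[e0 er]] := pos_der_right D0 h r0.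
 by rewrite addr0 ltNge Hr//= sub0r normrN gtr0_norm.
rewrite leNgt; apply/negP => g0.
have /is_derive_cvgP C := D2.
have H : \forall h \near 0^', 0 < h^-1 * (G1 (h + 0) - G1 0).
 by have /cvgrPdist_lt/(_ _ g0) := C; apply: filterS => h; rewrite ltr_distlC => /andP[]; rewrite subrr.
have [r1 /= r10 Hr1] := H; have [r2 /= r20 Hr2] := ND; have [r3 /= r30 Hr3] := NM.
pose h := Num.min r1 (Num.min r2 r3) / 2.
have m0 : 0 < Num.min r1 (Num.min r2 r3) by rewrite !lt_min r10 r20.
have m1 : Num.min r1 (Num.min r2 r3) <= r1 by rewrite ge_min lexx.
have m2 : Num.min r1 (Num.min r2 r3) <= r2 by rewrite !ge_min lexx orbT.
have m3 : Num.min r1 (Num.min r2 r3) <= r3 by rewrite !ge_min lexx !orbT.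
have h0 : 0 < h by rewrite /h; lra.
have hM : h < Num.min r1 (Num.min r2 r3) by rewrite /h; lra.
have [|c [c0 ch e]] := @MVT_itv R G G1 0 h h0.
 by move=> s s0 sh; apply: Hr2; rewrite /= sub0r normrN ger0_norm//; lra.
have : 0 < G1 c.
 have := Hr1 c; rewrite /= sub0r normrN gtr0_norm// addr0 G10 subr0 => /(_ _ _).
 by rewrite pmulr_rgt0 ?invr_gt0//; apply; [lra|rewrite gt_eqF].
have : G h <= G 0 by apply: Hr3; rewrite /= sub0r normrN gtr0_norm//; lra.
rewrite -subr_le0 e subr0 => h1 h2.
by move: h1; rewrite leNgt mulr_gt0.
Qed.

Lemma max_second_derv (n : nat) (G G1 : 'rV[R]_n -> R) (x v : 'rV[R]_n) (g2 : R) :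
 (\forall y \near x, is_derive y v G (G1 y)) ->
 is_derive x v G1 g2 -> (\forall y \near x, G y <= G x) -> g2 <= 0.
Proof.
move=> ND D2 NM.
have c : {for 0, continuous (fun s : R => s *: v + x)}.
 by apply: (@cvgD _ _ _ _ _ (fun s : R => s *: v) (fun=> x)); [apply: cvgZr_tmp; exact: cvg_id|exact: cvg_cst].
have e0 : 0 *: v + x = x by rewrite scale0r add0r.
have c' : (fun s : R => s *: v + x) @ (0 : R) --> x by rewrite -[X in _ --> X]e0; exact: c.
apply: (@max_second_der (fun s => G (s *: v + x)) (fun s => G1 (s *: v + x))).
- have N2 : \forall s \near (0 : R), is_derive (s *: v + x) v G (G1 (s *: v + x)) by exact: c' ND.
 apply: filterS N2 => s /is_derive_lineP D.
 apply/is_derive_shiftP; move: D; congr is_derive; apply/funext => r.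
 by rewrite scalerDl addrA.
- by move/is_derive_lineP: D2.
- by rewrite e0; exact: c' NM.
Qed.

End maximum_tests.

(** * Comparison away from the origin *)

Section comparison.
Variables (R : realType) (n : nat) (f : R -> R) (w wt : 'rV[R]_n -> R -> R) (dw ddw : 'I_n -> 'rV[R]_n -> R -> R)
 (Z : R -> R -> R) (T M : R).
Hypotheses (n2 : (2 < n)%N)
 (cw : forall (x : 'rV[R]_n) (t : R), 0 <= t -> t < T -> {for (x, t), jcont w})
 (wM : forall (x : 'rV[R]_n) (t : R), 0 <= t -> t < T -> w x t <= M)
 (Dwt : forall (x : 'rV[R]_n) (t : R), 0 < t -> t < T -> is_derive t 1 (w x) (wt x t))
 (Dw : forall i (x : 'rV[R]_n) (t : R), 0 < t -> t < T -> is_derive x (evec R i) (w ^~ t) (dw i x t))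
 (Ddw : forall i (x : 'rV[R]_n) (t : R), 0 < t -> t < T -> is_derive x (evec R i) (dw i ^~ t) (ddw i x t))
 (sub : forall (x : 'rV[R]_n) (t : R), x != 0 -> 0 < t -> t < T -> wt x t - \sum_i ddw i x t <= f (Z (ell x) t))
 (cZ : forall l t : R, 0 <= t -> t < T -> {for (l, t), continuous (fun p : R * R => Z p.1 p.2)})
 (Zt : forall l t : R, 0 < t -> t < T -> test_super n%:R f Z l t)
 (Z0 : forall l t : R, 0 <= t -> t < T -> 0 <= Z l t)
 (init : forall x : 'rV[R]_n, x != 0 -> w x 0 <= Z (ell x) 0).

Local Notation N := (n%:R : R).
(** The penalty [|x|^(2-N) + 1 + |x|^2] in logarithmic form: the harmonic term keeps a maximum off
    the origin, the quadratic one keeps it bounded, and the Laplacian is the constant [2 N]. *)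
Definition Bl (l : R) : R := expR (- (N - 2) * l) + 1 + expR (2 * l).
Definition Bl1 (l : R) : R := - (N - 2) * expR (- (N - 2) * l) + 2 * expR (2 * l).
Definition Bl2 (l : R) : R := (N - 2) ^+ 2 * expR (- (N - 2) * l) + 4 * expR (2 * l).

Lemma Bl_derive (l : R) : is_derive l 1 Bl (Bl1 l).
Proof.
apply: der_val (der_add (der_add (exp_lin_derive _ l) (der_cst 1 l)) (exp_lin_derive 2 l)) _.
by rewrite addr0.
Qed.

Lemma Bl1_derive (l : R) : is_derive l 1 Bl1 (Bl2 l).
Proof.
apply: der_val (der_add (der_scale _ (exp_lin_derive _ l)) (der_scale _ (exp_lin_derive 2 l))) _.
by rewrite /Bl2; ring.
Qed.

Lemma Bl_gt0 l : 0 < Bl l.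
Proof. by rewrite /Bl; have := expR_gt0 (- (N - 2) * l); have := expR_gt0 (2 * l); lra. Qed.

(** The time slope [2 N + 1] exceeds the Laplacian of the penalty by 1, which makes the inequality
    at a maximum strict. *)
Let Phi d (x : 'rV[R]_n) (t : R) : R := w x t - Z (ell x) t - d * (Bl (ell x) + (2 * N + 1) * t).

Lemma Phi_cont (d : R) (x : 'rV[R]_n) (t : R) : x != 0 -> 0 <= t -> t < T ->
 {for (x, t), jcont (Phi d)}.
Proof.
move=> x0 t0 tT.
have cf : {for (x, t), continuous (fun p : 'rV[R]_n * R => p.1)} by exact: cvg_fst.
have cs : {for (x, t), continuous (fun p : 'rV[R]_n * R => p.2)} by exact: cvg_snd.
have cl : {for (x, t), continuous (fun p : 'rV[R]_n * R => ell p.1)}.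
 exact: (@continuous_comp _ _ _ (fun p : 'rV[R]_n * R => p.1) (@ell R n) (x, t) cf (ell_cont x0)).
have cz : {for (x, t), continuous (fun p : 'rV[R]_n * R => Z (ell p.1) p.2)}.
 have cp := @cont_pair ('rV[R]_n * R)%type R R (fun p => ell p.1) (fun p => p.2) (x, t) cl cs.
 have H := (@continuous_comp ('rV[R]_n * R)%type (R * R)%type R (fun p => (ell p.1, p.2)) (fun p => Z p.1 p.2) (x, t) cp (@cZ (ell x) t t0 tT)); exact: H.
have cb : {for (x, t), continuous (fun p : 'rV[R]_n * R => Bl (ell p.1))}.
 exact: (@continuous_comp _ _ _ (fun p : 'rV[R]_n * R => ell p.1) Bl (x, t) cl (der_cont (Bl_derive _))).
have cc (c : R) : {for (x, t), continuous (fun _ : 'rV[R]_n * R => c)} by exact: cvg_cst.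
have ct : {for (x, t), continuous (fun p : 'rV[R]_n * R => (2 * N + 1) * p.2)}.
 exact: (@cvgM _ _ _ _ (fun=> 2 * N + 1) (fun p => p.2) _ _ (cc _) cs).
have cB : {for (x, t), continuous (fun p : 'rV[R]_n * R => d * (Bl (ell p.1) + (2 * N + 1) * p.2))}.
 apply: (@cvgM _ _ _ _ (fun=> d) (fun p : 'rV[R]_n * R => Bl (ell p.1) + (2 * N + 1) * p.2)); first exact: cc.
 exact: (@cvgD _ _ _ _ _ (fun p : 'rV[R]_n * R => Bl (ell p.1)) _ _ _ cb ct).
by apply: cvgB => //; apply: cvgB => //; exact: cw.
Qed.

Let N3 : 3 <= N. Proof. by rewrite (ler_nat R 3). Qed.

(** At a maximum of [Phi] the test functions of [Z] take the place of [Z]. The first derivative in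
    time and the second derivatives in space bound [wt - sum ddw] from below by [f(Z) + d], against
    [sub]. *)
Lemma no_max (d tb : R) (x : 'rV[R]_n) (t : R) : 0 < d -> tb < T -> x != 0 -> 0 < t -> t <= tb ->
 (forall (y : 'rV[R]_n) (s : R), y != 0 -> 0 <= s -> s <= tb -> Phi d y s <= Phi d x t) -> False.
Proof.
move=> d0 tbT x0 t0 ttb mx; have tT : t < T by lra.
have [P [P1 [Tm [P2 [dt [NP [DP1 DT] NT [PE TE] S]]]]]] := Zt (ell x) t0 tT.
have h1 : 0 <= wt x t - dt - d * (2 * N + 1).
 apply: (@left_max_der R (fun s => w x s - Tm s - d * (Bl (ell x) + (2 * N + 1) * s)) t).
  apply: der_val (der_sub (der_sub (Dwt x t0 tT) DT) (der_scale d (der_add (der_cst _ _) (der_line _ t)))) _.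
  by rewrite add0r.
 near=> s => st.
 have s0 : 0 <= s by apply: ltW; near: s; exact: lt_nbhsr.
 have := mx x s x0 s0 (le_trans st ttb); rewrite /Phi -TE.
 have : Z (ell x) s <= Tm s by near: s.
 lra.
have h2 i : ddw i x t - ((P2 + d * Bl2 (ell x)) * (x ord0 i / rho x) ^+ 2 +
  (P1 (ell x) + d * Bl1 (ell x)) * ((rho x)^-1 - 2 * x ord0 i ^+ 2 / rho x ^+ 2)) <= 0.
 have cl := ell_cont x0.
 have NPx : \forall y \near x, Z (ell y) t <= P (ell y) /\ is_derive (ell y) 1 P (P1 (ell y)).
  exact: cl NP.
 apply: (@max_second_derv R n (fun y => w y t - (P (ell y) + d * Bl (ell y)))
   (fun y => dw i y t - (P1 (ell y) + d * Bl1 (ell y)) * (y ord0 i / rho y)) x (evec R i)).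
 - near=> y.
  have y0 : y != 0 by near: y; exact: near_neq0.
  have [_ DP] : Z (ell y) t <= P (ell y) /\ is_derive (ell y) 1 P (P1 (ell y)) by near: y.
  have D := radial1 i y0 (der_add DP (der_scale d (Bl_derive (ell y)))).
  by have := derv_add (Dw i y t0 tT) (derv_scale (-1) D); under eq_fun do rewrite mulN1r; rewrite mulN1r.
 - have D := radial2 i x0 (der_add DP1 (der_scale d (Bl1_derive (ell x)))).
  by have := derv_add (Ddw i x t0 tT) (derv_scale (-1) D); under eq_fun do rewrite mulN1r; rewrite mulN1r.
 - near=> y.
  have y0 : y != 0 by near: y; exact: near_neq0.
  have [hP _] : Z (ell y) t <= P (ell y) /\ is_derive (ell y) 1 P (P1 (ell y)) by near: y.
  by have := mx y t y0 (ltW t0) ttb; rewrite /Phi -PE; lra.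
have h3 : \sum_i ddw i x t <= (P2 + d * Bl2 (ell x) + (N - 2) * (P1 (ell x) + d * Bl1 (ell x))) / rho x.
 rewrite -radial_sum//; last by apply: leq_trans n2.
 by apply: ler_sum => i _; rewrite -subr_le0.
have r0 := rho_gt0 x0; have eE := exp2_ell x0.
have e2 : expR (- 2 * ell x) = (rho x)^-1 by rewrite mulNr expRN eE.
have h4 : (P2 + d * Bl2 (ell x) + (N - 2) * (P1 (ell x) + d * Bl1 (ell x))) / rho x =
  expR (- 2 * ell x) * (P2 + (N - 2) * P1 (ell x)) + d * (2 * N).
 by rewrite e2 /Bl2 /Bl1 eE; field; rewrite gt_eqF.
by have := sub x0 t0 tT; lra.
Unshelve. all: by end_near. Qed.

Lemma rho_small_big (d : R) : 0 < d -> exists r1 r2 : R, 0 < r1 /\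
 forall x : 'rV[R]_n, x != 0 -> (rho x < r1 \/ r2 < rho x) -> M < d * Bl (ell x).
Proof.
move=> d0; pose M1 := `|M| + 1.
have M10 : 0 < M1 by rewrite /M1; have := normr_ge0 M; lra.
have MM : M < M1 by rewrite /M1; have := ler_norm M; lra.
have n20 : 0 < N - 2 by have := N3; lra.
have dM : 0 < d / M1 by rewrite divr_gt0.
have [l0 H0] := exp_small n20 dM.
exists (expR (2 * l0)), (M1 / d); split; first exact: expR_gt0.
move=> x x0; rewrite -exp2_ell// => -[h|h].
 have hl : ell x <= l0 by move: h; rewrite ltr_expR; lra.
 have h1 := H0 _ hl.
 have : M1 <= d * expR (- (N - 2) * ell x).
  rewrite mulNr expRN ler_pdivlMr ?expR_gt0//.
  by move: h1; rewrite ler_pdivlMr// mulrC.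
 rewrite /Bl; have := expR_gt0 (2 * ell x).
 by set E := expR _; set E' := expR _ => h2 h3; nra.
move: h; rewrite ltr_pdivrMr// => h.
rewrite /Bl; have := expR_gt0 (- (N - 2) * ell x).
by move: h; set E := expR _; set E' := expR _ => h2 h3; nra.
Qed.

(** The right side of [sub] is [f] of [Z], not of [w]: in the iteration the source is [f] of the
    preceding iterate, already known to lie below [Z]. Hence no Lipschitz bound for [f] enters. *)
Theorem comparison (x : 'rV[R]_n) (t : R) : x != 0 -> 0 <= t -> t < T -> w x t <= Z (ell x) t.
Proof.
move=> x0 t0 tT; rewrite leNgt; apply/negP => lt.
pose b := Bl (ell x) + (2 * N + 1) * t.
have b0 : 0 < b.
 have : 0 <= (2 * N + 1) * t by rewrite mulr_ge0//; have := N3; lra.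
 by have := Bl_gt0 (ell x); rewrite /b; lra.
(* The penalty takes half of the supposed gap, so [Phi] is still positive at [(x, t)]. *)
pose d := (w x t - Z (ell x) t) / (2 * b).
have d0 : 0 < d by rewrite divr_gt0 ?subr_gt0// mulr_gt0.
have P0 : 0 < Phi d x t.
 rewrite /Phi -/b (_ : d * b = (w x t - Z (ell x) t) / 2); first by lra.
 by rewrite /d; field; rewrite gt_eqF.
have [r1 [r2 [r10 Hr]]] := rho_small_big d0.
have Phi_neg (y : 'rV[R]_n) (s : R) : y != 0 -> 0 <= s -> s <= t -> (rho y < r1 \/ r2 < rho y) -> Phi d y s < 0.
 move=> y0 s0 st hr; have sT : s < T by lra.
 have h1 := Hr y y0 hr; have h2 := wM y s0 sT; have h3 := Z0 (ell y) s0 sT.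
 have h4 : 0 <= d * ((2 * N + 1) * s).
  apply: mulr_ge0; first exact: ltW.
  by apply: mulr_ge0 => //; have := N3; lra.
 by rewrite /Phi; lra.
have xr : r1 <= rho x /\ rho x <= r2.
 have PN := Phi_neg x t x0 t0 (lexx t).
 by split; rewrite leNgt; apply/negP => h; have : Phi d x t < 0 by [apply: PN; first [by left|by right]]; lra.
(* The annulus is written as a closed subset of a box, from which it inherits compactness. *)
pose K1 := [set v : 'rV[R]_n | forall i, `[- (r2 + 1), r2 + 1]%classic (v ord0 i)] `&` (@rho R n @^-1` `[r1, r2]).
have cK1 : compact K1.
 apply: compact_closedI.
  by apply: (@rV_compact _ _ (fun=> `[- (r2 + 1), r2 + 1]%classic)) => i; exact: segment_compact.
 apply: closed_comp; last exact: itv_closed.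
 by move=> y _; exact: rho_cont.
have K1P (y : 'rV[R]_n) : r1 <= rho y -> rho y <= r2 -> K1 y.
 move=> h1 h2; split => /=; last by rewrite in_itv/= h1 h2.
 move=> i; rewrite in_itv/= -ler_norml.
 have h3 : `|y ord0 i| ^+ 2 <= rho y.
  rewrite real_normK ?num_real// /rho (bigD1 i)//= lerDl.
  by apply: sumr_ge0 => j _; exact: sqr_ge0.
 have := normr_ge0 (y ord0 i); nra.
have K1n (y : 'rV[R]_n) : K1 y -> y != 0.
 by move=> [_ /=]; rewrite in_itv/= => /andP[h _]; apply: rho_neq0; lra.
pose K := K1 `*` `[0, t]%classic.
have cK : compact K by apply: compact_setX => //; exact: segment_compact.
have K0 : K !=set0.
 by exists (x, t); split => /=; [apply: K1P; [exact: xr.1|exact: xr.2]|rewrite in_itv/= t0 lexx].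
have cP : {within K, continuous (fun q : 'rV[R]_n * R => Phi d q.1 q.2)}.
 apply: continuous_in_subspaceT => -[y s]; rewrite inE => -[/= /K1n y0]; rewrite in_itv/= => /andP[s0 st].
 by apply: Phi_cont => //; lra.
have [[y s]] := compact_EVT_max K0 cK cP.
rewrite inE => -[/= Ky]; rewrite in_itv/= => /andP[s0 st] mx.
have y0 := K1n _ Ky.
have mx' (y' : 'rV[R]_n) (s' : R) : y' != 0 -> 0 <= s' -> s' <= t -> Phi d y' s' <= Phi d y s.
 move=> y'0 s'0 s't.
 have Pp : 0 <= Phi d y s.
  apply: ltW; apply: lt_le_trans P0 _; apply: (mx (x, t)); rewrite inE; split => /=.
   by apply: K1P; [exact: xr.1|exact: xr.2].
  by rewrite in_itv/= t0 lexx.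
 have [h1|h1] := ltP (rho y') r1.
  by apply: le_trans Pp; apply/ltW/Phi_neg => //; left.
 have [h2|h2] := ltP r2 (rho y').
  by apply: le_trans Pp; apply/ltW/Phi_neg => //; right.
 apply: (mx (y', s')); rewrite inE; split => /=; first exact: K1P.
 by rewrite in_itv/= s'0.
have sp : 0 < s.
 rewrite lt_neqAle s0 andbT; apply/eqP => e.
 have := mx' x t x0 t0 (lexx t); rewrite -e leNgt; apply/negP; rewrite negbK.
 apply: le_lt_trans P0; rewrite /Phi mulr0 addr0.
 have := init y0; have : 0 < d * Bl (ell y) by rewrite mulr_gt0// Bl_gt0.
 lra.
exact: (@no_max d t y s d0 tT y0 sp st mx').
Qed.

End comparison.

Lemma derv_cst (R : realType) (V : normedModType R) (c : R) (x v : V) : is_derive x v (fun _ : V => c) 0.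
Proof. by split; [exact: derivable_cst|exact: derive_cst]. Qed.

(** * A twice continuously differentiable step *)

Section smooth_step.
Variable R : realType.

(** Zero up to 1 and equal to 1 from 2 on; cubes of positive parts make it twice continuously
    differentiable. *)
Definition et (s : R) : R := pp 3 (1 - pp 3 (2 - s)).
Definition et1 (s : R) : R := 9 * (pp 2 (1 - pp 3 (2 - s)) * pp 2 (2 - s)).
Definition et2 (s : R) : R := 9 * (6 * pp 1 (1 - pp 3 (2 - s)) * pp 2 (2 - s) * pp 2 (2 - s)
 - 2 * pp 2 (1 - pp 3 (2 - s)) * pp 1 (2 - s)).

Let Dk k (s : R) : is_derive s 1 (fun s => pp k.+2 (2 - s)) (- (k.+2%:R * pp k.+1 (2 - s))).
Proof.
apply: der_val (@der_comp R (pp k.+2) (fun s => 2 - s) s _ _ (pp_derive k _) (der_sub (der_cst 2 s) (der_id s))) _.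
by rewrite sub0r mulrN1.
Qed.

Let Dk2 k (s : R) : is_derive s 1 (fun s => pp k.+2 (1 - pp 3 (2 - s)))
 (k.+2%:R * pp k.+1 (1 - pp 3 (2 - s)) * (3 * pp 2 (2 - s))).
Proof.
apply: der_val (@der_comp R (pp k.+2) (fun s => 1 - pp 3 (2 - s)) s _ _ (pp_derive k _) (der_sub (der_cst 1 s) (Dk 1 s))) _.
by rewrite sub0r opprK.
Qed.

Lemma et_derive (s : R) : is_derive s 1 et (et1 s).
Proof. by apply: der_val (Dk2 1 s) _; rewrite /et1; ring. Qed.

Lemma et1_derive (s : R) : is_derive s 1 et1 (et2 s).
Proof. by apply: der_val (der_scale 9 (der_mul (Dk2 0 s) (Dk 0 s))) _; rewrite /et2; ring. Qed.

Lemma et2_cont : continuous et2.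
Proof.
move=> s.
have c2s : {for s, continuous (fun s : R => 2 - s)} by apply: cfB; [exact: cfC|exact: cvg_id].
have p k : {for s, continuous (fun s : R => pp k (2 - s))} by apply: cfcomp c2s; exact: pp_cont.
have c k : {for s, continuous (fun s : R => pp k (1 - pp 3 (2 - s)))}.
 by apply: (@cfcomp R R (pp k) (fun s => 1 - pp 3 (2 - s))); [exact: pp_cont|apply: cfB (p 3%N); exact: cfC].
have H := cfM (cfC 9 s) (cfB (cfM (cfM (cfM (cfC 6 s) (c 1%N)) (p 2%N)) (p 2%N)) (cfM (cfM (cfC 2 s) (c 2%N)) (p 1%N))).
exact: H.
Qed.

Lemma pp_le1 k s : s <= 1 -> pp k s <= 1 :> R.
Proof. by move=> s1; rewrite /pp exprn_ile1// ?le_max ?lexx// ge_max ler01 s1. Qed.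

Let inner0 s : s <= 1 -> 1 - pp 3 (2 - s) <= 0 :> R.
Proof.
move=> s1; rewrite subr_le0 ppE; last by lra.
by apply: exprn_ege1; lra.
Qed.

Lemma et_lo s : s <= 1 -> [/\ et s = 0, et1 s = 0 & et2 s = 0].
Proof. by move=> /inner0 h; rewrite /et /et1 /et2 !(pp0 _ h) !(mul0r, mulr0, subr0). Qed.

Lemma et_hi s : 2 <= s -> [/\ et s = 1, et1 s = 0 & et2 s = 0].
Proof.
move=> h; have h2 : 2 - s <= 0 by lra.
by rewrite /et /et1 /et2 !(pp0 _ h2) !(mul0r, mulr0, subr0) ppE// expr1n.
Qed.

Lemma et1_ge0 s : 0 <= et1 s.
Proof. by apply: mulr_ge0 => //; apply: mulr_ge0; exact: pp_ge0. Qed.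

Lemma et_nd s s' : s <= s' -> et s <= et s'.
Proof. by move=> h; apply: (@der_nd R et et1) => // *; [exact: et_derive|exact: et1_ge0]. Qed.

Lemma et_ge0 s : 0 <= et s. Proof. exact: pp_ge0. Qed.

Lemma et_le1 s : et s <= 1.
Proof. by apply: pp_le1; rewrite gerBl pp_ge0. Qed.

Lemma et1_bd s : `|et1 s| <= 9.
Proof.
rewrite ger0_norm ?et1_ge0//; have [/et_lo[_ -> _]//|s1] := leP s 1.
have a : pp 2 (1 - pp 3 (2 - s)) <= 1 by apply: pp_le1; rewrite gerBl pp_ge0.
have b : pp 2 (2 - s) <= 1 by apply: pp_le1; lra.
rewrite /et1 -[leRHS]mulr1 ler_pM2l// -[leRHS]mulr1.
by apply: ler_pM => //; exact: pp_ge0.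
Qed.

Lemma et2_bd s : `|et2 s| <= 72.
Proof.
have [/et_lo[_ _ ->]|s1] := leP s 1; first by rewrite normr0.
have a k : 0 <= pp k (1 - pp 3 (2 - s)) <= 1 by rewrite pp_ge0 pp_le1// gerBl pp_ge0.
have b k : 0 <= pp k (2 - s) <= 1 by rewrite pp_ge0 pp_le1//; lra.
rewrite /et2 normrM (@ger0_norm _ 9)//.
have /andP[a1 a1'] := a 1; have /andP[a2 a2'] := a 2; have /andP[b1 b1'] := b 1; have /andP[b2 b2'] := b 2.
set x := pp 1 _ in a1 a1' *; set y := pp 2 _ in b2 b2' *; set x2 := pp 2 _ in a2 a2' *; set y1 := pp 1 _ in b1 b1' *.
have h1 : 0 <= x * y * y <= 1.
 by rewrite !mulr_ge0//= -[leRHS]mulr1 ler_pM ?mulr_ge0// -[leRHS]mulr1 ler_pM.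
have h2 : 0 <= x2 * y1 <= 1 by rewrite mulr_ge0//= -[leRHS]mulr1 ler_pM.
have -> : 6 * x * y * y - 2 * x2 * y1 = 6 * (x * y * y) - 2 * (x2 * y1) by ring.
case/andP: h1 => h1 h1'; case/andP: h2 => h2 h2'.
have : `|6 * (x * y * y) - 2 * (x2 * y1)| <= 8 by rewrite ler_norml; apply/andP; split; lra.
lra.
Qed.

End smooth_step.

Lemma sqr_div (R : realType) (a r : R) : 2 * a ^+ 2 / r ^+ 2 = 2 * (a / r) ^+ 2.
Proof. by rewrite expr_div_n (mulrA 2 (a ^+ 2)). Qed.

(** * Functions on the punctured space extended by zero *)

Section punctured.
Variables (R : realType) (n : nat).
Implicit Types (H : 'rV[R]_n -> R) (x y : 'rV[R]_n).

Definition cutz H x : R := if x == 0 then 0 else H x.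

Lemma cutzE H x : x != 0 -> cutz H x = H x. Proof. by rewrite /cutz => /negbTE ->. Qed.

Lemma cutz_near H x : x != 0 -> \forall y \near x, H y = cutz H y.
Proof. by move=> x0; apply: filterS (near_neq0 x0) => y y0; rewrite cutzE. Qed.

Definition vanish0 H := exists2 r : R, 0 < r & forall y, y != 0 -> rho y < r -> H y = 0.

Lemma rho0 : rho (0 : 'rV[R]_n) = 0.
Proof. by rewrite /rho big1// => i _; rewrite mxE expr0n. Qed.

Lemma cutz_near0 H : vanish0 H -> \forall y \near (0 : 'rV[R]_n), cutz H y = 0.
Proof.
move=> [r r0 Hr].
have N : \forall y \near (0 : 'rV[R]_n), rho y < r.
 by have := @rho_cont R n 0 => /cvgr_lt; apply; rewrite rho0.
apply: filterS N => y yr; rewrite /cutz; case: eqVneq => // y0; exact: Hr.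
Qed.

Lemma cutz_cont H : (forall x, x != 0 -> {for x, continuous H}) -> vanish0 H -> continuous (cutz H).
Proof.
move=> c v x; have [->|x0] := eqVneq x 0.
 apply: (@near_cont_at R 'rV[R]_n (fun=> 0)); last exact: cst_continuous.
 by apply: filterS (cutz_near0 v) => y ->.
by apply: (@near_cont_at R 'rV[R]_n H); [exact: cutz_near|exact: c].
Qed.

Lemma cutz_derive H H1 v x : (forall x, x != 0 -> is_derive x v H (H1 x)) -> vanish0 H ->
 is_derive x v (cutz H) (cutz H1 x).
Proof.
move=> D va; have [->|x0] := eqVneq x 0.
 have -> : cutz H1 0 = 0 by rewrite /cutz eqxx.
 have D0 := @derv_cst R 'rV[R]_n 0 0 v.
 apply: (derv_near _ D0).
 by apply: filterS (cutz_near0 va) => y ->.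
by rewrite cutzE//; apply: derv_near (cutz_near H x0) (D x x0).
Qed.

End punctured.

(** Away from the diagonal the Gaussian factor compensates the blow-up at small times. The optimum
    over [s] is found through [ln y <= y - 1]. *)
Lemma heatG_sup (R : realType) (n : nat) (d : R) : (0 < n)%N -> 0 < d ->
 exists2 C : R, 0 < C & forall (s : R) (x y : 'rV[R]_n), 0 < s -> d <= enorm (x - y) -> heatG s x y <= C.
Proof.
move=> n0 d0; have N0 : 0 < n%:R :> R by rewrite ltr0n.
(* The value of [4 pi s] at the maximising time [s = d^2 / (2 n)]. *)
pose c := 2 * pi * d ^+ 2 / n%:R : R.
have c0 : 0 < c by rewrite divr_gt0// !mulr_gt0 ?pi_gt0// exprn_gt0.
exists (expR (- (n%:R / 2) * (1 + ln c))); first exact: expR_gt0.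
move=> s x y s0 dxy; have a0 : 0 < 4 * pi * s by rewrite !mulr_gt0 ?pi_gt0.
rewrite /heatG /powR gt_eqF// -expRD ler_expR.
have h1 : - enorm (x - y) ^+ 2 / (4 * s) <= - d ^+ 2 / (4 * s).
 rewrite ler_pM2r ?invr_gt0 ?mulr_gt0// lerN2 ler_pXn2r// ?nnegrE ?(ltW d0)//.
 exact: le_trans (ltW d0) dxy.
have h2 : ln (c / (4 * pi * s)) <= c / (4 * pi * s) - 1.
 have p : -1 < c / (4 * pi * s) - 1 by rewrite ltrBrDl subrr divr_gt0.
 by have := le_ln1Dx p; rewrite addrC subrK.
rewrite lnM ?posrE ?invr_gt0// lnV ?posrE// in h2.
have h3 : - d ^+ 2 / (4 * s) = - (n%:R / 2) * (c / (4 * pi * s)).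
 by rewrite /c; move: (n%:R) N0 => N N0; have := pi_gt0 R; move: (pi : R) => P P0; field; rewrite !gt_eqF.
have h4 : (n%:R / 2) * (ln c - ln (4 * pi * s)) <= (n%:R / 2) * (c / (4 * pi * s) - 1).
 by apply: ler_wpM2l => //; rewrite divr_ge0// ltW.
lra.
Qed.

(** * Monotone limits and Gaussian bounds of heat potentials *)

Section heat_bounds.
Variables (R : realType) (n : nat).
Local Notation E m := (mst (lebN R m)).

Lemma heatG2_wint (q s : R) (x : 'rV[R]_n) : 0 < q -> 0 < s ->
 wint (lebRN R n) (fun y : E n => heatG q x (torow y) * heatG s (torow y) 0).
Proof.
move=> q0 s0; apply/integrableP; split.
 apply/measurable_EFinP/measurable_funM; first exact: measurable_heatGy.
 under eq_fun do rewrite heatGC//; exact: measurable_heatGy.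
rewrite (eq_integral (fun y => (heatG q x (torow y) * heatG s (torow y) 0)%:E)).
 by rewrite heatG_semig// ltry.
move=> y _ /=; rewrite ger0_norm//; apply: mulr_ge0; exact: heatG_ge0.
Qed.

Lemma measurable_Khy (q : R) (x : E n) : measT (fun y : E n => Kh q x y).
Proof.
have H := @measK R _ (E n) (@Kh R n) (@measurable_Kh R n) _ (E n) (fun=> q) (fun=> x) id.
by apply: H.
Qed.

Lemma Pe_cvg (q : R) (x : E n) (g_ : nat -> E n -> R) (g : E n -> R) :
 (forall k, measT (g_ k)) -> (forall k y, 0 <= g_ k y) ->
 (forall y k k', (k <= k')%N -> g_ k y <= g_ k' y) -> (forall y, g_ k y @[k --> \oo] --> g y) ->
 (PeE q (g_ k) x @[k --> \oo] --> PeE q g x)%E.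
Proof.
move=> mg g0 nd cv; rewrite /PeE /Pe.
have -> : (\int[lebRN R n]_y (Kh q x y * g y)%:E = \int[lebRN R n]_y limn (fun k => (Kh q x y * g_ k y)%:E))%E.
 apply: eq_integral => y _; apply/esym/cvg_lim => //.
 by apply: cvg_EFin; [exact: nearW|apply: cvgM; [exact: cvg_cst|exact: cv]].
apply: cvg_monotone_convergence => //.
- by move=> k; apply/measurable_EFinP/measurable_funM => //; exact: measurable_Khy.
- by move=> k y _; rewrite lee_fin mulr_ge0 ?Kh_ge0.
- by move=> y _ k k' kk; rewrite lee_fin; apply: ler_wpM2l; [exact: Kh_ge0|exact: nd].
Qed.

Lemma Pe_le (q : R) (x : E n) (g g' : E n -> R) : measT g -> measT g' ->
 (forall y, 0 <= g y) -> (forall y, g y <= g' y) -> (PeE q g x <= PeE q g' x)%E.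
Proof.
move=> mg mg' g0 gg; apply: ge0_le_integral => //.
- by move=> y _; rewrite lee_fin mulr_ge0 ?Kh_ge0.
- by apply/measurable_EFinP/measurable_funM => //; exact: measurable_Khy.
- by apply/measurable_EFinP/measurable_funM => //; exact: measurable_Khy.
- by move=> y _; rewrite lee_fin; apply: ler_wpM2l; [exact: Kh_ge0|exact: gg].
Qed.

Lemma measurable_PeEr (x : E n) (t : R) (h : R -> E n -> R) : measT (fun p : R * E n => h p.1 p.2) ->
 (forall r y, 0 <= h r y) -> measT (fun r : R => PeE (t - r) (h r) x).
Proof.
move=> mh h0.
exact: (@measurable_Per R _ (E n) (lebRN R n) (@Kh R n) (@Kh_ge0 R n) (@measurable_Kh R n) h t x mh h0).
Qed.

Lemma Du_cvg (x : E n) (t : R) (h_ : nat -> R -> E n -> R) (h : R -> E n -> R) :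
 (forall k, measT (fun p : R * E n => h_ k p.1 p.2)) -> (forall k r y, 0 <= h_ k r y) ->
 (forall r y k k', (k <= k')%N -> h_ k r y <= h_ k' r y) -> (forall r y, h_ k r y @[k --> \oo] --> h r y) ->
 (DuE (h_ k) x t @[k --> \oo] --> DuE h x t)%E.
Proof.
move=> mh h0 nd cv; rewrite /DuE /Du.
have ms k r : measT (h_ k r) by exact: measurable_slice (mh k).
have c r := @Pe_cvg (t - r) x (fun k => h_ k r) (h r) (ms^~ r) (fun k => h0 k r) (nd r) (cv r).
have -> : (\int[leb]_r \int[lebRN R n]_y (Kh (t - r) x y * h r y)%:E =
  \int[leb]_r limn (fun k => \int[lebRN R n]_y (Kh (t - r) x y * h_ k r y)%:E))%E.
 by apply: eq_integral => r _; apply/esym/cvg_lim => //; exact: c.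
apply: cvg_monotone_convergence => //.
- by move=> k; exact: measurable_PeEr (mh k) (h0 k).
- by move=> k r _; apply: integral_ge0 => y _; rewrite lee_fin mulr_ge0 ?Kh_ge0.
- by move=> r _ k k' kk; apply: Pe_le => // y; exact: nd.
Qed.

(** A Gaussian majorant is carried along by the semigroup law, so its constant [e] does not
    deteriorate. *)
Lemma Pz_le_heatG (q s e M : R) (k : 'rV[R]_n -> R) x : 0 < q -> 0 < s -> continuous k -> (forall y, `|k y| <= M) ->
 (forall y, `|k y| <= e * heatG s y 0) -> `|Pz q k x| <= e * heatG (q + s) x 0.
Proof.
move=> q0 s0 ck kM ke; rewrite Pz_heatG//.
have mk : measT (fun p : E n => k (torow p)).
 by apply: measurable_torow => p _; exact: ck.
have i1 : (lebRN R n).-integrable setT (EFin \o (fun y : E n => heatG q x (torow y) * k (torow y))).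
 by apply: (integrable_bddM measurableT (heatG_wint x q0) mk (M := M)).
apply: le_trans (le_normr_Rintegral measurableT i1) _.
have i2 := wintZ e (heatG2_wint x q0 s0).
have i3 := wint_norm i1.
have -> : e * heatG (q + s) x 0 = \int[lebRN R n]_y (e * (heatG q x (torow y) * heatG s (torow y) 0)).
 rewrite RintegralZl//; last exact: heatG2_wint.
 by rewrite /Rintegral heatG_semig.
apply: le_Rintegral => // y _; rewrite normrM (ger0_norm (heatG_ge0 _ _ _)) mulrCA.
by apply: ler_wpM2l; [exact: heatG_ge0|exact: ke].
Qed.

Lemma W_le_const (t C M : R) (k : 'rV[R]_n -> R) x : 0 < t -> continuous k -> (forall y, `|k y| <= M) ->
 (forall q, 0 < q -> q <= t -> `|Pz q k x| <= C) -> `|Wn (om t) (fun y _ => k y) x 0| <= C * t.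
Proof.
move=> t0 ck kM kC.
have [i1 ->] := Wom_slice x 0 t0 (cont_timecst ck) (fun y _ => kM y).
apply: le_trans (le_normr_Rintegral _ i1) _; first exact: measurable_itv.
have -> : C * t = \int[leb]_(q in `]0, t]) C.
 by rewrite /Rintegral integral_cst//= lebesgue_measure_itv/= lte_fin t0 sube0.
apply: le_Rintegral => //.
- move: (integrable_abse i1); apply: eq_integrable => //.
- apply/integrableP; split; first exact: measurable_cst.
 by rewrite integral_cst//= lebesgue_measure_itv/= lte_fin t0 sube0 -EFinM ltry.
- by move=> q /=; rewrite in_itv/= => /andP[h1 h2]; exact: kC.
Qed.

Lemma W_Pe (t M : R) (k : 'rV[R]_n -> R) x : 0 < t -> continuous k -> (forall y, `|k y| <= M) -> (forall y, 0 <= k y) ->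
 ((Wn (om t) (fun y _ => k y) x 0)%:E = \int[leb]_(q in `]0%R, t]) PeE q (fun y => k (torow y)) (fromrow x))%E.
Proof.
move=> t0 ck kM k0.
have [i1 ->] := Wom_slice x 0 t0 (cont_timecst ck) (fun y _ => kM y).
rewrite /Rintegral fineK; last by apply: integrable_fin_num.
by apply: eq_integral => q; rewrite inE/= in_itv/= => /andP[h1 h2]; rewrite (PeE_Pz x h1 ck kM k0).
Qed.

End heat_bounds.

(** * The singular solution satisfies the mild formula *)

Section singular_mild.
Variables (R : realType) (n : nat) (f U U1 : R -> R).
Local Notation N := (n%:R : R).
Local Notation E m := (mst (lebN R m)).
Hypotheses (n2 : (2 < n)%N) (fc : continuous f) (f_ge0 : forall u : R, 0 <= f u) (f0 : f 0 = 0)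
 (f_mono : forall u v : R, u <= v -> f u <= f v)
 (DU : forall l : R, is_derive l 1 U (U1 l))
 (DU1 : forall l : R, is_derive l 1 U1 (- (N - 2) * U1 l - expR (2 * l) * f (U l)))
 (U_ge0 : forall l : R, 0 <= U l) (U_ni : forall l l' : R, l <= l' -> U l' <= U l)
 (U1_le0 : forall l : R, U1 l <= 0)
 (M_nd : forall l l' : R, l <= l' -> expR ((N - 2) * l') * U1 l' <= expR ((N - 2) * l) * U1 l)
 (Usm : forall e : R, 0 < e -> exists l0 : R, forall l, l <= l0 -> U l * expR ((N - 2) * l) <= e).

Let N3 : 3 <= N. Proof. by rewrite (ler_nat R 3). Qed.
Let n0 : (0 < n)%N. Proof. exact: ltn_trans n2. Qed.

Definition us : 'rV[R]_n -> R := cutz (fun x => U (ell x)).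
Definition C1 : R := expR (N - 2).

(** By monotonicity of the flux the slope at [l] is at most [e^(N-2)] times the slope at any point
    of [[l, l + 1]], and the drop of [U] over that interval is at most [U l]. *)
Lemma U1_bd l : `|U1 l| <= C1 * U l.
Proof.
have l1 : l < l + 1 by rewrite ltrDl.
have [c [c1 c2 e]] := MVT_itv l1 (fun s _ _ => DU s).
have h := M_nd (ltW c1).
have hC : U1 c <= expR (- (N - 2)) * U1 l.
 have : expR ((N - 2) * c) * U1 c <= expR ((N - 2) * c) * (expR (- (N - 2)) * U1 l).
  apply: le_trans h _; rewrite mulrA -expRD.
  have -> : (N - 2) * c + - (N - 2) = (N - 2) * (c - 1) by ring.
  rewrite -subr_ge0 -mulrBl; apply: mulr_le0 => //.
  rewrite subr_le0 ler_expR; apply: ler_wpM2l; first by have := N3; lra.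
  lra.
 by rewrite ler_pM2l ?expR_gt0.
rewrite ler0_norm//; have u0 := U_ge0 (l + 1).
have h2 : - (expR (- (N - 2)) * U1 l) <= U l by move: e; rewrite (_ : l + 1 - l = 1) ?mulr1; lra.
have : C1 * - (expR (- (N - 2)) * U1 l) <= C1 * U l by rewrite ler_pM2l ?expR_gt0.
by rewrite mulrN mulrA /C1 -expRD subrr expR0 mul1r.
Qed.

Section level.
Variable k : nat.
Local Notation kk := (k%:R : R).
(** Zero for [r <= e^(1-k)] and equal to [U] for [r >= e^(2-k)]. *)
Definition Pk l : R := U l * et (l + kk).
Definition Pk1 l : R := U1 l * et (l + kk) + U l * et1 (l + kk).
Definition Pk2 l : R := (- (N - 2) * U1 l - expR (2 * l) * f (U l)) * et (l + kk) + U1 l * et1 (l + kk) +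
 (U1 l * et1 (l + kk) + U l * et2 (l + kk)).
(** The terms of [r^2] times the Laplacian in which at least one derivative hits the cutoff. *)
Definition ek l : R := 2 * U1 l * et1 (l + kk) + U l * (et2 (l + kk) + (N - 2) * et1 (l + kk)).

Let Dsh (g : R -> R) (l d : R) : is_derive (l + kk) 1 g d -> is_derive l 1 (fun l => g (l + kk)) d.
Proof.
by move=> D; apply: der_val (@der_comp R g (fun l => l + kk) l _ _ D (der_add (der_id l) (der_cst kk l))) _; rewrite addr0 mulr1.
Qed.

Lemma Pk_derive (l : R) : is_derive l 1 Pk (Pk1 l).
Proof. exact: der_mul (DU l) (Dsh (et_derive _)). Qed.

Lemma Pk1_derive (l : R) : is_derive l 1 Pk1 (Pk2 l).
Proof. exact: der_add (der_mul (DU1 l) (Dsh (et_derive _))) (der_mul (DU l) (Dsh (et1_derive _))). Qed.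

Lemma Pk_lap l : Pk2 l + (N - 2) * Pk1 l = - (expR (2 * l) * (f (U l) * et (l + kk))) + ek l.
Proof. by rewrite /Pk2 /Pk1 /ek; ring. Qed.

Let lo : R := 1 - kk.
Lemma Pk_lo l : l <= lo -> [/\ Pk l = 0, Pk1 l = 0, Pk2 l = 0 & ek l = 0].
Proof.
move=> h; have h1 : l + kk <= 1 by rewrite /lo in h; lra.
have [e0 e1 e2] := et_lo h1.
by rewrite /Pk /Pk1 /Pk2 /ek e0 e1 e2 !(mulr0, addr0).
Qed.

Definition gk : 'rV[R]_n -> R := cutz (fun x => Pk (ell x)).
Definition dgk i : 'rV[R]_n -> R := cutz (fun x => Pk1 (ell x) * (x ord0 i / rho x)).
Definition ddgk i : 'rV[R]_n -> R := cutz (fun x => Pk2 (ell x) * (x ord0 i / rho x) ^+ 2 +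
 Pk1 (ell x) * ((rho x)^-1 - 2 * x ord0 i ^+ 2 / rho x ^+ 2)).
Definition hk : 'rV[R]_n -> R := cutz (fun x => f (U (ell x)) * et (ell x + kk)).
Definition rk : 'rV[R]_n -> R := cutz (fun x => ek (ell x) / rho x).

Lemma ell_small (x : 'rV[R]_n) : x != 0 -> rho x < expR (2 * lo) -> ell x <= lo.
Proof. by move=> x0; rewrite -exp2_ell// ltr_expR; lra. Qed.

Let van (H : 'rV[R]_n -> R) : (forall x : 'rV[R]_n, x != 0 -> ell x <= lo -> H x = 0) -> vanish0 H.
Proof.
by move=> h; exists (expR (2 * lo)); [exact: expR_gt0|move=> y y0 yr; apply: h => //; exact: ell_small].
Qed.

Lemma van_gk : vanish0 (fun x : 'rV[R]_n => Pk (ell x)).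
Proof. by apply: van => x _ /Pk_lo[]. Qed.

Lemma van_dgk i : vanish0 (fun x : 'rV[R]_n => Pk1 (ell x) * (x ord0 i / rho x)).
Proof. by apply: van => x _ /Pk_lo[_ -> _ _]; rewrite mul0r. Qed.

Lemma van_ddgk i : vanish0 (fun x : 'rV[R]_n => Pk2 (ell x) * (x ord0 i / rho x) ^+ 2 +
 Pk1 (ell x) * ((rho x)^-1 - 2 * x ord0 i ^+ 2 / rho x ^+ 2)).
Proof. by apply: van => x _ /Pk_lo[_ -> -> _]; rewrite !mul0r addr0. Qed.

Lemma van_hk : vanish0 (fun x : 'rV[R]_n => f (U (ell x)) * et (ell x + kk)).
Proof.
apply: van => x _ h; have h1 : ell x + kk <= 1 by rewrite /lo in h; lra.
by have [-> _ _] := et_lo h1; rewrite mulr0.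
Qed.

Lemma van_rk : vanish0 (fun x : 'rV[R]_n => ek (ell x) / rho x).
Proof. by apply: van => x _ /Pk_lo[_ _ _ ->]; rewrite mul0r. Qed.

Let cell (P : R -> R) (x : 'rV[R]_n) : x != 0 -> {for ell x, continuous P} -> {for x, continuous (fun x => P (ell x))}.
Proof. by move=> x0 c; apply: (@continuous_comp _ _ _ (@ell R n) P); [exact: ell_cont|exact: c]. Qed.

Let crho (x : 'rV[R]_n) : x != 0 -> {for x, continuous (fun x => (rho x)^-1)}.
Proof. by move=> x0; apply: cfV; [rewrite gt_eqF// rho_gt0|exact: rho_cont]. Qed.

Let ccoord (x : 'rV[R]_n) i : {for x, continuous (fun x : 'rV[R]_n => x ord0 i)}.
Proof. exact: coord_continuous. Qed.

Let cU (l : R) : {for l, continuous U}. Proof. exact: der_cont (DU l). Qed.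
Let cU1 (l : R) : {for l, continuous U1}. Proof. exact: der_cont (DU1 l). Qed.
Let csh (g : R -> R) (l : R) : continuous g -> {for l, continuous (fun l => g (l + kk))}.
Proof.
move=> c; apply: (@continuous_comp R R R (fun l => l + kk) g); last exact: c.
by apply: cvgD; [exact: cvg_id|exact: cvg_cst].
Qed.
Let cfU (l : R) : {for l, continuous (fun l => f (U l))}.
Proof. by apply: (@continuous_comp R R R U f); [exact: cU|exact: fc]. Qed.
Let cet : continuous (@et R). Proof. by move=> s; exact: der_cont (et_derive s). Qed.
Let cet1 : continuous (@et1 R). Proof. by move=> s; exact: der_cont (et1_derive s). Qed.
Lemma Pk2_cont (l : R) : {for l, continuous Pk2}.
Proof.
have cE : {for l, continuous (fun l : R => expR (2 * l))} by exact: der_cont (exp_lin_derive 2 l).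
have e0 := @csh _ l cet; have e1 := @csh _ l cet1; have e2 := @csh _ l (@et2_cont R).
have H := cfD (cfD (cfM (cfB (cfM (cfC (- (N - 2)) l) (@cU1 l)) (cfM cE (@cfU l))) e0) (cfM (@cU1 l) e1))
 (cfD (cfM (@cU1 l) e1) (cfM (@cU l) e2)).
exact: H.
Qed.

Lemma ek_cont (l : R) : {for l, continuous ek}.
Proof.
have e1 := @csh _ l cet1; have e2 := @csh _ l (@et2_cont R).
have H := cfD (cfM (cfM (cfC 2 l) (@cU1 l)) e1) (cfM (@cU l) (cfD e2 (cfM (cfC (N - 2) l) e1))).
exact: H.
Qed.

Lemma gk_cont : continuous gk.
Proof. by apply: cutz_cont van_gk => x x0; apply: cell => //; exact: der_cont (Pk_derive _). Qed.

Lemma dgk_cont i : continuous (dgk i).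
Proof.
apply: cutz_cont (van_dgk i) => x x0.
exact: cfM (cell x0 (der_cont (Pk1_derive _))) (cfM (@ccoord x i) (crho x0)).
Qed.

Lemma ddgk_cont i : continuous (ddgk i).
Proof.
apply: cutz_cont (van_ddgk i) => x x0.
have cr := crho x0; have cxr := cfM (@ccoord x i) cr.
have cx2 : {for x, continuous (fun x : 'rV[R]_n => (x ord0 i / rho x) ^+ 2)} by exact: (cfM cxr cxr).
have c3 : {for x, continuous (fun x : 'rV[R]_n => (rho x)^-1 - 2 * x ord0 i ^+ 2 / rho x ^+ 2)}.
 have -> : (fun x : 'rV[R]_n => (rho x)^-1 - 2 * x ord0 i ^+ 2 / rho x ^+ 2) =
   (fun x => (rho x)^-1 - 2 * (x ord0 i / rho x) ^+ 2).
  by apply/funext => y; rewrite sqr_div.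
 exact: cfB cr (cfM (cfC 2 x) cx2).
have H1 := cfM (cell x0 (@Pk2_cont (ell x))) cx2.
have H2 := cfM (cell x0 (der_cont (Pk1_derive (ell x)))) c3.
have H := cfD H1 H2; exact: H.
Qed.

Lemma hk_cont : continuous hk.
Proof.
apply: cutz_cont van_hk => x x0; apply: (@cell (fun l => f (U l) * et (l + kk))) => //.
exact: cfM (@cfU _) (@csh _ _ cet).
Qed.

Lemma rk_cont : continuous rk.
Proof. by apply: cutz_cont van_rk => x x0; exact: (cfM (cell x0 (@ek_cont _)) (crho x0)). Qed.

Lemma gk_derive i x : is_derive x (evec R i) gk (dgk i x).
Proof. by apply: cutz_derive van_gk => y y0; exact: radial1 (Pk_derive _). Qed.

Lemma dgk_derive i x : is_derive x (evec R i) (dgk i) (ddgk i x).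
Proof. by apply: cutz_derive (van_dgk i) => y y0; exact: radial2 (Pk1_derive _). Qed.

Lemma sum_ddgk x : \sum_i ddgk i x = - hk x + rk x.
Proof.
have [->|x0] := eqVneq x 0.
 by rewrite big1 /ddgk /hk /rk /cutz ?eqxx ?oppr0 ?addr0// => i _; rewrite eqxx.
rewrite /hk /rk !cutzE//; under eq_bigr do rewrite /ddgk cutzE//.
rewrite radial_sum// Pk_lap exp2_ell//; have := rho_gt0 x0 => r0.
by field; rewrite gt_eqF.
Qed.

Lemma Pk_bd : exists M : R, forall l, [/\ `|Pk l| <= M, `|Pk1 l| <= M * expR l,
 `|Pk2 l| <= M * expR (2 * l), `|Pk1 l| <= M * expR (2 * l) & `|f (U l) * et (l + kk)| <= M].
Proof.
have C10 : 0 < C1 by exact: expR_gt0.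
pose Mu := U lo; have u0 : 0 <= Mu by exact: U_ge0.
have f0' : 0 <= f Mu by exact: f_ge0.
pose B := Mu * (100 + N * C1 + 18 * C1 + C1) + f Mu.
have N30 := N3.
have B0 : 0 <= B by rewrite /B addr_ge0// mulr_ge0//; have : 0 <= N * C1 by [rewrite mulr_ge0// ltW]; lra.
pose D := B * expR (- lo) * (1 + expR (- lo)) + B.
have E0 := expR_gt0 (- lo).
have BD : B <= D by rewrite /D lerDr !mulr_ge0// ?(ltW E0)// addr_ge0// ltW.
exists D => l; have D0 : 0 <= D by exact: le_trans BD.
have [h|h] := leP l lo.
 have [-> -> -> _] := Pk_lo h; have h1 : l + kk <= 1 by rewrite /lo in h; lra.
 by have [-> _ _] := et_lo h1; rewrite mulr0 normr0; split; rewrite ?mulr_ge0 ?expR_ge0.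
have e1 := et_le1 (l + kk); have e0 := et_ge0 (l + kk); have e1' := et1_bd (l + kk); have e2' := et2_bd (l + kk).
have Ul : U l <= Mu by exact: U_ni (ltW h).
have Ul0 := U_ge0 l; have b1 := U1_bd l.
have fl : f (U l) <= f Mu by exact: f_mono.
have fl0 := f_ge0 (U l).
have b1' : `|U1 l| <= C1 * Mu by apply: le_trans b1 _; rewrite ler_pM2l.
have CM0 : 0 <= C1 * Mu by rewrite mulr_ge0// ltW.
have NM0 : 0 <= N * (C1 * Mu) by rewrite mulr_ge0.
have p1 : `|Pk1 l| <= B.
 apply: le_trans (ler_normD _ _) _; rewrite (normrM (U1 l)) (normrM (U l)) (ger0_norm e0) (ger0_norm Ul0).
 have : `|U1 l| * et (l + kk) <= C1 * Mu * 1 by apply: ler_pM.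
 have : U l * `|et1 (l + kk)| <= Mu * 9 by apply: ler_pM.
 by rewrite /B; lra.
have L1 : expR (- lo) * expR l >= 1.
 by rewrite -expRD -[leLHS]expR0 ler_expR; lra.
have L2 : expR (- lo) * (1 + expR (- lo)) * expR (2 * l) >= 1.
 have -> : expR (2 * l) = expR l * expR l by rewrite -expRD; congr expR; ring.
 have := expR_gt0 l; set x := expR (- lo) in E0 L1 *; set y := expR l in L1 * => y0.
 have : 1 <= (x * y) * (x * y) by rewrite -[leLHS]mulr1 ler_pM.
 have : 0 <= x * (y * y) by rewrite mulr_ge0 ?mulr_ge0 ?ltW.
 lra.
have BL2 : B <= D * expR (2 * l).
 have : B * 1 <= B * (expR (- lo) * (1 + expR (- lo)) * expR (2 * l)) by rewrite ler_wpM2l.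
 have : 0 <= B * expR (2 * l) by rewrite mulr_ge0 ?expR_ge0.
 by rewrite /D; lra.
have BL1 : B <= D * expR l.
 have : B * 1 <= B * (expR (- lo) * expR l) by rewrite ler_wpM2l.
 have : 0 <= B * expR l by rewrite mulr_ge0 ?expR_ge0.
 have : 0 <= B * (expR (- lo) * expR (- lo) * expR l) by rewrite !mulr_ge0 ?expR_ge0.
 by rewrite /D; lra.
have hPk : `|Pk l| <= B.
 rewrite /Pk (normrM (U l)) (ger0_norm e0) (ger0_norm Ul0).
 have : U l * et (l + kk) <= Mu * 1 by apply: ler_pM.
 by rewrite /B; lra.
have hf : `|f (U l) * et (l + kk)| <= f Mu.
 by rewrite (normrM (f (U l))) (ger0_norm e0) (ger0_norm fl0) -[leRHS]mulr1 ler_pM.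
split; [exact: le_trans BD|exact: le_trans BL1| |exact: le_trans BL2|].
- rewrite /Pk2; apply: le_trans (ler_normD _ _) _.
 have q1 : `|(- (N - 2) * U1 l - expR (2 * l) * f (U l)) * et (l + kk)| <= N * (C1 * Mu) + expR (2 * l) * f Mu.
  rewrite (normrM (_ - _)) (ger0_norm e0) -[leRHS]mulr1; apply: ler_pM => //.
  apply: le_trans (ler_normB _ _) _; apply: lerD.
   have N20 : 0 <= N - 2 by lra.
   rewrite normrM normrN (ger0_norm N20).
   by apply: ler_pM => //; lra.
  by rewrite normrM (ger0_norm fl0) ger0_norm ?expR_ge0// ler_wpM2l ?expR_ge0.
 have q2 : `|U1 l * et1 (l + kk)| <= C1 * Mu * 9 by rewrite (normrM (U1 l)) ler_pM.
 have q3 : `|U l * et2 (l + kk)| <= Mu * 72 by rewrite (normrM (U l)) (ger0_norm Ul0) ler_pM.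
 have q4 := ler_normD ((- (N - 2) * U1 l - expR (2 * l) * f (U l)) * et (l + kk)) (U1 l * et1 (l + kk)).
 have q5 := ler_normD (U1 l * et1 (l + kk)) (U l * et2 (l + kk)).
 pose B' := Mu * (100 + N * C1 + 18 * C1 + C1).
 have B'0 : 0 <= B' by rewrite /B'; lra.
 have : B' * 1 <= B' * (expR (- lo) * (1 + expR (- lo)) * expR (2 * l)) by rewrite ler_wpM2l.
 have : 0 <= B' * expR (2 * l) by rewrite mulr_ge0 ?expR_ge0.
 have : 0 <= f Mu * (expR (- lo) * (1 + expR (- lo)) * expR (2 * l)) by rewrite mulr_ge0//; lra.
 rewrite /D /B /B'; lra.
- by apply: le_trans hf _; apply: le_trans BD; rewrite /B lerDr; lra.
Qed.


Lemma gk_bd : exists M : R, [/\ forall y, `|gk y| <= M, forall i y, `|dgk i y| <= M,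
 forall i y, `|ddgk i y| <= M & forall y, `|hk y| <= M].
Proof.
have [M HM] := Pk_bd; have M0 : 0 <= M by have [h _ _ _ _] := HM 0; apply: le_trans h.
have c0 (H : 'rV[R]_n -> R) (C : R) : 0 <= C -> (forall y, y != 0 -> `|H y| <= C) -> forall y, `|cutz H y| <= C.
 by move=> C0 h y; rewrite /cutz; case: eqVneq => [_|y0]; [rewrite normr0|exact: h].
have xr (y : 'rV[R]_n) i : y != 0 -> `|y ord0 i / rho y| * expR (ell y) <= 1.
 move=> y0; have r0 := rho_gt0 y0; have e0 := expR_gt0 (ell y).
 have rE : rho y = expR (ell y) ^+ 2 by rewrite -exp2_ell// -expRM_natl.
 have h : `|y ord0 i| <= expR (ell y).
  rewrite -(@ler_pXn2r _ 2)// ?nnegrE ?(ltW e0)// -rE real_normK ?num_real//.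
  by rewrite rho_enorm coord_le_enorm2.
 rewrite normrM normfV (gtr0_norm r0) -mulrA.
 have -> : (rho y)^-1 * expR (ell y) = (expR (ell y))^-1 by rewrite rE; field; rewrite gt_eqF.
 by rewrite ler_pdivrMr// mul1r.
exists (4 * M); split.
- apply: c0; first by lra.
 by move=> y y0; have [h _ _ _ _] := HM (ell y); lra.
- move=> i; apply: c0; first by lra.
 move=> y y0; have [_ h _ _ _] := HM (ell y); rewrite normrM.
 have : `|Pk1 (ell y)| * `|y ord0 i / rho y| <= M * expR (ell y) * `|y ord0 i / rho y| by rewrite ler_wpM2r.
 have : M * (`|y ord0 i / rho y| * expR (ell y)) <= M * 1 by rewrite ler_wpM2l ?xr.
 lra.
- move=> i; apply: c0; first by lra.
 move=> y y0; have [_ _ h2 h1 _] := HM (ell y).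
 have r0 := rho_gt0 y0; rewrite exp2_ell// in h1 h2.
 pose b := (y ord0 i / rho y) ^+ 2.
 have b0 : 0 <= b by exact: sqr_ge0.
 have br : b * rho y <= 1.
  have -> : b * rho y = (`|y ord0 i / rho y| * expR (ell y)) ^+ 2.
   by rewrite exprMn real_normK ?num_real// -expRM_natl exp2_ell.
  by apply: exprn_ile1; [rewrite mulr_ge0 ?expR_ge0|exact: xr].
 have -> : 2 * y ord0 i ^+ 2 / rho y ^+ 2 = 2 * b by rewrite /b sqr_div.
 rewrite -/b; clearbody b; apply: le_trans (ler_normD _ _) _; rewrite (normrM (Pk2 _)) (normrM (Pk1 _)) (ger0_norm b0).
 have q1 : `|Pk2 (ell y)| * b <= M * 1.
  apply: (@le_trans _ _ (M * rho y * b)); first by rewrite ler_wpM2r.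
  by rewrite -mulrA ler_wpM2l// mulrC.
 have q2 : `|(rho y)^-1 - 2 * b| * rho y <= 3.
  rewrite -{2}(gtr0_norm r0) -normrM mulrBl mulVf ?gt_eqF//.
  have : 0 <= b * rho y by rewrite mulr_ge0// ltW.
  rewrite -(mulrA 2 b); move: (b * rho y) br => v v1 v0.
  by rewrite ler_norml; apply/andP; split; lra.
 have q3 : `|Pk1 (ell y)| * `|(rho y)^-1 - 2 * b| <= M * 3.
  apply: (@le_trans _ _ (M * rho y * `|(rho y)^-1 - 2 * b|)); first by rewrite ler_wpM2r.
  by rewrite -mulrA ler_wpM2l// mulrC.
 lra.
- apply: c0; first by lra.
 by move=> y y0; have [_ _ _ _ h] := HM (ell y); lra.
Qed.

Lemma rk_bd0 : exists M : R, forall y, `|rk y| <= M.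
Proof.
have [M [_ _ h2 h3]] := gk_bd.
exists (n%:R * M + M) => y; have -> : rk y = \sum_i ddgk i y + hk y by rewrite sum_ddgk addrC addNKr.
apply: le_trans (ler_normD _ _) _; apply: lerD => //.
apply: le_trans (ler_norm_sum _ _ _) _; apply: le_trans (ler_sum _ (fun i _ => h2 i y)) _.
by rewrite sumr_const card_ord mulr_natl.
Qed.

(** [Pz_K] for the cut-off function, whose Laplacian is [- hk + rk]. *)
Lemma level_identity x (t : R) : 0 < t -> Pz t gk x + Wn (om t) (fun y _ => hk y) x 0 = gk x + Wn (om t) (fun y _ => rk y) x 0.
Proof.
move=> t0; have [M [h0 h1 h2 h3]] := gk_bd; have [M' h4] := rk_bd0.
have := Pz_K x t0 gk_cont gk_derive dgk_derive dgk_cont ddgk_cont h0 h1 h2.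
have -> : Wn (om t) (fun y _ => \sum_i ddgk i y) x 0 = Wn (om t) (fun y _ => rk y) x 0 - Wn (om t) (fun y _ => hk y) x 0.
 rewrite /W -RintegralB//.
 - by apply: eq_Rintegral => p _; rewrite sum_ddgk -mulrBr addrC.
 - exact: (W_int x 0 (wint_om n (ltW t0)) (cont_mSTc rk_cont) (fun y _ => h4 y)).
 - exact: (W_int x 0 (wint_om n (ltW t0)) (cont_mSTc hk_cont) (fun y _ => h3 y)).
lra.
Qed.

End level.

Definition C2 : R := 18 * C1 + 72 + 9 * N.

Lemma ek_bd k l : `|ek k l| <= C2 * U l.
Proof.
have e1' := et1_bd (l + k%:R); have e2' := et2_bd (l + k%:R); have b1 := U1_bd l; have u0 := U_ge0 l.
have N30 := N3; have C10 : 0 < C1 by exact: expR_gt0.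
rewrite /ek; apply: le_trans (ler_normD _ _) _.
have q1 : `|2 * U1 l * et1 (l + k%:R)| <= 18 * C1 * U l.
 rewrite (normrM (2 * U1 l)) (normrM 2) (@ger0_norm _ 2)//.
 have : `|U1 l| * `|et1 (l + k%:R)| <= C1 * U l * 9 by rewrite ler_pM.
 lra.
have q2 : `|et2 (l + k%:R) + (N - 2) * et1 (l + k%:R)| <= 72 + 9 * N.
 apply: le_trans (ler_normD _ _) _; apply: lerD => //.
 have N20 : 0 <= N - 2 by lra.
 rewrite (normrM (N - 2)) (ger0_norm N20).
 have : (N - 2) * `|et1 (l + k%:R)| <= N * 9 by apply: ler_pM => //; lra.
 lra.
have q3 : `|U l * (et2 (l + k%:R) + (N - 2) * et1 (l + k%:R))| <= U l * (72 + 9 * N).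
 by rewrite (normrM (U l)) (ger0_norm u0) ler_wpM2l.
by rewrite /C2; lra.
Qed.

(** On the cutoff shell [r] is of the order of [e^(-k)] and [U = o(r^(2-N))], so the remainder is
    [o(r^(-N))]: small compared with the heat kernel at time [e^(-2 k)], a majorant which the
    semigroup preserves. *)
Lemma rk_small (e : R) : 0 < e -> exists k0 : nat, forall k, (k0 <= k)%N ->
 forall y, `|rk k y| <= e * heatG (expR (- 2 * k%:R)) y 0.
Proof.
move=> e0.
(* A lower bound of [r^N] times the kernel at time [s = e^(-2 k)] on [e^(1-k) <= r <= e^(2-k)]:
   there [r^2/(4 s) <= e^4/4] and [r^N s^(-N/2) >= e^N]. *)
pose c := expR (- (N / 2 * ln (4 * pi)) - expR 4 / 4 + N) : R.
have c0 : 0 < c by exact: expR_gt0.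
have N30 := N3; have C10 : 0 < C1 by exact: expR_gt0.
have C20 : 0 < C2 by rewrite /C2; lra.
have e'0 : 0 < e * c / C2 by rewrite divr_gt0// mulr_gt0.
have [l0 Hl0] := Usm e'0.
have [k0 Hk0] : exists k0 : nat, 2 - l0 <= k0%:R by exists (Num.bound `|2 - l0|); exact: le_trans (ler_norm _) (ltW (archi_boundP (normr_ge0 _))).
exists k0 => k kk0 y.
have hk0 : k0%:R <= k%:R :> R by rewrite ler_nat.
rewrite /rk /cutz; case: eqVneq => [_|y0]; first by rewrite normr0 mulr_ge0 ?heatG_ge0// ltW.
have r0 := rho_gt0 y0; rewrite normrM normfV (gtr0_norm r0).
have [h1|h1] := leP (ell y + k%:R) 1.
 have h1' : ell y <= 1 - k%:R by lra.
 by have [_ _ _ ->] := Pk_lo h1'; rewrite normr0 mul0r mulr_ge0 ?heatG_ge0// ltW.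
have [h2|h2] := leP 2 (ell y + k%:R).
 have [_ e1 e2] := et_hi h2.
 by rewrite /ek e1 e2 !(mulr0, addr0) normr0 mul0r mulr_ge0 ?heatG_ge0// ltW.
have hl : ell y <= l0 by lra.
have hU := Hl0 _ hl.
have h3 : `|ek k (ell y)| / rho y <= e * c * expR (- N * ell y).
 have EE : expR (- N * ell y) * expR (2 * ell y) = (expR ((N - 2) * ell y))^-1.
  by rewrite -expRD -expRN; congr expR; ring.
 rewrite ler_pdivrMr// -exp2_ell// -(mulrA (e * c)) EE ler_pdivlMr ?expR_gt0//.
 have := ek_bd k (ell y); rewrite -(@ler_pM2r _ (expR ((N - 2) * ell y))) ?expR_gt0// => h; apply: le_trans h _.
 have : C2 * (U (ell y) * expR ((N - 2) * ell y)) <= C2 * (e * c / C2) by rewrite ler_pM2l.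
 by rewrite [C2 * (e * c / C2)]mulrC divfK ?gt_eqF// mulrA.
apply: le_trans h3 _; rewrite -mulrA ler_pM2l//.
rewrite /heatG /powR gt_eqF ?mulr_gt0 ?pi_gt0 ?expR_gt0// -expRD /c -expRD ler_expR subr0.
have lnE : ln (4 * pi * expR (- 2 * k%:R)) = ln (4 * pi) + - 2 * k%:R :> R.
 by rewrite lnM ?posrE ?expR_gt0 ?mulr_gt0 ?pi_gt0// expRK.
rewrite -rho_enorm -exp2_ell// lnE.
have h4 : expR (2 * ell y) / (4 * expR (- 2 * k%:R)) <= expR 4 / 4.
 rewrite ler_pdivrMr ?mulr_gt0 ?expR_gt0// (_ : expR 4 / 4 * (4 * expR (-2 * k%:R)) = expR 4 * expR (- 2 * k%:R)); last by field.
 by rewrite -expRD ler_expR; lra.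
have h5 : N * (1 - (ell y + k%:R)) <= 0 by rewrite mulr_ge0_le0//; lra.
lra.
Qed.

(** At a fixed [x != 0] the propagated majorant, a kernel centred at the origin, is bounded
    uniformly in time. *)
Lemma rk_W (e : R) (x : 'rV[R]_n) (t : R) : x != 0 -> 0 < t -> 0 < e -> exists k0 : nat, forall k, (k0 <= k)%N ->
 `|Wn (om t) (fun y _ => rk k y) x 0| <= e.
Proof.
move=> x0 t0 e0.
have d0 : 0 < enorm x by rewrite -ell_exp// expR_gt0.
have [C C0 HC] := heatG_sup n0 d0.
have e'0 : 0 < e / (C * t) by rewrite divr_gt0// mulr_gt0.
have [k0 Hk0] := rk_small e'0.
exists k0 => k kk; have [M HM] := rk_bd0 k.
have -> : e = e / (C * t) * C * t by field; rewrite !gt_eqF.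
apply: (W_le_const t0 (@rk_cont k) HM) => q q0 qt.
apply: le_trans (Pz_le_heatG x q0 (expR_gt0 _) (@rk_cont k) HM (Hk0 k kk)) _.
apply: ler_wpM2l; first exact: ltW.
by apply: HC; [rewrite addr_gt0 ?expR_gt0|rewrite subr0].
Qed.

Lemma gk_nd y k k' : (k <= k')%N -> gk k y <= gk k' y.
Proof.
move=> kk; rewrite /gk /cutz; case: ifP => // _; rewrite /Pk; apply: ler_wpM2l => //.
by apply: et_nd; rewrite lerD2l ler_nat.
Qed.

Lemma hk_nd y k k' : (k <= k')%N -> hk k y <= hk k' y.
Proof.
move=> kk; rewrite /hk /cutz; case: ifP => // _; apply: ler_wpM2l => //.
by apply: et_nd; rewrite lerD2l ler_nat.
Qed.

Lemma near_et (l : R) : \forall k \near \oo, et (l + k%:R) = 1 :> R.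
Proof.
exists (Num.bound `|2 - l|) => // k /= kk.
have h : 2 - l <= k%:R.
 apply: le_trans (ler_norm _) _; apply: le_trans (ltW (archi_boundP (normr_ge0 _))) _.
 by rewrite ler_nat.
by have [|-> _ _] := @et_hi R (l + k%:R) => //; lra.
Qed.

Lemma gk_near y : \forall k \near \oo, gk k y = us y.
Proof.
rewrite /gk /us /cutz; case: ifP => _; first by near=> k.
by apply: filterS (near_et (ell y)) => k e; rewrite /Pk e mulr1.
Unshelve. all: by end_near. Qed.

Lemma hk_near y : \forall k \near \oo, hk k y = f (us y).
Proof.
rewrite /hk /us /cutz; case: ifP => _; first by near=> k; rewrite f0.
by apply: filterS (near_et (ell y)) => k e; rewrite e mulr1.
Unshelve. all: by end_near. Qed.

Lemma gk_cvg y : gk k y @[k --> \oo] --> us y.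
Proof. by apply: cvg_near_cst; exact: gk_near. Qed.

Lemma hk_cvg y : hk k y @[k --> \oo] --> f (us y).
Proof. by apply: cvg_near_cst; exact: hk_near. Qed.

Lemma gk_ge0 k y : 0 <= gk k y.
Proof. by rewrite /gk /cutz; case: ifP => // _; rewrite mulr_ge0 ?et_ge0. Qed.

Lemma hk_ge0 k y : 0 <= hk k y.
Proof. by rewrite /hk /cutz; case: ifP => // _; rewrite mulr_ge0 ?et_ge0. Qed.

Lemma measurable_gk k : measT (fun y : E n => gk k (torow y)).
Proof. by apply: measurable_torow => p _; exact: gk_cont. Qed.

Lemma measurable_hk k : measT (fun y : E n => hk k (torow y)).
Proof. by apply: measurable_torow => p _; exact: hk_cont. Qed.

Lemma measurable_us : measT (fun y : E n => us (torow y)).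
Proof.
apply: (@measurable_fun_cvg _ _ R setT (fun k (y : E n) => gk k (torow y))).
 exact: measurable_gk.
by move=> y _; apply: cvg_near_cst; exact: gk_near.
Qed.

Lemma us_ge0 y : 0 <= us y.
Proof. by rewrite /us /cutz; case: ifP. Qed.


Lemma measurable_PeEq (x : E n) (g : 'rV[R]_n -> R) : measT (fun y : E n => g (torow y)) ->
 (forall y, 0 <= g y) -> measT (fun q : R => PeE q (fun y => g (torow y)) x).
Proof.
move=> mg g0; have m2 : measT (fun p : R * E n => g (torow p.2)) by exact: (measurableT_comp mg measurable_snd).
have H := @measurable_Pe R _ (E n) (lebRN R n) (@Kh R n) (@Kh_ge0 R n) (@measurable_Kh R n) _ R id (fun=> x)
 (fun _ y => g (torow y)).
by apply: H.
Qed.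

(** The cut-off datum and source increase with [k], so monotone convergence passes to the limit in
    each integral without prior integrability, while the remainder tends to 0. *)
Theorem singular_mild (x : 'rV[R]_n) (t : R) : x != 0 -> 0 < t ->
 ((us x)%:E = PeE t (fun y => us (torow y)) (fromrow x)
  + \int[leb]_(q in `]0%R, t]) PeE q (fun y => f (us (torow y))) (fromrow x))%E.
Proof.
move=> x0 t0.
have c1 := @Pe_cvg R n t (fromrow x) (fun k y => gk k (torow y)) (fun y => us (torow y)) measurable_gk
 (fun k y => gk_ge0 k _) (fun y => @gk_nd _) (fun y => @gk_cvg _).
have c2 (q : R) := @Pe_cvg R n q (fromrow x) (fun k y => hk k (torow y)) (fun y => f (us (torow y))) measurable_hk
 (fun k y => hk_ge0 k _) (fun y => @hk_nd _) (fun y => @hk_cvg _).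
have c3 : (\int[leb]_(q in `]0%R, t]) PeE q (fun y => hk k (torow y)) (fromrow x) @[k --> \oo] -->
  \int[leb]_(q in `]0%R, t]) PeE q (fun y => f (us (torow y))) (fromrow x))%E.
 have -> : (\int[leb]_(q in `]0%R, t]) PeE q (fun y => f (us (torow y))) (fromrow x) =
   \int[leb]_(q in `]0%R, t]) limn (fun k => PeE q (fun y => hk k (torow y)) (fromrow x)))%E.
  by apply: eq_integral => q _; apply/esym/cvg_lim => //; exact: c2.
 apply: cvg_monotone_convergence => //.
 - move=> k; apply: measurable_funTS; apply: measurable_PeEq; [exact: measurable_hk|exact: hk_ge0].
 - by move=> k q _; apply: Pe_ge0; [exact: Kh_ge0|move=> y; exact: hk_ge0].
 - move=> q _ k k' kk; apply: Pe_le; [exact: measurable_hk|exact: measurable_hk|by move=> y; exact: hk_ge0|].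
  by move=> y; exact: hk_nd.
set a := PeE t _ _ in c1 *; set b := (X in (_ = _ + X)%E) in c3 *.
have a0 : (0 <= a)%E by apply: Pe_ge0; [exact: Kh_ge0|move=> y; exact: us_ge0].
have b0 : (0 <= b)%E by apply: integral_ge0 => q _; apply: Pe_ge0; [exact: Kh_ge0|move=> y; exact: f_ge0].
have c4 := cvgeD (ge0_adde_def a0 b0) c1 c3.
have E_ k : (PeE t (fun y => gk k (torow y)) (fromrow x) + \int[leb]_(q in `]0%R, t]) PeE q (fun y => hk k (torow y)) (fromrow x))%E =
  (gk k x + Wn (om t) (fun y _ => rk k y) x 0)%:E.
 have [M [h0 _ _ h3]] := gk_bd k.
 rewrite (PeE_Pz x t0 (@gk_cont k) h0 (gk_ge0 k)) -(W_Pe x t0 (@hk_cont k) h3 (hk_ge0 k)) -EFinD.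
 by rewrite level_identity.
have c5 : (gk k x + Wn (om t) (fun y _ => rk k y) x 0) @[k --> \oo] --> us x.
 rewrite -[us x]addr0; apply: cvgD; first exact: gk_cvg.
 apply/cvgrPdist_le => e e0; have [k0 Hk0] := rk_W x0 t0 e0.
 by exists k0 => // k /= kk; rewrite sub0r normrN; exact: Hk0.
have c6 : ((gk k x + Wn (om t) (fun y _ => rk k y) x 0)%:E @[k --> \oo] --> (us x)%:E)%E.
 by apply: cvg_EFin => //; exact: nearW.
have c4' : ((gk k x + Wn (om t) (fun y _ => rk k y) x 0)%:E @[k --> \oo] --> a + b)%E.
 by under eq_fun do rewrite -E_; exact: c4.
exact: (cvg_unique _ c6 c4').
Qed.

End singular_mild.

Definition stationary_mild (R : realType) (n : nat) (f U : R -> R) : Prop := forall (x : 'rV[R]_n) (t : R), x != 0 -> 0 < t ->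
 ((us U x)%:E = PeE t (fun y => us U (torow y)) (fromrow x)
  + \int[@lebesgue_measure R]_(q in `]0%R, t]) PeE q (fun y => f (us U (torow y))) (fromrow x))%E.

(** * The origin is negligible; forms of the Duhamel integral *)

Section null_point.
Variables (R : realType).
Local Notation E m := (mst (lebN R m)).

Lemma lebN_slab n (a : R) : lebRN R n.+1 ([set a] `*` setT) = 0.
Proof. by rewrite /lebRN /= /pmeas product_measure1E// [X in (X * _)%E]lebesgue_measure_set1 mul0e. Qed.

Lemma null_slab n (a : R) : {ae lebRN R n.+1, forall p : E n.+1, p.1 != a}.
Proof.
exists ([set a] `*` setT); split; [exact: measurableX|exact: lebN_slab|].
by move=> p /= h; split => //=; apply/eqP/negPn/negP.
Qed.

Lemma ae_snd_neq0 n : (0 < n)%N -> {ae lebRN R n.+1, forall p : E n.+1, torow p.2 != 0}.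
Proof.
case: n => // n _; have mS : measurable ([set 0] `*` setT : set (E n.+1)) by exact: measurableX.
exists (setT `*` ([set 0] `*` setT)); split; first exact: measurableX.
- have H := product_measure1E leb (msm (lebN R n.+1)) measurableT mS.
 by rewrite [LHS]H [X in (_ * X)%E]lebN_slab mule0.
- by move=> p /= /negP; rewrite negbK => /eqP h; split => //=; split => //=; rewrite -torow0 h mxE.
Qed.

Lemma ae_torow_neq0 n : (0 < n)%N -> {ae lebRN R n, forall p, torow p != 0}.
Proof.
case: n => // n _; have := null_slab n 0; apply: filterS => p; apply: contra => /eqP h.
by rewrite -(torow0 p) h mxE.
Qed.

Variable n : nat.
Hypothesis n0 : (0 < n)%N.

Lemma measurable_eq0 : measT (fun y : E n => torow y == 0).
Proof.
apply: (@measurable_fun_bool _ _ _ _ true); rewrite setTI.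
have mr : measT (fun y : E n => rho (torow y)) by apply: measurable_torow => p _; exact: rho_cont.
rewrite (_ : _ @^-1` _ = (fun y : E n => rho (torow y)) @^-1` [set 0]).
 by rewrite -[X in measurable X]setTI; exact: mr.
apply/seteqP; split=> y /=; first by move=> /eqP ->; rewrite rho0.
by move=> h; apply/negPn/negP => /rho_gt0; rewrite h ltxx.
Qed.

Lemma measurable_cutz (g : 'rV[R]_n -> R) : measT (fun y : E n => g (torow y)) ->
 measT (fun y : E n => cutz g (torow y)).
Proof. by move=> mg; apply: measurable_fun_ifT => //; exact: measurable_eq0. Qed.

Lemma Pe_ae_le (t : R) (x : E n) (g g' : E n -> R) : measT g -> measT g' ->
 (forall y, 0 <= g y) -> (forall y, 0 <= g' y) -> (0 < t -> forall y, torow y != 0 -> g y <= g' y) ->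
 (PeE t g x <= PeE t g' x)%E.
Proof.
move=> mg mg' g0 g'0 h; apply: ae_ge0_le_integral => //.
- by move=> y _; rewrite lee_fin mulr_ge0 ?Kh_ge0.
- by apply/measurable_EFinP/measurable_funM => //; exact: measurable_Khy.
- by move=> y _; rewrite lee_fin mulr_ge0 ?Kh_ge0.
- by apply/measurable_EFinP/measurable_funM => //; exact: measurable_Khy.
- have := ae_torow_neq0 n0; apply: filterS => y yn _; rewrite lee_fin.
 have [t0|t0] := ltP 0 t; last by rewrite (Kh_neg _ _ t0) !mul0r.
 by apply: ler_wpM2l; [exact: Kh_ge0|exact: h].
Qed.

Lemma Pe_ae_eq (t : R) (x : E n) (g g' : E n -> R) : measT g -> measT g' ->
 (forall y, 0 <= g y) -> (forall y, 0 <= g' y) -> (forall y, torow y != 0 -> g y = g' y) ->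
 PeE t g x = PeE t g' x.
Proof. by move=> mg mg' g0 g'0 h; apply/le_anti/andP; split; apply: Pe_ae_le => // _ y /h ->. Qed.

Lemma Du_ae_le (t : R) (x : E n) (h h' : R -> E n -> R) : measT (fun p : R * E n => h p.1 p.2) ->
 measT (fun p : R * E n => h' p.1 p.2) -> (forall r y, 0 <= h r y) -> (forall r y, 0 <= h' r y) ->
 (forall r y, r < t -> torow y != 0 -> h r y <= h' r y) -> (DuE h x t <= DuE h' x t)%E.
Proof.
move=> mh mh' h0 h'0 hh; apply: ge0_le_integral => //.
- by move=> r _; apply: integral_ge0 => y _; rewrite lee_fin mulr_ge0 ?Kh_ge0.
- exact: measurable_PeEr mh h0.
- exact: measurable_PeEr mh' h'0.
- move=> r _; apply: (@Pe_ae_le (t - r) x (h r) (h' r)) => //; [exact: measurable_slice mh|exact: measurable_slice mh'|].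
 by move=> tr y; apply: hh; lra.
Qed.

Lemma Du_restrict (t : R) (x : E n) (h : R -> E n -> R) : (forall r y, r <= 0 -> h r y = 0) ->
 DuE h x t = (\int[leb]_(r in `]0%R, t[) PeE (t - r) (h r) x)%E.
Proof.
move=> h0; rewrite /DuE /Du [RHS]integral_mkcond; apply: eq_integral => r _.
rewrite patchE; case: ifPn => // /negP hr; apply: integral0_eq => y _.
have [r0|r0] := leP r 0; first by rewrite h0// mulr0.
have [rt|rt] := ltP r t; last by rewrite Kh_neg ?mul0r//; lra.
by exfalso; apply: hr; rewrite inE/= in_itv/= r0 rt.
Qed.

(** Reflection of time for a source that does not change after time 0; endpoints are immaterial. *)
Lemma Du_stationary (t : R) (x : E n) (k : E n -> R) : measT k -> (forall y, 0 <= k y) ->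
 DuE (fun r y => if 0 < r then k y else 0) x t = (\int[leb]_(q in `]0%R, t]) PeE q k x)%E.
Proof.
move=> mk k0.
have mP : measT (fun q : R => PeE q k x).
 have := @measurable_PeEr R n x 0 (fun r y => k y) (measurableT_comp mk measurable_snd) (fun r y => k0 y).
 move=> H; have := measurableT_comp H (@oppr_measurable R setT); apply: eq_measurable_fun => r _ /=.
 by rewrite sub0r opprK.
rewrite -integral_itv_bndo_bndc; last exact: measurable_funTS.
rewrite Du_restrict => [|r y]; last by rewrite ltNge => ->.
transitivity (\int[leb]_(r in `]0%R, t[) PeE (t - r) k x)%E.
 by apply: eq_integral => r; rewrite inE/= in_itv/= => /andP[r0 _]; rewrite r0.
rewrite integral_mkcond (@lebesgue_reflect R t).
- rewrite [RHS]integral_mkcond; apply: eq_integral => q _; rewrite !patchE.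
 have -> : (t - q \in `]0, t[%classic) = (q \in `]0, t[%classic).
  by rewrite !mem_setE !in_itv/= subr_gt0 gtrBl andbC.
 by rewrite opprB addrC subrK.
- apply: (measurable_restrictT _ _).1 => //; apply: measurable_funTS.
 by apply: (measurableT_comp mP); apply: measurable_funB.
- by move=> r; rewrite patchE; case: ifP => // _; apply: integral_ge0 => y _; rewrite lee_fin mulr_ge0 ?Kh_ge0.
Qed.

(** The bridge from the kernel that vanishes at nonpositive times to the integral over [[0, t]] in
    the definition of a solution. *)
Lemma Du_integral (t : R) (x : 'rV[R]_n) (h : R -> E n -> R) (k : 'rV[R]_n -> R -> R) : 0 < t ->
 measT (fun p : R * E n => h p.1 p.2) -> (forall r y, 0 <= h r y) ->
 (forall r y, r <= 0 -> h r y = 0) -> (forall r y, 0 < r -> r < t -> h r y = k (torow y) r) ->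
 DuE h (fromrow x) t = (\int[leb]_(s in [set s | (0 <= s <= t)%R])
   intN setT (fun y => (heatG (t - s) x y * k y s)%:E))%E.
Proof.
move=> t0 mh h0 hz hk; rewrite (Du_restrict _ _ hz).
transitivity (\int[leb]_(s in `]0%R, t[) intN setT (fun y => (heatG (t - s) x y * k y s)%:E))%E.
 apply: eq_integral => r; rewrite inE/= in_itv/= => /andP[r0 rt]; rewrite /intN preimage_setT; apply: eq_integral => y _.
 by rewrite KhE ?subr_gt0// torowK hk.
have -> : [set s : R | 0 <= s <= t] = `[0, t]%classic by apply/seteqP; split=> s /=; rewrite in_itv.
have mi : measurable_fun `]0, t[ (fun s => intN setT (fun y => (heatG (t - s) x y * k y s)%:E)).
 have := measurable_funTS (@measurable_PeEr R n (fromrow x) t h mh h0) (D := `]0, t[%classic).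
 apply: eq_measurable_fun => r; rewrite inE/= in_itv/= => /andP[r0 rt].
 rewrite /intN preimage_setT; apply: eq_integral => y _.
 by rewrite KhE ?subr_gt0// torowK hk.
rewrite integral_itv_obnd_cbnd// integral_itv_bndo_bndc//.
exact/emeasurable_fun_itv_obnd_cbndP.
Qed.

Lemma Pe_intN (t : R) (x : 'rV[R]_n) (g : 'rV[R]_n -> R) : 0 < t ->
 PeE t (fun y => g (torow y)) (fromrow x) = intN setT (fun y => (heatG t x y * g y)%:E).
Proof.
by move=> t0; rewrite /intN preimage_setT; apply: eq_integral => y _; rewrite KhE// torowK.
Qed.

End null_point.

(** * Order and continuity of heat potentials *)

Section semigroup_bounds.
Variables (R : realType) (n : nat).
Local Notation E m := (mst (lebN R m)).
Implicit Types (k : 'rV[R]_n -> R) (h : 'rV[R]_n -> R -> R).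

Lemma Pz_int (t : R) k (M : R) x : continuous k -> (forall y, `|k y| <= M) ->
 (lebRN R n).-integrable setT (EFin \o (fun z : E n => gau z * k (x - Num.sqrt (2 * t) *: torow z))).
Proof.
move=> ck kM; apply: (integrable_bddM measurableT (@wint_gau R n) _ (M := M)) => //.
exact: (cont_aff_measurable _ _ ck).
Qed.

Lemma Pz_le (t : R) k k' (M : R) x : continuous k -> (forall y, `|k y| <= M) -> continuous k' -> (forall y, `|k' y| <= M) ->
 (forall y, k y <= k' y) -> Pz t k x <= Pz t k' x.
Proof.
move=> ck kM ck' k'M kk; apply: le_Rintegral => //; [exact: Pz_int ck kM|exact: Pz_int ck' k'M|].
by move=> z _; apply: ler_wpM2l; [exact: gau_ge0|exact: kk].
Qed.

Lemma Pz_cst (t c : R) (x : 'rV[R]_n) : Pz t (fun=> c) x = c.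
Proof.
rewrite /Pz; have -> : \int[lebRN R n]_z (gau z * c) = c * \int[lebRN R n]_z gau z.
 by rewrite -RintegralZl//; [apply: eq_Rintegral => z _; rewrite mulrC|exact: wint_gau].
by rewrite Rint_gau mulr1.
Qed.

Lemma Pz_neg (t : R) k x : t <= 0 -> Pz t k x = k x.
Proof.
move=> t0; rewrite -[RHS](Pz_cst 0 (k x) x) /Pz; apply: eq_Rintegral => z _.
have -> : Num.sqrt (2 * t) = 0 by apply: ler0_sqrtr; rewrite mulr_ge0_le0.
by rewrite scale0r subr0.
Qed.

Lemma Pz_jcont k (M : R) : continuous k -> (forall y, `|k y| <= M) ->
 continuous (fun q : 'rV[R]_n * R => Pz q.2 k q.1).
Proof.
move=> ck kM q; apply: seq_continuous => u uq.
apply: (@Rint_dct _ _ _ (lebRN R n) (fun j z => gau z * k ((u j).1 - Num.sqrt (2 * (u j).2) *: torow z))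
 (fun z => gau z * k (q.1 - Num.sqrt (2 * q.2) *: torow z)) (fun z => M * gau z) setT) => //.
- move=> j; apply: measurable_funM; first exact: measurable_gau.
 exact: (cont_aff_measurable _ _ ck).
- move=> z _; apply: cvgM; first exact: cvg_cst.
 have c1 : (u j).1 @[j --> \oo] --> q.1 by exact: (cvg_comp _ _ uq cvg_fst).
 have c2 : (u j).2 @[j --> \oo] --> q.2 by exact: (cvg_comp _ _ uq cvg_snd).
 apply: (@cvg_comp _ _ _ (fun j => (u j).1 - Num.sqrt (2 * (u j).2) *: torow z) k); last exact: ck.
 apply: cvgB => //; apply: cvgZr_tmp.
 apply: (@cvg_comp _ _ _ (fun j => 2 * (u j).2) (@Num.sqrt R)); last exact: sqrt_continuous.
 by apply: cvgM => //; exact: cvg_cst.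
- move=> j z _; rewrite normrM (ger0_norm (gau_ge0 _)) mulrC; apply: ler_wpM2r => //; exact: gau_ge0.
- by have := wintZ M (@wint_gau R n).
Qed.

Lemma W_le (S M : R) h h' x t : 0 <= S -> jcont h -> (forall y s, `|h y s| <= M) ->
 jcont h' -> (forall y s, `|h' y s| <= M) ->
 (forall y s, h y s <= h' y s) -> Wn (om S) h x t <= Wn (om S) h' x t.
Proof.
move=> S0 ch hM ch' h'M hh; apply: le_Rintegral => //.
- exact: W_int (wint_om n S0) (cont_mSTE ch) hM.
- exact: W_int (wint_om n S0) (cont_mSTE ch') h'M.
- by move=> p _; apply: ler_wpM2l; [exact: om_ge0|exact: hh].
Qed.

Lemma W_ge0 (S : R) h x t : (forall y s, 0 <= h y s) -> 0 <= Wn (om S) h x t.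
Proof. by move=> h0; apply: Rintegral_ge0 => p _; rewrite mulr_ge0 ?om_ge0. Qed.

Lemma W_zero (S : R) h x t : (forall y s, s <= t -> h y s = 0) -> Wn (om S) h x t = 0.
Proof.
move=> h0; rewrite /W /Rintegral integral0_eq// => p _; rewrite /om indicE.
case: (boolP (sgE p \in _)) => [|_]; last by rewrite !mul0r.
by rewrite inE/= in_itv/= => /andP[p0 _]; rewrite h0 ?mulr0// gerBl.
Qed.

End semigroup_bounds.

Lemma seq_le (R : realType) (u v : nat -> R) (a b : R) : u k @[k --> \oo] --> a -> v k @[k --> \oo] --> b ->
 (\forall k \near \oo, u k <= v k) -> a <= b.
Proof. by move=> ua vb h; exact: (ler_cvg_to ua vb h). Qed.

(** * The monotone iteration and its limit *)

Section iteration.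
Variables (R : realType) (n : nat) (f f1 U : R -> R) (T : R).
Local Notation E m := (mst (lebN R m)).
Hypotheses (n2 : (2 < n)%N) (T0 : 0 < T) (f_ge0 : forall u : R, 0 <= f u) (f0 : f 0 = 0)
 (f_mono : forall u v : R, u <= v -> f u <= f v) (Df : forall u : R, is_derive u 1 f (f1 u)) (f1c : continuous f1)
 (U_ge0 : forall l : R, 0 <= U l) (Uc : continuous U)
 (Ucv : forall K : R, exists l0 : R, forall l, l <= l0 -> K < U l).

Let fc : continuous f. Proof. by move=> u; exact: der_cont (Df u). Qed.

(** The value [k] at the origin makes the truncated datum continuous, since [U] exceeds [k]
    nearby. *)
Definition mk (k : nat) (x : 'rV[R]_n) : R := if x == 0 then k%:R else Num.min (U (ell x)) k%:R.

Lemma mk_bd k x : 0 <= mk k x <= k%:R.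
Proof. by rewrite /mk; case: ifP => _; rewrite ?ler0n ?lexx// ge_min lexx orbT le_min U_ge0 ler0n. Qed.

Lemma mk_nrm k x : `|mk k x| <= k%:R.
Proof. by have /andP[h1 h2] := mk_bd k x; rewrite ger0_norm. Qed.

Lemma mk_cont k : continuous (mk k).
Proof.
move=> x; have [->|x0] := eqVneq x 0.
 have [l0 Hl0] := Ucv k%:R.
 have N : \forall y \near (0 : 'rV[R]_n), rho y < expR (2 * l0).
  by have := @rho_cont R n 0 => /cvgr_lt; apply; rewrite rho0 expR_gt0.
 apply: (@near_cont_at R 'rV[R]_n (fun=> k%:R)); last exact: cst_continuous.
 apply: filterS N => y yr; rewrite /mk; case: eqVneq => // y0; rewrite min_r//.
 apply/ltW/Hl0; move: yr; rewrite -exp2_ell// ltr_expR; lra.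
apply: (@near_cont_at R 'rV[R]_n (fun x => Num.min (U (ell x)) k%:R)).
 by apply: filterS (near_neq0 x0) => y /negbTE y0; rewrite /mk y0.
apply: (@continuous_min R 'rV[R]_n (fun x => U (ell x)) (fun=> k%:R) x); last exact: cst_continuous.
by apply: (@cfcomp R 'rV[R]_n U (@ell R n)); [exact: Uc|exact: ell_cont].
Qed.

Lemma mk_nd k k' x : (k <= k')%N -> mk k x <= mk k' x.
Proof.
move=> kk; rewrite /mk; case: ifP => _; first by rewrite ler_nat.
by rewrite le_min !ge_min lexx/= ler_nat kk orbT.
Qed.

(** A continuous switch in time, zero up to [1/(k+1)] and tending to 1 for [s > 0]. The operator [W]
    looks back over elapsed times up to [T] and so meets negative times, where the source must
    vanish continuously. *)
Definition ps (k : nat) (s : R) : R := Num.min 1 (Num.max 0 (k.+1%:R * s - 1)).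

Lemma ps_bd k s : 0 <= ps k s <= 1.
Proof. by rewrite /ps ge_min lexx/= le_min ler01/= le_max lexx. Qed.

Lemma ps0 k s : s <= k.+1%:R^-1 -> ps k s = 0.
Proof.
move=> h; rewrite /ps (max_l (_ : _ <= 0)) ?min_r//.
by rewrite subr_le0 mulrC -ler_pdivlMr ?ltr0n// div1r.
Qed.

Lemma ps_le0 k s : s <= 0 -> ps k s = 0.
Proof. by move=> s0; apply: ps0; apply: le_trans s0 _; rewrite invr_ge0 ler0n. Qed.

Lemma ps_nd k k' s : (k <= k')%N -> ps k s <= ps k' s.
Proof.
move=> kk; have [s0|s0] := leP s 0; first by rewrite !ps_le0.
rewrite /ps le_min ge_min lexx/= ge_min; apply/orP; right.
rewrite ge_max !le_max lexx/= lerD2r; apply/orP; right.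
by rewrite ler_pM2r// ler_nat.
Qed.

Lemma ps_cont k : continuous (ps k).
Proof.
move=> s; apply: (@continuous_min R R (fun=> 1) (fun s => Num.max 0 (k.+1%:R * s - 1)) s); first exact: cvg_cst.
apply: (@continuous_max R R (fun=> 0) (fun s => k.+1%:R * s - 1) s); first exact: cvg_cst.
by apply: cvgB; [apply: cvgM; [exact: cvg_cst|exact: cvg_id]|exact: cvg_cst].
Qed.

Lemma ps1 s : 0 < s -> \forall k \near \oo, ps k s = 1.
Proof.
move=> s0; exists (Num.bound (2 / s)) => // k /= kk.
rewrite /ps min_l// le_max; apply/orP; right; rewrite lerBrDr -ler_pdivrMr//.
have s20 : 0 <= 2 / s by rewrite divr_ge0// ltW.
apply: le_trans (ltW (archi_boundP s20)) _; rewrite ler_nat; exact: leq_trans kk _.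
Qed.

Fixpoint it (k : nat) (x : 'rV[R]_n) (t : R) : R :=
 match k with
 | 0 => 0
 | j.+1 => Pz t (mk j.+1) x + Wn (om T) (fun y s => ps j s * f (it j y s)) x t
 end.

Definition ih (k : nat) (y : 'rV[R]_n) (s : R) : R := ps k s * f (it k y s).

Lemma itS k x t : it k.+1 x t = Pz t (mk k.+1) x + Wn (om T) (ih k) x t.
Proof. by []. Qed.

Lemma ih_cont k : jcont (it k) -> jcont (ih k).
Proof.
move=> c q; have H := cfM (@snd_comp_cont R n (ps k) (@ps_cont k) q)
 (@cfcomp R ('rV[R]_n * R)%type f (fun q => it k q.1 q.2) q (@fc (it k q.1 q.2)) (@c q)).
exact: H.
Qed.

Lemma ih_bd k (M : R) : (forall y s, 0 <= it k y s <= M) -> forall y s, `|ih k y s| <= f M.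
Proof.
move=> B y s; have /andP[p0 p1] := ps_bd k s; have /andP[b0 b1] := B y s.
rewrite /ih ger0_norm ?mulr_ge0// -[leRHS]mul1r ler_pM//; exact: f_mono.
Qed.

Lemma ih_ge0 k y s : 0 <= ih k y s.
Proof. by rewrite mulr_ge0//; have /andP[] := ps_bd k s. Qed.

Lemma it_basic k : jcont (it k) /\ exists M : R, forall y s, 0 <= it k y s <= M.
Proof.
elim: k => [|k [c [M B]]].
 by split; [move=> q; exact: cst_continuous|exists 0 => y s; rewrite lexx].
have ci := ih_cont c; have bi := ih_bd B.
split.
 have cP := Pz_jcont (@mk_cont k.+1) (@mk_nrm k.+1).
 have cW : continuous (fun q : 'rV[R]_n * R => Wn (om T) (ih k) q.1 q.2).
  by apply: W_cont (wint_om n (ltW T0)) ci bi; [exact: measurable_sgE|exact: measurable_zzE].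
 move=> q; have H := cfD (@cP q) (@cW q).
 exact: H.
exists (k.+1%:R + f M * T) => y s; rewrite itS; apply/andP; split.
 apply: addr_ge0; last exact: W_ge0 (ih_ge0 k).
 by apply: Rintegral_ge0 => z _; rewrite mulr_ge0 ?gau_ge0//; have /andP[] := mk_bd k.+1 (y - Num.sqrt (2 * s) *: torow z).
apply: lerD.
 rewrite -[leRHS](Pz_cst s k.+1%:R y); apply: (@Pz_le R n s _ _ k.+1%:R) => //.
 - exact: mk_cont.
 - exact: mk_nrm.
 - by move=> z; exact: cst_continuous.
 - by move=> z; rewrite ger0_norm.
 - by move=> z; have /andP[] := mk_bd k.+1 z.
apply: le_trans (ler_norm _) _; apply: le_trans (W_bound y s (wint_om n (ltW T0)) (cont_mSTE ci) bi) _.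
apply: ler_wpM2l => //.
rewrite /Rintegral (eq_integral (fun p => (om T p)%:E)); last by move=> p _; rewrite ger0_norm ?om_ge0.
by rewrite int_om ?(ltW T0)//=.
Qed.

Let itc k := (it_basic k).1.
Let itB k := (it_basic k).2.

Lemma it_nd k y s : it k y s <= it k.+1 y s.
Proof.
elim: k y s => [|k IH] y s.
 by have [M B] := itB 1; have /andP[] := B y s.
have [M B] := itB k; have [M' B'] := itB k.+1.
have fM : f M <= f (Num.max M M') by apply: f_mono; rewrite le_max lexx.
have fM' : f M' <= f (Num.max M M') by apply: f_mono; rewrite le_max lexx orbT.
rewrite !itS; apply: lerD.
 apply: (@Pz_le R n s _ _ k.+2%:R); [exact: mk_cont| |exact: mk_cont|exact: mk_nrm|by move=> z; exact: mk_nd].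
 by move=> z; apply: le_trans (mk_nrm _ _) _; rewrite ler_nat.
apply: (@W_le R n T (f (Num.max M M'))); [exact: ltW|exact: (ih_cont (@itc k))| |exact: (ih_cont (@itc k.+1))| |].
- by move=> z r; apply: le_trans (ih_bd B z r) fM.
- by move=> z r; apply: le_trans (ih_bd B' z r) fM'.
move=> z r; apply: ler_pM => //; [by have /andP[] := ps_bd k r|exact: ps_nd|apply: f_mono; exact: IH].
Qed.

Lemma it_init k x : it k x 0 = mk k x * (k != 0)%:R.
Proof.
case: k => [|k]; first by rewrite /= mulr0.
rewrite itS mulr1 Pz_neg// W_zero ?addr0// => y s s0.
by rewrite /ih ps_le0// mul0r.
Qed.

Lemma it_mild k : mild (mk k.+1) (it k.+1) (ih k) T.
Proof.
move=> x t t0 tT; have [M B] := itB k.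
have [M1 /(_ _)] : exists M : R, forall y : 'rV[R]_n, `|mk k.+1 y| <= M by exists k.+1%:R; exact: mk_nrm.
move=> HM; rewrite (PeE_Pz x t0 (@mk_cont k.+1) HM); last by move=> y; have /andP[] := mk_bd k.+1 y.
have tT' : t < 0 + T by rewrite add0r.
have W0 := W_Du x T0 (ih_cont (@itc k)) (ih_bd B) (ih_ge0 k) _ tT'.
rewrite itS EFinD -W0; last by move=> y s s0; rewrite /ih ps_le0 ?mul0r// ltW.
congr (_ + _)%E; apply: eq_integral => r _; apply: eq_integral => y _.
rewrite /trunc; case: ifP => // /negbT; rewrite negb_and -!leNgt => /orP[r0|rT].
 by rewrite /ih ps_le0 ?mul0r ?mulr0.
by rewrite Kh_neg ?mul0r// subr_le0; lra.
Qed.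

Local Notation da k i := (fun y s => 'D_(evec R i) (it k ^~ s) y).

Lemma itW k : contW (it k) T.
Proof. by move=> y s _ _; exact: itc. Qed.

Lemma ihW k : contW (ih k) T.
Proof. by move=> y s _ _; exact: (ih_cont (@itc k)). Qed.

Lemma it_bddW k : bddW T (it k).
Proof.
have [M B] := itB k; move=> a b _ _ _; exists M => y s _ _.
by have /andP[h1 h2] := B y s; rewrite ger0_norm.
Qed.

Lemma ih_bddW k : bddW T (ih k).
Proof. by have [M B] := itB k; move=> a b _ _ _; exists (f M) => y s _ _; exact: ih_bd. Qed.

Let it_ge0 k (y : 'rV[R]_n) (s : R) : 0 <= it k y s.
Proof. by have [M B] := itB k; have /andP[] := B y s. Qed.

Lemma measurable_mk k : measT (fun y : E n => mk k (torow y)).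
Proof. by apply: measurable_torow => p _; exact: mk_cont. Qed.

Let mk0 k y : 0 <= mk k y. Proof. by have /andP[] := mk_bd k y. Qed.

Lemma it_reg k i : [/\ contW (da k i) T, bddW T (da k i) &
 forall y (s : R), 0 < s -> s < T -> is_derive y (evec R i) (it k ^~ s) (da k i y s)].
Proof.
case: k => [|k]; last first.
 exact: (reg1 (measurable_mk k.+1) (mk0 k.+1) (@itW k.+1) (@ihW k) (fun y s _ _ => it_ge0 k.+1 y s)
  (fun y s _ _ => ih_ge0 k y s) (it_mild k) (it_bddW k.+1) (ih_bddW k) i).
have d0 (y : 'rV[R]_n) (s : R) : is_derive y (evec R i) (it 0 ^~ s) 0 by exact: derv_cst.
have e0 : da 0 i = (fun _ _ => 0) by apply/funext => y; apply/funext => s; exact: is_deriveE (d0 y s).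
split => [||y s _ _]; last by rewrite (is_deriveE (d0 y s)); exact: d0.
 by rewrite e0 => y s _ _; exact: cst_continuous.
by rewrite e0 => a b _ _ _; exists 0 => y s _ _; rewrite normr0.
Qed.

Definition dih k i (y : 'rV[R]_n) (s : R) : R := ps k s * (f1 (it k y s) * da k i y s).

Lemma f1_bd (C : R) : exists2 B : R, 0 <= B & forall u : R, 0 <= u -> u <= C -> `|f1 u| <= B.
Proof.
have [C0|C0] := leP 0 C; last by exists 0 => // u h1 h2; have := le_trans h1 h2; rewrite leNgt C0.
have cn : {within `[0, C], continuous (fun u => `|f1 u|)}.
 by apply: continuous_subspaceT => u; apply: (@cvg_norm _ _ _ _ _ f1); exact: f1c.
have [c _ Hc] := @EVT_max R (fun u => `|f1 u|) 0 C C0 cn.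
by exists `|f1 c| => // u h1 h2; apply: Hc; rewrite in_itv/= h1.
Qed.

Lemma dih_W k i : [/\ contW (dih k i) T, bddW T (dih k i) &
 forall y (s : R), 0 < s -> s < T -> is_derive y (evec R i) (ih k ^~ s) (dih k i y s)].
Proof.
have [c b D] := it_reg k i; split.
- move=> y s s0 sT.
 have c1 := @cfcomp R ('rV[R]_n * R)%type f1 (fun q => it k q.1 q.2) (y, s) (@f1c _) (@itc k (y, s)).
 have H := cfM (@snd_comp_cont R n (ps k) (@ps_cont k) (y, s)) (cfM c1 (c y s s0 sT)).
 exact: H.
- move=> a' b' a0 ab bT; have [M1 H1] := b a' b' a0 ab bT.
 have [M B] := itB k; have [F F0 HF] := f1_bd M.
 exists (1 * (F * M1)) => y s h1 h2; have /andP[p0 p1] := ps_bd k s; have /andP[i0 i1] := B y s.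
 rewrite /dih (normrM (ps k s)) (ger0_norm p0); apply: ler_pM => //.
 by rewrite normrM; apply: ler_pM => //; [exact: HF|exact: H1].
- by move=> y s s0 sT; apply: derv_scale; apply: comp_derive (D y s s0 sT); exact: Df.
Qed.

Lemma it_reg2 k x (t : R) : 0 < t -> t < T ->
 is_derive t 1 (it k.+1 x) (ih k x t + \sum_i 'D_(evec R i) (da k.+1 i ^~ t) x) /\
 forall i, is_derive x (evec R i) (da k.+1 i ^~ t) ('D_(evec R i) (da k.+1 i ^~ t) x).
Proof.
move=> t0 tT.
have cd i : contW (dih k i) T by have [] := dih_W k i.
have bd i : bddW T (dih k i) by have [] := dih_W k i.
have dd i : forall y (s : R), 0 < s -> s < T -> is_derive y (evec R i) (ih k ^~ s) (dih k i y s) by have [] := dih_W k i.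
have [h1 h2] := reg2 (measurable_mk k.+1) (mk0 k.+1) (@itW k.+1) (@ihW k) (fun y s _ _ => it_ge0 k.+1 y s)
 (fun y s _ _ => ih_ge0 k y s) (it_mild k) (it_bddW k.+1) (ih_bddW k) cd bd dd x t0 tT.
by split => // i; have [] := h2 i i.
Qed.

(** Induction on [k]: the next iterate solves a heat equation whose source is at most [f] of the
    present one, hence at most [f(Z)], and comparison applies. The truncation level [K] of the
    barrier serves all steps up to [K]. *)
Lemma it_le_Z (Z : R -> R -> R) (K : nat) :
 (forall l t : R, 0 <= t -> t < T -> {for (l, t), continuous (fun p : R * R => Z p.1 p.2)}) ->
 (forall l t : R, 0 < t -> t < T -> test_super n%:R f Z l t) ->
 (forall l t : R, 0 <= t -> t < T -> 0 <= Z l t) ->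
 (forall l : R, Num.min (U l) K%:R <= Z l 0) ->
 forall k, (k <= K)%N -> forall (x : 'rV[R]_n) (t : R), x != 0 -> 0 <= t -> t < T -> it k x t <= Z (ell x) t.
Proof.
move=> cZ Zt Z0 Zi; elim=> [|k IH] kK x t x0 t0 tT; first exact: Z0.
have [M B] := itB k.+1.
apply: (@comparison R n f (it k.+1) (fun x t => ih k x t + \sum_i 'D_(evec R i) (da k.+1 i ^~ t) x) (fun i => da k.+1 i)
  (fun i x t => 'D_(evec R i) (da k.+1 i ^~ t) x) Z T M n2) => //.
- by move=> y s _ _; exact: itc.
- by move=> y s _ _; have /andP[] := B y s.
- by move=> y s s0 sT; have [] := it_reg2 k y s0 sT.
- by move=> i y s s0 sT; have [_ _ h] := it_reg k.+1 i; exact: h.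
- by move=> i y s s0 sT; have [_ h] := it_reg2 k y s0 sT; exact: h.
- move=> y s y0 s0 sT; rewrite addrK; have /andP[p0 p1] := ps_bd k s.
 apply: (@le_trans _ _ (1 * f (it k y s))); first by rewrite ler_wpM2r.
 by rewrite mul1r; apply: f_mono; apply: IH => //; [exact: ltnW|exact: ltW].
- move=> y y0; rewrite it_init mulr1; apply: le_trans (Zi (ell y)).
 by rewrite /mk (negbTE y0) le_min !ge_min lexx/= ler_nat kK orbT.
Qed.

Hypothesis bar : exists Z, barrier_family n%:R f U T Z.

(** For each [k] the barrier is taken with a [tau] suited to that level; its bound after time [b]
    does not depend on [tau], hence not on [k]. The origin, left out by comparison, is reached by
    continuity. *)
Lemma it_bound (b : R) : 0 < b -> exists2 C : R, 0 <= C & forall k y (s : R), b <= s -> s < T -> it k y s <= C.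
Proof.
move=> b0; have [Z [z1 z2 z3 z4 z5]] := bar; have [C HC] := z5 b b0.
have n0 : (0 < n)%N by exact: ltn_trans n2.
have H k (y : 'rV[R]_n) (s : R) : y != 0 -> b <= s -> s < T -> it k y s <= C.
 move=> y0 bs sT; have [tau [tau0 tauT Zi]] := z4 k%:R.
 have s0 : 0 <= s by lra.
 apply: (le_trans (it_le_Z (z1 tau tau0 tauT) (z2 tau tau0 tauT) (z3 tau tau0 tauT) Zi (leqnn k) y0 s0 sT)).
 exact: HC.
exists (Num.max 0 C) => [|k y s bs sT]; first by rewrite le_max lexx.
rewrite le_max; apply/orP; right.
have [->|y0] := eqVneq y 0; last exact: H.
rewrite leNgt; apply/negP => lt.
have c : {for (0 : R), continuous (fun r : R => it k (r *: evec R (Ordinal n0)) s)}.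
 have cp : {for (0 : R), continuous (fun r : R => (r *: evec R (Ordinal n0), s) : 'rV[R]_n * R)}.
  apply: (@cont_pair R 'rV[R]_n R); last exact: cst_continuous.
  by apply: cvgZr_tmp; exact: cvg_id.
 have e : (0 *: evec R (Ordinal n0), s) = (0, s) :> 'rV[R]_n * R by rewrite scale0r.
 exact: (@continuous_comp R ('rV[R]_n * R)%type R (fun r => (r *: evec R (Ordinal n0), s)) (fun q => it k q.1 q.2) 0 cp (@itc k _)).
have lt' : C < it k (0 *: evec R (Ordinal n0)) s by rewrite scale0r.
have /cvgr_gt/(_ _ lt')[r /= r0 Hr] := c.
have h : C < it k ((r / 2) *: evec R (Ordinal n0)) s.
 by apply: Hr; rewrite /= sub0r normrN gtr0_norm ?divr_gt0//; lra.
suff y0 : (r / 2) *: evec R (Ordinal n0) != 0 by have := H k _ s y0 bs sT; rewrite leNgt h.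
apply/eqP => /rowP/(_ (Ordinal n0)); rewrite !mxE !eqxx mulr1 => e.
by have := r0; lra.
Qed.

Let wind a b (C : R) : (forall k y (s : R), a <= s -> s < T -> it k y s <= C) -> 0 <= C -> b < T ->
 (forall k y (s : R), a <= s -> s <= b -> `|it k y s| <= Num.max C (f C)) /\
 (forall k y (s : R), a <= s -> s <= b -> `|ih k y s| <= Num.max C (f C)).
Proof.
move=> HC C0 bT; split=> k y s h1 h2.
 by rewrite ger0_norm// le_max HC//; lra.
have /andP[p0 p1] := ps_bd k s.
rewrite ger0_norm ?ih_ge0// le_max; apply/orP; right; rewrite /ih -[leRHS]mul1r.
by apply: ler_pM => //; apply: f_mono; apply: HC => //; lra.
Qed.

Let Cg_ge0 (a b : R) : a <= b -> 0 <= Cg a b.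
Proof. by move=> ab; rewrite /Cg addr_ge0 ?sqr_ge0// mulr_ge0//; lra. Qed.

Let chi_mono (a c t : R) : a < c -> c <= t -> (chi a t)^-1 <= (chi a c)^-1.
Proof.
move=> ac ct; have h1 := chi_gt0 ac; have h2 := chi_gt0 (lt_le_trans ac ct).
by rewrite lef_pV2 ?posrE// chi_nd.
Qed.

Let cI_ge0 (i : 'I_n) (S : R) : 0 <= cI i S.
Proof. by apply: Rintegral_ge0 => p _; exact: normr_ge0. Qed.

(** The window is enlarged to [[a/2, b]] so that the cutoff [chi] is bounded below on [[a, b]]; the
    constants then involve the iterates only through their uniform bound. *)
Lemma it_dx_unif (a b : R) : 0 < a -> a < b -> b < T -> exists2 M : R, 0 <= M &
 forall k i y (s : R), a <= s -> s <= b -> `|da k i y s| <= M.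
Proof.
move=> a0 ab bT; have a20 : 0 < a / 2 by lra.
have [C C0 HC] := it_bound a20; have [w1 w2] := wind HC C0 bT.
have C00 : 0 <= Num.max C (f C) by rewrite le_max C0.
have a2b : a / 2 < b by lra.
have a2a : a / 2 < a by lra.
pose M (i : 'I_n) := (chi (a / 2) a)^-1 * (Cg (a / 2) b * Num.max C (f C) * cI i (b - a / 2 + 1)).
have M0 i : 0 <= M i.
 by rewrite /M mulr_ge0 ?invr_ge0 ?chi_ge0// !mulr_ge0// Cg_ge0// ltW.
exists (\sum_i M i) => [|k i y s h1 h2]; first exact: sumr_ge0.
apply: (@le_trans _ _ (M i)); last by rewrite (bigD1 i)//= lerDl sumr_ge0.
case: k => [|k].
 by rewrite (is_deriveE (@derv_cst R 'rV[R]_n 0 y (evec R i))) normr0.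
have s1 : a / 2 < s by lra.
apply: (le_trans (reg_dx_bound (measurable_mk k.+1) (mk0 k.+1) (@itW k.+1) (@ihW k) (fun y s _ _ => it_ge0 k.+1 y s)
 (fun y s _ _ => ih_ge0 k y s) (it_mild k) a20 a2b bT (w1 k.+1) (w2 k) i y s1 h2)).
apply: ler_wpM2r; first by rewrite !mulr_ge0 ?Cg_ge0// ltW.
exact: chi_mono.
Qed.

(** The time derivative is read off the equation, as source plus Laplacian. Both are bounded by the
    window estimates, the second through uniform gradient bounds of iterate and source. *)
Lemma it_dt_unif (a b : R) : 0 < a -> a < b -> b < T -> exists2 M : R, 0 <= M &
 forall k y (s : R), a <= s -> s <= b -> exists2 d : R, is_derive s 1 (it k y) d & `|d| <= M.
Proof.
move=> a0 ab bT; have a20 : 0 < a / 2 by lra.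
pose b' := (b + T) / 2; have bb' : b < b' by rewrite /b'; lra.
have b'T : b' < T by rewrite /b'; lra.
have [C C0 HC] := it_bound a20; have [w1 w2] := wind HC C0 b'T.
have a2b : a / 2 < b' by lra.
have a2a : a / 2 < a by lra.
have [M1 M10 HM1] := it_dx_unif a20 a2b b'T.
have [F F0 HF] := f1_bd C.
pose M' := Num.max M1 (F * M1).
have M'0 : 0 <= M' by rewrite le_max M10.
have d1 k i y (s : R) : a / 2 <= s -> s <= b' -> `|da k i y s| <= M'.
 by move=> h1 h2; rewrite le_max HM1.
have d2 k i y (s : R) : a / 2 <= s -> s <= b' -> `|dih k i y s| <= M'.
 move=> h1 h2; have /andP[p0 p1] := ps_bd k s; rewrite le_max; apply/orP; right.
 rewrite /dih (normrM (ps k s)) (ger0_norm p0) -[leRHS]mul1r; apply: ler_pM => //.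
 rewrite normrM; apply: ler_pM => //; last exact: HM1.
 by apply: HF => //; apply: HC => //; lra.
pose M (i : 'I_n) := (chi (a / 2) a)^-1 * (Cg (a / 2) b' * M' * cI i (b' - a / 2 + 1)).
have M0 i : 0 <= M i.
 by rewrite /M mulr_ge0 ?invr_ge0 ?chi_ge0// !mulr_ge0// Cg_ge0// ltW.
have C00 : 0 <= Num.max C (f C) by rewrite le_max C0.
exists (Num.max C (f C) + \sum_i M i) => [|k y s h1 h2]; first by rewrite addr_ge0// sumr_ge0.
case: k => [|k].
 by exists 0; [exact: der_cst|rewrite normr0 addr_ge0// sumr_ge0].
have s1 : a / 2 < s by lra.
have s2 : s < b' by lra.
have cd i : contW (dih k i) T by have [] := dih_W k i.
have dd i : forall y (s : R), 0 < s -> s < T -> is_derive y (evec R i) (ih k ^~ s) (dih k i y s) by have [] := dih_W k i.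
have cda i : contW (da k.+1 i) T by have [] := it_reg k.+1 i.
have dda i : forall y (s : R), 0 < s -> s < T -> is_derive y (evec R i) (it k.+1 ^~ s) (da k.+1 i y s) by have [] := it_reg k.+1 i.
have s0 : 0 < s by lra.
have sT : s < T by lra.
have [D _] := it_reg2 k y s0 sT.
exists (ih k y s + \sum_i 'D_(evec R i) (da k.+1 i ^~ s) y) => //.
apply: le_trans (ler_normD _ _) _; apply: lerD; first by apply: w2; lra.
apply: le_trans (ler_norm_sum _ _ _) _; apply: ler_sum => i _.
apply: (le_trans (reg_ddx_bound (measurable_mk k.+1) (mk0 k.+1) (@itW k.+1) (@ihW k) (fun y s _ _ => it_ge0 k.+1 y s)
 (fun y s _ _ => ih_ge0 k y s) (it_mild k) a20 a2b b'T (w1 k.+1) (w2 k) cd cda dd dda (d1 k.+1) (d2 k) i i y s1 s2)).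
apply: ler_wpM2r; first by rewrite !mulr_ge0 ?Cg_ge0// ltW.
exact: chi_mono.
Qed.

Definition lm (y : 'rV[R]_n) (s : R) : R :=
 if (0 < s) && (s < T) then sup (range (fun k => it k y s)) else 0.

Lemma lm_cvg y (s : R) : 0 < s -> s < T -> it k y s @[k --> \oo] --> lm y s.
Proof.
move=> s0 sT; rewrite /lm s0 sT/=; apply: nondecreasing_cvgn.
 by apply/nondecreasing_seqP => k; exact: it_nd.
by have [C _ HC] := it_bound s0; exists C => _ [k _ <-]; exact: HC.
Qed.

Let it_nd2 k k' y s : (k <= k')%N -> it k y s <= it k' y s.
Proof. by move=> h; have /nondecreasing_seqP := (fun k => it_nd k y s); apply. Qed.

Lemma it_le_lm k y (s : R) : 0 < s -> s < T -> it k y s <= lm y s.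
Proof.
move=> s0 sT; apply: (@seq_le R (fun=> it k y s) (fun k => it k y s)); first exact: cvg_cst.
 exact: lm_cvg.
by exists k => // k' /= h; exact: it_nd2.
Qed.

Lemma lm_ge0 y s : 0 <= lm y s.
Proof.
have [/andP[s0 sT]|h] := boolP ((0 < s) && (s < T)); last by rewrite /lm (negbTE h).
exact: (it_le_lm 0 y s0 sT).
Qed.

Lemma lm_bound (b : R) : 0 < b -> exists2 C : R, 0 <= C & forall y (s : R), b <= s -> s < T -> lm y s <= C.
Proof.
move=> b0; have [C C0 HC] := it_bound b0; exists C => // y s bs sT.
have s0 : 0 < s by exact: lt_le_trans bs.
apply: (@seq_le R (fun k => it k y s) (fun=> C)); [exact: lm_cvg|exact: cvg_cst|].
by apply: nearW => k; exact: HC.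
Qed.

(** Space increments follow the axes one coordinate at a time, hence the factor [n]; time increments
    use the mean value theorem. *)
Lemma it_lip (a b : R) : 0 < a -> a < b -> b < T -> exists2 L : R, 0 <= L &
 forall k y y' (s s' : R), a <= s -> s <= b -> a <= s' -> s' <= b ->
  `|it k y s - it k y' s'| <= L * (`|y - y'| + `|s - s'|).
Proof.
move=> a0 ab bT; have [Mx Mx0 HMx] := it_dx_unif a0 ab bT; have [Mt Mt0 HMt] := it_dt_unif a0 ab bT.
have time k y (s s' : R) : a <= s -> s < s' -> s' <= b -> `|it k y s' - it k y s| <= Mt * (s' - s).
 move=> h1 h2 h3; have pk (r : R) : exists d : R, s <= r <= s' -> is_derive r 1 (it k y) d /\ `|d| <= Mt.
  have [/andP[r1 r2]|hr] := boolP (s <= r <= s'); last by exists 0.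
  have [||d Dd bd] := HMt k y r; [lra|lra|by exists d].
 have [d Hd] := choice pk.
 have [|c [c1 c2 ->]] := @MVT_itv R (it k y) d s s' h2.
  by move=> r r1 r2; have [|] := Hd r; first by rewrite r1 r2.
 have [|_ bd] := Hd c; first by rewrite !ltW.
 rewrite (normrM (d c)) (@ger0_norm _ (s' - s)); last by lra.
 by apply: ler_wpM2r => //; lra.
have time2 k y (s s' : R) : a <= s -> s <= b -> a <= s' -> s' <= b -> `|it k y s - it k y s'| <= Mt * `|s - s'|.
 move=> h1 h2 h3 h4; have [e|e|<-] := ltgtP s s'; last by rewrite !subrr normr0 mulr0.
  by rewrite distrC (distrC s); rewrite (@ger0_norm _ (s' - s)) ?time//; lra.
 by rewrite (@ger0_norm _ (s - s')) ?time//; lra.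
have sp k y y' (s : R) : a <= s -> s <= b -> `|it k y s - it k y' s| <= n%:R * Mx * `|y - y'|.
 move=> h1 h2; have s0 : 0 < s by lra.
 have sT : s < T by lra.
 have D i z : is_derive z (evec R i) (it k ^~ s) (da k i z s) by have [_ _] := it_reg k i; exact.
 set v := y - y'; have -> : y = v + y' by rewrite /v subrK.
 suff H (j : nat) : (j <= n)%N -> `|it k (vcut v j + y') s - it k y' s| <= j%:R * Mx * `|v|.
  by have := H n (leqnn n); rewrite vcutn.
 elim: j => [|j IH] jn; first by rewrite vcut0 add0r subrr normr0 !mul0r.
 have := vcutS v (Ordinal jn); rewrite /= => ->; rewrite -addrA.
 have [th _ e] := MVT_line (vcut v j + y') (v ord0 (Ordinal jn)) (D (Ordinal jn)).
 rewrite -[X in `|X|](subrKA (it k (vcut v j + y') s)) e.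
 apply: le_trans (ler_normD _ _) _; rewrite -natr1 !mulrDl mul1r addrC; apply: lerD; first exact: IH (ltnW jn).
 rewrite (normrM (v _ _)) mulrC; apply: ler_pM => //; first exact: HMx.
 exact: normr_coord.
have nM : 0 <= n%:R * Mx by exact: mulr_ge0.
exists (n%:R * Mx + Mt) => [|k y y' s s' h1 h2 h3 h4]; first exact: addr_ge0.
rewrite -[X in `|X|](subrKA (it k y' s)); apply: le_trans (ler_normD _ _) _.
have e1 := sp k y y' s h1 h2; have e2 := time2 k y' s s' h1 h2 h3 h4.
apply: le_trans (lerD e1 e2) _; have := normr_ge0 (y - y'); have := normr_ge0 (s - s').
by rewrite mulrDr !mulrDl; nra.
Qed.

(** A pointwise limit inherits the Lipschitz bound that is uniform in [k]. *)
Lemma lm_cont : contW lm T.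
Proof.
move=> y s s0 sT.
have a0 : 0 < s / 2 by lra.
have ab : s / 2 < (s + T) / 2 by lra.
have bT : (s + T) / 2 < T by lra.
have [L L0 HL] := it_lip a0 ab bT.
have HL2 (q : 'rV[R]_n * R) : s / 2 < q.2 < (s + T) / 2 -> `|lm y s - lm q.1 q.2| <= L * (`|y - q.1| + `|s - q.2|).
 move=> /andP[q1 q2].
 apply: (@seq_le R (fun k => `|it k y s - it k q.1 q.2|) (fun=> L * (`|y - q.1| + `|s - q.2|))).
 - by apply: cvg_norm; apply: cvgB; apply: lm_cvg; lra.
 - exact: cvg_cst.
 - by apply: nearW => k; apply: HL; lra.
apply/cvgrPdist_lt => e e0.
have e' : 0 < e / (2 * (L + 1)) by apply: divr_gt0 => //; lra.
have N1 : \forall q \near (y, s), s / 2 < q.2 < (s + T) / 2 by apply: snd_near; lra.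
set e1 := e / _ in e'; have N2 : \forall q \near (y, s), `|y - q.1| < e1 /\ `|s - q.2| < e1.
 exists (ball y e1, ball s e1); first by split; exact: nbhsx_ballx.
 by move=> q [/= h1 h2]; move: h1 h2; rewrite -!ball_normE.
near=> q; apply: (@le_lt_trans _ _ (L * (`|y - q.1| + `|s - q.2|))); first by apply: HL2; near: q.
have [h1 h2] : `|y - q.1| < e1 /\ `|s - q.2| < e1 by near: q.
apply: (@le_lt_trans _ _ (L * (e / (L + 1)))).
 apply: ler_wpM2l => //; have -> : e / (L + 1) = e1 + e1 by rewrite /e1; field; lra.
 by apply/ltW/ltrD.
by rewrite mulrA ltr_pdivrMr; [nra|lra].
Unshelve. all: by end_near. Qed.

Hypotheses (mus : measT (fun y : E n => us U (torow y)))
 (star : stationary_mild n f U).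

Let n0 : (0 < n)%N. Proof. exact: ltn_trans n2. Qed.
Let u0 (y : 'rV[R]_n) : 0 <= us U y. Proof. exact: us_ge0. Qed.

Let mfus : measT (fun y : E n => f (us U (torow y))).
Proof. exact: (measurableT_comp (continuous_measurable_fun fc) mus). Qed.

Lemma measurable_const_in_time (k : E n -> R) : measT k ->
 measT (fun p : R * E n => if 0 < p.1 then k p.2 else 0).
Proof.
move=> mk; apply: measurable_fun_ifT => //; last exact: measurableT_comp mk measurable_snd.
by apply: measurable_fun_ltr => //; exact: measurable_fst.
Qed.

Lemma mk_le_us k y : y != 0 -> mk k y <= us U y.
Proof. by move=> y0; rewrite /mk /us cutzE// (negbTE y0) ge_min lexx. Qed.

(** Induction, comparing the two integral formulas term by term. The bound on the sources fails to
    be known at the origin only, which is negligible. *)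
Lemma it_le_us k x (t : R) : x != 0 -> 0 < t -> t < T -> it k x t <= us U x.
Proof.
elim: k x t => [|k IH] x t x0 t0 tT; first exact: u0.
rewrite -lee_fin (it_mild k x t0 tT) (star x0 t0) -(Du_stationary _ _ mfus) => [|y]; last exact: f_ge0.
apply: leeD.
 by apply: Pe_ae_le => //; [exact: measurable_mk|move=> _ y; exact: mk_le_us].
apply: Du_ae_le => //.
- by apply: meas_trunc; exact: ihW.
- exact: (measurable_const_in_time mfus).
- by move=> r y; apply: trunc_ge0 => ? ? _ _; exact: ih_ge0.
- by move=> r y; case: ifP.
- move=> r y rt y0; rewrite /trunc (lt_trans rt tT) andbT; case: ifP => // r0.
 have /andP[p0 p1] := ps_bd k r; rewrite /ih -[leRHS]mul1r; apply: ler_pM => //.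
 by apply: f_mono; apply: IH => //; exact: lt_trans rt tT.
Qed.

Lemma lm_le_us x (t : R) : x != 0 -> 0 < t -> t < T -> lm x t <= us U x.
Proof.
move=> x0 t0 tT; apply: (@seq_le R (fun k => it k x t) (fun=> us U x)); [exact: lm_cvg|exact: cvg_cst|].
by apply: nearW => k; exact: it_le_us.
Qed.

Lemma Pe_mk_cvg (t : R) (x : E n) :
 (PeE t (fun y => mk k.+1 (torow y)) x @[k --> \oo] --> PeE t (fun y => us U (torow y)) x)%E.
Proof.
have mc k := measurable_cutz (measurable_mk k).
have c0 k (y : 'rV[R]_n) : 0 <= cutz (mk k) y by rewrite /cutz; case: ifP.
have -> : (fun k => PeE t (fun y => mk k.+1 (torow y)) x) = (fun k => PeE t (fun y => cutz (mk k.+1) (torow y)) x).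
 apply/funext => k; apply: Pe_ae_eq => //; first exact: measurable_mk.
 by move=> y y0; rewrite cutzE.
apply: (Pe_cvg (g_ := fun k (y : E n) => cutz (mk k.+1) (torow y))) => // [y k k' kk|y].
 by rewrite /cutz; case: ifP => // _; exact: mk_nd.
rewrite /us /cutz; case: ifPn => y0; first exact: cvg_cst.
apply: cvg_near_cst; have [K HK] : exists K : nat, U (ell (torow y)) <= K%:R.
 by exists (Num.trunc (U (ell (torow y)))).+1; apply/ltW; exact: truncnS_gt.
by exists K => // k /= kK; rewrite /mk (negbTE y0); apply/min_idPl/(le_trans HK); rewrite ler_nat ltnW.
Qed.

Let h0 (y : 'rV[R]_n) s : 0 <= f (lm y s). Proof. exact: f_ge0. Qed.

Let lmh : contW (fun y s => f (lm y s)) T.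
Proof. by move=> y s s0 sT; have H := cfcomp (g := fun q : 'rV[R]_n * R => lm q.1 q.2) (x := (y, s)) (@fc (lm y s)) (lm_cont s0 sT); exact: H. Qed.

(** Monotone convergence in the datum and in the source, where both the switch [ps] and the iterates
    increase. *)
Lemma lm_mild : mild (us U) lm (fun y s => f (lm y s)) T.
Proof.
move=> x t t0 tT.
have c1 : (it k.+1 x t)%:E @[k --> \oo] --> (lm x t)%:E.
 apply/cvg_EFin; first by apply: nearW.
 by rewrite (cvg_shiftS (fun k => it k x t)); exact: lm_cvg.
have c2 : (DuE (trunc T (ih k)) (fromrow x) t @[k --> \oo] --> DuE (trunc T (fun y s => f (lm y s))) (fromrow x) t)%E.
 apply: Du_cvg.
 - by move=> k; apply: meas_trunc; exact: ihW.
 - by move=> k r y; apply: trunc_ge0 => ? ? _ _; exact: ih_ge0.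
 - move=> r y k k' kk; rewrite /trunc; case: ifP => // _.
  have /andP[p0 p1] := ps_bd k r; apply: ler_pM => //; first exact: ps_nd.
  by apply: f_mono; exact: it_nd2.
 - move=> r y; rewrite /trunc; case: ifP => [/andP[r0 rT]|_]; last exact: cvg_cst.
  have cf : f (it k (torow y) r) @[k --> \oo] --> f (lm (torow y) r).
   exact: (cvg_comp _ _ (@lm_cvg (torow y) r r0 rT) (@fc (lm (torow y) r))).
  have cp : ps k r @[k --> \oo] --> (1 : R) by apply: cvg_near_cst; exact: ps1.
  by have H := cvgM cp cf; rewrite mul1r in H; apply: H.
have D0 : (PeE t (fun y => us U (torow y)) (fromrow x) +? DuE (trunc T (fun y s => f (lm y s))) (fromrow x) t)%E.
 apply: ge0_adde_def; rewrite inE; apply: integral_ge0 => r _; last apply: integral_ge0 => y _.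
  by rewrite lee_fin mulr_ge0 ?Kh_ge0.
 by rewrite lee_fin mulr_ge0 ?Kh_ge0// trunc_ge0.
have c3 : ((it k.+1 x t)%:E @[k --> \oo] --> PeE t (fun y => us U (torow y)) (fromrow x) +
  DuE (trunc T (fun y s => f (lm y s))) (fromrow x) t)%E.
 under eq_fun do rewrite (it_mild _ x t0 tT); exact: (cvgeD D0 (@Pe_mk_cvg t (fromrow x)) c2).
exact: (cvg_unique _ c1 c3).
Qed.

Lemma lm_ge_Pe x (t : R) : 0 < t -> t < T -> (PeE t (fun y => us U (torow y)) (fromrow x) <= (lm x t)%:E)%E.
Proof.
move=> t0 tT; rewrite (lm_mild x t0 tT) leeDl// integral_ge0// => r _.
by apply: integral_ge0 => y _; rewrite lee_fin mulr_ge0 ?Kh_ge0// trunc_ge0.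
Qed.

Let lmB : bddW T lm.
Proof.
move=> a b a0 ab bT; have [C C0 HC] := lm_bound a0; exists C => y s h1 h2.
by rewrite ger0_norm ?lm_ge0//; apply: HC => //; exact: le_lt_trans bT.
Qed.

Let hB : bddW T (fun y s => f (lm y s)).
Proof.
move=> a b a0 ab bT; have [C C0 HC] := lm_bound a0; exists (f C) => y s h1 h2.
by rewrite ger0_norm//; apply: f_mono; apply: HC => //; exact: le_lt_trans bT.
Qed.

Local Notation dlm i := (fun y s => 'D_(evec R i) (lm ^~ s) y).
Let r1 i := reg1 mus u0 lm_cont lmh (fun y s _ _ => lm_ge0 y s) (fun y s _ _ => h0 y s) lm_mild lmB hB i.

Let dh (i : 'I_n) y s : R := f1 (lm y s) * dlm i y s.
Let r2 x (t : R) : 0 < t -> t < T ->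
 is_derive t 1 (lm x) (f (lm x t) + \sum_i 'D_(evec R i) (dlm i ^~ t) x) /\
 forall i j, is_derive x (evec R j) (dlm i ^~ t) ('D_(evec R j) (dlm i ^~ t) x) /\
  {for (x, t), continuous (fun q : 'rV[R]_n * R => 'D_(evec R j) (dlm i ^~ q.2) q.1)}.
Proof.
apply: (reg2 mus u0 lm_cont lmh (fun y s _ _ => lm_ge0 y s) (fun y s _ _ => h0 y s) lm_mild lmB hB (dh := dh)).
- move=> i y s s0 sT; have [c _ _] := r1 i.
 by have H := cfM (cfcomp (g := fun q : 'rV[R]_n * R => lm q.1 q.2) (x := (y, s)) (@f1c (lm y s)) (lm_cont s0 sT)) (c y s s0 sT); exact: H.
- move=> i a b a0 ab bT; have [_ B _] := r1 i; have [M HM] := B a b a0 ab bT.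
 have [C C0 HC] := lm_bound a0; have [F F0 HF] := f1_bd C.
 exists (F * M) => y s h1 h2; rewrite normrM; apply: ler_pM => //; last exact: HM.
 by apply: HF; [exact: lm_ge0|apply: HC => //; exact: le_lt_trans bT].
- move=> i y s s0 sT; have [_ _ D] := r1 i; have Ds := D y s s0 sT.
 apply/is_derive_lineP; rewrite /dh.
 have H := der_comp (g := fun r : R => lm (r *: evec R i + y) s) (x := 0 : R).
 by have := H f _ _ _ ((is_derive_lineP _ _ _ _).1 Ds); apply; rewrite scale0r add0r.
Qed.

Lemma sum_cont (X : topologicalType) m (g : 'I_m -> X -> R) (x : X) : (forall i, {for x, continuous (g i)}) ->
 {for x, continuous (fun y => \sum_i g i y)}.
Proof.
move=> H; have -> : (fun y => \sum_i g i y) = \sum_i g i by apply/funext => y; rewrite fct_sumE.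
by elim/big_ind: _ => [|a b ca cb|i _]; [exact: cvg_cst|have h := cfD ca cb; exact: h|].
Qed.

(** The limit satisfies its own mild equation, so the regularity theory applies to it directly, with
    [f1 (lm)] times the gradient of [lm] as gradient of the source. *)
Lemma lm_classical : classical_sol f lm T.
Proof.
move=> x t t0 tT; have [Dt D2] := r2 x t0 tT; split.
- exact: lm_cont.
- split; first by have [] := Dt.
 apply: (@near_cont_at R _ (fun q => f (lm q.1 q.2) + \sum_i 'D_(evec R i) (dlm i ^~ q.2) q.1)).
  have := snd_near x t0 tT; apply: filterS => q /andP[q0 qT].
  by have [D _] := r2 q.1 q0 qT; rewrite derive1E (is_deriveE D).
 have H := cfD (lmh t0 tT) (sum_cont (fun i => (D2 i i).2)); exact: H.
- by move=> i; have [c _ D] := r1 i; split; [have [] := D x t t0 tT|exact: c].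
- by move=> i j; have [D c] := D2 i j; split => //; have [] := D.
- by rewrite derive1E (is_deriveE Dt) /laplacian addrK.
Qed.

Lemma lm_Linfty : Linfty_loc lm T.
Proof.
move=> a b a0 ab bT; have [C C0 HC] := lm_bound a0; exists C => t h1 h2; apply: nearW => y.
by rewrite ger0_norm ?lm_ge0//; apply: HC => //; exact: le_lt_trans bT.
Qed.

End iteration.

(** * The stationary solution and the limit as two distinct solutions *)

Section solutions.
Variables (R : realType) (n : nat) (f U : R -> R) (v : 'rV[R]_n -> R).
Local Notation E m := (mst (lebN R m)).
Hypotheses (n2 : (2 < n)%N) (fc : continuous f) (f_ge0 : forall u : R, 0 <= f u)
 (U_ge0 : forall l : R, 0 <= U l) (v_ge0 : forall x, 0 <= v x) (vE : forall x, x != 0 -> v x = us U x)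
 (mus : measT (fun y : E n => us U (torow y))).
Let n0 : (0 < n)%N. Proof. exact: ltn_trans n2. Qed.
Let u0 (y : 'rV[R]_n) : 0 <= us U y. Proof. exact: us_ge0. Qed.

Lemma measurable_v : measT (fun y : E n => v (torow y)).
Proof.
rewrite (_ : (fun y : E n => _) = fun y : E n => if torow y == 0 then v 0 else us U (torow y)).
 by apply: measurable_fun_ifT => //; exact: measurable_eq0.
by apply/funext => y; case: eqP => [->//|/eqP]; exact: vE.
Qed.

Let mfv : measT (fun y : E n => f (v (torow y))).
Proof. exact: (measurableT_comp (continuous_measurable_fun fc) measurable_v). Qed.
Let mfu : measT (fun y : E n => f (us U (torow y))).
Proof. exact: (measurableT_comp (continuous_measurable_fun fc) mus). Qed.

Let Pev (t : R) (x : E n) : PeE t (fun y => v (torow y)) x = PeE t (fun y => us U (torow y)) x.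
Proof. by apply: Pe_ae_eq => // [|y]; [exact: measurable_v|exact: vE]. Qed.

(** The value of [v] at the origin is arbitrary; the formula is claimed almost everywhere, and the
    slabs [t = 0] and [x = 0] are null. *)
Lemma stationary_solution :
 stationary_mild n f U ->
 is_solution f v (fun x _ => v x) +oo%E.
Proof.
move=> star; split=> //.
 apply: measurable_funTS; have H := measurableT_comp measurable_v (@measurable_snd _ _ R (E n)); exact: H.
have := ae_snd_neq0 R n0; have := @null_slab R n 0; apply: filterS2 => p p1 p2 t0 _.
have {}t0 : 0 < p.1 by rewrite lt_neqAle eq_sym p1.
rewrite (vE p2) (star _ _ p2 t0) -Pev (Pe_intN _ _ t0); congr (_ + _)%E.
rewrite -(@Du_integral R n p.1 (torow p.2) (fun r y => if 0 < r then f (v (torow y)) else 0) (fun y _ => f (v y)) t0).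
- rewrite (Du_stationary p.1 _ mfv (fun y => f_ge0 _)); apply: eq_integral => q _.
 by apply: (Pe_ae_eq n0 q _ mfu mfv) => [y|y|y y0]; [exact: f_ge0|exact: f_ge0|rewrite vE].
- exact: (measurable_const_in_time mfv).
- by move=> r y; case: ifP.
- by move=> r y; rewrite leNgt => /negbTE ->.
- by move=> r y ->.
Qed.

Lemma mild_solution (w : 'rV[R]_n -> R -> R) (T : R) : contW w T -> (forall y s, 0 <= w y s) ->
 (forall y s, ~~ ((0 < s) && (s < T)) -> w y s = 0) -> mild (us U) w (fun y s => f (w y s)) T ->
 is_solution f v w T%:E.
Proof.
move=> cw w0 wz wm; split=> //.
 apply: measurable_funTS; have H := meas_trunc cw; apply: eq_measurable_fun H => p _ /=.
 by rewrite /trunc; case: ifPn => // /wz ->.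
have cfw : contW (fun y s => f (w y s)) T.
 move=> y s s0 sT; have H := cfcomp (g := fun q : 'rV[R]_n * R => w q.1 q.2) (x := (y, s)) (@fc (w y s)) (cw y s s0 sT).
 exact: H.
have := @null_slab R n 0; apply: filterS => p p1 t0; rewrite lte_fin => tT.
have {}t0 : 0 < p.1 by rewrite lt_neqAle eq_sym p1.
rewrite (wm _ _ t0 tT) -Pev (Pe_intN _ _ t0); congr (_ + _)%E.
apply: (@Du_integral R n p.1 (torow p.2) (trunc T (fun y s => f (w y s))) (fun y s => f (w y s)) t0 (meas_trunc cfw)).
- by move=> r y; apply: trunc_ge0.
- by move=> r y r0; rewrite /trunc ltNge r0.
- by move=> r y r0 rt; rewrite /trunc r0 (lt_trans rt tT).
Qed.

Lemma leb_oo (a b : R) : a < b -> (0 < leb (`]a, b[%classic : set R))%E.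
Proof. by move=> ab; rewrite lebesgue_measure_itv/= lte_fin ab -EFinB lte_fin subr_gt0. Qed.

(** A product set near the origin, so that positivity of its measure follows coordinate by
    coordinate. *)
Fixpoint cube (m : nat) (d : R) {struct m} : set (E m) :=
 match m return set (E m) with 0 => setT | j.+1 => `]0, d[%classic `*` cube d end.

Arguments cube : clear implicits.
Lemma cubeP m (d : R) : 0 < d -> [/\ measurable (cube m d), (0 < lebRN R m (cube m d))%E &
 forall p : E m, cube m d p -> forall i, (i < m)%N -> 0 < coords p i < d].
Proof.
move=> d0; elim: m => [|m [mc pc cc]].
 by split=> //; rewrite /lebRN /= diracE in_setT lte_fin.
split=> /=; first exact: measurableX.
- rewrite /lebRN /= /pmeas product_measure1E//; apply: mule_gt0 => //.
 exact: leb_oo.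
- move=> p [/= h1 h2] [|i] /= il; first by move: h1; rewrite in_itv.
 exact: cc.
Qed.

(** After time [T/3] the function [w] is bounded, while [v] exceeds that bound on a small cube; the
    corresponding box in space-time has positive measure. *)
Lemma lm_differs (w : 'rV[R]_n -> R -> R) (T : R) : 0 < T ->
 (forall b : R, 0 < b -> exists2 C : R, 0 <= C & forall y (s : R), b <= s -> s < T -> w y s <= C) ->
 (forall K : R, exists l0 : R, forall l, l <= l0 -> K < U l) ->
 ~ aeST (fun x t => 0 <= t -> t < T -> w x t = v x).
Proof.
move=> T0 wb Ucv [Z [mZ Z0 HZ]]; have b0 : 0 < T / 3 by lra.
have [C C0 HC] := wb _ b0; have [l0 Hl] := Ucv C.
have nR : 0 < n%:R :> R by rewrite ltr0n.
(* On the cube [|x|^2 <= n d^2 <= expR (2 * l0)]. *)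
pose d := expR l0 / n%:R; have d0 : 0 < d by rewrite divr_gt0// expR_gt0.
have [mc pc cc] := cubeP n d0.
pose A : set (E n.+1) := `]T / 3, T[%classic `*` cube n d.
have mA : measurable A by exact: measurableX.
have AZ : A `<=` Z.
 move=> p [/= /[!in_itv]/= /andP[p1 p2] p3]; apply: HZ => /= H.
 have {}H := H (ltW (lt_trans b0 p1)) p2.
 have cp (i : 'I_n) : 0 < torow p.2 ord0 i < d by rewrite mxE; exact: cc.
 have rd : rho (torow p.2) <= expR (2 * l0).
  have -> : 2 * l0 = l0 + l0 by ring.
  rewrite expRD; apply: (@le_trans _ _ (\sum_(i < n) d ^+ 2)).
   by apply: ler_sum => i _; have /andP[h1 h2] := cp i; rewrite ler_sqr ?nnegrE; [|exact: ltW..]; exact: ltW.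
  rewrite sumr_const card_ord -[leLHS]mulr_natr /d.
  have -> : (expR l0 / n%:R) ^+ 2 * n%:R = expR l0 * expR l0 / n%:R by field; rewrite gt_eqF.
  by rewrite ler_pdivrMr// ler_peMr// ?mulr_ge0 ?expR_ge0// (ler_nat R 1).
 have x0 : torow p.2 != 0.
  apply/eqP => e; have /andP[] := cp (Ordinal n0); by rewrite e mxE ltxx.
 have le : ell (torow p.2) <= l0.
  by rewrite -(ler_pM2l (ltr0n R 2)) -ler_expR exp2_ell.
 have := HC (torow p.2) p.1 (ltW p1) p2; rewrite H vE// /us cutzE//.
 by have := Hl _ le; lra.
have : (lebST R n A <= lebST R n Z)%E by apply: le_measure; rewrite ?inE.
rewrite [X in (_ <= X)%E]Z0 leNgt => /negP; apply.
rewrite /lebST /= /pmeas product_measure1E//; apply: mule_gt0 => //.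
by apply: leb_oo; lra.
Qed.

End solutions.

(** * Integrals of powers by products over the coordinates *)

Section power_integrals.
Variable R : realType.
Local Notation E m := (mst (lebN R m)).

Lemma integral_sing (F g : R -> R) (S : R) : 0 < S -> (forall s : R, 0 < s -> is_derive s 1 F (g s)) ->
 (forall s : R, 0 < s -> {for s, continuous g}) -> (forall s, 0 <= F s) -> (forall s, 0 <= g s) ->
 measT g -> (\int[leb]_(s in `]0%R, S]) (g s)%:E <= (F S)%:E)%E.
Proof.
move=> S0 D c F0 g0 mg.
have m2 : measurable_fun [set: R] (fun s => (g s)%:E) by apply/measurable_EFinP.
have H : (\int[leb]_(s in `[(k.+1%:R^-1)%R, S]) (g s)%:E @[k --> \oo] --> \int[leb]_(s in `]0%R, S]) (g s)%:E)%E.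
 rewrite -bigcup_itv0; apply: ge0_nondecreasing_set_cvg_integral => //.
 - move=> i j ij; apply/subsetPset => s /=; rewrite !in_itv/= => /andP[h ->].
  by rewrite andbT (le_trans _ h)// lef_pV2 ?posrE ?ltr0n// ler_nat ltnS.
 - by move=> i; exact: measurable_funTS.
 - by move=> i s _; rewrite lee_fin.
rewrite -(cvg_lim _ H)//; apply: lime_le.
 by apply/cvg_ex; eexists; exact: H.
apply: nearW => k; have k0 : 0 < (k.+1%:R : R)^-1 by rewrite invr_gt0.
have [kS|Sk] := ltP (k.+1%:R^-1) S; first by rewrite (FTC_pos k0 kS D c) -EFinB lee_fin lerBlDr lerDl.
rewrite (_ : `[_, S]%classic = if k.+1%:R^-1 == S then [set S] else set0); last first.
 case: eqP => [->|ne]; first by rewrite set_itv1.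
 by rewrite set_itv_ge// -ltNge lt_neqAle Sk andbT eq_sym; apply/eqP.
by case: ifP => _; rewrite ?integral_set1 ?integral_set0// lee_fin.
Qed.

Variables (a d : R).
Hypotheses (a1 : a < 1) (d0 : 0 < d).
(** The one-sided power [x^(-a)] on []0, d]]. Products of [hp x + hp (- x)] over the coordinates
    dominate powers of [|y|] and are integrated without polar coordinates. *)
Definition hp (x : R) : R := if (0 < x) && (x <= d) then expR (- a * ln x) else 0.
Definition pw : R := 2 * (expR ((1 - a) * ln d) / (1 - a)).

Lemma hp_ge0 x : 0 <= hp x. Proof. by rewrite /hp; case: ifP => // _; exact: expR_ge0. Qed.

Let mexp : measT (fun x : R => expR (- a * ln x)).
Proof.
apply: measurableT_comp; first exact: measurable_expR.
by apply: measurable_funM => //; exact: measurable_ln.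
Qed.

Lemma measurable_hp : measT hp.
Proof.
apply: measurable_fun_ifT => //; apply: measurable_and; first exact: measurable_fun_ltr.
exact: measurable_fun_ler.
Qed.

Lemma hp_int : (\int[leb]_x (hp x + hp (- x))%:E <= pw%:E)%E.
Proof.
have mE : measT (fun x => (hp x)%:E) by apply/measurable_EFinP; exact: measurable_hp.
have h0 x : (0 <= (hp x)%:E)%E by rewrite lee_fin hp_ge0.
have mE2 : measT (fun x : R => (hp (- x))%:E).
 by have H := measurableT_comp mE (@oppr_measurable R setT); apply: H.
under eq_integral do rewrite EFinD.
rewrite ge0_integralD//; have := lebesgue_reflect 0 mE h0.
under [RHS]eq_integral do rewrite sub0r.
move=> <-; have J : (\int[leb]_x (hp x)%:E <= (expR ((1 - a) * ln d) / (1 - a))%:E)%E.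
 have -> : (\int[leb]_x (hp x)%:E = \int[leb]_(x in `]0%R, d]) (expR (- a * ln x))%:E)%E.
  rewrite [RHS]integral_mkcond; apply: eq_integral => x _; rewrite patchE mem_setE in_itv/= /hp.
  by case: ifP.
 apply: (@integral_sing (fun s => expR ((1 - a) * ln s) / (1 - a)) (fun x => expR (- a * ln x)) d d0 _ _ _ _ mexp).
 - move=> s s0; have a10 : 1 - a != 0 by have h := a1; lra.
  have D := der_scale (1 - a)^-1 (der_exp (der_scale (1 - a) (der_ln s0 (der_id s)))).
  apply: is_derive_eq; first by under eq_fun do rewrite mulrC; exact: D.
  rewrite (_ : - a * ln s = (1 - a) * ln s - ln s); last by ring.
  by rewrite expRD expRN lnK ?posrE//; field; rewrite a10 gt_eqF.
 - move=> s s0; have D := der_exp (der_scale (- a) (der_ln s0 (der_id s))).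
  exact: der_cont D.
 - by move=> s; have h := a1; rewrite divr_ge0 ?expR_ge0//; lra.
 - by move=> s; exact: expR_ge0.
by apply: le_trans (leeD J J) _; rewrite -EFinD lee_fin /pw; lra.
Qed.

Lemma prod_int n (h : R -> R) (c : R) : measT h -> (forall x, 0 <= h x) ->
 (\int[leb]_x (h x)%:E <= c%:E)%E ->
 measT (fun p : E n => \prod_(i < n) h (coords p i)) /\
 (\int[lebRN R n]_p (\prod_(i < n) h (coords p i))%:E <= (c ^+ n)%:E)%E.
Proof.
move=> mh h0 hc; elim: n => [|n [IHm IH]].
 under eq_fun do rewrite big_ord0; split; first exact: measurable_cst.
 under eq_integral do rewrite big_ord0.
 by rewrite /lebRN /= integral_dirac//= diracE in_setT mul1e.
have EQ (p : E n.+1) : \prod_(i < n.+1) h (coords p i) = h p.1 * \prod_(i < n) h (coords p.2 i).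
 by rewrite big_ord_recl.
have P0 (p : E n) : 0 <= \prod_(i < n) h (coords p i) by exact: prodr_ge0.
under eq_fun do rewrite EQ; split.
 by apply: measurable_funM; [exact: measurableT_comp mh measurable_fst|exact: measurableT_comp IHm measurable_snd].
under eq_integral do rewrite EQ.
have H := int_pmeas_mul leb (msm (lebN R n)) mh IHm h0 P0; rewrite [leLHS]H exprS EFinM.
by apply: lee_pmul => //; apply: integral_ge0 => x _; rewrite lee_fin.
Qed.

Lemma ae_coords_neq0 n : {ae lebRN R n, forall p : E n, forall i, (i < n)%N -> coords p i != 0}.
Proof.
elim: n => [|n [Z [mZ Z0 HZ]]]; first exact: aeW.
have m1 : measurable ([set 0] `*` setT : set (E n.+1)) by exact: measurableX.
have m2 : measurable (setT `*` Z : set (E n.+1)) by exact: measurableX.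
exists ([set 0] `*` setT `|` setT `*` Z); split; first exact: measurableU.
- apply/eqP; rewrite eq_le measure_ge0 andbT; apply: le_trans (measureU2 _ m1 m2) _.
 have H := product_measure1E leb (msm (lebN R n)) measurableT mZ.
 by rewrite [X in (X + _)%E]lebN_slab add0e [leLHS]H [X in (_ * X)%E]Z0 mule0.
- move=> p /=; apply: contra_notP => /not_orP[n1 n2] [|i] il /=.
  by apply/eqP => e; apply: n1; split.
 have [//|e] := pselect (coords p.2 i != 0); exfalso; apply: n2; split=> //=; apply: HZ => /= H.
 by apply: e; exact: H.
Qed.

End power_integrals.

(** * Convergence to the datum in uniformly local norms *)

Section uniform_local.
Variables (R : realType) (n : nat) (f U : R -> R).
Local Notation E m := (mst (lebN R m)).
Hypotheses (n0 : (0 < n)%N) (fc : continuous f) (f_ge0 : forall u : R, 0 <= f u)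
 (f_mono : forall u v : R, u <= v -> f u <= f v)
 (U_ge0 : forall l : R, 0 <= U l) (U_ni : forall l l' : R, l <= l' -> U l' <= U l)
 (mus : measT (fun y : E n => us U (torow y)))
 (star : stationary_mild n f U).
Let u0 (y : 'rV[R]_n) : 0 <= us U y. Proof. exact: us_ge0. Qed.
Let mfus : measT (fun y : E n => f (us U (torow y))).
Proof. exact: (measurableT_comp (continuous_measurable_fun fc) mus). Qed.
Local Notation fus := (fun y : E n => f (us U (torow y))).

Lemma rho_sub_le (x y : 'rV[R]_n) : rho x <= 2 * rho (x - y) + 2 * rho y.
Proof.
by rewrite /rho !mulr_sumr -big_split; apply: ler_sum => i _; rewrite !mxE /=; have := sqr_ge0 (x ord0 i - 2 * y ord0 i); lra.
Qed.

Lemma rho_sub_ge (x y : 'rV[R]_n) : rho (x - y) <= 2 * rho x + 2 * rho y.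
Proof.
by rewrite /rho !mulr_sumr -big_split; apply: ler_sum => i _; rewrite !mxE /=; have := sqr_ge0 (x ord0 i + y ord0 i); lra.
Qed.

Lemma heatG_low (D : R) : 0 <= D -> exists2 c : R, 0 < c & forall (q : R) (x y : 'rV[R]_n),
 2^-1 <= q -> q <= 1 -> rho (x - y) <= D -> c <= heatG q x y.
Proof.
move=> D0; have p0 := pi_gt0 R; have p4 : 0 < 4 * pi :> R by lra.
exists ((4 * pi) `^ (- (n%:R / 2)) * expR (- (D / 2))) => [|q x y q1 q2 h].
 by rewrite mulr_gt0 ?expR_gt0// powR_gt0.
have q0 : 0 < q by lra.
rewrite /heatG; apply: ler_pM; [exact: powR_ge0|exact: expR_ge0| |].
 have e0 : 0 <= n%:R / 2 :> R by rewrite divr_ge0.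
 have h1 : 0 < 4 * pi * q by rewrite mulr_gt0.
 rewrite !powRN lef_pV2 ?posrE ?powR_gt0//; apply: ge0_ler_powR => //; rewrite ?nnegrE; [exact: ltW|exact: ltW|].
 by apply: ler_piMr => //; exact: ltW.
rewrite ler_expR -rho_enorm mulNr lerN2 ler_pdivrMr; last by lra.
by have := rho_ge0 (x - y); nra.
Qed.

Let mlt (d : R) : measT (fun y : E n => rho (torow y) < d).
Proof.
by apply: measurable_fun_ltr => //; apply: measurable_torow => p _; exact: rho_cont.
Qed.

Lemma measurable_PeEq' (x : E n) : measT (fun q : R => PeE q fus x).
Proof. by have H := @measurable_PeEq R n x (fun y => f (us U y)) mfus (fun y => f_ge0 _); apply: H. Qed.

(** Local integrability of the singular source is read off the mild formula at the single point
    [x1]: for elapsed times in [[1/2, 1]] the kernel is bounded below near the origin, and the left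
    side is finite. *)
Lemma fus_near_int (d : R) : exists2 J : R, 0 <= J &
 (\int[lebRN R n]_y (if rho (torow y) < d then f (us U (torow y)) else 0)%:E <= J%:E)%E.
Proof.
pose x1 : 'rV[R]_n := const_mx 1.
have x10 : x1 != 0 by apply/eqP => /rowP /(_ (Ordinal n0)); rewrite !mxE => /eqP; rewrite oner_eq0.
pose G := (\int[lebRN R n]_y (if rho (torow y) < d then f (us U (torow y)) else 0)%:E)%E.
have G0 : (0 <= G)%E by apply: integral_ge0 => y _; rewrite lee_fin; case: ifP.
have D0 : 0 <= 2 * rho x1 + 2 * `|d| by rewrite addr_ge0// mulr_ge0 ?rho_ge0.
have [c c0 Hc] := heatG_low D0.
have mg : measT (fun y : E n => (if rho (torow y) < d then f (us U (torow y)) else 0)%:E).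
 by apply/measurable_EFinP; apply: measurable_fun_ifT.
have P (q : R) : 2^-1 <= q -> q <= 1 -> (c%:E * G <= PeE q fus (fromrow x1))%E.
 move=> q1 q2; have q0 : 0 < q by lra.
 rewrite /G -ge0_integralZl//; [|by move=> y _; rewrite lee_fin; case: ifP|by rewrite lee_fin ltW].
 apply: ge0_le_integral => //.
 - by move=> y _; rewrite -EFinM lee_fin mulr_ge0 ?(ltW c0)//; case: ifP.
 - exact: measurable_funeM.
 - by apply/measurable_EFinP/measurable_funM => //; exact: measurable_Khy.
 - move=> y _; rewrite -EFinM lee_fin; case: ifP => h; last by rewrite mulr0 mulr_ge0 ?Kh_ge0.
  apply: ler_wpM2r => //; rewrite KhE// torowK; apply: Hc => //.
  by apply: le_trans (rho_sub_ge _ _) _; rewrite lerD2l ler_pM2l// (le_trans (ltW h)) ?ler_norm.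
have L : (c%:E * G * (2^-1)%:E <= (us U x1)%:E)%E.
 rewrite (star x10 ltr01); apply: (@le_trans _ _ (\int[leb]_(q in `]0%R, 1%R]) PeE q fus (fromrow x1)))%E; last first.
  by rewrite leeDr// Pe_ge0//; exact: Kh_ge0.
 apply: (@le_trans _ _ (\int[leb]_(q in `[2^-1%R, 1%R]) PeE q fus (fromrow x1)))%E; last first.
  apply: ge0_subset_integral => //; first by apply: measurable_funTS; exact: measurable_PeEq'.
   by move=> q _; apply: Pe_ge0 => //; exact: Kh_ge0.
  by move=> q /=; rewrite !in_itv/= => /andP[h1 ->]; rewrite andbT; lra.
 have -> : (2^-1)%:E = leb (`[2^-1%R, 1%R]%classic : set R).
  by rewrite lebesgue_measure_itv/= lte_fin ifT ?invf_lt1 ?ltr1n// -EFinB; congr EFin; lra.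
 rewrite -integral_cst//; apply: ge0_le_integral => //.
 - by move=> q _; rewrite /= mule_ge0// lee_fin ltW.
 - by apply: measurable_funTS; exact: measurable_PeEq'.
 - by move=> q /=; rewrite in_itv/= => /andP[h1 h2]; exact: P.
have Gf : G \is a fin_num.
 rewrite ge0_fin_numE// ltNge leye_eq; apply/negP => /eqP e; move: L; rewrite e.
 by rewrite mulry gtr0_sg// mul1e mulyr gtr0_sg ?invr_gt0// mul1e leNgt ltry.
by exists (fine G); [exact: fine_ge0|rewrite fineK].
Qed.

(** The source is split at [rho y = d / 8]. Inside, it is integrable and the kernel is bounded since
    [x] is far away; outside, it is bounded because [U] is monotone, and the kernel has mass 1. *)
Lemma far_bound (d : R) : 0 < d -> exists2 A : R, 0 <= A &
 forall (x : 'rV[R]_n) (q : R), d <= rho x -> 0 < q -> (PeE q fus (fromrow x) <= A%:E)%E.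
Proof.
move=> d0; have [J J0 HJ] := fus_near_int (d / 8).
(* From [rho x >= d] and [rho y < d / 8] the inequality [rho_sub_le] gives
   [rho (x - y) >= d / 4]. *)
have s0 : 0 < Num.sqrt (d / 4) by rewrite sqrtr_gt0; lra.
have [C C0 HC] := @heatG_sup R n _ n0 s0.
pose A1 := f (U (ln (d / 8) / 2)).
exists (A1 + C * J) => [|x q dx q0]; first exact: addr_ge0 (f_ge0 _) (mulr_ge0 (ltW C0) J0).
have mI : measT (fun y : E n => (if rho (torow y) < d / 8 then f (us U (torow y)) else 0)%:E).
 by apply/measurable_EFinP; apply: measurable_fun_ifT.
have mK : measT (fun y : E n => (Kh q (fromrow x) y)%:E).
 by apply/measurable_EFinP; exact: measurable_Khy.
have I0 (y : E n) : 0 <= (if rho (torow y) < d / 8 then f (us U (torow y)) else 0) by case: ifP.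
apply: (@le_trans _ _ (\int[lebRN R n]_y (A1%:E * (Kh q (fromrow x) y)%:E +
  C%:E * (if rho (torow y) < d / 8 then f (us U (torow y)) else 0)%:E)))%E.
 apply: ge0_le_integral => //.
 - by move=> y _; rewrite lee_fin mulr_ge0 ?Kh_ge0.
 - by apply/measurable_EFinP/measurable_funM => //; exact: measurable_Khy.
 - by apply: emeasurable_funD; exact: measurable_funeM.
 - move=> y _; rewrite -!EFinM -EFinD lee_fin; case: ifPn => h.
   apply: ler_wpDl; first exact: mulr_ge0 (f_ge0 _) (Kh_ge0 _ _ _).
   apply: ler_wpM2r => //; rewrite KhE// torowK; apply: HC => //.
   rewrite -[enorm _]ger0_norm ?sqrtr_ge0// -sqrtr_sqr ler_wsqrtr// -rho_enorm.
   by have := rho_sub_le x (torow y); lra.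
  rewrite mulr0 addr0 mulrC; apply: ler_wpM2r; first exact: Kh_ge0.
  have y0 : torow y != 0 by apply: rho_neq0; move: h; rewrite -leNgt; apply: lt_le_trans; lra.
  apply: f_mono; rewrite /us cutzE//; apply: U_ni; rewrite ler_pM2r// ler_ln ?posrE ?rho_gt0//; last by lra.
  by rewrite leNgt.
rewrite ge0_integralD//; first last.
- exact: measurable_funeM.
- by move=> y _; rewrite mule_ge0// lee_fin// ltW.
- exact: measurable_funeM.
- by move=> y _; rewrite -EFinM lee_fin; exact: mulr_ge0 (f_ge0 _) (Kh_ge0 _ _ _).
rewrite !ge0_integralZl//; first last.
- by rewrite lee_fin f_ge0.
- by move=> y _; rewrite lee_fin Kh_ge0.
- by rewrite lee_fin ltW.
- by move=> y _; rewrite lee_fin.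
rewrite EFinD EFinM; apply: leeD; last by apply: lee_wpmul2l => //; rewrite lee_fin ltW.
rewrite -[leRHS]mule1; apply: lee_wpmul2l; first by rewrite lee_fin f_ge0.
by under eq_integral do rewrite (KhE _ _ q0) torowK; rewrite heatG_int.
Qed.

(** By the mild formula the loss of [us] under the semigroup up to time [t] is an integral over []0,
    t]] of a quantity bounded by [A]. *)
Lemma us_far (d : R) : 0 < d -> exists2 A : R, 0 <= A & forall (x : 'rV[R]_n) (t w : R), d <= rho x -> 0 < t ->
 (PeE t (fun y => us U (torow y)) (fromrow x) <= w%:E)%E -> us U x - w <= A * t.
Proof.
move=> d0; have [A A0 HA] := far_bound d0; exists A => // x t w dx t0 hw.
have x0 : x != 0 by apply: rho_neq0; exact: lt_le_trans dx.
rewrite lerBlDr addrC -lee_fin EFinD (star x0 t0).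
have L : leb (`]0, t]%classic : set R) = t%:E by rewrite lebesgue_measure_itv/= lte_fin t0 -EFinB subr0.
apply: leeD => //; have -> : (A * t)%:E = (\int[leb]_(q in `]0%R, t]) cst A%:E q)%E.
 by rewrite integral_cst// [X in (_ * X)%E]L -EFinM.
apply: ge0_le_integral => //.
- by move=> q _; apply: Pe_ge0 => //; exact: Kh_ge0.
- by apply: measurable_funTS; exact: measurable_PeEq'.
- by move=> q /=; rewrite in_itv/= => /andP[q0 _]; exact: HA.
Qed.

(** With [a = al g / n < 1], the power [|y|^(- al g)] is the [n]-fold product of [|y|^(-a)], and
    [|y_i| <= |y|] bounds it by the product of the integrable functions [|y_i|^(-a)]. *)
Lemma near_int (C al l0 g e : R) : (forall l, l <= l0 -> U l <= C * expR (- al * l)) -> 0 <= al -> 0 < g ->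
 al * g < n%:R -> 0 < e -> exists2 d : R, 0 < d &
 (\int[lebRN R n]_y (if rho (torow y) < d then us U (torow y) `^ g else 0)%:E <= e%:E)%E.
Proof.
move=> HU al0 g0 ag e0; have nR : 0 < n%:R :> R by rewrite ltr0n.
pose a := al * g / n%:R; have a1 : a < 1 by rewrite /a ltr_pdivrMr// mul1r.
have a0 : 0 <= a by rewrite /a !mulr_ge0// ?invr_ge0// ltW.
pose C' := Num.max C 1; have C'0 : 0 < C' by rewrite lt_max ltr01 orbT.
pose K := expR (g * ln C'); have K0 : 0 < K by exact: expR_gt0.
(* The bound by 1 gives [pw ^+ n <= pw], the bound by [e / K] then reaches [e]. *)
pose m := Num.min 1 (e / K); have m0 : 0 < m by rewrite lt_min ltr01 divr_gt0.
have b0 : 0 < 1 - a by lra.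
have b1 : 0 < m * (1 - a) / 2 by rewrite divr_gt0// mulr_gt0.
have [l1 Hl1] := exp_small b0 b1.
pose l := Num.min l0 l1; pose r := expR l; have r0 : 0 < r by exact: expR_gt0.
have lnr : ln r = l by rewrite /r expRK.
have pm : pw a r <= m.
 rewrite /pw lnr mulrA ler_pdivrMr//.
 by have := Hl1 l; rewrite /l ge_min lexx orbT => /(_ isT); lra.
have pw0 : 0 <= pw a r by rewrite /pw mulr_ge0// divr_ge0 ?expR_ge0// ltW.
pose h (x : R) := hp a r x + hp a r (- x).
have h0 x : 0 <= h x by rewrite addr_ge0 ?hp_ge0.
have mh : measT h.
 apply: measurable_funD; first exact: measurable_hp.
 by have H := measurableT_comp (measurable_hp a r) (@oppr_measurable R setT); apply: H.
have [mP IP] := prod_int n mh h0 (hp_int a1 r0).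
exists (r ^+ 2); first exact: exprn_gt0.
apply: (@le_trans _ _ (\int[lebRN R n]_p (K%:E * (\prod_(i < n) h (coords p i))%:E)))%E; last first.
 rewrite ge0_integralZl//; [|exact/measurable_EFinP|by move=> y _; rewrite lee_fin prodr_ge0|by rewrite lee_fin ltW].
 apply: le_trans (lee_wpmul2l _ IP) _; first by rewrite lee_fin ltW.
 rewrite -EFinM lee_fin -ler_pdivlMl// mulrC; apply: (@le_trans _ _ (pw a r)).
  by rewrite -[leRHS]expr1 ler_wiXn2l//; apply: le_trans pm _; rewrite /m ge_min lexx.
 by apply: le_trans pm _; rewrite /m ge_min lexx orbT.
apply: ae_ge0_le_integral => //.
- by move=> y _; rewrite lee_fin; case: ifP => // _; exact: powR_ge0.
- apply/measurable_EFinP; apply: measurable_fun_ifT => //.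
 exact: (measurableT_comp (measurable_powR g) mus).
- by move=> y _; rewrite -EFinM lee_fin mulr_ge0 ?prodr_ge0// ltW.
- by apply: measurable_funeM; apply/measurable_EFinP.
have := @ae_coords_neq0 R n; apply: filterS => y yn _; rewrite -EFinM lee_fin.
case: ifP => hr; last by rewrite mulr_ge0 ?prodr_ge0// ltW.
have cy (i : 'I_n) : torow y ord0 i != 0 by rewrite mxE; exact: yn.
have y0 : torow y != 0 by apply/eqP => e1; have := cy (Ordinal n0); rewrite e1 mxE eqxx.
have cr (i : 'I_n) : torow y ord0 i ^+ 2 <= rho (torow y) by rewrite rho_enorm; exact: coord_le_enorm2.
have L : ell (torow y) <= l.
 by rewrite -(ler_pM2l (ltr0n R 2)) -ler_expR exp2_ell// (_ : 2 * l = l + l) ?expRD -?expr2 ?(ltW hr)//; ring.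
have LU : U (ell (torow y)) <= C' * expR (- al * ell (torow y)).
 apply: le_trans (HU _ (le_trans L _)) _; first by rewrite /l ge_min lexx.
 by rewrite ler_wpM2r ?expR_ge0// /C' le_max lexx.
have PK : us U (torow y) `^ g <= K * expR (- (al * g) * ell (torow y)).
 rewrite /us cutzE//; have [e1|/negPf e1] := eqVneq (U (ell (torow y))) 0.
  by rewrite e1 powR0 ?gt_eqF// mulr_ge0 ?expR_ge0// ltW.
 have Up : 0 < U (ell (torow y)) by rewrite lt_neqAle eq_sym e1 U_ge0.
 rewrite /powR e1 /K -expRD ler_expR (_ : _ + _ = g * (ln C' + - al * ell (torow y))); last by ring.
 by rewrite ler_wpM2l ?(ltW g0)// -[X in _ + X]expRK -lnM ?posrE ?expR_gt0// ler_ln ?posrE ?mulr_gt0 ?expR_gt0.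
apply: le_trans PK _; apply: ler_wpM2l; first exact: ltW.
rewrite (_ : - (al * g) * ell (torow y) = \sum_(i < n) (- a * ell (torow y))); last first.
 by rewrite sumr_const card_ord -[RHS]mulr_natr /a; field; rewrite gt_eqF.
rewrite expR_sum; apply: ler_prod => i _; rewrite expR_ge0/=.
have ci := cy i; have cri := cr i; rewrite mxE in ci cri.
have main (x : R) : 0 < x -> x ^+ 2 <= rho (torow y) -> expR (- a * ell (torow y)) <= hp a r x.
 move=> x0 xr; rewrite /hp x0 (_ : x <= r) /=; last first.
  by rewrite -ler_sqr ?nnegrE; [exact: le_trans xr (ltW hr)|exact: ltW|exact: ltW].
 rewrite ler_expR !mulNr lerN2 ler_wpM2l//.
 have : ln (x ^+ 2) <= ln (rho (torow y)) by rewrite ler_ln ?posrE ?rho_gt0// exprn_gt0.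
 by rewrite lnXn// mulr2n /ell; lra.
rewrite /h; have [x0|x0|e1] := ltgtP (coords y i) 0.
- by apply: (le_trans (main (- coords y i) _ _)); rewrite ?sqrrN ?oppr_gt0// lerDr hp_ge0.
- by apply: (le_trans (main (coords y i) _ _)) => //; rewrite lerDl hp_ge0.
- by move: ci; rewrite e1 eqxx.
Qed.

Definition unit_ball (z : 'rV[R]_n) : set (E n) := @torow R n @^-1` [set y | enorm (y - z) < 1].

Lemma measurable_unit_ball (z : 'rV[R]_n) : measurable (unit_ball z).
Proof.
have m : measT (fun y : E n => enorm (torow y - z)).
 apply: (@measurable_comp_rV R _ (E n) n setT (fun p => torow p - z) (fun=> 0) (fun x _ => enorm x)) => // [i|p _].
  under eq_fun do rewrite !mxE; apply: measurable_funB => //; exact: measurable_coords.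
 apply: (@continuous_comp _ _ _ (fst : 'rV[R]_n * R -> _) (@enorm R n)); [exact: cvg_fst|exact: enorm_cont].
have := @measurable_fun_ltr _ (E n) R setT _ (fun=> 1) m (measurable_cst _).
by move=> /(_ measurableT [set true] Logic.I); rewrite setTI.
Qed.

(** The kernel at time 1 has mass 1 and is bounded below on unit balls about its centre, which gives
    a bound uniform in [z]. *)
Lemma ball_volume_bound : exists2 K : R, 0 < K &
 forall z : 'rV[R]_n, (lebRN R n (unit_ball z) <= K%:E)%E.
Proof.
have [c c0 Hc] := heatG_low (ler01 : 0 <= (1 : R)).
exists c^-1 => [|z]; first by rewrite invr_gt0.
have mG : measT (fun y : E n => (heatG 1 z (torow y))%:E).
 by apply/measurable_EFinP; exact: measurable_heatGy.
have c'0 : (0 <= (c^-1)%:E)%E by rewrite lee_fin invr_ge0 ltW.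
rewrite -[leRHS]mule1 -(heatG_int z (ltr01 : 0 < (1 : R))) -ge0_integralZl//; last first.
 by move=> y _; rewrite lee_fin heatG_ge0.
rewrite -[leLHS]mul1e -(@integral_cst _ _ _ (lebRN R n) _ (measurable_unit_ball z) 1%E).
rewrite integral_mkcond; apply: ge0_le_integral => //.
- by move=> y _; rewrite patchE; case: ifP.
- by apply/(measurable_restrictT _ (measurable_unit_ball _)).
- exact: measurable_funeM.
move=> y _; rewrite patchE; case: ifPn => [|_]; last by rewrite mule_ge0// lee_fin heatG_ge0.
rewrite inE /= => yz; rewrite -EFinM lee_fin mulrC ler_pdivlMr// mul1r; apply: Hc => //.
 by rewrite invf_le1// ler1n.
rewrite rho_enorm; have -> : enorm (z - torow y) = enorm (torow y - z).
 by rewrite /enorm; congr Num.sqrt; apply: eq_bigr => i _; rewrite !mxE -sqrrN opprB.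
by apply: exprn_ile1; [exact: sqrtr_ge0|exact: ltW].
Qed.

(** Near the origin [|w|] is below [us], whose power has a small integral; elsewhere [|w| <= A] on a
    ball of bounded volume. Neither estimate depends on the centre of the ball. *)
Lemma ulnorm_small (w : 'rV[R]_n -> R) (g d A K e : R) : 1 <= g -> 0 < d -> 0 < e -> 0 < K ->
 (\int[lebRN R n]_y (if rho (torow y) < d then us U (torow y) `^ g else 0)%:E <= (e `^ g / 2)%:E)%E ->
 (forall z : 'rV[R]_n, (lebRN R n (unit_ball z) <= K%:E)%E) ->
 measT (fun y : E n => w (torow y)) ->
 (forall x, x != 0 -> `|w x| <= us U x) -> (forall x, d <= rho x -> `|w x| <= A) -> 0 <= A ->
 A `^ g * K <= e `^ g / 2 -> (ulnorm g w <= e%:E)%E.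
Proof.
move=> g1 d0 e0 K0 hn hK mw w1 w2 A0 hA; have g0 : 0 < g by lra.
apply/ereal_supP => _ [z _ <-]; have mB := measurable_unit_ball z.
have -> : e%:E = poweR (e `^ g)%:E g^-1.
 by rewrite poweR_EFin -powRrM mulfV ?gt_eqF// powRr1// ltW.
have ge0 : (0 <= e `^ g)%R by exact: powR_ge0.
apply: gt0_ler_poweR; first by rewrite invr_ge0 ltW.
- by rewrite in_itv/= leey andbT; apply: integral_ge0 => y _; rewrite lee_fin powR_ge0.
- by rewrite in_itv/= leey lee_fin ge0.
have mn : measT (fun y : E n => (if rho (torow y) < d then us U (torow y) `^ g else 0)%:E).
 apply/measurable_EFinP; apply: measurable_fun_ifT => //.
 exact: (measurableT_comp (measurable_powR g) mus).
have n_ge0 (y : E n) : (0 <= (if rho (torow y) < d then us U (torow y) `^ g else 0)%:E)%E.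
 by rewrite lee_fin; case: ifP => // _; exact: powR_ge0.
have Ag : 0 <= A `^ g by exact: powR_ge0.
apply: (@le_trans _ _ (\int[lebRN R n]_(y in unit_ball z)
  ((if rho (torow y) < d then us U (torow y) `^ g else 0)%:E + (A `^ g)%:E)))%E; last first.
 rewrite ge0_integralD//; last by apply: measurable_funTS.
 rewrite integral_cst// (_ : e `^ g = e `^ g / 2 + e `^ g / 2); last by field.
 rewrite EFinD; apply: leeD.
  by apply: le_trans hn; apply: ge0_subset_integral.
 apply: (@le_trans _ _ ((A `^ g)%:E * K%:E)%E); last by rewrite -EFinM lee_fin.
 by apply: lee_wpmul2l; [rewrite lee_fin|exact: hK].
apply: ae_ge0_le_integral; first exact: mB.
- by move=> y _; rewrite lee_fin powR_ge0.
- apply: measurable_funTS; apply/measurable_EFinP.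
 apply: (measurableT_comp (measurable_powR g)); exact: measurableT_comp mw.
- by move=> y _; rewrite adde_ge0.
- by apply: measurable_funTS; apply: emeasurable_funD.
have := @ae_coords_neq0 R n; apply: filterS => y yn _; rewrite -EFinD lee_fin.
have y0 : torow y != 0 by apply/eqP => /rowP /(_ (Ordinal n0)) /eqP; rewrite !mxE; apply/negP; exact: yn.
have mono (a b : R) : 0 <= a -> a <= b -> a `^ g <= b `^ g.
 by move=> a0 ab; apply: ge0_ler_powR => //; rewrite ?nnegrE ?(ltW g0)//; exact: le_trans ab.
case: ifPn => h; first by apply: le_trans (mono _ _ _ (w1 _ y0)) _; rewrite ?lerDl.
by rewrite add0r; apply: mono => //; apply: w2; rewrite leNgt.
Qed.

(** First [d] is chosen by integrability of the singularity, with no reference to [w]; then time is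
    made small to control the region [rho x >= d], where the difference is at most [A t]. *)
Lemma ulnorm_cvg (v : 'rV[R]_n -> R) (w : 'rV[R]_n -> R -> R) (T g C al l0 : R) : 0 < T -> 1 <= g -> 0 <= al ->
 al * g < n%:R -> (forall l, l <= l0 -> U l <= C * expR (- al * l)) ->
 (forall x, x != 0 -> v x = us U x) -> measT (fun y : E n => v (torow y)) ->
 (forall t, 0 < t -> t < T -> measT (fun y : E n => w (torow y) t)) ->
 (forall x t, 0 <= w x t) -> (forall x t, x != 0 -> 0 < t -> t < T -> w x t <= us U x) ->
 (forall x t, 0 < t -> t < T -> (PeE t (fun y => us U (torow y)) (fromrow x) <= (w x t)%:E)%E) ->
 ulnorm g (fun x => w x t - v x) @[t --> 0^'+] --> 0%E.
Proof.
move=> T0 g1 al0 alg HU vE mv mw w_ge0 w_le w_ge; have g0 : 0 < g by lra.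
have [K K0 HK] := ball_volume_bound.
have small (e : R) : 0 < e -> \forall t \near 0^'+, (ulnorm g (fun x => (w x t - v x)%R) <= e%:E)%E.
 move=> e0; have e1 : 0 < e `^ g / 2 by rewrite divr_gt0// powR_gt0.
 have [d d0 Hd] := near_int HU al0 g0 alg e1; have [A A0 HA] := us_far d0.
 (* The solution of [s^g K = e^g / 2]; times with [A t <= s] are small enough. *)
 pose s := (e `^ g / 2 / K) `^ g^-1; have s0 : 0 < s by rewrite powR_gt0// divr_gt0.
 have sA : 0 < s / (A + 1) by rewrite divr_gt0// ltr_wpDl.
 near=> t; have t0 : 0 < t by near: t; exact: nbhs_right_gt.
 have tT : t < T by near: t; exact: nbhs_right_lt.
 have ts : t < s / (A + 1) by near: t; exact: nbhs_right_lt.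
 have Ats : A * t <= s by move: ts; rewrite ltr_pdivlMr ?ltr_wpDl//; lra.
 have At0 : 0 <= A * t by rewrite mulr_ge0// ltW.
 apply: (@ulnorm_small _ g d (A * t) K e) => //.
 - by apply: measurable_funB => //; exact: mw.
 - move=> x x0; rewrite vE// distrC ger0_norm ?subr_ge0 ?w_le//.
  by rewrite lerBlDr lerDl.
 - move=> x dx; have x0 : x != 0 by apply: rho_neq0; exact: lt_le_trans dx.
  by rewrite vE// distrC ger0_norm ?subr_ge0 ?w_le//; apply: HA => //; exact: w_ge.
 rewrite -ler_pdivlMr//; apply: (@le_trans _ _ (s `^ g)).
  by apply: ge0_ler_powR => //; rewrite ?nnegrE ltW.
 by rewrite /s -powRrM mulVf ?gt_eqF// powRr1// divr_ge0// ltW.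
have u_ge0 t : (0 <= ulnorm g (fun x => (w x t - v x)%R))%E.
 by apply: ereal_sup_ge; exists (poweR (intN [set y | (enorm (y - 0) < 1)%R] (fun y => ((`|w y t - v y| `^ g)%R)%:E)) g^-1);
  [exists 0|exact: poweR_ge0].
apply/fine_cvgP; split.
 apply: filterS (small 1 ltr01) => t h; rewrite ge0_fin_numE//; exact: le_lt_trans h (ltry _).
apply/cvgrPdist_le => e e0; apply: filterS (small e e0) => t h.
rewrite sub0r normrN ger0_norm ?fine_ge0//= -lee_fin fineK//.
by rewrite ge0_fin_numE//; exact: le_lt_trans h (ltry _).
Unshelve. all: by end_near. Qed.

End uniform_local.

(** * The nonlinearity extended by zero to the line *)

Section extension_by_zero.
Variables (R : realType) (f : R -> R).
Hypotheses (fneg : forall s, s < 0 -> f s = 0) (f0 : f 0 = 0)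
 (fd : forall s, 0 <= s -> derivable f s 1)
 (f1w : {within [set s | 0 <= s], continuous (derive1 f)}) (f10 : (derive1 f) 0 = 0)
 (f1_gt0 : forall s, 0 < s -> 0 < (derive1 f) s).
Local Notation f1 := (derive1 f).

Let neg_derive (s : R) : s < 0 -> is_derive s 1 f 0.
Proof.
move=> s0; have N : \forall y \near s, (fun=> 0) y = f y.
 by near=> y; rewrite fneg//; near: y; exact: lt_nbhsl.
exact: near_eq_is_derive N (der_cst 0 s).
Unshelve. all: by end_near. Qed.

Lemma ext_derive (s : R) : is_derive s 1 f (f1 s).
Proof.
rewrite derive1E; have [s0|s0] := leP 0 s; first by split; first exact: fd.
by have D := neg_derive s0; rewrite (is_deriveE D).
Qed.

Let f1neg (s : R) : s < 0 -> f1 s = 0.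
Proof. by move=> s0; rewrite derive1E; apply: is_deriveE; exact: neg_derive. Qed.

Lemma ext_derive_ge0 (s : R) : 0 <= f1 s.
Proof.
have [s0|s0|->] := ltgtP s 0; [by rewrite f1neg|exact/ltW/f1_gt0|by rewrite f10].
Qed.

(** The derivative vanishes on the negative axis and at 0, so it equals its composition with
    [max 0]; this carries the one-sided continuity over to the line. *)
Lemma ext_derive_cont : continuous f1.
Proof.
have -> : f1 = f1 \o (fun s => Num.max 0 s).
 apply/funext => s /=; have [s0|s0] := leP s 0; last by [].
 by rewrite f10; move: s0; rewrite le_eqVlt => /orP[/eqP ->|/f1neg].
have cm (s : R) : {for s, continuous (fun s : R => Num.max 0 s)}.
 by apply: (@continuous_max R R (fun=> 0) id); [exact: cvg_cst|exact: cvg_id].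
move=> s; apply/cvgrPdist_lt => e e0.
have m0 : [set s : R | 0 <= s] (Num.max 0 s) by rewrite /= le_max lexx.
have /(subspace_continuousP _ _).1 /(_ _ m0) /cvgrPdist_lt /(_ _ e0) := f1w.
move=> H; have H' : \forall y \near s, 0 <= Num.max 0 y -> `|f1 (Num.max 0 s) - f1 (Num.max 0 y)| < e := cm s _ H.
by apply: filterS H' => y; apply; rewrite le_max lexx.
Qed.

Lemma ext_mono (u v : R) : u <= v -> f u <= f v.
Proof. by move=> uv; apply: (der_nd uv (fun s _ _ => ext_derive s)) => s _ _; exact: ext_derive_ge0. Qed.

Lemma ext_ge0 (u : R) : 0 <= f u.
Proof. by have [u0|u0] := ltP u 0; [rewrite fneg|rewrite -f0; exact: ext_mono]. Qed.

Lemma ext_gt0 (u : R) : 0 < u -> 0 < f u.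
Proof.
move=> u0; have h : 0 < u / 2 by lra.
apply: (@le_lt_trans _ _ (f (u / 2))); first exact: ext_ge0.
apply: (@der_inc R f f1) => [|s _ _|s s1 _]; [lra|exact: ext_derive|apply: f1_gt0; lra].
Qed.

End extension_by_zero.

(** With [y = 4 q - N] the claim reads [y^2 < 4 (N - 1)]. The lower bound on [y] is [q_JL < q], and
    [q < q_S] gives [y < 2 <= 2 sqrt (N - 1)]. *)
Lemma JL_discriminant (R : realType) (N : nat) (q : R) : (2 < N)%N -> qJL R N < q < qS R N ->
 (N%:R + 2 - 4 * q) ^+ 2 < 4 * (2 * N%:R - 4 * q).
Proof.
move=> N2 /andP[]; rewrite /qJL /qS ltr_pdivrMr// ltr_pdivlMr// => h1 h2.
have N3 : 3 <= N%:R :> R by rewrite (ler_nat R 3).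
have s2 : Num.sqrt (N%:R - 1) ^+ 2 = N%:R - 1 :> R by rewrite sqr_sqrtr//; lra.
have s1 : 1 <= Num.sqrt (N%:R - 1) :> R.
 by rewrite -[leLHS]sqrtr1 ler_wsqrtr//; lra.
set s := Num.sqrt (N%:R - 1) in h1 s2 s1 *.
have P : 0 < (4 * q - N%:R + 2 * s) * (2 * s + N%:R - 4 * q) by apply: mulr_gt0; lra.
nra.
Qed.

Lemma measurable_contW_slice (R : realType) (n : nat) (w : 'rV[R]_n -> R -> R) (T t : R) : contW w T -> 0 < t -> t < T ->
 measT (fun y : mst (lebN R n) => w (torow y) t).
Proof.
move=> cw t0 tT; apply: (@measurable_torow R n setT (w ^~ t)) => p _.
apply: (@continuous_comp _ _ _ (fun y : 'rV[R]_n => (y, t)) (fun q : 'rV[R]_n * R => w q.1 q.2)); last exact: cw.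
by apply: (@cont_pair 'rV[R]_n 'rV[R]_n R id (fun=> t)) => //; exact: cst_continuous.
Qed.

Theorem theorem1p3 (R : realType) (N : nat) (f : R -> R) (qf : R)
    (ustar : 'rV[R]_N -> R) :
  (2 < N)%N ->
  (* f on [0,oo), extended by 0 on (-oo,0) *)
  (forall s, s < 0 -> f s = 0) ->
  (* (A1) *)
  f 0 = 0 ->
  (forall s, 0 <= s -> derivable f s 1) ->
  {within [set s | 0 <= s], continuous (derive1 f)} ->
  (derive1 f) 0 = 0 ->
  (forall s, 0 < s -> derivable (derive1 f) s 1) ->
  (forall s, 0 < s -> {for s, continuous (derive1n 2 f)}) ->
  (* (A2) *)
  (forall s, 0 < s -> 0 < (derive1 f) s /\ 0 < (derive1n 2 f) s) ->
  (* (A3) *)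
  (fun s => (derive1 f) s ^+ 2 / (f s * (derive1n 2 f) s)) x @[x --> +oo] --> qf ->
  (* (A4) *)
  (forall s, 0 <= s ->
     ((s * f s)%:E - (pS R N + 1)%:E * \int[@lebesgue_measure R]_(r in [set r | (0 <= r <= s)%R]) (f r)%:E
        >= 0)%E) ->
  (* u^* : the radial nonnegative singular solution *)
  (forall x, 0 <= ustar x) ->
  (exists phi : R -> R, forall x, x != 0 -> ustar x = phi (enorm x)) ->
  C2_on [set x | x != 0] ustar ->
  (forall x, x != 0 -> - laplacian ustar x = f (ustar x)) ->
  (forall M : R, exists2 d : R, 0 < d &
     forall x, x != 0 -> enorm x < d -> M < ustar x) ->
  (* (A5) *)
  qJL R N < qf < qS R N ->
  (* (A6) *)
  (qf = 1 -> \forall s \near +oo, (derive1 f) s ^+ 2 / (f s * (derive1n 2 f) s) <= 1) ->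
  (* conclusion *)
  is_solution f ustar (fun x _ => ustar x) +oo%E /\
  exists t0 : R, 0 < t0 /\
  exists u : 'rV[R]_N -> R -> R,
    [/\ is_solution f ustar u t0%:E,
        ~ aeST (fun x t => 0 <= t -> t < t0 -> u x t = ustar x),
        Linfty_loc u t0,
        classical_sol f u t0
      & forall gamma : R, 1 <= gamma -> (gamma%:E < gamma_star N qf)%E ->
          ulnorm gamma (fun x => u x t - ustar x) @[t --> 0^'+] --> 0%E].
Proof.
move=> N2 fneg f0 fd f1w f10 f1d f2c A2 A3 _ u_ge0 rad C2 eqn sing A5 _.
have f1_gt0 s : 0 < s -> 0 < derive1 f s by move=> /A2[].
have Df := ext_derive fneg fd; have f1c := ext_derive_cont fneg f1w f10.
have f_mono := ext_mono fneg fd f10 f1_gt0; have f_ge0 := ext_ge0 fneg f0 fd f10 f1_gt0.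
have f_gt0 := ext_gt0 fneg f0 fd f10 f1_gt0.
have fc : continuous f by move=> u; exact: der_cont (Df u).
have Dfp (u : R) : 0 < u -> is_derive u 1 f (derive1 f u) by move=> _; exact: Df.
have Df1 (u : R) : 0 < u -> is_derive u 1 (derive1 f) (derive1n 2 f u).
 by move=> u0; split; [exact: f1d|rewrite -derive1E].
have f2_gt0 s : 0 < s -> 0 < derive1n 2 f s by move=> /A2[].
have cvR (e : R) : 0 < e -> exists2 A : R, 0 < A & forall u : R, A <= u ->
  `|derive1 f u ^+ 2 / (f u * derive1n 2 f u) - qf| <= e.
 move=> e0; move/cvgrPdist_le : A3 => /(_ _ e0) [M [_ HM]].
 exists (Num.max 1 (M + 1)) => [|u]; first by rewrite lt_max ltr01.
 by rewrite ge_max distrC => /andP[_ h]; apply: HM; lra.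
have q1 := q_ge1 Dfp Df1 f_gt0 f1_gt0 f2_gt0 cvR.
have JL := JL_discriminant N2 A5; have /andP[_ qS] := A5; rewrite /Defs.qS in qS.
have N3 : 3 <= N%:R :> R by rewrite (ler_nat R 3).
(* The growth rate needed for the vanishing of the flux. The requirement [1 - 1/qf < 1 - 2/N] means
   [qf < N/2], which follows from [qf < (N + 2)/4] as [N > 2]. *)
pose th : R := (N%:R - 2) / N%:R.
have th0 : 0 < th by rewrite divr_gt0//; lra.
have th1 : th < 1 by rewrite ltr_pdivrMr; lra.
have qth : 1 - qf^-1 < th.
 rewrite (_ : th = 1 - 2 / N%:R); last by rewrite /th; field; lra.
 rewrite ltrD2l ltrN2 ltr_pdivrMr; last by lra.
 by rewrite mulrC ltr_pdivlMr; lra.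
have fgrow := ff1_th Dfp Df1 f_gt0 f1_gt0 f2_gt0 cvR qth.
have [F [A [A0 DF F_gt0 F_cv]]] := ex_F Dfp Df1 f_gt0 f1_gt0 f2_gt0 cvR th0 th1 qth.
have Qcv := Q_cv Dfp Df1 f_gt0 f1_gt0 f2_gt0 cvR th0 qth A0 DF F_gt0 F_cv.
have Qslow := Q_slow Dfp Df1 f_gt0 f1_gt0 f2_gt0 cvR th0 qth A0 DF F_gt0 F_cv.
(* The axis vector [e0] lives in a dimension of the form [m.+1]. *)
case: N => [//|m] in ustar N2 u_ge0 rad C2 eqn sing A5 JL qS N3 th th0 th1 qth fgrow *.
pose U := Ur ustar; pose U1 := Ur1 ustar.
have DU := Ur_derive C2; have DU1 := Ur1_derive rad C2 eqn.
have U_ge0 l : 0 <= U l by exact: u_ge0.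
have Ucv (K : R) : exists l0 : R, forall l, l <= l0 -> K < U l.
 have [d d0 Hd] := sing K; exists (ln d - 1) => l ll.
 apply: Hd; first exact/e0_neq0/expR_gt0.
 rewrite /enorm -/(rho (_ *: e0 R m)) rho_e0 sqrtr_sqr gtr0_norm ?expR_gt0//.
 by rewrite -[ltRHS]lnK ?posrE// ltr_expR; lra.
have Uni := U_ni f_ge0 DU DU1 Ucv.
have U1n := U1_le0 f_ge0 DU DU1 Ucv.
have Usm := U_small N3 f_ge0 Dfp f_gt0 f1_gt0 DU DU1 Ucv fgrow.
have Mnd (l l' : R) : l <= l' -> expR ((m.+1%:R - 2) * l') * U1 l' <= expR ((m.+1%:R - 2) * l) * U1 l.
 by move=> ll; rewrite -lerN2; exact: (Mf_nd f_ge0 DU1 ll).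
have [lA UA] : exists lA : R, forall l, l <= lA -> A <= U l.
 by have [l0 Hl] := Ucv A; exists l0 => l /Hl /ltW.
have DV := Vf_derive f_gt0 DU A0 DF F_gt0 UA; have Dp := pf_derive Dfp f_gt0 DU DU1 A0 DF F_gt0 UA.
have prof := profile_cv N3 f_ge0 f_mono Dfp f_gt0 DU DU1 Ucv q1 qS A0 DF F_gt0 F_cv Qcv UA.
have zE (l : R) : l <= lA -> zf U F l * F (U l) = expR (2 * l).
 by move=> ll; rewrite /zf /Vf divfK// gt_eqF// F_gt0// UA.
have [t0 [Z [t00 bar0]]] := barrier_exists Dfp f_gt0 A0 DF F_gt0 F_cv DU DU1 Uni U_ge0 UA DV Dp zE
 (fun=> erefl) N3 q1 qS JL prof Qcv Qslow.
have bar := ex_intro _ Z bar0.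
have Uc : continuous U by move=> l; exact: der_cont (DU l).
have mus := measurable_us (n := m.+1) f DU.
have star : stationary_mild m.+1 f U := singular_mild N2 fc f_ge0 f0 f_mono DU DU1 U_ge0 Uni U1n Mnd Usm.
have vE x : x != 0 -> ustar x = us U x by move=> x0; rewrite /us cutzE//; exact: ustarE.
split; first exact: (stationary_solution N2 fc f_ge0 U_ge0 u_ge0 vE mus star).
have w_ge0 := lm_ge0 N2 t00 f_ge0 f_mono Df f1c U_ge0 Uc Ucv bar.
have w_c := lm_cont N2 t00 f_ge0 f_mono Df f1c U_ge0 Uc Ucv bar.
exists t0; split => //; exists (@lm R m.+1 f U t0); split.
- apply: (mild_solution N2 fc f_ge0 U_ge0 u_ge0 vE mus w_c w_ge0).
  by move=> y s /negbTE h; rewrite /lm h.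
 exact: lm_mild N2 t00 f_ge0 f_mono Df f1c U_ge0 Uc Ucv bar.
- exact: (lm_differs N2 vE t00 (lm_bound N2 t00 f_ge0 f_mono Df f1c U_ge0 Uc Ucv bar) Ucv).
- exact: (lm_Linfty N2 t00 f_ge0 f_mono Df f1c U_ge0 Uc Ucv bar).
- exact: (lm_classical N2 t00 f_ge0 f_mono Df f1c U_ge0 Uc Ucv bar mus).
move=> g g1 gs; have g0 : 0 < g by lra.
have qg : 2 * (qf - 1) < m.+1%:R / g.
 rewrite ltr_pdivlMr//; move: gs; rewrite /gamma_star; case: ifPn => [q'|].
  by rewrite lte_fin ltr_pdivlMr; lra.
 rewrite -leNgt => q' _; have -> : qf = 1 by apply/eqP; rewrite eq_le q'.
 by rewrite subrr mulr0 mul0r ltr0n.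
(* Midway between [2 (qf - 1)], above which the power bound for the singular solution holds, and
   [N / g], below which the [g]-th power of that bound is integrable at the origin. *)
pose al := (2 * (qf - 1) + m.+1%:R / g) / 2.
have al1 : 2 * (qf - 1) < al by rewrite /al; lra.
have al2 : al * g < m.+1%:R by rewrite -ltr_pdivlMr// /al; lra.
have [C [l0 HU]] := U_power N3 f_ge0 f_mono Dfp f_gt0 f1_gt0 DU DU1 Ucv q1 qS A0 DF F_gt0 F_cv Qcv UA al1
 (ff1_le Dfp Df1 f_gt0 f1_gt0 f2_gt0 cvR).
apply: (ulnorm_cvg _ fc f_ge0 f_mono U_ge0 Uni mus star t00 g1 _ al2 HU vE) => //.
- by lra.
- exact: measurable_v vE mus.
- by move=> t ? ?; exact: (measurable_contW_slice w_c).
- exact: (lm_le_us N2 t00 f_ge0 f_mono Df f1c U_ge0 Uc Ucv bar mus star).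
- exact: (lm_ge_Pe N2 t00 f_ge0 f_mono Df f1c U_ge0 Uc Ucv bar).
Qed.
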